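(* (Reverse mathematics of hitting sets.) The axiom schemes $\mathsf{dWPHP}(\mathsf{PV})$ and $\mathsf{HS}(\mathsf{PV})$ are provably equivalent over $\mathsf{S^1_2}$.
   Context: $\mathsf{S^1_2}$ denotes Buss's bounded arithmetic theory $\mathsf{S^1_2}$ extended with a symbol for every polynomial-time function ($\mathsf{PV}$) and their defining equations; objects are coded by natural numbers, integers in sign-magnitude. $[k]=\{1,\ldots,k\}$; $\mathrm{Log}$ = binary lengths; $|q|$ = binary length of $q$. $\mathsf{dWPHP}(\mathsf{PV})$ is the scheme containing, for every $\mathsf{PV}$-symbol $f$, the universal closure of $(b\ge2a\wedge a\ge1)\to\exists y\in[b]\,\forall x\in[a]\ f(x,c)\ne y$. $\mathrm{Ckt}(n,d,s)$ = algebraic circuits over $\mathbb{Z}$ (straight-line programs with variables, plugged integer constants, $+$, $\times$) with at most $n$ indeterminates, maximum syntactic individual degree (over variables and parameters; max at $+$, sum at $\times$) at most $d$, representation size at most $s$. $S_q=\{0,\ldots,q-1\}$. For a $\mathsf{PV}$-symbol $g$ (written $g_e(\ldots)$ with parameter $e$), the hitting set axiom $\mathsf{HS}(g)$ is: $\forall e\ \forall n,d,s,q,r,m\in\mathrm{Log}\ (q\ge 2nd\wedge r>m+n|q| \to \exists H=(\overline{h}_1,\ldots,\overline{h}_r)\in(S_q^n)^r\ \forall x\in\{0,1\}^m\ \forall C\in\mathrm{Ckt}(n,d,s)\ (g_e(n,d,s,x)=C \to ((\exists\overline{a}\in\mathbb{Z}^n\ C(\overline{a})\ne0)\to\exists i<r\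 C(\overline{h}_{i+1})\ne0)))$. $\mathsf{HS}(\mathsf{PV})$ is the scheme of all $\mathsf{HS}(g)$ for $g\in\mathsf{PV}$.
   Formalization: HS(g) is stated with the extra condition q ≥ 1: for n ≥ 1 and d = q = 0 the condition q ≥ 2nd holds but S_q^n is empty, so HS(g) as written would be false; instances with n, d ≥ 1 are unaffected. *)

(* Defs.v *)
From Stdlib Require Import List.
From Stdlib Require Fin Vector.
Import Vector.VectorNotations ListNotations.
Local Open Scope list_scope.
Set Implicit Arguments.

(** * PV symbols *)

(** Cobham's function algebra over the initial functions 0, S, +, *, |x/2|, |x|
    and # (all of them symbols of Buss's language).

    [pv_lrec g h0 h1 k] is limited recursion on notation.  The recursion variable
    comes first, and [h0], [h1] receive (y, previous value, parameters).  The
    bound [k] is enforced by a cutoff: each value is the minimum of [k] and the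
    value prescribed by [g], [h0], [h1].  Hence every syntactically well-formed
    symbol denotes a polynomial-time function, with no side condition on [k], and
    a recursion whose values stay below [k] is unaffected by the cutoff. *)
Inductive pv : nat -> Set :=
| pv_zero : pv 0
| pv_succ : pv 1
| pv_add : pv 2
| pv_mul : pv 2
| pv_half : pv 1
| pv_len : pv 1
| pv_smash : pv 2
| pv_proj (n : nat) (i : Fin.t n) : pv n
| pv_comp (n k : nat) (f : pv k) (gs : Vector.t (pv n) k) : pv n
| pv_lrec (n : nat) (g : pv n) (h0 h1 : pv (S (S n))) (k : pv (S n)) : pv (S n).

(** * First-order syntax (de Bruijn) *)

Inductive tm : Set :=
| var (i : nat)
| fapp (n : nat) (f : pv n) (ts : Vector.t tm n).

Inductive fm : Set :=
| Bot
| Eq (s t : tm)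
| Le (s t : tm)
| Imp (A B : fm)
| And (A B : fm)
| Or (A B : fm)
| All (A : fm)
| Ex (A : fm).

Fixpoint tsubst (sigma : nat -> tm) (t : tm) : tm :=
  match t with
  | var i => sigma i
  | fapp f ts => fapp f (Vector.map (tsubst sigma) ts)
  end.

Definition scons (t : tm) (sigma : nat -> tm) (i : nat) : tm :=
  match i with 0 => t | S j => sigma j end.

Definition tlift : tm -> tm := tsubst (fun i => var (S i)).

Definition up (sigma : nat -> tm) : nat -> tm :=
  scons (var 0) (fun i => tlift (sigma i)).

Fixpoint fsubst (sigma : nat -> tm) (A : fm) : fm :=
  match A with
  | Bot => Bot
  | Eq s t => Eq (tsubst sigma s) (tsubst sigma t)
  | Le s t => Le (tsubst sigma s) (tsubst sigma t)
  | Imp A B => Imp (fsubst sigma A) (fsubst sigma B)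
  | And A B => And (fsubst sigma A) (fsubst sigma B)
  | Or A B => Or (fsubst sigma A) (fsubst sigma B)
  | All A => All (fsubst (up sigma) A)
  | Ex A => Ex (fsubst (up sigma) A)
  end.

Definition flift : fm -> fm := fsubst (fun i => var (S i)).
Definition inst (A : fm) (t : tm) : fm := fsubst (scons t var) A.
Definition Not (A : fm) : fm := Imp A Bot.

(** * Provability *)

(** Classical natural deduction with equality.  Free variables of axioms are
    read universally: [p_all] lifts the hypotheses [G] but not the axioms. *)
Inductive provable (T : fm -> Prop) : list fm -> fm -> Prop :=
| p_ax G A : T A -> provable T G A
| p_hyp G A : In A G -> provable T G A
| p_imp G A B : provable T (A :: G) B -> provable T G (Imp A B)
| p_mp G A B : provable T G (Imp A B) -> provable T G A -> provable T G B
| p_and G A B : provable T G A -> provable T G B -> provable T G (And A B)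
| p_and1 G A B : provable T G (And A B) -> provable T G A
| p_and2 G A B : provable T G (And A B) -> provable T G B
| p_or1 G A B : provable T G A -> provable T G (Or A B)
| p_or2 G A B : provable T G B -> provable T G (Or A B)
| p_case G A B C : provable T G (Or A B) -> provable T (A :: G) C ->
    provable T (B :: G) C -> provable T G C
| p_raa G A : provable T (Not A :: G) Bot -> provable T G A
| p_all G A : provable T (map flift G) A -> provable T G (All A)
| p_inst G A t : provable T G (All A) -> provable T G (inst A t)
| p_ex G A t : provable T G (inst A t) -> provable T G (Ex A)
| p_exE G A B : provable T G (Ex A) ->
    provable T (A :: map flift G) (flift B) -> provable T G B
| p_refl G t : provable T G (Eq t t)
| p_rew G A s t : provable T G (Eq s t) -> provable T G (inst A s) ->
    provable T G (inst A t).

Definition union (T U : fm -> Prop) (A : fm) : Prop := T A \/ U A.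

(** * Named binders *)

(** A [frm] (resp. [trm]) maps the number of enclosing binders to a de Bruijn
    formula (resp. term).  Rocq variables can then serve as bound variables:
    the variable introduced below [d] binders has index [d' - S d] at depth [d']. *)
Definition trm := nat -> tm.
Definition frm := nat -> fm.

Definition fn0 (f : pv 0) : trm := fun _ => fapp f []%vector.
Definition fn1 (f : pv 1) (s : trm) : trm := fun d => fapp f [s d]%vector.
Definition fn2 (f : pv 2) (s t : trm) : trm := fun d => fapp f [s d; t d]%vector.

Definition lh : trm -> trm := fn1 pv_len.
Definition half : trm -> trm := fn1 pv_half.

Definition fEq (s t : trm) : frm := fun d => Eq (s d) (t d).
Definition fLe (s t : trm) : frm := fun d => Le (s d) (t d).
Definition fNot (A : frm) : frm := fun d => Not (A d).
Definition fImp (A B : frm) : frm := fun d => Imp (A d) (B d).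
Definition fAnd (A B : frm) : frm := fun d => And (A d) (B d).
Definition fOr (A B : frm) : frm := fun d => Or (A d) (B d).
Definition fAll (A : trm -> frm) : frm :=
  fun d => All (A (fun d' => var (d' - S d)) (S d)).
Definition fEx (A : trm -> frm) : frm :=
  fun d => Ex (A (fun d' => var (d' - S d)) (S d)).

Definition close (A : frm) : fm := A 0.

Declare Scope frm_scope.
Delimit Scope frm_scope with F.

Notation "s ≐ t" := (fEq s t) (at level 70, no associativity) : frm_scope.
Notation "s <= t" := (fLe s t) : frm_scope.
Notation "¬ A" := (fNot A) (at level 75, right associativity) : frm_scope.
Notation "A ∧ B" := (fAnd A B) (at level 80, right associativity) : frm_scope.
Notation "A ∨ B" := (fOr A B) (at level 85, right associativity) : frm_scope.
Notation "A ⇒ B" := (fImp A B) (at level 90, right associativity) : frm_scope.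
Notation "A ⇔ B" := (fAnd (fImp A B) (fImp B A)) (at level 95, no associativity)
  : frm_scope.
Notation "∀ x .. y , A" := (fAll (fun x => .. (fAll (fun y => A)) ..))
  (at level 10, x binder, y binder, A at level 200) : frm_scope.
Notation "∃ x .. y , A" := (fEx (fun x => .. (fEx (fun y => A)) ..))
  (at level 10, x binder, y binder, A at level 200) : frm_scope.

Notation "0" := (fn0 pv_zero) : frm_scope.
Notation "'σ' t" := (fn1 pv_succ t) (at level 9, t at level 9) : frm_scope.
Notation "1" := (σ 0)%F : frm_scope.
Notation "2" := (σ 1)%F : frm_scope.
Notation "3" := (σ 2)%F : frm_scope.
Notation "s + t" := (fn2 pv_add s t) : frm_scope.
Notation "s * t" := (fn2 pv_mul s t) : frm_scope.
Notation "s # t" := (fn2 pv_smash s t) (at level 38, no associativity) : frm_scope.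
Notation "s < t" := (fLe (fn1 pv_succ s) t) : frm_scope.

(** * The theory S^1_2 over the language PV *)

Local Open Scope frm_scope.

(** Buss's 32 open axioms, in his order. *)
Definition BASIC_axioms : list fm := map close
  [ ∀ x y, y <= x ⇒ y <= σ x;
    ∀ x, ¬ x ≐ σ x;
    ∀ x, 0 <= x;
    ∀ x y, x <= y ∧ ¬ x ≐ y ⇔ σ x <= y;
    ∀ x, ¬ x ≐ 0 ⇒ ¬ 2 * x ≐ 0;
    ∀ x y, y <= x ∨ x <= y;
    ∀ x y, x <= y ∧ y <= x ⇒ x ≐ y;
    ∀ x y z, x <= y ∧ y <= z ⇒ x <= z;
    lh 0 ≐ 0;
    ∀ x, ¬ x ≐ 0 ⇒ lh (2 * x) ≐ σ (lh x) ∧ lh (σ (2 * x)) ≐ σ (lh x);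
    lh 1 ≐ 1;
    ∀ x y, x <= y ⇒ lh x <= lh y;
    ∀ x y, lh (x # y) ≐ σ (lh x * lh y);
    ∀ y, 0 # y ≐ 1;
    ∀ x, ¬ x ≐ 0 ⇒ 1 # (2 * x) ≐ 2 * (1 # x) ∧ 1 # (σ (2 * x)) ≐ 2 * (1 # x);
    ∀ x y, x # y ≐ y # x;
    ∀ x y z, lh x ≐ lh y ⇒ x # z ≐ y # z;
    ∀ x y u v, lh x ≐ lh u + lh v ⇒ x # y ≐ (u # y) * (v # y);
    ∀ x y, x <= x + y;
    ∀ x y, x <= y ∧ ¬ x ≐ y ⇒ σ (2 * x) <= 2 * y ∧ ¬ σ (2 * x) ≐ 2 * y;
    ∀ x y, x + y ≐ y + x;
    ∀ x, x + 0 ≐ x;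
    ∀ x y, x + σ y ≐ σ (x + y);
    ∀ x y z, (x + y) + z ≐ x + (y + z);
    ∀ x y z, x + y <= x + z ⇔ y <= z;
    ∀ x, x * 0 ≐ 0;
    ∀ x y, x * σ y ≐ (x * y) + x;
    ∀ x y, x * y ≐ y * x;
    ∀ x y z, x * (y + z) ≐ (x * y) + (x * z);
    ∀ x y z, 1 <= x ⇒ (x * y <= x * z ⇔ y <= z);
    ∀ x, ¬ x ≐ 0 ⇒ lh x ≐ σ (lh (half x));
    ∀ x y, x ≐ half y ⇔ (2 * x ≐ y ∨ σ (2 * x) ≐ y) ].

Definition BASIC (A : fm) : Prop := In A BASIC_axioms.

Definition zero : tm := fapp pv_zero []%vector.
Definition succ (t : tm) : tm := fapp pv_succ [t]%vector.
Definition dbl (t : tm) : tm := fapp pv_mul [succ (succ zero); t]%vector.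

Definition is_min (s t m : tm) : fm :=
  And (Imp (Le s t) (Eq m s)) (Imp (Not (Le s t)) (Eq m t)).

(** Defining axioms of the composite symbols; those of the initial functions
    are in [BASIC]. *)
Inductive pv_defining : fm -> Prop :=
| def_proj n (i : Fin.t n) (xs : Vector.t tm n) :
    pv_defining (Eq (fapp (pv_proj i) xs) (Vector.nth xs i))
| def_comp n k (f : pv k) (gs : Vector.t (pv n) k) (xs : Vector.t tm n) :
    pv_defining (Eq (fapp (pv_comp f gs) xs)
                    (fapp f (Vector.map (fun g => fapp g xs) gs)))
| def_rec_zero n (g : pv n) h0 h1 k (xs : Vector.t tm n) :
    pv_defining
      (is_min (fapp g xs) (fapp k (zero :: xs)%vector)
              (fapp (pv_lrec g h0 h1 k) (zero :: xs)%vector))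
| def_rec_even n (g : pv n) h0 h1 k (y : tm) (xs : Vector.t tm n) :
    let f t := fapp (pv_lrec g h0 h1 k) (t :: xs)%vector in
    pv_defining
      (Imp (Not (Eq y zero))
           (is_min (fapp h0 (y :: f y :: xs)%vector)
                   (fapp k (dbl y :: xs)%vector)
                   (f (dbl y))))
| def_rec_odd n (g : pv n) h0 h1 k (y : tm) (xs : Vector.t tm n) :
    let f t := fapp (pv_lrec g h0 h1 k) (t :: xs)%vector in
    pv_defining
      (is_min (fapp h1 (y :: f y :: xs)%vector)
              (fapp k (succ (dbl y) :: xs)%vector)
              (f (succ (dbl y)))).

Definition len (t : tm) : tm := fapp pv_len [t]%vector.

(** Bounded quantifiers; the bound does not contain the bound variable. *)
Definition AllB (t : tm) (A : fm) : fm := All (Imp (Le (var 0) (tlift t)) A).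
Definition ExB (t : tm) (A : fm) : fm := Ex (And (Le (var 0) (tlift t)) A).

(** [sigma1b true]: the Sigma^b_1 formulas; [sigma1b false]: the Pi^b_1
    formulas. *)
Inductive sigma1b : bool -> fm -> Prop :=
| sb_bot p : sigma1b p Bot
| sb_eq p s t : sigma1b p (Eq s t)
| sb_le p s t : sigma1b p (Le s t)
| sb_imp p A B : sigma1b (negb p) A -> sigma1b p B -> sigma1b p (Imp A B)
| sb_and p A B : sigma1b p A -> sigma1b p B -> sigma1b p (And A B)
| sb_or p A B : sigma1b p A -> sigma1b p B -> sigma1b p (Or A B)
| sb_sall p t A : sigma1b p A -> sigma1b p (AllB (len t) A)
| sb_sex p t A : sigma1b p A -> sigma1b p (ExB (len t) A)
| sb_ex t A : sigma1b true A -> sigma1b true (ExB t A)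
| sb_all t A : sigma1b false A -> sigma1b false (AllB t A).

(** A(0) /\ forall x (A(|x/2|) -> A(x)) -> forall x A(x), with [var 0] as x. *)
Definition pind (A : fm) : fm :=
  let A_half :=
    fsubst (scons (fapp pv_half [var 0]%vector) (fun i => var (S i))) A in
  Imp (And (inst A zero) (All (Imp A_half A))) (All A).

Inductive S12 : fm -> Prop :=
| S12_basic A : BASIC A -> S12 A
| S12_def A : pv_defining A -> S12 A
| S12_pind A : sigma1b true A -> S12 (pind A).

(** * The dual weak pigeonhole principle *)

Definition dWPHP (f : pv 2) : fm := close
  (∀ a b c, 2 * a <= b ∧ 1 <= a ⇒
    ∃ y, (1 <= y ∧ y <= b) ∧ ∀ x, 1 <= x ∧ x <= a ⇒ ¬ fn2 f x c ≐ y).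

Inductive dWPHP_PV : fm -> Prop :=
| dWPHP_PV_ax (f : pv 2) : dWPHP_PV (dWPHP f).

(** * Coding *)

Definition isLog (n : trm) : frm := ∃ y, n ≐ lh y.

(** p = 2^n with n a length, using 1 # y = 2^|y|. *)
Definition isPow2 (n p : trm) : frm := ∃ y, lh y ≐ n ∧ p ≐ 1 # y.

(** Injective because x <= x + y. *)
Definition tpair (x y : trm) : trm := (x + y) * (x + y) + x.
Notation "⟨ x , y ⟩" := (tpair x y) (at level 0) : frm_scope.

(** A sequence u_0, ..., u_{k-1} is coded by ⟨l, w⟩, where l >= 1, each u_i is
    less than 2^l, and the binary expansion of w is a leading 1 followed by the
    k blocks of l bits u_{k-1}, ..., u_0. *)
Definition isSeq (a k : trm) : frm :=
  ∃ l w, 1 <= l ∧ a ≐ ⟨l, w⟩ ∧ lh w ≐ σ (k * l).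

(** u is the entry of index i < k; 1 <= hi holds exactly when i < k. *)
Definition entry (a i u : trm) : frm :=
  ∃ l w hi lo p q, a ≐ ⟨l, w⟩ ∧ isPow2 l q ∧ isPow2 (i * l) p ∧
    w ≐ (hi * q + u) * p + lo ∧ 1 <= hi ∧ u < q ∧ lo < p.

(** Sign-magnitude: z codes pos - neg with pos or neg zero; the lowest bit of z is
    the sign and the remaining bits are the magnitude.  Both 0 and 1 code the
    integer 0. *)
Definition intVal (z pos neg : trm) : frm :=
  (z ≐ 2 * pos ∧ neg ≐ 0) ∨ (z ≐ σ (2 * neg) ∧ pos ≐ 0).

Definition intAdd (x y z : trm) : frm :=
  ∃ px nx py ny pz nz, intVal x px nx ∧ intVal y py ny ∧ intVal z pz nz ∧
    px + py + nz ≐ nx + ny + pz.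

Definition intMul (x y z : trm) : frm :=
  ∃ px nx py ny pz nz, intVal x px nx ∧ intVal y py ny ∧ intVal z pz nz ∧
    px * py + nx * ny + nz ≐ px * ny + nx * py + pz.

Definition intNonzero (z : trm) : frm :=
  ∃ pos neg, intVal z pos neg ∧ ¬ pos ≐ neg.

(** * Algebraic circuits *)

(** A straight-line program is a sequence of gates; the last one is the output.
    Every constant gate is a parameter of its own, plugged with its constant. *)
Definition gVar (j : trm) : trm := ⟨0, j⟩.
Definition gConst (z : trm) : trm := ⟨1, z⟩.
Definition gAdd (u v : trm) : trm := ⟨2, ⟨u, v⟩⟩.
Definition gMul (u v : trm) : trm := ⟨3, ⟨u, v⟩⟩.

(** C has gates 0, ..., o and indeterminates of index less than n. *)
Definition isSLP (C n o : trm) : frm :=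
  isSeq C (σ o) ∧
  ∀ i, i <= o ⇒ ∃ g, entry C i g ∧
    ((∃ j, j < n ∧ g ≐ gVar j) ∨
     (∃ z, g ≐ gConst z) ∨
     (∃ u v, u < i ∧ v < i ∧ (g ≐ gAdd u v ∨ g ≐ gMul u v))).

Definition isMax (x y m : trm) : frm := (x <= y ∧ m ≐ y) ∨ (y <= x ∧ m ≐ x).

(** D lists the syntactic degrees of the gates with respect to the input (variable
    or parameter) that occurs exactly at the gates i, with instruction g, such
    that [src i g]. *)
Definition isDegTrace (src : trm -> trm -> frm) (C o D : trm) : frm :=
  isSeq D (σ o) ∧
  ∀ i, i <= o ⇒ ∃ g e, entry C i g ∧ entry D i e ∧
    (((∃ z, g ≐ gVar z ∨ g ≐ gConst z) ∧
        ((src i g ∧ e ≐ 1) ∨ (¬ src i g ∧ e ≐ 0))) ∨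
     (∃ u v eu ev, entry D u eu ∧ entry D v ev ∧
        ((g ≐ gAdd u v ∧ isMax eu ev e) ∨ (g ≐ gMul u v ∧ e ≐ eu + ev)))).

Definition degLe (src : trm -> trm -> frm) (C o d : trm) : frm :=
  ∃ D e, isDegTrace src C o D ∧ entry D o e ∧ e <= d.

Definition Ckt (C n d s : trm) : frm :=
  lh C <= s ∧
  ∃ o, isSLP C n o ∧
    (∀ j, j < n ⇒ degLe (fun _ g => g ≐ gVar j) C o d) ∧
    (∀ c, c <= o ∧ (∃ z, entry C c (gConst z)) ⇒ degLe (fun i _ => i ≐ c) C o d).

(** t lists the values of the gates of C at the integer tuple a: entry 0 if the
    value is not computed, and z + 1 if it is the integer coded by z.  A computed
    gate needs computed arguments.  Partiality matters for gates that do not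
    feed into the output: the degree of C does not bound their values. *)
Definition isEvalTrace (C o a t : trm) : frm :=
  isSeq t (σ o) ∧
  ∀ i z, i <= o ∧ entry t i (σ z) ⇒ ∃ g, entry C i g ∧
    ((∃ j, g ≐ gVar j ∧ entry a j z) ∨
     (g ≐ gConst z) ∨
     (∃ u v x y, entry t u (σ x) ∧ entry t v (σ y) ∧
        ((g ≐ gAdd u v ∧ intAdd x y z) ∨ (g ≐ gMul u v ∧ intMul x y z)))).

Definition evalNonzero (C a : trm) : frm :=
  ∃ o t z, isSeq C (σ o) ∧ isEvalTrace C o a t ∧ entry t o (σ z) ∧ intNonzero z.

(** h is an element of S_q^n; the integer c >= 0 has sign-magnitude code 2c. *)
Definition inCube (h n q : trm) : frm :=
  isSeq h n ∧ ∀ j, j < n ⇒ ∃ c, c < q ∧ entry h j (2 * c).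

(** * The hitting set axioms *)

Definition fn5 (g : pv 5) (t1 t2 t3 t4 t5 : trm) : trm :=
  fun d => fapp g [t1 d; t2 d; t3 d; t4 d; t5 d]%vector.

(** Strings in {0,1}^m are coded by the numbers of length at most m.  The
    condition 1 <= q makes S_q nonempty: for d = q = 0 and n >= 1, the inequality
    q >= 2nd would hold although S_q^n has no element. *)
Definition HS (g : pv 5) : fm := close
  (∀ e n d s q r m,
    isLog n ∧ isLog d ∧ isLog s ∧ isLog q ∧ isLog r ∧ isLog m ⇒
    1 <= q ∧ 2 * n * d <= q ∧ m + n * lh q < r ⇒
    ∃ H, (isSeq H r ∧ ∀ i, i < r ⇒ ∃ h, entry H i h ∧ inCube h n q) ∧
      ∀ x, lh x <= m ⇒
      ∀ C, Ckt C n d s ⇒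
        fn5 g e n d s x ≐ C ⇒
        (∃ a, isSeq a n ∧ evalNonzero C a) ⇒
        ∃ i h, i < r ∧ entry H i h ∧ evalNonzero C h).

Inductive HS_PV : fm -> Prop :=
| HS_PV_ax (g : pv 5) : HS_PV (HS g).

(** Each scheme is provable from the other one over the base theory [T]. *)
Definition provably_equivalent (T U V : fm -> Prop) : Prop :=
  (forall A, V A -> provable (union T U) [] A) /\
  (forall A, U A -> provable (union T V) [] A).

(* Main.v *)
(** By the completeness theorem it suffices to compare the two schemes in an arbitrary model
    of S^1_2, where limited recursion and induction on notation can be used informally.

    dWPHP gives HS.  Let C be a circuit of individual degree at most d < q that does not vanish
    on Z^n.  On a line through a nonroot there are at most d roots in S_q, so the coordinates
    of a nonroot can be replaced one by one, until it is a point a of S_q^n.  Given a, a root Y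
    in S_q^n has a short code: exchanging the coordinates of Y for those of a one by one, let i
    be the step at which the value becomes nonzero; the i-th coordinate of Y is one of at most
    d roots on a line that the other coordinates and a determine.  There are
    n d q^(n-1) <= q^n/2 such codes.  Hence the tuples of r points that are not hitting for the
    circuits g(x), |x| <= m, are the values of a PV function on a domain of size
    2^m 2^(n|q|) (q^n/2)^r, at most half of q^(nr), and dWPHP provides another tuple.
    The bound on the number of roots avoids the (possibly too long) list of coefficients: the
    value of the circuit at a large power of 2 is divisible, up to small factors, by a product
    over the roots, and too small for that when there are more than d of them.

    HS gives dWPHP.  If f maps [1, a] onto [1, 2a], then iterating it yields a PV function from
    [0, a) onto [0, a 2^(jr)).  Reading the values as r digits c_t < q = 2^j, let g output the
    circuit for the product of the X - c_t.  It is nonzero at q, but every r points of S_q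
    are roots of one of these circuits, against HS(g). *)

(* The model may be nonstandard, so a function has to be given by a parameter-free term ([Df false])
   and an induction needs a Sigma^b_1 predicate ([Sg true]). Only lengths can be counted or
   exponentiated. Therefore induction statements mention computed values in place of unbounded
   witnesses, and a family of witnesses is gathered one by one into a single bounded number.

   The obstacle with circuits is the size of their values: repeated squaring of a constant reaches
   doubly exponential numbers. The degree bound excludes this because constants count as inputs: the
   degrees of the output in all its inputs sum to at most (n + o + 1) d, where o is the output gate,
   and this sum controls the lengths of all values on which the output depends. Other gates may
   still have huge values; the evaluator marks these as not computed.

   In the root bound, the numbers B - x for distinct roots x (B = 2^b) need not be coprime, but a
   common divisor of B - x and B - h divides x - h, which is less than q. A common multiple F of 1,
   ..., q absorbs all such divisors, and b is chosen so large that the factors lost to F do not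
   matter. *)
From Stdlib Require Import List Classical ClassicalEpsilon FunctionalExtensionality
  PropExtensionality Eqdep_dec PeanoNat Lia.
From Stdlib Require Fin Vector Cantor.
From mathcomp Require Import choice.
Require Import Defs.
Import ListNotations.
Local Open Scope list_scope.
Set Implicit Arguments.

(** * Substitution *)

Section TmInd.
Variable P : tm -> Prop.
Hypothesis Hvar : forall i, P (var i).
Hypothesis Happ : forall n (f : pv n) ts, Vector.Forall P ts -> P (fapp f ts).
Fixpoint tm_nested_ind (t : tm) : P t :=
  match t with
  | var i => Hvar i
  | fapp n f ts => Happ f
      ((fix go n (v : Vector.t tm n) : Vector.Forall P v :=
         match v with
         | Vector.nil => Vector.Forall_nil P
         | Vector.cons t n v => @Vector.Forall_cons _ P n t v (tm_nested_ind t) (go n v)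
         end) _ ts)
  end.
End TmInd.

Lemma vmap_ext_Forall (A B : Type) (f g : A -> B) n (v : Vector.t A n) :
  Vector.Forall (fun x => f x = g x) v -> Vector.map f v = Vector.map g v.
Proof. induction 1; simpl; congruence. Qed.

Lemma vmap_map (A B C : Type) (f : A -> B) (g : B -> C) n (v : Vector.t A n) :
  Vector.map g (Vector.map f v) = Vector.map (fun x => g (f x)) v.
Proof. induction v; simpl; congruence. Qed.

Lemma vmap_id (A : Type) (f : A -> A) n (v : Vector.t A n) :
  (forall x, f x = x) -> Vector.map f v = v.
Proof. intro H; induction v; simpl; rewrite ?H, ?IHv; trivial. Qed.

Lemma tsubst_tsubst s r t :
  tsubst s (tsubst r t) = tsubst (fun i => tsubst s (r i)) t.
Proof.
  induction t using tm_nested_ind; simpl; trivial.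
  rewrite vmap_map. f_equal. now apply vmap_ext_Forall.
Qed.

Lemma tsubst_var t : tsubst var t = t.
Proof.
  induction t using tm_nested_ind; simpl; trivial.
  f_equal. clear f. induction H as [|m x v Hx _ IH]; simpl; rewrite ?Hx, ?IH; trivial.
Qed.

Lemma up_comp s r :
  (fun i => tsubst (up s) (up r i)) = up (fun i => tsubst s (r i)).
Proof.
  apply functional_extensionality; intros [|i]; simpl; trivial.
  unfold tlift; now rewrite !tsubst_tsubst.
Qed.

Lemma fsubst_fsubst A : forall s r,
  fsubst s (fsubst r A) = fsubst (fun i => tsubst s (r i)) A.
Proof.
  induction A; intros; simpl; rewrite ?tsubst_tsubst;
    solve [now rewrite IHA, up_comp | f_equal; auto].
Qed.

Lemma up_var : up var = var.
Proof. apply functional_extensionality; now intros [|i]. Qed.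

Lemma fsubst_var A : fsubst var A = A.
Proof. induction A; simpl; rewrite ?tsubst_var, ?up_var; congruence. Qed.

Lemma tsubst_up_tlift s t : tsubst (up s) (tlift t) = tlift (tsubst s t).
Proof. unfold tlift; now rewrite !tsubst_tsubst. Qed.

Lemma fsubst_up_flift s A : fsubst (up s) (flift A) = flift (fsubst s A).
Proof. unfold flift; now rewrite !fsubst_fsubst. Qed.

Lemma fsubst_inst s A t :
  fsubst s (inst A t) = inst (fsubst (up s) A) (tsubst s t).
Proof.
  unfold inst; rewrite !fsubst_fsubst; f_equal.
  apply functional_extensionality; intros [|i]; simpl; trivial.
  unfold tlift; now rewrite tsubst_tsubst, tsubst_var.
Qed.

Lemma inst_up s A t : inst (fsubst (up s) A) t = fsubst (scons t s) A.
Proof.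
  unfold inst; rewrite fsubst_fsubst; f_equal.
  apply functional_extensionality; intros [|i]; simpl; trivial.
  unfold tlift; now rewrite tsubst_tsubst, tsubst_var.
Qed.

Lemma tsubst_inst_tlift s t : tsubst (scons s var) (tlift t) = t.
Proof. unfold tlift; rewrite tsubst_tsubst; apply tsubst_var. Qed.

(** An upper bound replaces the set of free variables: bounds of finitely many terms are combined by
    a maximum, and the variable at the bound is fresh. *)
Fixpoint tfv (N : nat) (t : tm) : Prop :=
  match t with
  | var i => i < N
  | fapp n f ts => (fix go n (v : Vector.t tm n) : Prop :=
         match v with
         | Vector.nil => True
         | Vector.cons t n v => tfv N t /\ go n v
         end) _ ts
  end.

Fixpoint ffv (N : nat) (A : fm) : Prop :=
  match A with
  | Bot => True
  | Eq s t | Le s t => tfv N s /\ tfv N t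
  | Imp A B | And A B | Or A B => ffv N A /\ ffv N B
  | All A | Ex A => ffv (S N) A
  end.

Lemma tfv_app N n (f : pv n) ts : tfv N (fapp f ts) <-> Vector.Forall (tfv N) ts.
Proof.
  simpl; clear f; induction ts; split; trivial; [constructor| |].
  - intros [? ?]; constructor; tauto.
  - intro H. rewrite Vector.Forall_cons_iff in H. tauto.
Qed.

Lemma vForall_impl (A : Type) (P Q : A -> Prop) n (v : Vector.t A n) :
  (forall x, P x -> Q x) -> Vector.Forall P v -> Vector.Forall Q v.
Proof. induction 2; constructor; auto. Qed.

Lemma vForall_and (A : Type) (P Q : A -> Prop) n (v : Vector.t A n) :
  Vector.Forall P v -> Vector.Forall Q v -> Vector.Forall (fun x => P x /\ Q x) v.
Proof.
  induction v; intros H K; constructor;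
    rewrite Vector.Forall_cons_iff in *; intuition.
Qed.

Lemma tfv_mono t N K : N <= K -> tfv N t -> tfv K t.
Proof.
  induction t using tm_nested_ind; intros L.
  - simpl; lia.
  - rewrite !tfv_app. intro W. generalize (vForall_and H W).
    apply vForall_impl; tauto.
Qed.

Lemma ffv_mono A : forall N K, N <= K -> ffv N A -> ffv K A.
Proof.
  induction A; simpl; intros N K L; trivial;
    try (intros [? ?]; split; eauto using tfv_mono);
    apply IHA; lia.
Qed.

Lemma vForall_ex_bound (A : Type) (P : nat -> A -> Prop) n (v : Vector.t A n) :
  (forall N K x, N <= K -> P N x -> P K x) ->
  Vector.Forall (fun x => exists N, P N x) v -> exists N, Vector.Forall (P N) v.
Proof.
  intros mono. induction 1 as [|n x v [N HN] _ [K HK]].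
  - exists 0; constructor.
  - exists (Nat.max N K); constructor.
    + apply mono with N; trivial; lia.
    + revert HK; apply vForall_impl; intro; apply mono; lia.
Qed.

Lemma tfv_ex t : exists N, tfv N t.
Proof.
  induction t using tm_nested_ind.
  - exists (S i); simpl; lia.
  - destruct (@vForall_ex_bound _ tfv _ ts) as [N HN]; trivial.
    + intros; eapply tfv_mono; eauto.
    + exists N; now apply tfv_app.
Qed.

Lemma ffv_ex A : exists N, ffv N A.
Proof.
  assert (two : forall (P Q : nat -> Prop), (forall N K, N <= K -> P N -> P K) ->
     (forall N K, N <= K -> Q N -> Q K) -> (exists N, P N) -> (exists N, Q N) ->
     exists N, P N /\ Q N).
  { intros P Q mP mQ [N HN] [K HK]. exists (Nat.max N K).
    split; [apply mP with N|apply mQ with K]; trivial; lia. }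
  induction A; simpl;
    try (apply two; auto using tfv_ex; intros; eauto using tfv_mono, ffv_mono).
  - now exists 0.
  - destruct IHA as [N HN]; exists N; apply ffv_mono with N; auto.
  - destruct IHA as [N HN]; exists N; apply ffv_mono with N; auto.
Qed.

Lemma tsubst_agree t N s r :
  tfv N t -> (forall i, i < N -> s i = r i) -> tsubst s t = tsubst r t.
Proof.
  induction t using tm_nested_ind; intros F E.
  - simpl in *; auto.
  - simpl. f_equal. apply vmap_ext_Forall. rewrite tfv_app in F.
    generalize (vForall_and H F). apply vForall_impl; tauto.
Qed.

Lemma fsubst_agree A : forall N s r,
  ffv N A -> (forall i, i < N -> s i = r i) -> fsubst s A = fsubst r A.
Proof.
  induction A; simpl; intros N u r F E; trivial;
    try (destruct F; f_equal; eauto using tsubst_agree);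
    (f_equal; apply IHA with (S N); trivial; intros [|i] L; simpl; trivial;
     rewrite E; trivial; lia).
Qed.

(** * Derivations *)

Definition subst_closed (T : fm -> Prop) : Prop :=
  forall A s, T A -> T (fsubst s A).

Section Provability.
Variable T : fm -> Prop.

Lemma weaken G A : provable T G A -> forall G', incl G G' -> provable T G' A.
Proof.
  induction 1; intros G' L;
    try solve [econstructor; eauto using incl_cons, incl_tl, in_eq].
  - apply p_all. apply IHprovable. now apply incl_map.
  - eapply p_exE; [now apply IHprovable1|]. apply IHprovable2.
    apply incl_cons; [apply in_eq|]. apply incl_tl. now apply incl_map.
Qed.

Hypothesis T_closed : subst_closed T.

(** The rule [p_ax] gives axioms in any context, so after a substitution the instances of axioms
    must be axioms again; this is what [T_closed] provides. *)
Lemma provable_subst G A : provable T G A ->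
  forall r, provable T (map (fsubst r) G) (fsubst r A).
Proof.
  induction 1; intro r; simpl in *;
    try solve [econstructor; eauto].
  - apply p_hyp. now apply in_map.
  - apply p_all. specialize (IHprovable (up r)).
    rewrite map_map in *. erewrite map_ext; [exact IHprovable|].
    intro B. simpl. symmetry; apply fsubst_up_flift.
  - rewrite fsubst_inst. apply p_inst. apply IHprovable.
  - apply p_ex with (tsubst r t). rewrite <- fsubst_inst. apply IHprovable.
  - eapply p_exE; [apply IHprovable1|].
    specialize (IHprovable2 (up r)). rewrite <- fsubst_up_flift.
    rewrite map_map in *. erewrite map_ext; [exact IHprovable2|].
    intro C. simpl. symmetry; apply fsubst_up_flift.
  - rewrite fsubst_inst. eapply p_rew; [apply IHprovable1|].
    rewrite <- fsubst_inst. apply IHprovable2.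
Qed.

(** The fresh variable [N] plays the role of a Henkin constant. *)
Lemma fresh_witness G B N : ffv (S N) B -> Forall (ffv N) G ->
  provable T (inst B (var N) :: G) Bot -> provable T (B :: map flift G) Bot.
Proof.
  intros FB FG H.
  apply provable_subst with (r := fun i => if Nat.eqb i N then var 0 else var (S i)) in H.
  simpl in H.
  assert (E : fsubst (fun i => if Nat.eqb i N then var 0 else var (S i)) (inst B (var N)) = B).
  { unfold inst. rewrite fsubst_fsubst.
    rewrite <- (fsubst_var B) at 2. apply fsubst_agree with (S N); trivial.
    intros [|i] L; simpl.
    - now rewrite Nat.eqb_refl.
    - destruct (Nat.eqb_spec i N); trivial; lia. }
  rewrite E in H. eapply weaken; [exact H|].
  apply incl_cons; [apply in_eq|]. apply incl_tl.
  intros C HC. apply in_map_iff in HC. destruct HC as [A [<- HA]].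
  apply in_map_iff. exists A; split; trivial.
  rewrite Forall_forall in FG. apply fsubst_agree with N; auto.
  intros i L. destruct (Nat.eqb_spec i N); trivial; lia.
Qed.

End Provability.

(** * Countability of the language *)

Section PvInd.
Variable P : forall n, pv n -> Prop.
Hypotheses (H0 : P pv_zero) (H1 : P pv_succ) (H2 : P pv_add) (H3 : P pv_mul)
  (H4 : P pv_half) (H5 : P pv_len) (H6 : P pv_smash)
  (H7 : forall n (i : Fin.t n), P (pv_proj i))
  (H8 : forall n k (f : pv k) (gs : Vector.t (pv n) k),
     P f -> Vector.Forall (@P n) gs -> P (pv_comp f gs))
  (H9 : forall n (g : pv n) h0 h1 k, P g -> P h0 -> P h1 -> P k ->
     P (pv_lrec g h0 h1 k)).
Fixpoint pv_nested_ind n (f : pv n) : P f :=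
  match f with
  | pv_zero => H0 | pv_succ => H1 | pv_add => H2 | pv_mul => H3
  | pv_half => H4 | pv_len => H5 | pv_smash => H6
  | pv_proj n i => H7 i
  | pv_comp n k f gs => @H8 n k f gs (pv_nested_ind f)
      ((fix go k (v : Vector.t (pv n) k) : Vector.Forall (@P n) v :=
         match v with
         | Vector.nil => Vector.Forall_nil (@P n)
         | Vector.cons t k v => @Vector.Forall_cons _ (@P n) k t v (pv_nested_ind t) (go k v)
         end) _ gs)
  | pv_lrec n g h0 h1 k => H9 (pv_nested_ind g) (pv_nested_ind h0)
      (pv_nested_ind h1) (pv_nested_ind k)
  end.
End PvInd.

Notation tree := (choice.GenTree.tree nat).
Notation Lf := choice.GenTree.Leaf.
Notation Nd := choice.GenTree.Node.

Fixpoint enc_pv n (f : pv n) : tree :=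
  match f with
  | pv_zero => Nd 0 [] | pv_succ => Nd 1 [] | pv_add => Nd 2 []
  | pv_mul => Nd 3 [] | pv_half => Nd 4 [] | pv_len => Nd 5 [] | pv_smash => Nd 6 []
  | pv_proj n i => Nd 7 [Lf n; Lf (proj1_sig (Fin.to_nat i))]
  | pv_comp n k f gs =>
      Nd 8 (Lf n :: Lf k :: enc_pv f :: Vector.to_list (Vector.map (@enc_pv n) gs))
  | pv_lrec n g h0 h1 k => Nd 9 [Lf n; enc_pv g; enc_pv h0; enc_pv h1; enc_pv k]
  end.

Lemma to_list_map_inj (A B : Type) (f : A -> B) n (v w : Vector.t A n) :
  Vector.Forall (fun x => forall y, f x = f y -> x = y) v ->
  Vector.to_list (Vector.map f v) = Vector.to_list (Vector.map f w) -> v = w.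
Proof.
  induction v as [|x n v IH]; intros H E.
  - symmetry. apply (Vector.case0 (fun w => w = Vector.nil A)). reflexivity.
  - revert E. apply (Vector.caseS' w). intros y w' E.
    rewrite Vector.Forall_cons_iff in H. simpl in E.
    rewrite !Vector.to_list_cons in E. injection E as E1 E2.
    destruct H as [Hx Hv]. rewrite (Hx _ E1), (IH w'); trivial.
Qed.

Lemma existT_nat_inj (P : nat -> Type) n (x y : P n) :
  existT P n x = existT P n y -> x = y.
Proof. apply inj_pair2_eq_dec, Nat.eq_dec. Qed.

(** The arities are compared together with the symbols because the inner arity of a composition is
    not visible in its type; the code of a composition or projection therefore records it. *)
Lemma enc_pv_sig n (f : pv n) : forall n' (f' : pv n'),
  enc_pv f = enc_pv f' -> existT pv n f = existT pv n' f'.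
Proof.
  induction f using pv_nested_ind; intros n' f' E;
    try solve [destruct f'; simpl in E; try discriminate; reflexivity].
  - destruct f'; simpl in E; try discriminate. injection E as E1 E2. subst.
    apply Fin.to_nat_inj in E2. now subst.
  - destruct f'; simpl in E; try discriminate. injection E as E1 E2 E3 E4. subst.
    apply IHf in E3. apply existT_nat_inj in E3. subst.
    apply to_list_map_inj in E4; [now subst|].
    revert H. apply vForall_impl. intros g Hg h Eh.
    now apply existT_nat_inj, Hg.
  - destruct f'; simpl in E; try discriminate. injection E as E0 E1 E2 E3 E4. subst.
    apply IHf1 in E1; apply IHf2 in E2; apply IHf3 in E3; apply IHf4 in E4.
    apply existT_nat_inj in E1, E2, E3, E4. now subst.
Qed.

Fixpoint enc_tm (t : tm) : tree :=
  match t with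
  | var i => Lf i
  | fapp n f ts => Nd n (enc_pv f :: Vector.to_list (Vector.map enc_tm ts))
  end.

Lemma enc_tm_inj t : forall t', enc_tm t = enc_tm t' -> t = t'.
Proof.
  induction t using tm_nested_ind; intros [j|n' f' ts'] E; simpl in E; try discriminate.
  - now injection E as ->.
  - injection E as E1 E2 E3. subst.
    apply enc_pv_sig in E2. apply existT_nat_inj in E2. subst.
    apply to_list_map_inj in E3; [now subst|]. exact H.
Qed.

Fixpoint enc_fm (A : fm) : tree :=
  match A with
  | Bot => Nd 0 []
  | Eq s t => Nd 1 [enc_tm s; enc_tm t]
  | Le s t => Nd 2 [enc_tm s; enc_tm t]
  | Imp A B => Nd 3 [enc_fm A; enc_fm B]
  | And A B => Nd 4 [enc_fm A; enc_fm B]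
  | Or A B => Nd 5 [enc_fm A; enc_fm B]
  | All A => Nd 6 [enc_fm A]
  | Ex A => Nd 7 [enc_fm A]
  end.

Lemma enc_fm_inj A : forall B, enc_fm A = enc_fm B -> A = B.
Proof.
  induction A; intros [] E; simpl in E; try discriminate; trivial;
    injection E; intros; f_equal; auto using enc_tm_inj.
Qed.

Lemma fm_countable : exists e : nat -> fm, forall A, exists k, e k = A.
Proof.
  set (c A := choice.pickle (enc_fm A)).
  assert (inj : forall A B, c A = c B -> A = B).
  { intros A B E. apply enc_fm_inj.
    assert (E' : choice.unpickle (c A) = choice.unpickle (c B) :> option tree) by now rewrite E.
    unfold c in E'. rewrite !choice.pickleK in E'. now injection E'. }
  exists (fun k => epsilon (inhabits Bot) (fun A => c A = k)).
  intro A. exists (c A). apply inj.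
  apply (epsilon_spec (inhabits Bot) (fun B => c B = c A)). now exists A.
Qed.

(** * Semantics *)

Record structure : Type := Structure {
  dom :> Type;
  fint : forall n, pv n -> Vector.t dom n -> dom;
  leint : dom -> dom -> Prop
}.

Definition ocons (D : Type) (x : D) (rho : nat -> D) (i : nat) : D :=
  match i with 0 => x | S j => rho j end.

Fixpoint eval (M : structure) (rho : nat -> M) (t : tm) : M :=
  match t with
  | var i => rho i
  | fapp n f ts => fint M f (Vector.map (eval M rho) ts)
  end.

Fixpoint sat (M : structure) (rho : nat -> M) (A : fm) : Prop :=
  match A with
  | Bot => False
  | Eq s t => eval M rho s = eval M rho t
  | Le s t => leint M (eval M rho s) (eval M rho t)
  | Imp A B => sat M rho A -> sat M rho B
  | And A B => sat M rho A /\ sat M rho B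
  | Or A B => sat M rho A \/ sat M rho B
  | All A => forall x, sat M (ocons x rho) A
  | Ex A => exists x, sat M (ocons x rho) A
  end.

Definition models (M : structure) (T : fm -> Prop) : Prop :=
  forall A rho, T A -> sat M rho A.

(** * Completeness *)

Section Completeness.
Variable T : fm -> Prop.
Hypothesis T_closed : subst_closed T.
Variable A0 : fm.
Hypothesis A0_unprovable : ~ provable T [] A0.

Definition enum : nat -> fm := proj1_sig (constructive_indefinite_description _ fm_countable).
Lemma enum_surj A : exists k, enum k = A.
Proof. exact (proj2_sig (constructive_indefinite_description _ fm_countable) A). Qed.

Definition bound (G : list fm) : nat :=
  epsilon (inhabits 0) (fun N => Forall (ffv N) G).

Lemma bound_spec G : Forall (ffv (bound G)) G.
Proof.
  apply (epsilon_spec (inhabits 0) (fun N => Forall (ffv N) G)).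
  induction G as [|A G [N IH]].
  - exists 0; constructor.
  - destruct (ffv_ex A) as [K HK]. exists (Nat.max N K). constructor.
    + apply ffv_mono with K; trivial; lia.
    + eapply Forall_impl; [|exact IH]. intros B; apply ffv_mono; lia.
Qed.

Definition witness (A : fm) (G : list fm) : list fm :=
  match A with
  | Ex B => [inst B (var (bound (A :: G)))]
  | _ => []
  end.

Definition consistent (G : list fm) : Prop := ~ provable T G Bot.

(** Henkin's construction by finite stages. As a stage is a finite list, a variable outside it is
    always available as a witness, and the language need not be extended by constants. *)
Fixpoint stage (k : nat) : list fm :=
  match k with
  | 0 => [Not A0]
  | S k => if excluded_middle_informative (consistent (enum k :: stage k))
           then witness (enum k) (stage k) ++ enum k :: stage k
           else stage k
  end.

Lemma stage_consistent k : consistent (stage k).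
Proof.
  induction k as [|k IH]; simpl.
  - intro H. apply A0_unprovable. now apply p_raa.
  - destruct excluded_middle_informative as [C|C]; trivial.
    destruct (enum k) as [| | | | | | |A] eqn:E; simpl; trivial.
    intro H. apply C.
    assert (B := bound_spec (Ex A :: stage k)).
    eapply p_exE with (A := A); [apply p_hyp, in_eq|].
    change (flift Bot) with Bot.
    apply fresh_witness with (N := bound (Ex A :: stage k)); trivial.
    now inversion B.
Qed.

Lemma stage_mono k l : k <= l -> incl (stage k) (stage l).
Proof.
  induction 1 as [|l L IH]; [apply incl_refl|]. simpl.
  destruct excluded_middle_informative; trivial.
  apply incl_appr, incl_tl, IH.
Qed.

Definition thm (A : fm) : Prop := exists k, provable T (stage k) A.

Lemma thm_mp1 A B :
  (forall G, provable T G A -> provable T G B) -> thm A -> thm B.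
Proof. intros H [k HA]. exists k; auto. Qed.

Lemma thm_mp2 A B C :
  (forall G, provable T G A -> provable T G B -> provable T G C) ->
  thm A -> thm B -> thm C.
Proof.
  intros H [k HA] [l HB]. exists (Nat.max k l). apply H.
  - eapply weaken; [exact HA|]. apply stage_mono; lia.
  - eapply weaken; [exact HB|]. apply stage_mono; lia.
Qed.

Lemma thm_0 A : (forall G, provable T G A) -> thm A.
Proof. exists 0; auto. Qed.

Lemma thm_consistent : ~ thm Bot.
Proof. intros [k H]. now apply (@stage_consistent k). Qed.

Lemma thm_complete A : thm A \/ thm (Not A).
Proof.
  destruct (enum_surj A) as [k Hk].
  destruct (classic (consistent (A :: stage k))) as [C|C].
  - left. exists (S k). simpl. rewrite Hk.
    destruct excluded_middle_informative; [|tauto].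
    apply p_hyp, in_or_app. right. apply in_eq.
  - right. exists k. apply p_imp. now apply NNPP.
Qed.

Lemma thm_mp A B : thm (Imp A B) -> thm A -> thm B.
Proof. apply thm_mp2. intros G; apply p_mp. Qed.

Lemma thm_not A : thm (Not A) <-> ~ thm A.
Proof.
  split.
  - intros N H. now apply thm_consistent, (thm_mp N).
  - intro N. destruct (thm_complete A); tauto.
Qed.

Lemma thm_ex A : thm (Ex A) -> exists i, thm (inst A (var i)).
Proof.
  intro H. destruct (enum_surj (Ex A)) as [k Hk].
  exists (bound (Ex A :: stage k)).
  assert (C : consistent (Ex A :: stage k)).
  { intro C. apply thm_consistent. apply thm_mp with (Ex A); trivial.
    exists k. now apply p_imp. }
  exists (S k). simpl. rewrite Hk.
  destruct excluded_middle_informative; [|tauto].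
  apply p_hyp. apply in_eq.
Qed.

(** From right to left by completeness: otherwise [Ex (Not A)] would be a theorem, and its witness,
    a variable, would refute an instance. *)
Lemma thm_all A : thm (All A) <-> forall t, thm (inst A t).
Proof.
  split.
  - intros H t. revert H. apply thm_mp1. intros G; apply p_inst.
  - intro H. destruct (thm_complete (All A)) as [|N]; trivial. exfalso.
    assert (E : thm (Ex (Not A))).
    { revert N. apply thm_mp1. intros G N. apply p_raa.
      apply p_mp with (All A); [eapply weaken; [exact N|apply incl_tl, incl_refl]|].
      apply p_all, p_raa. simpl.
      apply p_mp with (flift (Ex (Not A))); [apply p_hyp; right; left; trivial|].
      simpl. apply p_ex with (var 0). unfold inst. simpl.
      rewrite fsubst_fsubst.
      replace (fun i : nat => _) with var.
      - rewrite fsubst_var. apply p_hyp, in_eq.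
      - apply functional_extensionality. now intros [|i]. }
    destruct (thm_ex E) as [i Hi]. apply thm_consistent.
    now apply thm_mp with (inst A (var i)).
Qed.

Definition teq (s t : tm) : Prop := thm (Eq s t).

Lemma thm_rew A s t : teq s t -> thm (inst A s) -> thm (inst A t).
Proof. apply thm_mp2. intros G; apply p_rew. Qed.

Lemma teq_refl t : teq t t.
Proof. apply thm_0. intro; apply p_refl. Qed.

Lemma teq_sym s t : teq s t -> teq t s.
Proof.
  intro H. assert (K := @thm_rew (Eq (var 0) (tlift s)) s t H).
  unfold inst in K. simpl in K. rewrite !tsubst_inst_tlift in K.
  apply K, teq_refl.
Qed.

Lemma teq_trans r s t : teq r s -> teq s t -> teq r t.
Proof.
  intros H H'. assert (K := @thm_rew (Eq (tlift r) (var 0)) s t H').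
  unfold inst in K. simpl in K. rewrite !tsubst_inst_tlift in K. exact (K H).
Qed.

Inductive vteq : forall n, Vector.t tm n -> Vector.t tm n -> Prop :=
| vteq_nil : vteq (Vector.nil tm) (Vector.nil tm)
| vteq_cons n s t (u v : Vector.t tm n) :
    teq s t -> vteq u v -> vteq (Vector.cons tm s n u) (Vector.cons tm t n v).

(** [F] is a term context: substituting into its lift [F'] instantiates the holes. *)
Lemma teq_context n (u v : Vector.t tm n) : vteq u v ->
  forall F F' : Vector.t tm n -> tm,
  (forall t w, tsubst (scons t var) (F' w) = F (Vector.map (tsubst (scons t var)) w)) ->
  teq (F u) (F v).
Proof.
  induction 1 as [|n s t u v E _ IH]; intros F F' HF; [apply teq_refl|].
  apply teq_trans with (F (Vector.cons tm t n u)).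
  - set (lu := Vector.map tlift u).
    assert (K := @thm_rew (Eq (F' (Vector.cons tm (tlift s) n lu))
                              (F' (Vector.cons tm (var 0) n lu))) s t E).
    assert (Hlu : forall r, Vector.map (tsubst (scons r var)) lu = u).
    { intro r. unfold lu. rewrite vmap_map. apply vmap_id. apply tsubst_inst_tlift. }
    unfold inst in K. simpl in K. rewrite !HF in K. simpl in K.
    rewrite !Hlu, !tsubst_inst_tlift in K. apply K, teq_refl.
  - apply (IH (fun w => F (Vector.cons tm t n w))
              (fun w => F' (Vector.cons tm (tlift t) n w))).
    intros r w. rewrite HF. simpl. now rewrite tsubst_inst_tlift.
Qed.

Lemma teq_fapp n (f : pv n) u v : vteq u v -> teq (fapp f u) (fapp f v).
Proof. intro H. now apply (teq_context H (fapp f) (fapp f)). Qed.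

(** The quotient of the terms by provable equality. A class is the membership predicate [teq t], so
    that provably equal terms have equal classes and the model interprets [Eq] by equality. *)
Definition class : Type := { c : tm -> Prop | exists t, c = teq t }.
Definition cls (t : tm) : class := exist _ (teq t) (ex_intro _ t eq_refl).

Lemma cls_eq s t : cls s = cls t <-> teq s t.
Proof.
  split.
  - intro E. assert (K : teq s t = teq t t) by exact (f_equal (fun c => proj1_sig c t) E).
    rewrite K. apply teq_refl.
  - intro H. assert (E : teq s = teq t).
    { apply functional_extensionality; intro r. apply propositional_extensionality.
      split; intro; [apply teq_trans with s|apply teq_trans with t]; auto using teq_sym. }
    unfold cls. generalize (ex_intro (fun t0 => teq s = teq t0) s eq_refl).
    rewrite E. intro e. f_equal; apply proof_irrelevance.
Qed.

Definition rep (c : class) : tm :=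
  epsilon (inhabits (var 0)) (fun t => cls t = c).

Lemma cls_rep c : cls (rep c) = c.
Proof.
  apply (epsilon_spec (inhabits (var 0)) (fun t => cls t = c)).
  destruct c as [c [t ->]]. exists t. unfold cls. f_equal; apply proof_irrelevance.
Qed.

Definition term_model : structure := {|
  dom := class;
  fint := fun n f v => cls (fapp f (Vector.map rep v));
  leint := fun c d => thm (Le (rep c) (rep d))
|}.

Lemma teq_rep_cls t : teq (rep (cls t)) t.
Proof. apply cls_eq, cls_rep. Qed.

Lemma eval_term_model s t :
  eval term_model (fun i => cls (s i)) t = cls (tsubst s t).
Proof.
  induction t using tm_nested_ind; simpl; trivial.
  apply cls_eq, teq_fapp. rewrite vmap_map. clear f.
  induction H as [|n t ts E _ IH]; simpl; constructor; trivial.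
  rewrite E. apply teq_rep_cls.
Qed.

Lemma thm_le_congr s t s' t' : teq s s' -> teq t t' -> thm (Le s t) -> thm (Le s' t').
Proof.
  intros E E' H.
  assert (K := @thm_rew (Le (var 0) (tlift t)) s s' E).
  assert (K' := @thm_rew (Le (tlift s') (var 0)) t t' E').
  unfold inst in K, K'; simpl in K, K'. rewrite !tsubst_inst_tlift in *. auto.
Qed.

Lemma ocons_cls t s :
  ocons (cls t) (fun i => cls (s i)) = (fun i => cls (scons t s i)).
Proof. apply functional_extensionality; now intros [|i]. Qed.

Lemma truth A : forall s,
  sat term_model (fun i => cls (s i)) A <-> thm (fsubst s A).
Proof.
  induction A as [|t u|t u|A IHA B IHB|A IHA B IHB|A IHA B IHB|A IHA|A IHA]; intro s; simpl.
  - split; [tauto|]. apply thm_consistent.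
  - rewrite !eval_term_model. apply cls_eq.
  - rewrite !eval_term_model.
    split; apply thm_le_congr; auto using teq_sym, teq_rep_cls.
  - rewrite IHA, IHB. split.
    + intro H. destruct (thm_complete (fsubst s A)) as [K|K].
      * apply H in K. revert K. apply thm_mp1. intros G K. apply p_imp.
        eapply weaken; [exact K|apply incl_tl, incl_refl].
      * revert K. apply thm_mp1. intros G K. apply p_imp, p_raa.
        apply p_mp with (fsubst s A).
        -- eapply weaken; [exact K|apply incl_tl, incl_tl, incl_refl].
        -- apply p_hyp. right. apply in_eq.
    + apply thm_mp.
  - rewrite IHA, IHB. split.
    + intros [? ?]. revert H H0. apply thm_mp2. intro G; apply p_and.
    + intro H; split; revert H; apply thm_mp1; intro G; [apply p_and1|apply p_and2].
  - rewrite IHA, IHB. split.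
    + intros [H|H]; revert H; apply thm_mp1; intro G; [apply p_or1|apply p_or2].
    + intro H. destruct (thm_complete (fsubst s A)) as [|NA]; [now left|].
      destruct (thm_complete (fsubst s B)) as [|NB]; [now right|]. exfalso.
      apply thm_consistent. apply thm_mp with (fsubst s A); [exact NA|].
      apply thm_mp with (Not (fsubst s B)); trivial.
      revert H. apply thm_mp1. intros G H. apply p_imp.
      eapply p_case.
      * eapply weaken; [exact H|apply incl_tl, incl_refl].
      * apply p_hyp, in_eq.
      * apply p_raa. apply p_mp with (fsubst s B); apply p_hyp; simpl; tauto.
  - rewrite thm_all. split.
    + intros H t. rewrite inst_up, <- IHA, <- ocons_cls. apply H.
    + intros H c. rewrite <- (cls_rep c), ocons_cls, IHA, <- inst_up. apply H.
  - split.
    + intros [c H]. rewrite <- (cls_rep c), ocons_cls, IHA, <- inst_up in H.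
      revert H. apply thm_mp1. intros G; apply p_ex.
    + intro H. apply thm_ex in H. destruct H as [i H].
      exists (cls (var i)). now rewrite ocons_cls, IHA, <- inst_up.
Qed.

Lemma term_model_models : models term_model T.
Proof.
  intros A rho HA.
  (* Representatives turn the assignment into a substitution, and the resulting instance of the
     axiom is an axiom. *)
  replace rho with (fun i => cls (rep (rho i))).
  - apply truth. apply thm_0. intro G. now apply p_ax, T_closed.
  - apply functional_extensionality; intro; apply cls_rep.
Qed.

Lemma term_model_counter : ~ sat term_model (fun i => cls (var i)) A0.
Proof.
  rewrite truth, fsubst_var. apply thm_not. exists 0. apply p_hyp, in_eq.
Qed.

End Completeness.

Theorem completeness T A : subst_closed T ->
  (forall M : structure, models M T -> forall rho, sat M rho A) -> provable T [] A.
Proof.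
  intros C H. apply NNPP. intro N.
  apply (@term_model_counter T C A N). apply H. now apply term_model_models.
Qed.

(** * Closure of the theories under substitution, and substitution in structures *)

Lemma sigma1b_subst p A : sigma1b p A -> forall s, sigma1b p (fsubst s A).
Proof.
  induction 1; intro r; simpl; try (constructor; auto);
    rewrite ?tsubst_up_tlift; constructor; auto.
Qed.

Lemma pind_subst A s : fsubst s (pind A) = pind (fsubst (up s) A).
Proof.
  unfold pind. simpl. rewrite fsubst_inst. simpl.
  do 4 f_equal. rewrite !fsubst_fsubst. f_equal.
  apply functional_extensionality; intros [|i]; simpl; trivial.
  unfold tlift. now rewrite tsubst_tsubst.
Qed.

Lemma vmap_nth_eq (f : tm -> tm) n (v : Vector.t tm n) i :
  f (Vector.nth v i) = Vector.nth (Vector.map f v) i.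
Proof. symmetry. now apply Vector.nth_map. Qed.

Lemma pv_defining_subst A s : pv_defining A -> pv_defining (fsubst s A).
Proof.
  destruct 1; simpl.
  - rewrite vmap_nth_eq. constructor.
  - rewrite vmap_map. apply (def_comp f gs (Vector.map (tsubst s) xs)).
  - apply (def_rec_zero g h0 h1 k (Vector.map (tsubst s) xs)).
  - apply (def_rec_even g h0 h1 k (tsubst s y) (Vector.map (tsubst s) xs)).
  - apply (def_rec_odd g h0 h1 k (tsubst s y) (Vector.map (tsubst s) xs)).
Qed.

Lemma BASIC_subst A s : BASIC A -> fsubst s A = A.
Proof.
  intro H. unfold BASIC in H. cbv [BASIC_axioms map] in H. simpl In in H.
  repeat (destruct H as [<-|H]; [reflexivity|]). destruct H.
Qed.

Lemma S12_subst : subst_closed S12.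
Proof.
  intros A s [B H|B H|B H].
  - rewrite BASIC_subst; trivial. now apply S12_basic.
  - now apply S12_def, pv_defining_subst.
  - rewrite pind_subst. now apply S12_pind, sigma1b_subst.
Qed.

Lemma S12_dWPHP_subst : subst_closed (union S12 dWPHP_PV).
Proof.
  intros A s [H|[f]]; [left; now apply S12_subst|right].
  exact (dWPHP_PV_ax f).
Qed.

Lemma S12_HS_subst : subst_closed (union S12 HS_PV).
Proof.
  intros A s [H|[g]]; [left; now apply S12_subst|right].
  exact (HS_PV_ax g).
Qed.

Lemma eval_tm_subst (M : structure) s t : forall rho,
  eval M rho (tsubst s t) = eval M (fun i => eval M rho (s i)) t.
Proof.
  induction t using tm_nested_ind; intro rho; simpl; trivial.
  rewrite vmap_map. f_equal. apply vmap_ext_Forall.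
  revert H. apply vForall_impl; auto.
Qed.

Lemma eval_tlift (M : structure) x rho t : eval M (ocons x rho) (tlift t) = eval M rho t.
Proof. unfold tlift. rewrite eval_tm_subst. reflexivity. Qed.

Lemma sat_fsubst (M : structure) A : forall s rho,
  sat M rho (fsubst s A) <-> sat M (fun i => eval M rho (s i)) A.
Proof.
  assert (E : forall s rho x, (fun i => eval M (ocons x rho) (up s i)) =
    ocons x (fun i => eval M rho (s i))).
  { intros s rho x. apply functional_extensionality. intros [|i]; simpl; trivial.
    apply eval_tlift. }
  induction A; intros r rho; simpl; rewrite ?eval_tm_subst; try tauto;
    try (rewrite IHA1, IHA2; tauto).
  - split; intros H x; generalize (H x); rewrite IHA, E; trivial.
  - split; intros [x H]; exists x; revert H; rewrite IHA, E; trivial.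
Qed.

Lemma sat_ext (M : structure) rho rho' A : (forall i, rho i = rho' i) ->
  sat M rho A <-> sat M rho' A.
Proof.
  intro H. replace rho' with rho; [tauto|]. now apply functional_extensionality.
Qed.

(** * Models of the base theory and definability with parameters *)

Record s12 : Type := S12Model {
  carrier :> structure;
  carrier_models : models carrier S12
}.

Fixpoint vtab (A : Type) (n : nat) (f : nat -> A) : Vector.t A n :=
  match n with
  | 0 => Vector.nil A
  | S n => Vector.cons A (f 0) n (vtab n (fun i => f (S i)))
  end.

Lemma vtab_map (A B : Type) (g : A -> B) n : forall f,
  Vector.map g (vtab n f) = vtab n (fun i => g (f i)).
Proof. induction n; intro f; simpl; f_equal; auto. Qed.

Lemma vtab_nth (A : Type) n : forall (f : nat -> A) (i : Fin.t n),
  Vector.nth (vtab n f) i = f (proj1_sig (Fin.to_nat i)).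
Proof.
  induction n; intros f i; [inversion i|].
  apply (Fin.caseS' i); simpl; trivial.
  intro j. rewrite IHn. destruct (Fin.to_nat j); reflexivity.
Qed.

Section Definability.
Variable M : s12.

Definition zr : M := fint M pv_zero (Vector.nil M).
Definition ap1 (f : pv 1) (x : M) : M := fint M f (vtab 1 (fun _ => x)).
Definition ap2 (f : pv 2) (x y : M) : M :=
  fint M f (Vector.cons M x 1 (Vector.cons M y 0 (Vector.nil M))).
Definition su : M -> M := ap1 pv_succ.
Definition hf : M -> M := ap1 pv_half.
Definition ln : M -> M := ap1 pv_len.
Definition ad : M -> M -> M := ap2 pv_add.
Definition ml : M -> M -> M := ap2 pv_mul.
Definition sm : M -> M -> M := ap2 pv_smash.
Definition le : M -> M -> Prop := leint M.
Definition lt (x y : M) : Prop := le (su x) y.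

Definition shift (rho : nat -> M) : nat -> M := fun i => rho (S i).

Definition mix (rho sigma : nat -> M) (i : nat) : M :=
  if Nat.even i then rho (Nat.div2 i) else sigma (Nat.div2 i).

Lemma mix_even rho sigma i : mix rho sigma (2 * i) = rho i.
Proof. unfold mix. now rewrite Nat.even_even, Nat.div2_double. Qed.

Lemma mix_odd rho sigma i : mix rho sigma (S (2 * i)) = sigma i.
Proof.
  unfold mix. rewrite Nat.div2_succ_double.
  replace (S (2 * i)) with (2 * i + 1) by lia. now rewrite Nat.even_odd.
Qed.

(** [Df false F]: [F] is the interpretation of a term; [Df true F]: of a term with
    parameters from the model, which sit at the odd variables. *)
Definition Df (b : bool) (F : (nat -> M) -> M) : Prop :=
  if b then exists t sigma, forall rho, F rho = eval M (mix rho sigma) t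
  else exists t, forall rho, F rho = eval M rho t.

(** [true] stands for Sigma^b_1 and [false] for Pi^b_1; parameters from the model sit at the odd
    variables. *)
Definition Sg (p : bool) (P : (nat -> M) -> Prop) : Prop :=
  exists A sigma, sigma1b p A /\ forall rho, sat M (mix rho sigma) A <-> P rho.

Lemma Df_true b F : Df b F -> Df true F.
Proof.
  destruct b; trivial. intros [t H].
  exists (tsubst (fun i => var (2 * i)) t), (fun _ => zr). intro rho.
  rewrite H, eval_tm_subst. f_equal. apply functional_extensionality; intro i.
  cbn [eval]. now rewrite mix_even.
Qed.

(** Renames the parameters of the [k]-th of a family of terms. *)
Definition ren (k : nat) (i : nat) : nat :=
  if Nat.even i then i else S (2 * Cantor.to_nat (k, Nat.div2 i)).

Definition join (s : nat -> nat -> M) (i : nat) : M :=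
  let (k, j) := Cantor.of_nat i in s k j.

Lemma mix_ren rho s k i :
  mix rho (join s) (ren k i) = mix rho (s k) i.
Proof.
  unfold ren. destruct (Nat.even i) eqn:E.
  - unfold mix. now rewrite E.
  - rewrite mix_odd. unfold mix, join. now rewrite E, Cantor.cancel_of_to.
Qed.

Lemma eval_ren rho s k t :
  eval M (mix rho (join s)) (tsubst (fun i => var (ren k i)) t) = eval M (mix rho (s k)) t.
Proof.
  rewrite eval_tm_subst. f_equal. apply functional_extensionality; intro i.
  apply mix_ren.
Qed.

Lemma sat_ren rho s k A :
  sat M (mix rho (join s)) (fsubst (fun i => var (ren k i)) A) <-> sat M (mix rho (s k)) A.
Proof.
  rewrite sat_fsubst. apply sat_ext. intro i. apply mix_ren.
Qed.

Lemma Df_var b i : Df b (fun rho => rho i).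
Proof.
  assert (H : Df false (fun rho => rho i)) by now exists (var i).
  destruct b; [now apply Df_true in H|trivial].
Qed.

Lemma Df_cst m : Df true (fun _ => m).
Proof. exists (var 1), (fun _ => m). reflexivity. Qed.

Definition Dfs b (E : (nat -> M) -> nat -> M) : Prop := forall i, Df b (fun rho => E rho i).

(** There is one inner term for each variable, hence infinitely many parameter assignments; [join]
    merges them into one by Cantor pairing. *)
Lemma Df_comp b F E : Df false F -> Dfs b E -> Df b (fun rho => F (E rho)).
Proof.
  intros [t Ht] HE. destruct b.
  - assert (C : forall i, exists p : tm * (nat -> M), forall rho,
      E rho i = eval M (mix rho (snd p)) (fst p)).
    { intro i. destruct (HE i) as [u [s H]]. now exists (u, s). }
    pose (c i := proj1_sig (constructive_indefinite_description _ (C i))).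
    assert (Hc : forall i rho, E rho i = eval M (mix rho (snd (c i))) (fst (c i))).
    { intro i. exact (proj2_sig (constructive_indefinite_description _ (C i))). }
    exists (tsubst (fun i => tsubst (fun j => var (ren i j)) (fst (c i))) t),
      (join (fun i => snd (c i))).
    intro rho. rewrite Ht, eval_tm_subst. f_equal.
    apply functional_extensionality; intro i.
    now rewrite Hc, (@eval_ren rho (fun i => snd (c i)) i).
  - assert (C : forall i, exists u, forall rho, E rho i = eval M rho u) by exact HE.
    pose (c i := proj1_sig (constructive_indefinite_description _ (C i))).
    assert (Hc : forall i rho, E rho i = eval M rho (c i)).
    { intro i. exact (proj2_sig (constructive_indefinite_description _ (C i))). }
    exists (tsubst c t). intro rho. rewrite Ht, eval_tm_subst. f_equal.
    apply functional_extensionality; intro i. apply Hc.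
Qed.

Definition enil : nat -> M := fun _ => zr.

Lemma Df_zr b : Df b (fun _ => zr).
Proof.
  assert (H : Df false (fun _ => zr)) by now exists (fapp pv_zero (Vector.nil tm)).
  destruct b; [now apply Df_true in H|trivial].
Qed.

Lemma Dfs_nil b : Dfs b (fun _ => enil).
Proof. intro i. apply Df_zr. Qed.

Lemma Dfs_cons b a E : Df b a -> Dfs b E -> Dfs b (fun rho => ocons (a rho) (E rho)).
Proof. intros Ha HE [|i]; simpl; auto. Qed.

Lemma Df_ap1 f b a : Df b a -> Df b (fun rho => ap1 f (a rho)).
Proof.
  intro H. apply (@Df_comp b (fun rho => ap1 f (rho 0)) (fun rho => ocons (a rho) enil)).
  - exists (fapp f (Vector.cons _ (var 0) _ (Vector.nil _))). reflexivity.
  - apply Dfs_cons; trivial. apply Dfs_nil.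
Qed.

Lemma Df_ap2 f b a1 a2 : Df b a1 -> Df b a2 -> Df b (fun rho => ap2 f (a1 rho) (a2 rho)).
Proof.
  intros H H'. apply (@Df_comp b (fun rho => ap2 f (rho 0) (rho 1))
    (fun rho => ocons (a1 rho) (ocons (a2 rho) enil))).
  - exists (fapp f (Vector.cons _ (var 0) _ (Vector.cons _ (var 1) _ (Vector.nil _)))).
    reflexivity.
  - auto using Dfs_cons, Dfs_nil.
Qed.

(** ** Sigma^b_1 and Pi^b_1 predicates *)

Lemma Sg_ext p P Q : (forall rho, P rho <-> Q rho) -> Sg p P -> Sg p Q.
Proof.
  intros E [A [s [HA H]]]. exists A, s. split; trivial. intro rho. now rewrite H.
Qed.

Lemma Sg_bot p : Sg p (fun _ => False).
Proof. exists Bot, enil. split; [constructor|]. reflexivity. Qed.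

Lemma Sg_atom p (R : tm -> tm -> fm) (r : M -> M -> Prop) F F' :
  (forall s t, sigma1b p (R s t)) ->
  (forall rho s t, sat M rho (R s t) <-> r (eval M rho s) (eval M rho t)) ->
  Df true F -> Df true F' -> Sg p (fun rho => r (F rho) (F' rho)).
Proof.
  intros HR Hr [t [s H]] [t' [s' H']].
  pose (ss k := match k with 0 => s | _ => s' end).
  exists (R (tsubst (fun i => var (ren 0 i)) t) (tsubst (fun i => var (ren 1 i)) t')),
    (join ss).
  split; trivial. intro rho. now rewrite Hr, !eval_ren, H, H'.
Qed.

Lemma Sg_eq p F F' : Df true F -> Df true F' -> Sg p (fun rho => F rho = F' rho).
Proof. apply (Sg_atom Eq (fun x y => x = y)); [constructor|reflexivity]. Qed.

Lemma Sg_le p F F' : Df true F -> Df true F' -> Sg p (fun rho => le (F rho) (F' rho)).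
Proof. apply (Sg_atom Le le); [constructor|reflexivity]. Qed.

Lemma Sg_binary p q (c : fm -> fm -> fm) (r : Prop -> Prop -> Prop) P Q :
  (forall A B, sigma1b q A -> sigma1b p B -> sigma1b p (c A B)) ->
  (forall rho A B, sat M rho (c A B) <-> r (sat M rho A) (sat M rho B)) ->
  (forall A B A' B', (A <-> A') -> (B <-> B') -> (r A B <-> r A' B')) ->
  Sg q P -> Sg p Q -> Sg p (fun rho => r (P rho) (Q rho)).
Proof.
  intros Hc Hr Hcong [A [s [HA H]]] [B [s' [HB H']]].
  pose (ss k := match k with 0 => s | _ => s' end).
  exists (c (fsubst (fun i => var (ren 0 i)) A) (fsubst (fun i => var (ren 1 i)) B)),
    (join ss).
  split; [apply Hc; now apply sigma1b_subst|].
  intro rho. rewrite Hr. apply Hcong; rewrite sat_ren; [apply H|apply H'].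
Qed.

Lemma Sg_and p P Q : Sg p P -> Sg p Q -> Sg p (fun rho => P rho /\ Q rho).
Proof. apply (Sg_binary And and); [constructor; trivial|reflexivity|tauto]. Qed.

Lemma Sg_or p P Q : Sg p P -> Sg p Q -> Sg p (fun rho => P rho \/ Q rho).
Proof. apply (Sg_binary Or or); [constructor; trivial|reflexivity|tauto]. Qed.

Lemma Sg_imp p P Q : Sg (negb p) P -> Sg p Q -> Sg p (fun rho => P rho -> Q rho).
Proof.
  apply (Sg_binary Imp (fun A B => A -> B)); [constructor; trivial|reflexivity|tauto].
Qed.

Lemma Sg_not p P : Sg (negb p) P -> Sg p (fun rho => ~ P rho).
Proof. intro H. apply Sg_imp; trivial. apply Sg_bot. Qed.

(** Brings a parameter assignment under a binder. *)
Definition rup (i : nat) : nat :=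
  if Nat.even i then match i with 0 => 0 | _ => Nat.pred i end else S i.

Lemma mix_rup x rho s i : ocons x (mix rho s) (rup i) = mix (ocons x rho) s i.
Proof.
  unfold rup. destruct (Nat.even i) eqn:E.
  - apply Nat.even_spec in E. destruct E as [j ->]. destruct j as [|j].
    + reflexivity.
    + rewrite mix_even. replace (2 * S j) with (S (S (2 * j))) by lia.
      cbn [ocons Nat.pred]. now rewrite mix_even.
  - simpl. unfold mix. now rewrite E.
Qed.

Lemma sat_rup x rho s A :
  sat M (ocons x (mix rho s)) (fsubst (fun i => var (rup i)) A) <->
  sat M (mix (ocons x rho) s) A.
Proof. rewrite sat_fsubst. apply sat_ext. intro i. apply mix_rup. Qed.

Lemma Sg_bounded p q (c : tm -> fm -> fm) (r : M -> (M -> Prop) -> Prop) F P :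
  (forall t A, sigma1b q A -> sigma1b p (c t A)) ->
  (forall rho t A, sat M rho (c t A) <-> r (eval M rho t) (fun x => sat M (ocons x rho) A)) ->
  (forall m X Y, (forall x, X x <-> Y x) -> (r m X <-> r m Y)) ->
  Df true F -> Sg q (fun rho => P (rho 0) (shift rho)) ->
  Sg p (fun rho => r (F rho) (fun x => P x rho)).
Proof.
  intros Hc Hr Hcong [t [s H]] [A [s' [HA H']]].
  pose (ss k := match k with 0 => s | _ => s' end).
  exists (c (tsubst (fun i => var (ren 0 i)) t)
    (fsubst (fun i => var (rup i)) (fsubst (fun i => var (ren 1 i)) A))), (join ss).
  split; [apply Hc; now repeat apply sigma1b_subst|].
  intro rho. rewrite Hr, eval_ren, <- H. apply Hcong.
  intro x. rewrite sat_rup, sat_ren. apply H'.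
Qed.

Lemma Sg_comp p P E : Sg p P -> Dfs true E -> Sg p (fun rho => P (E rho)).
Proof.
  intros [A [s [HA H]]] HE.
  assert (C : forall i, exists q : tm * (nat -> M), forall rho,
    E rho i = eval M (mix rho (snd q)) (fst q)).
  { intro i. destruct (HE i) as [u [s' H']]. now exists (u, s'). }
  pose (c i := proj1_sig (constructive_indefinite_description _ (C i))).
  assert (Hc : forall i rho, E rho i = eval M (mix rho (snd (c i))) (fst (c i))).
  { intro i. exact (proj2_sig (constructive_indefinite_description _ (C i))). }
  pose (ss k := match k with 0 => s | S i => snd (c i) end).
  exists (fsubst (fun j => if Nat.even j
      then tsubst (fun k => var (ren (S (Nat.div2 j)) k)) (fst (c (Nat.div2 j)))
      else var (ren 0 j)) A), (join ss).
  split; [now apply sigma1b_subst|]. intro rho. rewrite sat_fsubst, <- H.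
  apply sat_ext. intro j. destruct (Nat.even j) eqn:Ej.
  - rewrite eval_ren. unfold ss. rewrite <- Hc. unfold mix. now rewrite Ej.
  - cbn [eval]. rewrite mix_ren. unfold mix. now rewrite Ej.
Qed.

Lemma Df_comp_true F E : Df true F -> Dfs true E -> Df true (fun rho => F (E rho)).
Proof.
  intros [t0 [s H]] HE.
  assert (C : forall i, exists q : tm * (nat -> M), forall rho,
    E rho i = eval M (mix rho (snd q)) (fst q)).
  { intro i. destruct (HE i) as [u [s' H']]. now exists (u, s'). }
  pose (c i := proj1_sig (constructive_indefinite_description _ (C i))).
  assert (Hc : forall i rho, E rho i = eval M (mix rho (snd (c i))) (fst (c i))).
  { intro i. exact (proj2_sig (constructive_indefinite_description _ (C i))). }
  pose (ss k := match k with 0 => s | S i => snd (c i) end).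
  exists (tsubst (fun j => if Nat.even j
      then tsubst (fun k => var (ren (S (Nat.div2 j)) k)) (fst (c (Nat.div2 j)))
      else var (ren 0 j)) t0), (join ss).
  intro rho. rewrite eval_tm_subst, H. f_equal.
  apply functional_extensionality. intro j. destruct (Nat.even j) eqn:Ej.
  - rewrite eval_ren. unfold ss. rewrite <- Hc. unfold mix. now rewrite Ej.
  - cbn [eval]. rewrite mix_ren. unfold mix. now rewrite Ej.
Qed.

Lemma Sg_ex F P : Df true F -> Sg true (fun rho => P (rho 0) (shift rho)) ->
  Sg true (fun rho => exists x, le x (F rho) /\ P x rho).
Proof.
  apply (Sg_bounded ExB (fun m X => exists x, le x m /\ X x)).
  - constructor; trivial.
  - intros rho t A. simpl. split; intros [x H]; exists x; rewrite eval_tlift in *; trivial.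
  - intros m X Y E. split; intros [x H]; exists x; [rewrite <- E|rewrite E]; trivial.
Qed.

Lemma Sg_sall p F P : Df true F -> Sg p (fun rho => P (rho 0) (shift rho)) ->
  Sg p (fun rho => forall x, le x (ln (F rho)) -> P x rho).
Proof.
  apply (Sg_bounded (fun t => AllB (len t)) (fun m X => forall x, le x (ln m) -> X x)).
  - intros; constructor; trivial.
  - intros rho t A. simpl. split; intros H x; generalize (H x);
      fold (tlift t); rewrite eval_tlift; trivial.
  - intros m X Y E. split; intros H x L; apply E; auto.
Qed.

(** The further free variables of the scheme [pind] carry the parameters, so the predicate may
    mention arbitrary elements of the model. *)
Theorem PIND (P : M -> Prop) : Sg true (fun rho => P (rho 0)) ->
  P zr -> (forall x, P (hf x) -> P x) -> forall x, P x.
Proof.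
  intros [A [s [HA H]]] P0 PS x.
  set (A' := fsubst (fun i => var (rup i)) A).
  assert (HA' : forall x rho, sat M (ocons x (mix rho s)) A' <-> P x).
  { intros y rho. unfold A'. rewrite sat_rup. apply H. }
  assert (K := @carrier_models M (pind A') (mix enil s)).
  simpl in K. unfold inst in K. rewrite sat_fsubst in K.
  apply HA' with enil, K.
  - apply S12_pind. now apply sigma1b_subst.
  - split.
    + apply (HA' zr enil) in P0. revert P0. apply sat_ext. now intros [|i].
    + intros y. rewrite sat_fsubst.
      intro L. apply HA', PS, (HA' _ enil). revert L. apply sat_ext. now intros [|i].
Qed.

(** ** Terms as symbols, and limited recursion *)

Lemma fint_proj n (i : Fin.t n) rho :
  fint M (pv_proj i) (vtab n rho) = rho (proj1_sig (Fin.to_nat i)).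
Proof.
  assert (K := @carrier_models M _ rho (S12_def (def_proj i (vtab n var)))).
  simpl in K. now rewrite vtab_map, vtab_nth in K.
Qed.

Lemma fint_comp n k (f : pv k) (gs : Vector.t (pv n) k) rho :
  fint M (pv_comp f gs) (vtab n rho) =
  fint M f (Vector.map (fun g => fint M g (vtab n rho)) gs).
Proof.
  assert (K := @carrier_models M _ rho (S12_def (def_comp f gs (vtab n var)))).
  simpl in K. rewrite vmap_map, vtab_map in K. simpl in K.
  rewrite vtab_map in K. exact K.
Qed.

Lemma symbol_of_term n t : tfv n t ->
  exists f : pv n, forall rho, fint M f (vtab n rho) = eval M rho t.
Proof.
  induction t using tm_nested_ind; intro F.
  - simpl in F. exists (pv_proj (Fin.of_nat_lt F)). intro rho.
    now rewrite fint_proj, Fin.to_nat_of_nat.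
  - rewrite tfv_app in F.
    assert (K : exists gs : Vector.t (pv n) n0, forall rho,
      Vector.map (fun g => fint M g (vtab n rho)) gs = Vector.map (eval M rho) ts).
    { generalize (vForall_and H F). clear. induction ts as [|t k ts IH]; intro H.
      - now exists (Vector.nil _).
      - rewrite Vector.Forall_cons_iff in H. destruct H as [[H1 H2] H3].
        destruct (H1 H2) as [g Hg]. destruct (IH H3) as [gs Hgs].
        exists (Vector.cons _ g _ gs). intro rho. simpl. now rewrite Hg, Hgs. }
    destruct K as [gs Hgs]. exists (pv_comp f gs). intro rho.
    rewrite fint_comp, Hgs. reflexivity.
Qed.

Definition ismin (s t m : M) : Prop :=
  (le s t -> m = s) /\ (~ le s t -> m = t).

Definition mdbl (x : M) : M := ml (su (su zr)) x.

Lemma limited_recursion G H0 H1 K :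
  Df false G -> Df false H0 -> Df false H1 -> Df false K ->
  exists R : M -> (nat -> M) -> M,
    Df false (fun rho => R (rho 0) (shift rho)) /\
    (forall rho, ismin (G rho) (K (ocons zr rho)) (R zr rho)) /\
    (forall rho y, y <> zr ->
      ismin (H0 (ocons y (ocons (R y rho) rho))) (K (ocons (mdbl y) rho)) (R (mdbl y) rho)) /\
    (forall rho y,
      ismin (H1 (ocons y (ocons (R y rho) rho))) (K (ocons (su (mdbl y)) rho))
        (R (su (mdbl y)) rho)).
Proof.
  intros [tg Eg] [t0 E0] [t1 E1] [tk Ek].
  (* Each of the four terms mentions finitely many variables. With a common bound [N] they become
     symbols of the arities that [pv_lrec] expects. *)
  assert (B : exists N, tfv N tg /\ tfv (S (S N)) t0 /\ tfv (S (S N)) t1 /\ tfv (S N) tk).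
  { destruct (tfv_ex tg) as [N1 ?], (tfv_ex t0) as [N2 ?], (tfv_ex t1) as [N3 ?],
      (tfv_ex tk) as [N4 ?].
    exists (N1 + N2 + N3 + N4). repeat split;
      [apply tfv_mono with N1|apply tfv_mono with N2|apply tfv_mono with N3
      |apply tfv_mono with N4]; trivial; lia. }
  destruct B as [N [Fg [F0 [F1 Fk]]]].
  destruct (symbol_of_term _ _ Fg) as [g Hg], (symbol_of_term _ _ F0) as [h0 H0'],
    (symbol_of_term _ _ F1) as [h1 H1'], (symbol_of_term _ _ Fk) as [k Hk].
  exists (fun y rho => fint M (pv_lrec g h0 h1 k) (vtab (S N) (ocons y rho))).
  split; [|split; [|split]].
  - exists (fapp (pv_lrec g h0 h1 k) (vtab (S N) var)). intro rho.
    simpl. now rewrite vtab_map.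
  - intro rho.
    assert (L := @carrier_models M _ rho (S12_def (def_rec_zero g h0 h1 k (vtab N var)))).
    rewrite Eg, Ek, <- Hg, <- Hk. simpl in *. rewrite vtab_map in L. exact L.
  - intros rho y Hy.
    assert (L := @carrier_models M _ (ocons y rho)
      (S12_def (def_rec_even g h0 h1 k (var 0) (vtab N (fun i => var (S i)))))).
    rewrite E0, Ek, <- H0', <- Hk. simpl in *. rewrite vtab_map in L. exact (L Hy).
  - intros rho y.
    assert (L := @carrier_models M _ (ocons y rho)
      (S12_def (def_rec_odd g h0 h1 k (var 0) (vtab N (fun i => var (S i)))))).
    rewrite E1, Ek, <- H1', <- Hk. simpl in *. rewrite vtab_map in L. exact L.
Qed.

End Definability.

Arguments zr {M}.
Arguments enil {M}.
Arguments Df {M}.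
Arguments Dfs {M}.
Arguments Sg {M}.
Arguments shift {M}.
Arguments ismin {M}.

From Stdlib Require Import Ring.
Unset Strict Implicit.

(** * Arithmetic in a model *)

Declare Scope M_scope.
Delimit Scope M_scope with M.
Notation "0" := zr : M_scope.
Notation "1" := (su _ zr) : M_scope.
Notation "2" := (su _ (su _ zr)) : M_scope.
Notation "x + y" := (ad _ x y) : M_scope.
Notation "x * y" := (ml _ x y) : M_scope.
Notation "x <= y" := (le _ x y) : M_scope.
Notation "x < y" := (lt _ x y) : M_scope.

Section Arithmetic.
Variable M : s12.
Local Open Scope M_scope.
Implicit Types x y z : M.

Lemma basic i : (i < 32)%nat -> sat M enil (nth i BASIC_axioms Bot).
Proof.
  intro H. apply carrier_models, S12_basic. apply nth_In. exact H.
Qed.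

Ltac ax i := exact (basic (i := i) ltac:(lia)).

Lemma mle_su x y : y <= x -> y <= su M x.
Proof. revert x y; ax 0%nat. Qed.
Lemma su_neq x : x <> su M x.
Proof. revert x; ax 1%nat. Qed.
Lemma mle0 x : 0 <= x.
Proof. revert x; ax 2%nat. Qed.
Lemma mlt_def x y : (x <= y /\ x <> y) <-> su M x <= y.
Proof. revert x y; ax 3%nat. Qed.
Lemma mle_total x y : y <= x \/ x <= y.
Proof. revert x y; ax 5%nat. Qed.
Lemma mle_antisym x y : x <= y /\ y <= x -> x = y.
Proof. revert x y; ax 6%nat. Qed.
Lemma mle_trans x y z : x <= y /\ y <= z -> x <= z.
Proof. revert x y z; ax 7%nat. Qed.
Lemma ln0 : ln M 0 = 0.
Proof. ax 8%nat. Qed.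
Lemma ln_mono x y : x <= y -> ln M x <= ln M y.
Proof. revert x y; ax 11%nat. Qed.
Lemma ln_sm x y : ln M (sm M x y) = su M (ln M x * ln M y).
Proof. revert x y; ax 12%nat. Qed.
Lemma sm0 y : sm M 0 y = 1.
Proof. revert y; ax 13%nat. Qed.
Lemma sm1 x : x <> 0 -> sm M 1 (2 * x) = 2 * sm M 1 x /\ sm M 1 (su M (2 * x)) = 2 * sm M 1 x.
Proof. revert x; ax 14%nat. Qed.
Lemma sm_comm x y : sm M x y = sm M y x.
Proof. revert x y; ax 15%nat. Qed.
Lemma sm_ln x y z : ln M x = ln M y -> sm M x z = sm M y z.
Proof. revert x y z; ax 16%nat. Qed.
Lemma sm_add x y u v : ln M x = ln M u + ln M v -> sm M x y = sm M u y * sm M v y.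
Proof. revert x y u v; ax 17%nat. Qed.
Lemma ln_dbl x : x <> 0 ->
  ln M (2 * x) = su M (ln M x) /\ ln M (su M (2 * x)) = su M (ln M x).
Proof. revert x; ax 9%nat. Qed.
Lemma ln1 : ln M 1 = 1.
Proof. ax 10%nat. Qed.
Lemma mle_addr x y : x <= x + y.
Proof. revert x y; ax 18%nat. Qed.
Lemma ad_comm x y : x + y = y + x.
Proof. revert x y; ax 20%nat. Qed.
Lemma ad0 x : x + 0 = x.
Proof. revert x; ax 21%nat. Qed.
Lemma ad_su x y : x + su M y = su M (x + y).
Proof. revert x y; ax 22%nat. Qed.
Lemma ad_assoc x y z : (x + y) + z = x + (y + z).
Proof. revert x y z; ax 23%nat. Qed.
Lemma ad_le x y z : x + y <= x + z <-> y <= z.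
Proof. revert x y z; ax 24%nat. Qed.
Lemma ml0 x : x * 0 = 0.
Proof. revert x; ax 25%nat. Qed.
Lemma ml_su x y : x * su M y = x * y + x.
Proof. revert x y; ax 26%nat. Qed.
Lemma ml_comm x y : x * y = y * x.
Proof. revert x y; ax 27%nat. Qed.
Lemma ml_ad x y z : x * (y + z) = x * y + x * z.
Proof. revert x y z; ax 28%nat. Qed.
Lemma ml_le x y z : 1 <= x -> (x * y <= x * z <-> y <= z).
Proof. revert x y z; ax 29%nat. Qed.
Lemma ln_hf x : x <> 0 -> ln M x = su M (ln M (hf M x)).
Proof. revert x; ax 30%nat. Qed.
Lemma hf_def x y : x = hf M y <-> (2 * x = y \/ su M (2 * x) = y).
Proof. revert x y; ax 31%nat. Qed.

Lemma hf_cases x : x = 2 * hf M x \/ x = su M (2 * hf M x).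
Proof. destruct (proj1 (hf_def (hf M x) x) eq_refl); auto. Qed.

Lemma su_ad x : su M x = x + 1.
Proof. now rewrite ad_su, ad0. Qed.

Lemma ml1 x : x * 1 = x.
Proof. now rewrite ml_su, ml0, ad_comm, ad0. Qed.

Lemma ml2 x : 2 * x = x + x.
Proof. now rewrite ml_comm, ml_su, ml1. Qed.

(** Associativity of multiplication is not among the basic axioms; it follows by induction on the
    notation of z from distributivity. *)
Lemma ml_assoc x y z : (x * y) * z = x * (y * z).
Proof.
  revert z. apply PIND with (P := fun z => (x * y) * z = x * (y * z)).
  - apply Sg_eq; repeat (apply Df_ap2 || apply Df_cst || apply Df_var).
  - now rewrite !ml0.
  - intros z E. destruct (hf_cases z) as [-> | ->].
    + rewrite ml2, !ml_ad, E. trivial.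
    + rewrite ml2, !ml_su, !ml_ad, E. trivial.
Qed.

Lemma M_semi_ring : semi_ring_theory 0 1 (ad M) (ml M) (@eq M).
Proof.
  constructor; intros.
  - now rewrite ad_comm, ad0.
  - apply ad_comm.
  - symmetry; apply ad_assoc.
  - now rewrite ml_comm, ml1.
  - now rewrite ml_comm, ml0.
  - apply ml_comm.
  - symmetry; apply ml_assoc.
  - now rewrite ml_comm, ml_ad, (ml_comm p), (ml_comm p).
Qed.

Add Ring M_ring : M_semi_ring.

Lemma two : (2 : M) = 1 + 1.
Proof. apply su_ad. Qed.

Ltac mring := rewrite ?two; ring.

Lemma mle_refl x : x <= x.
Proof. now destruct (mle_total x x). Qed.

Lemma mle_addl x y : x <= y + x.
Proof. rewrite ad_comm. apply mle_addr. Qed.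

Lemma mnot_le x y : ~ x <= y <-> y < x.
Proof.
  unfold lt. rewrite <- mlt_def. split.
  - intro H. destruct (mle_total x y) as [L|L]; [|tauto]. split; trivial.
    intros ->. exact (H (mle_refl x)).
  - intros [H N] K. apply N, mle_antisym. tauto.
Qed.

Lemma ad_cancel x y z : x + y = x + z -> y = z.
Proof.
  intro E. apply mle_antisym. split; apply (ad_le x); rewrite E; apply mle_refl.
Qed.

Lemma ml_mono x y z : y <= z -> x * y <= x * z.
Proof.
  intro H. destruct (classic (x = 0)) as [->|N].
  - rewrite !(ml_comm 0), !ml0. apply mle_refl.
  - apply ml_le; trivial. apply (proj1 (mlt_def _ _)). split; auto using mle0.
Qed.

Lemma ml_le2 x y z w : x <= y -> z <= w -> x * z <= y * w.
Proof.
  intros H K. apply mle_trans with (x * w). split; [now apply ml_mono|].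
  rewrite (ml_comm x), (ml_comm y). now apply ml_mono.
Qed.

Lemma sm_10 : sm M 1 0 = 1.
Proof. now rewrite sm_comm, sm0. Qed.

Lemma ml_eq0 x y : x * y = 0 -> x = 0 \/ y = 0.
Proof.
  intro E. destruct (classic (x = 0)) as [|N]; [tauto|right].
  apply mle_antisym. split; [|apply mle0].
  apply (@ml_le x y 0).
  - apply (proj1 (mlt_def _ _)). split; auto using mle0.
  - rewrite E, ml0. apply mle_refl.
Qed.

Lemma neq10 : (1 : M) <> 0.
Proof. intro E. symmetry in E. revert E. apply su_neq. Qed.

Lemma su_neq0 x : su M x <> 0.
Proof.
  intro E. assert (H : x < 0). { unfold lt. rewrite E. apply mle_refl. }
  apply mnot_le in H. apply H, mle0.
Qed.

Lemma hf_neq0 x : x <> 0 -> x <> 1 -> hf M x <> 0.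
Proof.
  intros H K E. destruct (hf_cases x) as [L|L]; rewrite E, ml0 in L; tauto.
Qed.

Lemma hf0 : hf M 0 = 0.
Proof. symmetry. apply hf_def. left. apply ml0. Qed.

Lemma hf1 : hf M 1 = 0.
Proof. symmetry. apply hf_def. right. now rewrite ml0. Qed.

Lemma ml_cancel x y z : x <> 0 -> x * y = x * z -> y = z.
Proof.
  intros H E. assert (L : 1 <= x) by (apply (proj1 (mlt_def _ _)); split; auto using mle0).
  apply mle_antisym. split; apply (@ml_le x _ _ L);
    rewrite E; apply mle_refl.
Qed.

Lemma ln2 : ln M (2 * 1) = 2.
Proof. destruct (ln_dbl neq10) as [E _]. now rewrite E, ln1. Qed.

Lemma sm11 : sm M 1 1 = 2.
Proof.
  assert (N : sm M 1 1 <> 0).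
  { intro E. assert (L := ln_sm 1 1). rewrite E, ln0 in L.
    symmetry in L. revert L. apply su_neq0. }
  apply ml_cancel with (sm M 1 1); trivial.
  rewrite <- (@sm_add (2 * 1) 1 1 1), sm_comm.
  - destruct (sm1 neq10) as [E _]. rewrite E. mring.
  - rewrite ln2, ln1. mring.
Qed.

(** [sm M 1 x] is 2^|x|. *)
Lemma sm1_hf x : x <> 0 -> sm M 1 x = 2 * sm M 1 (hf M x).
Proof.
  intro H. destruct (classic (x = 1)) as [->|N].
  - rewrite hf1, sm_10, ml1. apply sm11.
  - destruct (hf_cases x) as [E|E]; rewrite E at 1; apply sm1; now apply hf_neq0.
Qed.

Lemma lt_sm1 x : x < sm M 1 x.
Proof.
  apply PIND with (P := fun x => x < sm M 1 x).
  - apply Sg_le; repeat (apply Df_ap2 || apply Df_ap1 || apply Df_cst || apply Df_var).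
  - unfold lt. rewrite sm_10. apply mle_refl.
  - clear x. intros x L. destruct (classic (x = 0)) as [->|N].
    { unfold lt. rewrite sm_10. apply mle_refl. }
    rewrite sm1_hf; trivial. unfold lt in *.
    apply mle_trans with (2 * su M (hf M x)). split; [|now apply ml_mono].
    rewrite ml_su. 
    destruct (hf_cases x) as [E|E]; rewrite E at 1.
    + apply mle_trans with (2 * hf M x + 1). split; [|apply ad_le, (proj1 (mlt_def _ _)); split].
      * rewrite su_ad. apply mle_refl.
      * apply mle0.
      * intro K; symmetry in K; now apply su_neq0 in K.
    + rewrite su_ad, (su_ad (2 * hf M x)), ad_assoc.
      replace (1 + 1 : M) with (2 : M) by mring. apply mle_refl.
Qed.

(** The gap between [x + z] and [y] is halved |u| times. *)
Lemma difference_ex x y : x <= y -> exists z, x + z = y.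
Proof.
  intro H.
  (* [z] approximates the difference from below with an error of at most [e], where e 2^|u| <= y. At
     u = y this leaves only e = 0, because 2^|y| > y. The bounds z, e <= y make the statement
     Sigma^b_1. *)
  assert (K : exists z, z <= y /\ exists e, e <= y /\
    (x + z <= y /\ y <= x + z + e /\ e * sm M 1 y <= y)).
  { apply PIND with (P := fun u => exists z, z <= y /\ exists e, e <= y /\
      (x + z <= y /\ y <= x + z + e /\ e * sm M 1 u <= y)).
    - apply Sg_ex with (P := fun z rho => exists e, e <= y /\
        (x + z <= y /\ y <= x + z + e /\ e * sm M 1 (rho 0%nat) <= y)); [apply Df_cst|].
      apply Sg_ex with (P := fun e rho =>
        (x + rho 0%nat <= y /\ y <= x + rho 0%nat + e /\ e * sm M 1 (rho 1%nat) <= y));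
        [apply Df_cst|].
      repeat apply Sg_and; apply Sg_le;
        repeat (apply Df_cst || apply Df_ap2 || apply Df_ap1 || apply Df_var
          || apply (Df_var M true 2)).
    - exists 0; split; [apply mle0|]. exists y; split; [apply mle_refl|].
      rewrite sm_10, ml1, ad0. repeat split; auto using mle_refl, mle_addl.
    - intros u [z [_ [e [_ [H1 [H2 H3]]]]]].
      destruct (classic (u = 0)) as [E|N].
      { rewrite E, hf0 in *. exists z; split.
        - apply mle_trans with (x + z). split; trivial. apply mle_addl.
        - exists e; split; [|tauto]. rewrite sm_10, ml1 in H3. exact H3. }
      set (h := hf M e).
      assert (E2 : h + h <= e).
      { rewrite <- ml2. destruct (hf_cases e) as [E|E]; fold h in E; rewrite E;
          [apply mle_refl|apply mle_su, mle_refl]. }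
      assert (H3' : h * sm M 1 u <= y).
      { apply mle_trans with (e * sm M 1 (hf M u)). split; trivial.
        rewrite (sm1_hf N).
        replace (h * (2 * sm M 1 (hf M u))) with ((h + h) * sm M 1 (hf M u)) by mring.
        apply ml_le2; auto using mle_refl. }
      assert (Lh : h <= y).
      { apply mle_trans with (h * sm M 1 u). split; trivial.
        rewrite <- (ml1 h) at 1. apply ml_mono.
        apply mle_trans with (su M u). split; [|apply lt_sm1].
        apply (proj1 (mlt_def _ _)). split;
          auto using mle0. intro K. symmetry in K. now apply su_neq0 in K. }
      destruct (mle_total (x + z + h) y) as [L|L].
      + exists z; split; [apply mle_trans with (x + z); split; trivial; apply mle_addl|].
        exists h; tauto.
      + destruct (hf_cases e) as [E|E]; fold h in E.
        * exists (z + h); split.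
          { apply mle_trans with (x + z + h). split; trivial. rewrite ad_assoc. apply mle_addl. }
          exists h; split; trivial. rewrite <- ad_assoc. repeat split; trivial.
          rewrite E, ml2 in H2. now rewrite ad_assoc.
        (* Here e = 2h + 1. Advancing [z] by h could leave an error of h + 1, so it advances by h +
           1, unless x + z + h is already y. *)
        * destruct (classic (x + z + h = y)) as [Ey|Ny].
          { exists z; split; [apply mle_trans with (x + z); split; trivial; apply mle_addl|].
            exists h; split; trivial. rewrite Ey. auto using mle_refl. }
          assert (L' : x + (z + su M h) <= y).
          { rewrite ad_su, ad_su, <- ad_assoc. now apply (proj1 (mlt_def _ _)). }
          exists (z + su M h); split.
          { apply mle_trans with (x + (z + su M h)). split; trivial. apply mle_addl. }
          exists h; split; trivial. repeat split; trivial.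
          rewrite E, ml2 in H2.
          replace (x + (z + su M h) + h) with (x + z + su M (h + h)); trivial.
          rewrite (su_ad (h + h)), (su_ad h). mring. }
  destruct K as [z [_ [e [_ [H1 [H2 H3]]]]]]. exists z.
  apply mle_antisym. split; trivial.
  assert (E : e = 0).
  { apply NNPP. intro N. apply (proj2 (mnot_le (sm M 1 y) y)); [apply lt_sm1|].
    apply mle_trans with (e * sm M 1 y). split; trivial.
    rewrite ml_comm. rewrite <- (ml1 (sm M 1 y)) at 1. apply ml_mono.
    apply (proj1 (mlt_def _ _)). split; auto using mle0. }
  now rewrite E, ad0 in H2.
Qed.

(** * The integers of a model *)

Inductive ZM : Type := Zp (m : M) | Zn (m : M).

(** [Zn m] is -(m+1). *)
Definition zpos (z : ZM) : M := match z with Zp m => m | Zn _ => 0 end.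
Definition zneg (z : ZM) : M := match z with Zp _ => 0 | Zn m => su M m end.
Definition zeqv (z : ZM) (p n : M) : Prop := p + zneg z = zpos z + n.

Lemma zeqv_ex p n : exists z : ZM, zeqv z p n.
Proof.
  unfold zeqv. destruct (classic (n <= p)) as [L|L].
  - destruct (difference_ex L) as [d E]. exists (Zp d). simpl. rewrite <- E. mring.
  - apply mnot_le in L. destruct (difference_ex L) as [d E]. exists (Zn d). simpl.
    rewrite <- E, (su_ad d), (su_ad p). mring.
Qed.

Definition zmk (p n : M) : ZM := proj1_sig (constructive_indefinite_description _ (zeqv_ex p n)).

Lemma zmk_spec p n : p + zneg (zmk p n) = zpos (zmk p n) + n.
Proof. exact (proj2_sig (constructive_indefinite_description _ (zeqv_ex p n))). Qed.

Lemma z_eq (z w : ZM) : zpos z + zneg w = zpos w + zneg z -> z = w.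
Proof.
  destruct z as [m|m], w as [k|k]; simpl; intro E.
  - f_equal. now rewrite !ad0 in E.
  - exfalso. apply (@su_neq0 (m + k)). rewrite <- ad_su, E. mring.
  - exfalso. apply (@su_neq0 (k + m)). rewrite <- ad_su, <- E. mring.
  - f_equal. rewrite !(ad_comm 0), !ad0 in E.
    apply (@ad_cancel 1). rewrite !(ad_comm 1), <- !su_ad. congruence.
Qed.

Lemma zmk_eq p n (z : ZM) : p + zneg z = zpos z + n -> zmk p n = z.
Proof.
  intro E. apply z_eq. assert (K := zmk_spec p n).
  apply (@ad_cancel (p + n)).
  replace (p + n + (zpos (zmk p n) + zneg z)) with ((zpos (zmk p n) + n) + (p + zneg z)) by mring.
  rewrite E, <- K. mring.
Qed.

Lemma zmk_rep (z : ZM) : zmk (zpos z) (zneg z) = z.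
Proof. now apply zmk_eq. Qed.

Lemma zmk_zmk p n q m : p + m = q + n <-> zmk p n = zmk q m.
Proof.
  assert (E1 := zmk_spec q m). assert (E2 := zmk_spec p n). split; intro E.
  - apply zmk_eq. apply (@ad_cancel (q + m)).
    transitivity ((p + m) + (q + zneg (zmk q m))); [mring|]. rewrite E, E1. mring.
  - rewrite E in E2. apply (@ad_cancel (zpos (zmk q m) + zneg (zmk q m))).
    transitivity ((p + zneg (zmk q m)) + (zpos (zmk q m) + m)); [mring|].
    rewrite E2, <- E1. mring.
Qed.

Definition zadd (z w : ZM) := zmk (zpos z + zpos w) (zneg z + zneg w).
Definition zmul (z w : ZM) :=
  zmk (zpos z * zpos w + zneg z * zneg w) (zpos z * zneg w + zneg z * zpos w).
Definition zopp (z : ZM) := zmk (zneg z) (zpos z).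
Definition zle (z w : ZM) : Prop := zpos z + zneg w <= zpos w + zneg z.

Lemma zadd_mk p n q m : zadd (zmk p n) (zmk q m) = zmk (p + q) (n + m).
Proof.
  symmetry. apply zmk_eq. unfold zadd.
  assert (E1 := zmk_spec p n). assert (E2 := zmk_spec q m).
  set (z := zmk p n) in *. set (w := zmk q m) in *.
  assert (E3 := zmk_spec (zpos z + zpos w) (zneg z + zneg w)).
  set (r := zmk (zpos z + zpos w) _) in *.
  apply (@ad_cancel (zpos z + zneg z + zpos w + zneg w)).
  transitivity ((p + zneg z) + (q + zneg w) + (zpos z + zpos w + zneg r)); [mring|].
  rewrite E1, E2, E3. mring.
Qed.

Lemma zopp_mk p n : zopp (zmk p n) = zmk n p.
Proof.
  unfold zopp. apply zmk_zmk. rewrite ad_comm, zmk_spec. apply ad_comm.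
Qed.

Lemma zmul_mk p n q m : zmul (zmk p n) (zmk q m) = zmk (p * q + n * m) (p * m + n * q).
Proof.
  symmetry. unfold zmul. apply zmk_zmk.
  assert (E1 := zmk_spec p n). assert (E2 := zmk_spec q m).
  set (z := zmk p n) in *. set (w := zmk q m) in *.
  apply (@ad_cancel (zneg z * q + zpos z * m + zpos z * q + zneg z * m)).
  transitivity ((p + zneg z) * q + (zpos z + n) * m + zpos z * (q + zneg w)
    + zneg z * (zpos w + m)); [mring|].
  replace ((p + zneg z) * q) with ((zpos z + n) * q) by now rewrite E1.
  replace ((zpos z + n) * m) with ((p + zneg z) * m) by now rewrite E1.
  rewrite E2. replace (zneg z * (zpos w + m)) with (zneg z * (q + zneg w)) by now rewrite E2.
  mring.
Qed.

Lemma zle_mk p n q m : zle (zmk p n) (zmk q m) <-> p + m <= q + n.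
Proof.
  unfold zle. assert (E1 := zmk_spec p n). assert (E2 := zmk_spec q m).
  set (z := zmk p n) in *. set (w := zmk q m) in *.
  rewrite <- (ad_le (p + q + n + m)).
  replace (p + q + n + m + (zpos z + zneg w)) with ((zpos z + n) + (q + zneg w) + (p + m)) by mring.
  replace (p + q + n + m + (zpos w + zneg z)) with ((p + zneg z) + (zpos w + m) + (q + n)) by mring.
  rewrite E1, E2. apply ad_le.
Qed.

Definition z0 : ZM := zmk 0 0.
Definition z1 : ZM := zmk 1 0.

(** Writes an integer as a difference of two arbitrary elements of the model. A ring law then
    becomes, through [zmk_zmk], an identity of the semiring. *)
Ltac zc u := let p := fresh "p" in let n := fresh "n" in
  rewrite <- (zmk_rep u); generalize (zpos u) (zneg u); intros p n; clear u.

Lemma zaddA u v w : zadd u (zadd v w) = zadd (zadd u v) w.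
Proof.
  zc u; zc v; zc w. rewrite !zadd_mk. apply zmk_zmk. mring.
Qed.
Lemma zaddC u v : zadd u v = zadd v u.
Proof. zc u; zc v. rewrite !zadd_mk. apply zmk_zmk. mring. Qed.
Lemma zadd0 u : zadd z0 u = u.
Proof. zc u. unfold z0. rewrite !zadd_mk. apply zmk_zmk. mring. Qed.
Lemma zaddN u : zadd (zopp u) u = z0.
Proof. zc u. unfold z0. rewrite zopp_mk, !zadd_mk. apply zmk_zmk. mring. Qed.
Lemma zmulA u v w : zmul u (zmul v w) = zmul (zmul u v) w.
Proof.
  zc u; zc v; zc w. rewrite !zmul_mk. apply zmk_zmk. mring.
Qed.
Lemma zmulC u v : zmul u v = zmul v u.
Proof. zc u; zc v. rewrite !zmul_mk. apply zmk_zmk. mring. Qed.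
Lemma zmul1 u : zmul z1 u = u.
Proof. zc u. unfold z1. rewrite !zmul_mk. apply zmk_zmk. mring. Qed.
Lemma zmulD u v w : zmul (zadd u v) w = zadd (zmul u w) (zmul v w).
Proof.
  zc u; zc v; zc w. rewrite ?zadd_mk, !zmul_mk, zadd_mk.
  apply zmk_zmk. mring.
Qed.
Lemma z1_neq0 : z1 <> z0.
Proof. intro E. apply zmk_zmk in E. rewrite !ad0 in E. now apply neq10 in E. Qed.

Definition inj (x : M) : ZM := zmk x 0.

Lemma inj_add x y : inj (x + y) = zadd (inj x) (inj y).
Proof. unfold inj. rewrite zadd_mk. apply zmk_zmk. mring. Qed.
Lemma inj_mul x y : inj (x * y) = zmul (inj x) (inj y).
Proof. unfold inj. rewrite zmul_mk. apply zmk_zmk. mring. Qed.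
Lemma inj_inj x y : inj x = inj y -> x = y.
Proof. intro E. apply zmk_zmk in E. now rewrite !ad0 in E. Qed.
Lemma inj_le x y : zle (inj x) (inj y) <-> x <= y.
Proof. unfold inj. rewrite zle_mk, !ad0. tauto. Qed.

Lemma zge0_ex u : zle z0 u <-> exists x, u = inj x.
Proof.
  zc u. unfold z0. rewrite zle_mk, ad0, (ad_comm 0), ad0. split.
  - intro L. destruct (difference_ex L) as [x E]. exists x. apply zmk_zmk. rewrite <- E. mring.
  - intros [x E]. apply zmk_zmk in E. rewrite ad0 in E. rewrite E. apply mle_addl.
Qed.

Lemma zle_sub u v : zle u v <-> zle z0 (zadd v (zopp u)).
Proof.
  zc u; zc v. unfold z0. rewrite zopp_mk, zadd_mk, !zle_mk.
  match goal with |- ?a <= ?b <-> ?c <= ?d =>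
    replace c with a by mring; replace d with b by mring end. tauto.
Qed.

Lemma zle_anti u : zle z0 u -> zle u z0 -> u = z0.
Proof.
  zc u. unfold z0. rewrite !zle_mk.
  intros H K. apply zmk_zmk. now apply mle_antisym.
Qed.

Lemma zle_total u : zle z0 u \/ zle u z0.
Proof.
  zc u. unfold z0. rewrite !zle_mk.
  apply mle_total.
Qed.

Lemma zmul_eq0 u v : zmul u v = z0 -> u = z0 \/ v = z0.
Proof.
  assert (H : forall x y, zmul (inj x) (inj y) = z0 -> inj x = z0 \/ inj y = z0).
  { intros x y E. rewrite <- inj_mul in E. apply (inj_inj (y := 0)) in E.
    destruct (ml_eq0 E) as [-> | ->]; [left|right]; reflexivity. }
  assert (N : forall w, zopp w = z0 -> w = z0).
  { intro w. zc w. unfold z0. rewrite zopp_mk.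
    rewrite <- !zmk_zmk, !ad0. intro E. rewrite ad_comm, ad0 in *. congruence. }
  assert (Nl : forall a b, zmul (zopp a) b = zopp (zmul a b)).
  { intros a b; zc a; zc b.
    rewrite zmul_mk, !zopp_mk, zmul_mk. apply zmk_zmk. mring. }
  assert (S : forall w, exists x, w = inj x \/ zopp w = inj x).
  { intro w. destruct (zle_total w) as [L|L].
    - apply zge0_ex in L. destruct L as [x E]. eauto.
    - apply zle_sub, zge0_ex in L. destruct L as [x E]. rewrite zadd0 in E. eauto. }
  assert (NN : zopp z0 = z0) by (unfold z0; now rewrite zopp_mk).
  intro E. destruct (S u) as [x [Ex|Ex]], (S v) as [y [Ey|Ey]].
  - subst. now apply H.
  - assert (K : zmul u (zopp v) = z0) by (rewrite zmulC, Nl, zmulC, E; apply NN).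
    subst u. rewrite Ey in *. apply H in K. destruct K as [K|K]; [tauto|].
    right. apply N. congruence.
  - assert (K : zmul (zopp u) v = z0) by (rewrite Nl, E; apply NN).
    subst v. rewrite Ex in *. apply H in K. destruct K as [K|K]; [|tauto].
    left. apply N. congruence.
  - assert (K : zmul (zopp u) (zopp v) = z0) by (rewrite Nl, zmulC, Nl, zmulC, E, NN; apply NN).
    rewrite Ex, Ey in *. apply H in K.
    destruct K as [K|K]; [left|right]; apply N; congruence.
Qed.

End Arithmetic.

From HB Require Import structures.
From mathcomp Require Import all_boot all_order all_algebra.
From mathcomp Require boolp.
From mathcomp Require Import ring lra.
Import Order.TTheory GRing.Theory Num.Theory.
Local Open Scope ring_scope.
Delimit Scope M_scope with M.

(** * The integers of a model as an ordered integral domain *)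

Section IntegerRing.
Variable M : s12.
Local Notation Z := (ZM M).

HB.instance Definition _ := boolp.gen_eqMixin Z.
HB.instance Definition _ := boolp.gen_choiceMixin Z.
HB.instance Definition _ := GRing.isZmodule.Build Z
  (@zaddA M) (@zaddC M) (@zadd0 M) (@zaddN M).

Fact z1_neq0_bool : z1 M != 0.
Proof. by apply/eqP/z1_neq0. Qed.

HB.instance Definition _ := GRing.Zmodule_isComNzRing.Build Z
  (@zmulA M) (@zmulC M) (@zmul1 M) (@zmulD M) z1_neq0_bool.

(** Integral domains are reached in the hierarchy through rings with a unit predicate and a total
    inverse, both of which classical choice supplies. *)
Definition zunit : {pred Z} := [pred x | boolp.asbool (exists y : Z, y * x = 1)].
Definition zinv (x : Z) : Z :=
  if x \in zunit then epsilon (inhabits 0) (fun y : Z => y * x = 1) else x.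

Fact zmulVx : {in zunit, left_inverse 1 zinv *%R}.
Proof.
move=> x Ux; rewrite /zinv Ux; apply: (epsilon_spec (inhabits 0) (fun y : Z => y * x = 1)).
by move: Ux; rewrite inE /= => Ux; apply/boolp.asboolP.
Qed.
Fact zunitPl (x y : Z) : y * x = 1 -> zunit x.
Proof. by move=> E; apply/boolp.asboolP; exists y. Qed.
Fact zinv_out : {in [predC zunit], zinv =1 id}.
Proof. by move=> x; rewrite inE /zinv => /negbTE ->. Qed.

HB.instance Definition _ := GRing.ComNzRing_hasMulInverse.Build Z zmulVx zunitPl zinv_out.

Fact z_idomain : GRing.integral_domain_axiom Z.
Proof.
move=> x y E; apply/orP; have [->|->] := zmul_eq0 E; [left|right]; exact: eqxx.
Qed.

HB.instance Definition _ := GRing.ComUnitRing_isIntegral.Build Z z_idomain.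

Definition zleb (x y : Z) : bool := boolp.asbool (zle x y).
Definition zltb (x y : Z) : bool := (y != x) && zleb x y.
Definition znorm (x : Z) : Z := if zleb 0 x then x else - x.

Fact zle0_add (x y : Z) : zleb 0 x -> zleb 0 y -> zleb 0 (x + y).
Proof.
move=> /boolp.asboolP/zge0_ex[a ->] /boolp.asboolP/zge0_ex[b ->].
apply/boolp.asboolP/zge0_ex; exists (ad M a b); by rewrite inj_add.
Qed.
Fact zle0_mul (x y : Z) : zleb 0 x -> zleb 0 y -> zleb 0 (x * y).
Proof.
move=> /boolp.asboolP/zge0_ex[a ->] /boolp.asboolP/zge0_ex[b ->].
apply/boolp.asboolP/zge0_ex; exists (ml M a b); by rewrite inj_mul.
Qed.
Fact zle0_anti (x : Z) : zleb 0 x -> zleb x 0 -> x = 0.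
Proof. move=> /boolp.asboolP H /boolp.asboolP K; exact: zle_anti. Qed.
Fact zsub_ge0 (x y : Z) : zleb 0 (y - x) = zleb x y.
Proof.
have H := zle_sub x y.
by apply/idP/idP => /boolp.asboolP K; apply/boolp.asboolP; apply H.
Qed.
Fact zle0_total (x : Z) : zleb 0 x || zleb x 0.
Proof.
apply/orP; have [H|H] := zle_total x; [left|right]; exact/boolp.asboolP.
Qed.
Fact zge0_norm (x : Z) : zleb 0 x -> znorm x = x.
Proof. by rewrite /znorm => ->. Qed.
Fact znormN (x : Z) : znorm (- x) = znorm x.
Proof.
rewrite /znorm -sub0r zsub_ge0 sub0r opprK; have := zle0_total x.
case: ifP => H; case: ifP => K //= _.
by rewrite (zle0_anti K H) oppr0.
Qed.
Fact zlt_def (x y : Z) : zltb x y = (y != x) && zleb x y.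
Proof. by []. Qed.

HB.instance Definition _ := Num.IntegralDomain_isLeReal.Build Z
  zle0_add zle0_mul zle0_anti zsub_ge0 zle0_total znormN zge0_norm zlt_def.

End IntegerRing.

(** * Transfer of arithmetic statements from the model to its integers *)

Section Transfer.
Variable M : s12.
Local Notation Z := (ZM M).
Implicit Types x y : M.

Lemma injD x y : inj (ad M x y) = inj x + inj y.
Proof. exact: inj_add. Qed.
Lemma injM x y : inj (ml M x y) = inj x * inj y.
Proof. exact: inj_mul. Qed.
Lemma inj0 : inj (zr : M) = 0.
Proof. by []. Qed.
Lemma inj1 : inj (su M zr) = 1.
Proof. by []. Qed.
Lemma injS x : inj (su M x) = inj x + 1.
Proof. by rewrite su_ad injD inj1. Qed.
Lemma leE x y : le M x y <-> inj x <= inj y.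
Proof.
split=> [H|]; first by apply/boolp.asboolP/inj_le.
by move/boolp.asboolP/inj_le.
Qed.
Lemma ltE x y : lt M x y <-> inj x + 1 <= inj y.
Proof. by rewrite /lt leE injS. Qed.
Lemma eqE x y : x = y <-> inj x = inj y.
Proof. by split=> [->|/inj_inj]. Qed.
Lemma nleE x y : ~ le M x y <-> inj y + 1 <= inj x.
Proof. by rewrite mnot_le ltE. Qed.
Lemma nltE x y : ~ lt M x y <-> inj y <= inj x.
Proof.
rewrite -leE -mnot_le; split=> [H|]; last by tauto.
exact: NNPP.
Qed.
Lemma inj_ge0 x : 0 <= inj x.
Proof. by rewrite -inj0 -leE; apply: mle0. Qed.
Lemma eq_of_le x y : inj x <= inj y -> inj y <= inj x -> x = y.
Proof. by move=> H K; apply/eqE/eqP; rewrite eq_le H K. Qed.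
Lemma neqE x y : x <> y <-> inj x + 1 <= inj y \/ inj y + 1 <= inj x.
Proof.
rewrite -!nleE; split=> [N|[N|N] E]; last 2 first.
- by apply: N; rewrite E; apply: mle_refl.
- by apply: N; rewrite E; apply: mle_refl.
apply: NNPP => K; apply: N; apply: mle_antisym; split; apply: NNPP; tauto.
Qed.
Lemma zge0P (u : Z) : 0 <= u -> exists x, u = inj x.
Proof. by move/boolp.asboolP/zge0_ex. Qed.
Lemma zdiscrete (u v : Z) : u < v -> u + 1 <= v.
Proof.
move=> L; have [|x E] := @zge0P (v - u); first by rewrite subr_ge0 ltW.
have : x <> zr.
  move=> E0; move: E; rewrite E0 inj0 => /eqP.
  by rewrite subr_eq0 => /eqP E; rewrite E ltxx in L.
move/neqE; rewrite inj0 -E => -[|] H; last by lra.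
by have := inj_ge0 x; rewrite -E => *; lra.
Qed.

End Transfer.

Section NormalForms.
Variables (M : s12) (x y : M) (u v : ZM M).
Hypotheses (Ex : inj x = u) (Ey : inj y = v).
Lemma injD_nf : inj (ad M x y) = u + v. Proof. by rewrite injD Ex Ey. Qed.
Lemma injM_nf : inj (ml M x y) = u * v. Proof. by rewrite injM Ex Ey. Qed.
Lemma injS_nf : inj (su M x) = u + 1. Proof. by rewrite injS Ex. Qed.
Lemma le_nf : le M x y <-> u <= v. Proof. by rewrite leE Ex Ey. Qed.
Lemma lt_nf : lt M x y <-> u + 1 <= v. Proof. by rewrite ltE Ex Ey. Qed.
Lemma eq_nf : x = y <-> u = v. Proof. by rewrite eqE Ex Ey. Qed.
Lemma nle_nf : ~ le M x y <-> v + 1 <= u. Proof. by rewrite nleE Ex Ey. Qed.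
Lemma nlt_nf : ~ lt M x y <-> v <= u. Proof. by rewrite nltE Ex Ey. Qed.
Lemma eq_of_le_nf : u <= v -> v <= u -> x = y.
Proof. by move=> H K; apply: eq_of_le; rewrite Ex Ey. Qed.
End NormalForms.

(** Decides goals of linear arithmetic over the model, by passing to its integers.
    [inj_nf x] proves [inj x = e] with [e] a ring expression in atoms; it is syntactic. *)
Ltac inj_nf x :=
  lazymatch x with
  | ad ?M ?a ?b => let p := inj_nf a in let q := inj_nf b in constr:(injD_nf p q)
  | ml ?M ?a ?b => let p := inj_nf a in let q := inj_nf b in constr:(injM_nf p q)
  | su ?M ?a => let p := inj_nf a in constr:(injS_nf p)
  | @zr ?M => constr:(inj0 M)
  | _ => constr:(Logic.eq_refl (inj x))
  end.
Ltac inj_rel L a b := let p := inj_nf a in let q := inj_nf b in constr:(L _ a b _ _ p q).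
Ltac inj_hyp H :=
  let t := type of H in
  let e := lazymatch t with
    | le _ ?a ?b => inj_rel le_nf a b
    | lt _ ?a ?b => inj_rel lt_nf a b
    | ~ le _ ?a ?b => inj_rel nle_nf a b
    | ~ lt _ ?a ?b => inj_rel nlt_nf a b
    | @eq (dom _) ?a ?b => inj_rel eq_nf a b
    end in
  let K := fresh H in pose proof (proj1 e H) as K; clear H.
Ltac inj_atoms :=
  repeat match goal with
  | |- context [inj ?x] =>
    lazymatch goal with _ : is_true (0 <= inj x) |- _ => fail | _ => idtac end;
    pose proof (inj_ge0 x)
  | _ : context [inj ?x] |- _ =>
    lazymatch goal with _ : is_true (0 <= inj x) |- _ => fail | _ => idtac end;
    pose proof (inj_ge0 x)
  end.
Ltac inj_goal :=
  lazymatch goal with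
  | |- le _ ?a ?b => let e := inj_rel le_nf a b in apply (proj2 e)
  | |- lt _ ?a ?b => let e := inj_rel lt_nf a b in apply (proj2 e)
  | |- @eq (dom _) ?a ?b => let e := inj_rel eq_of_le_nf a b in apply e
  | _ => idtac
  end.
Ltac mlia :=
  intros;
  repeat match goal with
  | |- ~ _ => intro
  | |- _ /\ _ => split
  | H : _ /\ _ |- _ => destruct H
  end;
  inj_goal;
  repeat match goal with H : ~ (@eq _ _ _) |- _ => clear H end;
  repeat match goal with H : _ |- _ => inj_hyp H end;
  inj_atoms.
Ltac mlra := solve [mlia; lra].
Ltac mnra := solve [mlia; nra].
Ltac clra := clear; mlra.

(** * Programming with limited recursion *)

Create HintDb pv.

Section Tests.
Variable M : s12.
Implicit Types (b : bool) (F G : (nat -> M) -> M).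

Lemma Df_su b F : Df b F -> Df b (fun r => su M (F r)). Proof. exact: Df_ap1. Qed.
Lemma Df_hf b F : Df b F -> Df b (fun r => hf M (F r)). Proof. exact: Df_ap1. Qed.
Lemma Df_ln b F : Df b F -> Df b (fun r => ln M (F r)). Proof. exact: Df_ap1. Qed.
Lemma Df_ad b F G : Df b F -> Df b G -> Df b (fun r => ad M (F r) (G r)). Proof. exact: Df_ap2. Qed.
Lemma Df_ml b F G : Df b F -> Df b G -> Df b (fun r => ml M (F r) (G r)). Proof. exact: Df_ap2. Qed.
Lemma Df_sm b F G : Df b F -> Df b G -> Df b (fun r => sm M (F r) (G r)). Proof. exact: Df_ap2. Qed.

Lemma Df1 (F : M -> M) b u : Df false (fun r => F (r 0%N)) -> Df b u -> Df b (fun r => F (u r)).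
Proof.
move=> HF Hu; apply: (@Df_comp M b (fun r => F (r 0%N)) (fun r => ocons (u r) enil)) => //.
by apply: Dfs_cons => //; apply: Dfs_nil.
Qed.
Lemma Df2 (F : M -> M -> M) b u v : Df false (fun r => F (r 0%N) (r 1%N)) ->
  Df b u -> Df b v -> Df b (fun r => F (u r) (v r)).
Proof.
move=> HF Hu Hv; apply: (@Df_comp M b (fun r => F (r 0%N) (r 1%N))
  (fun r => ocons (u r) (ocons (v r) enil))) => //.
by do 2 apply: Dfs_cons => //; apply: Dfs_nil.
Qed.
Lemma Df3 (F : M -> M -> M -> M) b u v w : Df false (fun r => F (r 0%N) (r 1%N) (r 2%N)) ->
  Df b u -> Df b v -> Df b w -> Df b (fun r => F (u r) (v r) (w r)).
Proof.
move=> HF Hu Hv Hw; apply: (@Df_comp M b (fun r => F (r 0%N) (r 1%N) (r 2%N))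
  (fun r => ocons (u r) (ocons (v r) (ocons (w r) enil)))) => //.
by do 3 apply: Dfs_cons => //; apply: Dfs_nil.
Qed.
Lemma Df1_true (F : M -> M) u : Df true (fun r => F (r 0%N)) -> Df true u ->
  Df true (fun r => F (u r)).
Proof.
move=> HF Hu; apply: (@Df_comp_true M (fun r => F (r 0%N)) (fun r => ocons (u r) enil)) => //.
by apply: Dfs_cons => //; apply: Dfs_nil.
Qed.
Lemma Df_under F b E : Df false F -> Dfs b E -> Df b (fun r => F (E r)).
Proof. exact: Df_comp. Qed.
Lemma Sg_lt p F G : Df true F -> Df true G -> Sg p (fun r => lt M (F r) (G r)).
Proof. by move=> HF HG; apply: Sg_le => //; apply: Df_su. Qed.
End Tests.

#[export] Hint Resolve Df_var Df_cst Df_zr Df_su Df_hf Df_ln Df_ad Df_ml Df_sm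
  Dfs_nil Dfs_cons : pv.
#[export] Hint Resolve Sg_eq Sg_le Sg_lt Sg_and Sg_or Sg_imp Sg_not Sg_bot : pv.

(** Definability goals; [shift] and [ocons] only rearrange variables. *)
Ltac env := cbv beta iota delta [shift ocons].
Ltac df := first [solve [auto 200 with pv nocore] | env; solve [auto 200 with pv nocore]].

Ltac pick L := exact (proj1_sig (constructive_indefinite_description _ L)).

Section Programs.
Variable M : s12.
Local Open Scope M_scope.
Implicit Types x y z u v c : M.

Notation env1 x := (ocons x enil).
Notation env2 x y := (ocons x (env1 y)).
Notation env3 x y z := (ocons x (env2 y z)).

Lemma ismin_le (s t m : M) : ismin s t m -> s <= t -> m = s.
Proof. by case. Qed.

Lemma ismin_leq (s t m : M) : ismin s t m -> m <= t.
Proof.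
case=> H K; case: (classic (s <= t)) => L; first by rewrite H.
by rewrite K //; apply: mle_refl.
Qed.

Lemma lrec1 (G H K : (nat -> M) -> M) : Df false G -> Df false H -> Df false K ->
  exists R : M -> (nat -> M) -> M,
    Df false (fun r => R (r 0%N) (shift r)) /\
    (forall r, ismin (G r) (K (ocons 0 r)) (R 0 r)) /\
    (forall r c, c <> 0 ->
      ismin (H (ocons (hf M c) (ocons (R (hf M c) r) r))) (K (ocons c r)) (R c r)).
Proof.
move=> HG HH HK; have [R [DR [R0 [Re Ro]]]] := limited_recursion HG HH HH HK.
exists R; split=> //; split=> // r c Hc.
case: (hf_cases c) => E; rewrite {3 4}E; last exact: Ro.
by apply: Re => Z; apply: Hc; rewrite E Z ml0.
Qed.

(** Case distinction is a recursion that ignores its previous value: the base gives [y] and every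
    step gives [x], both below the cutoff x + y. *)
Lemma cond_ex : exists F : M -> M -> M -> M,
  Df false (fun r => F (r 0%N) (r 1%N) (r 2%N)) /\
  forall c x y, (c = 0 -> F c x y = y) /\ (c <> 0 -> F c x y = x).
Proof.
have [R [DR [R0 RS]]] := @lrec1 (fun r => r 1%N) (fun r => r 2%N)
  (fun r => r 1%N + r 2%N) ltac:(df) ltac:(df) ltac:(df).
exists (fun c x y => R c (env2 x y)); split.
  apply: (@Df_under M (fun r => R (r 0%N) (shift r)) false
    (fun r => env3 (r 0%N) (r 1%N) (r 2%N))) => //; df.
move=> c x y; split=> [->|Hc].
- by apply: (ismin_le (R0 _)); env; mlra.
- by apply: (ismin_le (RS _ _ Hc)); env; mlra.
Qed.

Definition cond : M -> M -> M -> M. pick cond_ex. Defined.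
Lemma cond_spec c x y : (c = 0 -> cond c x y = y) /\ (c <> 0 -> cond c x y = x).
Proof. exact: (proj2 (proj2_sig (constructive_indefinite_description _ cond_ex))). Qed.
Lemma Df_cond b F G H : Df b F -> Df b G -> Df b H -> Df b (fun r => cond (F r) (G r) (H r)).
Proof. apply: Df3; exact: (proj1 (proj2_sig (constructive_indefinite_description _ cond_ex))). Qed.

Lemma cond0 x y : cond 0 x y = y.
Proof. exact: (proj1 (cond_spec 0 x y)). Qed.
Lemma condN c x y : c <> 0 -> cond c x y = x.
Proof. exact: (proj2 (cond_spec c x y)). Qed.
Lemma cond1 x y : cond 1 x y = x.
Proof. by apply: condN; apply: neq10. Qed.

(** [pw x] is 2^|x|. *)
Definition pw x : M := sm M 1 x.
Lemma Df_pw b F : Df b F -> Df b (fun r => pw (F r)).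
Proof. by move=> H; apply: Df_sm => //; apply: Df_su; apply: Df_zr. Qed.
Hint Resolve Df_pw Df_cond : pv.

Lemma pw0 : pw 0 = 1. Proof. exact: sm_10. Qed.
Lemma pw_hf x : x <> 0 -> pw x = 2 * pw (hf M x). Proof. exact: sm1_hf. Qed.
Lemma lt_pw x : x < pw x. Proof. exact: lt_sm1. Qed.
Lemma pw_gt0 x : 1 <= pw x.
Proof. have := lt_pw x; mlra. Qed.
Lemma pw_ln x y : ln M x = ln M y -> pw x = pw y.
Proof. by move=> E; rewrite /pw !(sm_comm 1); apply: sm_ln. Qed.
Lemma pw_add x y z : ln M x = ln M y + ln M z -> pw x = pw y * pw z.
Proof. by move=> E; rewrite /pw !(sm_comm 1); apply: sm_add. Qed.
Lemma ln_pw x : ln M (pw x) = su M (ln M x).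
Proof. by rewrite /pw ln_sm ln1 ml_comm ml1. Qed.
Lemma su_inj x y : su M x = su M y -> x = y.
Proof. mlra. Qed.
Lemma hf_bounds x : 2 * hf M x <= x /\ x <= 2 * hf M x + 1.
Proof. by case: (hf_cases x) => E; have := E; mlra. Qed.
Lemma eq0_or x : x = 0 \/ 1 <= x.
Proof.
case: (classic (x = 0)) => [|/neqE H]; [by left|right].
by case: H => H; move: H; rewrite inj0 => H; mlra.
Qed.
Lemma neq0 x : x <> 0 <-> 1 <= x.
Proof. by split=> [N|L E]; [case: (eq0_or x)|rewrite E in L; mlra]. Qed.
Lemma hf_eq x y : 2 * y <= x -> x <= 2 * y + 1 -> hf M x = y.
Proof.
move=> H K; have [L1 L2] := hf_bounds x; case: (classic (hf M x = y)) => // /neqE N.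
by exfalso; case: N => N; mlra.
Qed.

Lemma pw_le2 x : x <> 0 -> pw x <= 2 * x.
Proof.
move: x; apply: PIND.
- df.
- by [].
- move=> x IH Hx; have [L1 L2] := hf_bounds x; rewrite pw_hf //.
  case: (classic (hf M x = 0)) => [E|N]; last by have := IH N; mlra.
  by rewrite E pw0; move/neq0: Hx; mlra.
Qed.

Lemma shr_ex : exists F : M -> M -> M, Df false (fun r => F (r 0%N) (r 1%N)) /\
  forall x, F 0 x = x /\ forall v, v <> 0 -> F v x = hf M (F (hf M v) x).
Proof.
have [R [DR [R0 RS]]] := @lrec1 (fun r => r 0%N) (fun r => hf M (r 1%N))
  (fun r => r 1%N) ltac:(df) ltac:(df) ltac:(df).
exists (fun v x => R v (env1 x)); split.
  apply: (@Df_under M (fun r => R (r 0%N) (shift r)) false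
    (fun r => env2 (r 0%N) (r 1%N))) => //; df.
move=> x; split=> [|v Hv]; first by apply: (ismin_le (R0 _)); env; apply: mle_refl.
apply: (ismin_le (RS _ _ Hv)); env.
suff L : forall c, R c (env1 x) <= x by have := L (hf M v);
  have := hf_bounds (R (hf M v) (env1 x)); mlra.
move=> c; case: (classic (c = 0)) => [->|Hc]; first exact: (ismin_leq (R0 _)).
exact: (ismin_leq (RS _ _ Hc)).
Qed.

(** [shr v x] is x shifted right by |v| bits. *)
Definition shr : M -> M -> M. pick shr_ex. Defined.
Lemma shr_spec x : shr 0 x = x /\ forall v, v <> 0 -> shr v x = hf M (shr (hf M v) x).
Proof. exact: (proj2 (proj2_sig (constructive_indefinite_description _ shr_ex))). Qed.
Lemma Df_shr b F G : Df b F -> Df b G -> Df b (fun r => shr (F r) (G r)).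
Proof. apply: Df2; exact: (proj1 (proj2_sig (constructive_indefinite_description _ shr_ex))). Qed.
Hint Resolve Df_shr : pv.

Lemma shr_bounds v x : pw v * shr v x <= x /\ x < pw v * (shr v x + 1).
Proof.
move: v; apply: PIND; first df.
  by rewrite (proj1 (shr_spec x)) pw0; mlra.
move=> v [H K]; case: (classic (v = 0)) => [->|N].
  by rewrite (proj1 (shr_spec x)) pw0; mlra.
rewrite (proj2 (shr_spec x)) // pw_hf //.
set a := shr (hf M v) x in H K *; have [L1 L2] := hf_bounds a; have := pw_gt0 (hf M v).
move: (pw (hf M v)) (hf M a) H K L1 L2 => p h H K L1 L2 Hp.
have : p * (2 * h) <= p * a by apply: ml_mono.
have : p * (a + 1) <= p * (2 * h + 2) by apply: ml_mono; mlra.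
clear -H K; mlra.
Qed.

Lemma ln_neq0 x : x <> 0 -> ln M x <> 0.
Proof. by move=> H; rewrite ln_hf //; apply: su_neq0. Qed.

Lemma ln_shr v x : ln M v <= ln M x -> ln M (shr v x) + ln M v = ln M x.
Proof.
move: v; apply: PIND; first df.
  by rewrite (proj1 (shr_spec x)) ln0 ad0.
move=> v IH; case: (classic (v = 0)) => [->|N].
  by rewrite (proj1 (shr_spec x)) ln0 ad0.
rewrite (proj2 (shr_spec x)) // (ln_hf N) => L.
have {}IH := IH ltac:(mlra).
case: (classic (shr (hf M v) x = 0)) => [E|N'].
  by move: IH; rewrite E ln0 => IH; exfalso; mlra.
by have := ln_hf N'; mlra.
Qed.

Lemma pw_mono x y : ln M x <= ln M y -> pw x <= pw y.
Proof.
move=> L; have E := ln_shr L.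
have -> : pw y = pw x * pw (shr x y) by apply: pw_add; rewrite -E; mlra.
have := pw_gt0 (shr x y); have := pw_gt0 x; mnra.
Qed.

Lemma ln_lt_pw x y : x < pw y -> ln M x <= ln M y.
Proof.
move=> L; apply: NNPP => N.
have Nx : x <> 0 by move=> E; move: N; rewrite E ln0; have := mle0 (ln M y).
have : pw y <= pw (hf M x) by apply: pw_mono; have := ln_hf Nx; mlra.
have := pw_le2 Nx; rewrite pw_hf //; mlra.
Qed.

Lemma lt_pw_ln x y : ln M x <= ln M y -> x < pw y.
Proof. by move=> L; have := pw_mono L; have := lt_pw x; mlra. Qed.

Lemma cpl_ex : exists F : M -> M, Df false (fun r => F (r 0%N)) /\
  forall x, x + F x + 1 = pw x.
Proof.
have [R [DR [R0 [Re Ro]]]] := @limited_recursion M (fun _ => 0) (fun r => 2 * r 1%N + 1)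
  (fun r => 2 * r 1%N) (fun r => pw (r 0%N)) ltac:(df) ltac:(df) ltac:(df) ltac:(df).
exists (fun x => R x enil); split.
  apply: (@Df_under M (fun r => R (r 0%N) (shift r)) false (fun r => env1 (r 0%N))) => //; df.
apply: PIND.
- have D : Df true (fun r : nat -> M => R (r 0%N) enil).
    apply: (@Df_under M (fun r => R (r 0%N) (shift r)) true (fun r => env1 (r 0%N))) => //; df.
  by apply: Sg_eq; auto with pv.
- rewrite (ismin_le (R0 _)); env; first by rewrite pw0 !ad0; mlra.
  exact: mle0.
- move=> x IH; case: (classic (x = 0)) => [->|N].
    rewrite (ismin_le (R0 _)); env; first by rewrite pw0 !ad0; mlra.
    exact: mle0.
  rewrite pw_hf //; case: (hf_cases x) => E.
    have N' : hf M x <> 0 by move=> Z; apply: N; rewrite E Z ml0.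
    have -> : R x enil = 2 * R (hf M x) enil + 1; last by mlra.
    rewrite {1}E; apply: (ismin_le (Re _ _ N')); env.
    have -> : mdbl M (hf M x) = x by [].
    by rewrite pw_hf //; mlra.
  have -> : R x enil = 2 * R (hf M x) enil; last by mlra.
  rewrite {1}E; apply: (ismin_le (Ro _ _)); env.
  have -> : su M (mdbl M (hf M x)) = x by [].
  by rewrite pw_hf //; mlra.
Qed.

(** The bitwise complement 2^|x| - 1 - x. *)
Definition cpl : M -> M. pick cpl_ex. Defined.
Lemma cpl_spec x : x + cpl x + 1 = pw x.
Proof. exact: (proj2 (proj2_sig (constructive_indefinite_description _ cpl_ex))). Qed.
Lemma Df_cpl b F : Df b F -> Df b (fun r => cpl (F r)).
Proof. apply: Df1; exact: (proj1 (proj2_sig (constructive_indefinite_description _ cpl_ex))). Qed.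
Hint Resolve Df_cpl : pv.

(** The shifted number y + (2^|x| - 1 - x) + 1 equals 2^|x| + (y - x), so something is left after a
    shift by |x| bits exactly when x <= y. *)
Definition leb x y : M := cond (shr x (y + cpl x + 1)) 1 0.
Lemma Df_leb b F G : Df b F -> Df b G -> Df b (fun r => leb (F r) (G r)).
Proof. by move=> HF HG; rewrite /leb; df. Qed.
Hint Resolve Df_leb : pv.

Lemma leb_spec x y : (x <= y -> leb x y = 1) /\ (y < x -> leb x y = 0).
Proof.
rewrite /leb; have := cpl_spec x; have [] := shr_bounds x (y + cpl x + 1).
move: (cpl x) (pw x) (shr x (y + cpl x + 1)) => c p s H K E; split=> L.
- apply: condN => Z; rewrite Z in K; mlra.
- case: (eq0_or s) => [Z|Hs]; first by rewrite Z cond0.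
  have : p * 1 <= p * s by apply: ml_mono.
  rewrite ml1 => ?; exfalso; mlra.
Qed.

Lemma lebP x y : leb x y <> 0 <-> x <= y.
Proof.
have [H K] := leb_spec x y; split=> [N|/H ->]; last exact: neq10.
by apply: NNPP => /mnot_le /K.
Qed.

Lemma leb1 x y : x <= y -> leb x y = 1. Proof. exact: (proj1 (leb_spec x y)). Qed.
Lemma leb0 x y : y < x -> leb x y = 0. Proof. exact: (proj2 (leb_spec x y)). Qed.

(** Binary search: the step at the number [c] has width 2^(|B|-|c|). *)
Lemma search (T : M -> (nat -> M) -> M) (B : (nat -> M) -> M) :
  Df false (fun r => T (r 0%N) (shift r)) -> Df false B ->
  exists F : (nat -> M) -> M, Df false F /\
    forall r, T 0 r <> 0 -> T (pw (B r)) r = 0 -> T (F r) r <> 0 /\ T (F r + 1) r = 0.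
Proof.
move=> DT DB.
(* The step sees hf c instead of c; the width that belongs to c is half of the one that belongs to
   hf c. *)
pose W (r : nat -> M) := hf M (pw (shr (r 0%N) (B (shift (shift r))))).
have DBs : Df false (fun r => B (shift (shift r))).
  by apply: (Df_under DB) => i; apply: Df_var.
have DW : Df false W by rewrite /W; df.
have DH : Df false (fun r : nat ->
  M => cond (T (r 1%N + W r) (shift (shift r))) (r 1%N + W r) (r 1%N)).
  apply: Df_cond; [|df|df].
  apply: (@Df_under M (fun r => T (r 0%N) (shift r)) false
    (fun r => ocons (r 1%N + W r) (shift (shift r)))) => //.
  apply: Dfs_cons; first df.
  by move=> i; apply: Df_var.
have DK : Df false (fun r : nat -> M => pw (B (shift r))).
  by apply: Df_pw; apply: (Df_under DB) => i; apply: Df_var.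
have [R [DR [R0 RS]]] := lrec1 (Df_zr M false) DH DK.
exists (fun r => R (B r) r); split.
  apply: (@Df_under M (fun r => R (r 0%N) (shift r)) false (fun r => ocons (B r) r)) => //.
  by apply: Dfs_cons => // i; apply: Df_var.
move=> r T0 TB.
have R00 : R 0 r = 0 by apply: (ismin_le (R0 r)); apply: mle0.
have I0 : T (R 0 r) r <> 0 /\ T (R 0 r + pw (shr 0 (B r))) r =
  0 /\ R 0 r + pw (shr 0 (B r)) <= pw (B r).
  rewrite R00 (proj1 (shr_spec _)) !(ad_comm 0) !ad0; do !split=> //; exact: mle_refl.
(* The test holds at the left end of the current interval and fails at the right end, which suffices
   without monotonicity. The last conjunct keeps the values below the cutoff [pw (B r)]. *)
have Inv : forall c, ln M c <= ln M (B r) ->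
    T (R c r) r <> 0 /\ T (R c r + pw (shr c (B r))) r = 0 /\ R c r + pw (shr c (B r)) <= pw (B r).
  apply: PIND.
  - have D1 : Df true (fun r0 : nat -> M => R (r0 0%N) r).
      apply: (@Df_under M (fun r => R (r 0%N) (shift r)) true (fun r0 => ocons (r0 0%N) r)) => //.
      by apply: Dfs_cons; [df|move=> i; apply: Df_cst].
    have D2 f : Df true f -> Df true (fun r0 : nat -> M => T (f r0) r).
      move=> Df_f; apply: (@Df_under M (fun r => T (r 0%N) (shift r)) true (fun r0 =>
        ocons (f r0) r)) => //.
      by apply: Dfs_cons => // i; apply: Df_cst.
    apply: Sg_imp; first df.
    apply: Sg_and; first by apply: Sg_not; apply: Sg_eq; [apply: D2|df].
    apply: Sg_and; last by apply: Sg_le; auto with pv.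
    by apply: Sg_eq; [apply: D2|]; auto with pv.
  - by [].
  - move=> c IH Lc; case: (classic (c = 0)) => [->|N] //.
    have E := ln_hf N; have {IH} := IH ltac:(mlra).
    set z := R (hf M c) r; move=> [I1 [I2 I3]].
    have Ns : shr (hf M c) (B r) <> 0.
      move=> Z; have : ln M (hf M c) <= ln M (B r) by mlra.
      by move/ln_shr; rewrite Z ln0; mlra.
    have Ew : pw (shr (hf M c) (B r)) = 2 * pw (shr c (B r)).
      by rewrite pw_hf // (proj2 (shr_spec (B r)) c N).
    have Hw : W (ocons (hf M c) (ocons z r)) = pw (shr c (B r)).
      by rewrite /W /=; apply: hf_eq; rewrite Ew; mlra.
    have Ec : R c r = cond (T (z + pw (shr c (B r))) r) (z + pw (shr c (B r))) z.
      have := RS r c N; rewrite -/z Hw => /ismin_le; apply; env.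
      case: (classic (T (z + pw (shr c (B r))) r = 0)) => [->|NT].
        rewrite cond0; mlra.
      rewrite condN //; mlra.
    rewrite Ec; case: (classic (T (z + pw (shr c (B r))) r = 0)) => [Z|NT].
      by rewrite Z cond0; do !split => //; mlra.
    have E2 : z + pw (shr c (B r)) + pw (shr c (B r)) = z + pw (shr (hf M c) (B r)) by mlra.
    by rewrite condN // E2; do !split.
have [H1 [H2 _]] := Inv (B r) (mle_refl _).
split=> //; move: H2.
have -> : shr (B r) (B r) = 0; last by rewrite pw0.
apply: NNPP => /ln_neq0; apply.
have := ln_shr (mle_refl (ln M (B r))); mlra.
Qed.

End Programs.
#[export] Hint Resolve Df_pw Df_cond Df_shr Df_cpl Df_leb : pv.
#[global] Opaque cond shr cpl.

Section Programs2.
Variable M : s12.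
Local Open Scope M_scope.
Implicit Types x y z u v c i j l : M.

Notation env1 x := (ocons x enil).
Notation env2 x y := (ocons x (env1 y)).
Notation env3 x y z := (ocons x (env2 y z)).

Lemma pw_neq0 x : pw x <> 0. Proof. by apply/neq0; apply: pw_gt0. Qed.

(** Search for the largest z with y + z <= x. The test is made true at z = 0, so that the search can
    start for y > x as well and then ends at 0. *)
Lemma monus_ex : exists F : M -> M -> M, Df false (fun r => F (r 0%N) (r 1%N)) /\
  forall x y, (y <= x -> F x y + y = x) /\ (x <= y -> F x y = 0).
Proof.
have [F [DF HF]] := @search M (fun z r => cond z (leb (r 1%N + z) (r 0%N)) 1) (fun r => r 0%N)
  ltac:(df) ltac:(df).
exists (fun x y => F (env2 x y)); split.
  by apply: (Df_under DF (E := fun r => env2 (r 0%N) (r 1%N))); df.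
move=> x y; have := HF (env2 x y); env => /(_ _ _)[].
- by rewrite cond0; apply: neq10.
- by rewrite condN ?leb0 //; [have := lt_pw x; mlra|apply: pw_neq0].
set f := F _ => H; rewrite condN; last by apply: su_neq0 || (rewrite -su_ad; apply: su_neq0).
move=> K.
have L : ~ (y + (f + 1) <= x) by move=> /leb1 E; rewrite E in K; apply: (neq10 K).
case: (eq0_or f) => [E|Hf]; first by rewrite E in L *; split=> ?; mlra.
move: H; rewrite condN; last by apply/neq0.
by move/lebP => H; split=> ?; mlra.
Qed.

Definition monus : M -> M -> M. pick monus_ex. Defined.
Lemma monus_spec x y : (y <= x -> monus x y + y = x) /\ (x <= y -> monus x y = 0).
Proof. exact: (proj2 (proj2_sig (constructive_indefinite_description _ monus_ex))). Qed.
Lemma Df_monus b F G : Df b F -> Df b G -> Df b (fun r => monus (F r) (G r)).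
Proof. apply: Df2; exact: (proj1 (proj2_sig (constructive_indefinite_description _ monus_ex))). Qed.
Hint Resolve Df_monus : pv.

Lemma monusK x y : y <= x -> monus x y + y = x. Proof. exact: (proj1 (monus_spec x y)). Qed.
Lemma monus0 x y : x <= y -> monus x y = 0. Proof. exact: (proj2 (monus_spec x y)). Qed.
Lemma monusE x y z : z + y = x -> monus x y = z.
Proof. by move=> E; have := @monusK x y ltac:(mlra); mlra. Qed.

Lemma dv_ex : exists F : M -> M -> M, Df false (fun r => F (r 0%N) (r 1%N)) /\
  forall x y, y <> 0 -> y * F x y <= x /\ x < y * (F x y + 1).
Proof.
have [F [DF HF]] := @search M (fun z r => leb (r 1%N * z) (r 0%N)) (fun r => r 0%N)
  ltac:(df) ltac:(df).
exists (fun x y => F (env2 x y)); split.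
  by apply: (Df_under DF (E := fun r => env2 (r 0%N) (r 1%N))); df.
move=> x y /neq0 Hy; have := HF (env2 x y); env => /(_ _ _)[].
- by rewrite lebP ml0; apply: mle0.
- by rewrite leb0 //; have := lt_pw x; mnra.
move=> /lebP H K; split=> //; apply/mnot_le => L; move: K; rewrite leb1 //; exact: neq10.
Qed.

Definition dv : M -> M -> M. pick dv_ex. Defined.
Lemma dv_spec x y : y <> 0 -> y * dv x y <= x /\ x < y * (dv x y + 1).
Proof. exact: (proj2 (proj2_sig (constructive_indefinite_description _ dv_ex))). Qed.
Lemma Df_dv b F G : Df b F -> Df b G -> Df b (fun r => dv (F r) (G r)).
Proof. apply: Df2; exact: (proj1 (proj2_sig (constructive_indefinite_description _ dv_ex))). Qed.
Hint Resolve Df_dv : pv.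

Definition md x y : M := monus x (y * dv x y).
Lemma Df_md b F G : Df b F -> Df b G -> Df b (fun r => md (F r) (G r)).
Proof. by rewrite /md => *; df. Qed.
Hint Resolve Df_md : pv.

Lemma dv_md x y : y <> 0 -> x = y * dv x y + md x y /\ md x y < y.
Proof.
move=> Hy; have [H K] := dv_spec x Hy; rewrite /md.
by have := monusK H; move: (monus _ _) => m E; split; mlra.
Qed.

Lemma dv_unique x y q r : x = y * q + r -> r < y -> dv x y = q /\ md x y = r.
Proof.
move=> E L; have Hy : y <> 0 by move=> Z; rewrite Z in L; mlra.
have [E' L'] := dv_md x Hy; move: (dv x y) (md x y) E' L' => q' r' E' L'.
have Eq : q' = q.
  case: (classic (q' = q)) => // /neqE; rewrite -!injS -!leE => -[N|N]; exfalso.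
  - have : y * (su M q') <= y * q by apply: ml_mono; mlra.
    by mlra.
  - have : y * (su M q) <= y * q' by apply: ml_mono; mlra.
    by mlra.
by split=> //; rewrite Eq in E'; mlra.
Qed.

Lemma sqrt_ex : exists F : M -> M, Df false (fun r => F (r 0%N)) /\
  forall x, F x * F x <= x /\ x < (F x + 1) * (F x + 1).
Proof.
have [F [DF HF]] := @search M (fun z r => leb (z * z) (r 0%N)) (fun r => r 0%N)
  ltac:(df) ltac:(df).
exists (fun x => F (env1 x)); split.
  by apply: (Df_under DF (E := fun r => env1 (r 0%N))); df.
move=> x; have := HF (env1 x); env => /(_ _ _)[].
- by rewrite lebP ml0; apply: mle0.
- by rewrite leb0 //; have := lt_pw x; mnra.
move=> /lebP H K; split=> //; apply/mnot_le => L; move: K; rewrite leb1 //; exact: neq10.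
Qed.

Definition isqrt : M -> M. pick sqrt_ex. Defined.
Lemma isqrt_spec x : isqrt x * isqrt x <= x /\ x < (isqrt x + 1) * (isqrt x + 1).
Proof. exact: (proj2 (proj2_sig (constructive_indefinite_description _ sqrt_ex))). Qed.
Lemma Df_isqrt b F : Df b F -> Df b (fun r => isqrt (F r)).
Proof. apply: Df1; exact: (proj1 (proj2_sig (constructive_indefinite_description _ sqrt_ex))). Qed.
Hint Resolve Df_isqrt : pv.

Definition pr x y : M := (x + y) * (x + y) + x.
Definition p1 c : M := monus c (isqrt c * isqrt c).
Definition p2 c : M := monus (isqrt c) (p1 c).
Lemma Df_pr b F G : Df b F -> Df b G -> Df b (fun r => pr (F r) (G r)).
Proof. by rewrite /pr => *; df. Qed.
Lemma Df_p1 b F : Df b F -> Df b (fun r => p1 (F r)).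
Proof. by rewrite /p1 => *; df. Qed.
Hint Resolve Df_pr Df_p1 : pv.
Lemma Df_p2 b F : Df b F -> Df b (fun r => p2 (F r)).
Proof. by rewrite /p2 => *; df. Qed.
Hint Resolve Df_p2 : pv.

(** Since x <= 2 (x + y), the pair code lies between the squares of x + y and of x + y + 1. This
    makes the pairing computably invertible. *)
Lemma isqrt_pr x y : isqrt (pr x y) = x + y.
Proof.
have [] := isqrt_spec (pr x y); move: (isqrt _) => s; rewrite /pr => H K.
case: (classic (s = x + y)) => // /neqE N; exfalso.
case: N => N.
- have : (s + 1) * (s + 1) <= (x + y) * (x + y) by apply: ml_le2; move: N; rewrite -injS -leE; mlra.
  by mlra.
- have : (x + y + 1) * (x + y + 1) <= s * s by apply: ml_le2; move: N; rewrite -injS -leE; mlra.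
  by mlra.
Qed.
Lemma p1_pr x y : p1 (pr x y) = x.
Proof. by rewrite /p1 isqrt_pr; apply: monusE; rewrite /pr; mlra. Qed.
Lemma p2_pr x y : p2 (pr x y) = y.
Proof. by rewrite /p2 isqrt_pr p1_pr; apply: monusE; mlra. Qed.
Lemma pr_inj x y u v : pr x y = pr u v -> x = u /\ y = v.
Proof.
move=> E; split; first by rewrite -(p1_pr x y) E p1_pr.
by rewrite -(p2_pr x y) E p2_pr.
Qed.

Definition mn x y : M := cond (leb x y) x y.
Lemma Df_mn b F G : Df b F -> Df b G -> Df b (fun r => mn (F r) (G r)).
Proof. by rewrite /mn => *; df. Qed.
Hint Resolve Df_mn : pv.
Lemma mn_l x y : x <= y -> mn x y = x.
Proof. by move=> H; rewrite /mn leb1 // cond1. Qed.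
Lemma mn_r x y : y <= x -> mn x y = y.
Proof.
move=> H; rewrite /mn; case: (classic (x <= y)) => L.
  by rewrite leb1 // cond1; apply: mle_antisym.
by rewrite leb0 ?cond0 //; apply/mnot_le.
Qed.
Lemma mn_le x y : mn x y <= x /\ mn x y <= y.
Proof.
case: (mle_total x y) => H; [rewrite (mn_r H)|rewrite (mn_l H)]; split=> //; exact: mle_refl.
Qed.

Definition mx x y : M := cond (leb x y) y x.
Lemma Df_mx b F G : Df b F -> Df b G -> Df b (fun r => mx (F r) (G r)).
Proof. by rewrite /mx => *; df. Qed.
Lemma mx_spec x y : (x <= y /\ mx x y = y) \/ (y <= x /\ mx x y = x).
Proof.
rewrite /mx; case: (classic (x <= y)) => L; [left|right].
  by rewrite leb1 // cond1.
by rewrite leb0 ?cond0 //; [split=> //; mlra|apply/mnot_le].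
Qed.

Definition eqt x y : M := leb x y * leb y x.
Lemma Df_eqt b F G : Df b F -> Df b G -> Df b (fun r => eqt (F r) (G r)).
Proof. by rewrite /eqt => *; df. Qed.
Lemma eqtP x y : eqt x y <> 0 <-> x = y.
Proof.
rewrite /eqt; split=> [N|->]; last by rewrite leb1 ?ml1; [apply: neq10|apply: mle_refl].
apply: mle_antisym; split; apply/lebP => E; apply: N; rewrite E ?ml0 //.
by rewrite ml_comm ml0.
Qed.
Lemma eqt1 x : eqt x x = 1.
Proof. by rewrite /eqt leb1 ?ml1 //; apply: mle_refl. Qed.
Lemma eqt0 x y : x <> y -> eqt x y = 0.
Proof. by move=> N; apply: NNPP => E; apply: N; apply/eqtP. Qed.

Lemma ln_le x : ln M x <= x.
Proof.
move: x; apply: PIND; first df.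
  by rewrite ln0; apply: mle0.
move=> x IH; case: (classic (x = 0)) => [->|N]; first by rewrite ln0; apply: mle0.
have := ln_hf N; have [H K] := hf_bounds x; case: (eq0_or (hf M x)) => [E|H'].
  by rewrite E ln0; move/neq0: N; mlra.
by mlra.
Qed.

Lemma mask_ex : exists F : M -> M -> M, Df false (fun r => F (r 0%N) (r 1%N)) /\
  forall z i, i <= ln M z -> ln M (F z i) = i /\ F z i + 1 = pw (F z i).
Proof.
have [F [DF HF]] := @search M (fun v r => leb (ln M v) (r 1%N)) (fun r => r 0%N)
  ltac:(df) ltac:(df).
exists (fun x y => F (env2 x y)); split.
  by apply: (Df_under DF (E := fun r => env2 (r 0%N) (r 1%N))); df.
move=> z i Hi; have := HF (env2 z i); env => /(_ _ _)[].
- by rewrite lebP ln0; apply: mle0.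
- by rewrite leb0 // ln_pw; mlra.
set f := F _ => /lebP H K.
have L : i < ln M (f + 1) by apply/mnot_le => L; move: K; rewrite leb1 //; apply: neq10.
have E : f + 1 = pw f.
  apply: mle_antisym; split; first by have := lt_pw f; mlra.
  by apply: NNPP => /mnot_le/ln_lt_pw; mlra.
by split=> //; move: L; rewrite E ln_pw; mlra.
Qed.

(** [mask z i] is 2^i - 1, for i <= |z|. *)
Definition mask : M -> M -> M. pick mask_ex. Defined.
Lemma mask_spec z i : i <= ln M z -> ln M (mask z i) = i /\ mask z i + 1 = pw (mask z i).
Proof. exact: (proj2 (proj2_sig (constructive_indefinite_description _ mask_ex))). Qed.
Lemma Df_mask b F G : Df b F -> Df b G -> Df b (fun r => mask (F r) (G r)).
Proof. apply: Df2; exact: (proj1 (proj2_sig (constructive_indefinite_description _ mask_ex))). Qed.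
Hint Resolve Df_mask : pv.

(** ** Logarithmically small elements and their exponentials *)

Definition lg i : Prop := exists z, ln M z = i.
(** The power 2^i of a length i, picked by choice and so no term of the language. Definable
    predicates use [bz z i] in its place, which agrees with it for i <= |z|. *)
Definition ex i : M := epsilon (inhabits 0) (fun p => exists2 z, ln M z = i & p = pw z).

Lemma ex_ln z : ex (ln M z) = pw z.
Proof.
have [] : exists2 y, ln M y = ln M z & ex (ln M z) = pw y.
  by apply: (epsilon_spec (inhabits 0) (fun p => exists2 y, ln M y = ln M z & p = pw y));
    exists (pw z), z.
by move=> y E ->; apply: pw_ln.
Qed.
Lemma ln_lg z : lg (ln M z). Proof. by exists z. Qed.
Lemma lg_le i j : lg j -> i <= j -> lg i.
Proof. by case=> z <- L; exists (mask z i); case: (mask_spec L). Qed.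
Lemma lg0 : lg 0. Proof. by exists 0; apply: ln0. Qed.
Lemma ex0 : ex 0 = 1. Proof. by rewrite -{1}ln0 ex_ln pw0. Qed.
Lemma lgS i : lg i -> lg (i + 1).
Proof. by case=> z <-; exists (pw z); rewrite ln_pw su_ad. Qed.
Lemma exS i : lg i -> ex (i + 1) = 2 * ex i.
Proof.
case=> z <-; have -> : ln M z + 1 = ln M (pw z) by rewrite ln_pw -su_ad.
rewrite !ex_ln pw_hf; last exact: pw_neq0.
congr (_ * _); apply: pw_ln; apply: su_inj.
by rewrite -ln_hf ?ln_pw //; apply: pw_neq0.
Qed.
Lemma lgM i j : lg i -> lg j -> lg (i * j).
Proof.
case=> x <- [y <-]; apply: (@lg_le _ (ln M (sm M x y))); first exact: ln_lg.
by rewrite ln_sm; mlra.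
Qed.
Lemma lgD i j : lg i -> lg j -> lg (i + j).
Proof.
move=> Hi Hj; apply: (@lg_le _ ((i + 1) * (j + 1))); first by apply: lgM; apply: lgS.
have := mle0 (i * j); mlra.
Qed.
Lemma exD i j : lg i -> lg j -> ex (i + j) = ex i * ex j.
Proof.
move=> Hi Hj; have := lgD Hi Hj; case: Hi => x <-; case: Hj => y <- [z E].
by rewrite -E !ex_ln; apply: pw_add.
Qed.
Lemma ex_mono i j : lg j -> i <= j -> ex i <= ex j.
Proof.
move=> Hj L; have := lg_le Hj L; case: Hj L => y <- L [x E]; rewrite -E in L *.
by rewrite !ex_ln; apply: pw_mono.
Qed.
Lemma ex_ge1 i : lg i -> 1 <= ex i.
Proof. by case=> x <-; rewrite ex_ln; apply: pw_gt0. Qed.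
Lemma ex_neq0 i : lg i -> ex i <> 0.
Proof. by move=> H; apply/neq0; apply: ex_ge1. Qed.
Lemma ex_gt i : lg i -> i < ex i.
Proof. by case=> x <-; rewrite ex_ln; have := lt_pw x; have := ln_le x; mlra. Qed.
Lemma ln_ex x i : lg i -> ln M x <= i <-> x < ex i.
Proof.
case=> z <-; rewrite ex_ln; split; [exact: lt_pw_ln|exact: ln_lt_pw].
Qed.
Lemma lt_exln x : x < ex (ln M x). Proof. by rewrite ex_ln; apply: lt_pw. Qed.
Lemma mask_ex1 z i : i <= ln M z -> mask z i + 1 = ex i.
Proof. by case/mask_spec => E ->; rewrite -{2}E ex_ln. Qed.
Lemma ex_strict i j : lg j -> i < j -> ex i < ex j.
Proof.
move=> Hj L; have Hi : lg i by apply: lg_le Hj _; mlra.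
have : ex (i + 1) <= ex j by apply: ex_mono => //; mlra.
by rewrite exS //; have := ex_ge1 Hi; mlra.
Qed.

(** Induction on notation for the statement P(|c|): halving c lowers |c| by one. *)
Lemma LIND (P : M -> Prop) n : Sg true (fun r => P (r 0%N)) -> lg n ->
  P 0 -> (forall i, i < n -> P i -> P (i + 1)) -> P n.
Proof.
move=> D [z <-] P0 PS.
suff H : forall c, ln M c <= ln M z -> P (ln M c) by apply: H; apply: mle_refl.
apply: PIND.
- apply: Sg_imp; first df.
  apply: (@Sg_comp M true (fun r => P (r 0%N)) (fun r => ocons (ln M (r 0%N)) enil)) => //; df.
- by rewrite ln0.
- move=> c IH Lc; case: (classic (c = 0)) => [->|N]; first by rewrite ln0.
  have E := ln_hf N; rewrite E su_ad; apply: PS; first by mlra.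
  by apply: IH; mlra.
Qed.

Lemma LIND_le (P : M -> Prop) n : Sg true (fun r => P (r 0%N)) -> lg n ->
  P 0 -> (forall i, i < n -> P i -> P (i + 1)) -> forall i, i <= n -> P i.
Proof.
move=> D Hn P0 PS i Hi; apply: LIND => //; first exact: lg_le Hn Hi.
by move=> j Hj; apply: PS; mlra.
Qed.

Lemma LIND_flip (P : M -> Prop) n : Sg true (fun r => P (r 0%N)) -> lg n ->
  P 0 -> ~ P n -> exists i, i < n /\ P i /\ ~ P (i + 1).
Proof.
move=> D Hn P0 Pn; apply: NNPP => N; apply: Pn; apply: LIND => // i Hi Pi.
by apply: NNPP => K; apply: N; exists i.
Qed.

(** ** Iteration along an initial segment of the lengths *)

(** Recursion on notation along the numbers 2^i - 1: halving such a number yields the preceding one,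
    and their lengths run through 0, 1, ..., |z|. *)
Lemma iterate (G H K : (nat -> M) -> M) : Df false G -> Df false H -> Df false K ->
  exists I : M -> M -> (nat -> M) -> M,
    Df false (fun r => I (r 0%N) (r 1%N) (shift (shift r))) /\
    forall z r, ismin (G r) (K (ocons 0 r)) (I z 0 r) /\
    forall i, i < ln M z ->
      ismin (H (ocons i (ocons (I z i r) r))) (K (ocons (i + 1) r)) (I z (i + 1) r).
Proof.
move=> DG DH DK.
have DH' : Df false (fun r : nat -> M => H (ocons (ln M (r 0%N)) (shift r))).
  by apply: (Df_under DH); apply: Dfs_cons; [df|move=> i; apply: Df_var].
have DK' : Df false (fun r : nat -> M => K (ocons (ln M (r 0%N)) (shift r))).
  by apply: (Df_under DK); apply: Dfs_cons; [df|move=> i; apply: Df_var].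
have [R [DR [R0 RS]]] := lrec1 DG DH' DK'.
exists (fun z i r => R (mask z i) r); split.
  apply: (Df_under DR (E := fun r => ocons (mask (r 0%N) (r 1%N)) (shift (shift r)))).
  by apply: Dfs_cons; [df|move=> i; apply: Df_var].
move=> z r; split.
  have [E _] := @mask_spec z 0 (mle0 _).
  have -> : mask z 0 = 0.
    by apply: NNPP => /ln_neq0; apply.
  by have := R0 r; env; rewrite ln0.
move=> i Hi; have Hi1 : i + 1 <= ln M z by mlra.
have Hi0 : i <= ln M z by mlra.
have [E1 F1] := mask_spec Hi1; have [E0 F0] := mask_spec Hi0.
have F1' := mask_ex1 Hi1; have F0' := mask_ex1 Hi0.
have N : mask z (i + 1) <> 0 by move=> Z; move: E1; rewrite Z ln0; mlra.
have Eh : hf M (mask z (i + 1)) = mask z i.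
  have := exS (lg_le (ln_lg z) Hi0).
  by move=> E; apply: hf_eq; mlra.
by have := RS r _ N; env; rewrite Eh E0 E1.
Qed.

End Programs2.
#[export] Hint Resolve Df_monus Df_dv Df_md Df_isqrt Df_pr Df_p1 Df_p2 Df_mn Df_mx Df_eqt
  Df_mask : pv.
#[global] Opaque monus dv isqrt mask.

(** ** Tables and sequences *)

Section Tables.
Variable M : s12.
Local Open Scope M_scope.
Implicit Types x y z u v w c i j k l T a : M.
Implicit Types r : nat -> M.

Definition bz z i : M := mask z i + 1.
Lemma Df_bz b F G : Df b F -> Df b G -> Df b (fun r : nat -> M => bz (F r) (G r)).
Proof. by rewrite /bz => *; df. Qed.
Hint Resolve Df_bz : pv.
Lemma bzE z i : i <= ln M z -> bz z i = ex i.
Proof. exact: mask_ex1. Qed.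

(** Block [i] of length [l] of the binary expansion of [T]. *)
Definition rd l T i : M :=
  md (dv T (bz T (mn (l * i) (ln M T)))) (bz T (mn l (ln M T))).
Lemma Df_rd b F G H : Df b F -> Df b G -> Df b H ->
  Df b (fun r : nat -> M => rd (F r) (G r) (H r)).
Proof. by rewrite /rd => *; df. Qed.
Hint Resolve Df_rd : pv.

Lemma dv_small x y : x < y -> dv x y = 0 /\ md x y = x.
Proof. by move=> L; apply: dv_unique => //; rewrite ml0 ad_comm ad0. Qed.

Lemma md_lt x y : y <> 0 -> md x y < y.
Proof. by move=> N; case: (dv_md x N). Qed.

(** The truncations of l i and l at |T| in [rd] are harmless: as T < 2^|T|, they change neither the
    quotient nor the remainder. *)
Lemma rdE l T i : lg (l * i) -> lg l -> rd l T i = md (dv T (ex (l * i))) (ex l).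
Proof.
move=> Hli Hl; rewrite /rd.
have LT := lt_exln T.
have -> : dv T (bz T (mn (l * i) (ln M T))) = dv T (ex (l * i)).
  case: (mle_total (l * i) (ln M T)) => L; last by rewrite mn_l // bzE.
  rewrite mn_r // bzE; last exact: mle_refl.
  rewrite (proj1 (dv_small LT)); symmetry; apply: (proj1 (dv_small _)).
  by have := ex_mono Hli L; mlra.
case: (mle_total l (ln M T)) => L; last by rewrite mn_l // bzE.
rewrite mn_r // bzE; last exact: mle_refl.
have H : dv T (ex (l * i)) <= T.
  have [K _] := dv_spec T (ex_neq0 Hli); have := ex_ge1 Hli.
  by mnra.
rewrite (proj2 (dv_small (x := dv _ _) _)); last by mlra.
by rewrite (proj2 (dv_small (x := dv _ _) _)) //; have := ex_mono Hl L; mlra.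
Qed.

Lemma rd_lt l T i : lg (l * i) -> lg l -> rd l T i < ex l.
Proof. by move=> H K; rewrite rdE //; apply: md_lt; apply: ex_neq0. Qed.

Lemma rd_unique l T i hi u lo : lg (l * i) -> lg l ->
  T = (hi * ex l + u) * ex (l * i) + lo -> u < ex l -> lo < ex (l * i) -> rd l T i = u.
Proof.
move=> Hli Hl E Lu Llo; rewrite rdE //.
have [-> _] := @dv_unique M T (ex (l * i)) (hi * ex l + u) lo ltac:(mlra) Llo.
by have [] := @dv_unique M (hi * ex l + u) (ex l) hi u ltac:(mlra) Lu.
Qed.

Lemma lg_block l k i : lg (l * k) -> i < k -> lg (l * i) /\ lg (l * (i + 1)).
Proof.
move=> H L; split; apply: (lg_le H); apply: ml_mono; mlra.
Qed.

Lemma lg_blockl l k i : lg (l * k) -> i < k -> lg l.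
Proof.
move=> H L; apply: (lg_le H); rewrite -{1}(ml1 l); apply: ml_mono; mlra.
Qed.

Lemma ex_block l k i : lg (l * k) -> i < k ->
  ex (l * k) = ex (l * i) * (ex l * ex (l * monus k (i + 1))).
Proof.
move=> H L; have [H1 H2] := lg_block H L; have Hl := lg_blockl H L.
have E := @monusK M k (i + 1) ltac:(mlra).
move: (monus _ _) E => m E; rewrite -{}E in H *.
have lm : lg (l * m) by apply: (lg_le H); mnra.
rewrite -exD // -exD //; first by congr (ex _); mlra.
by apply: (lg_le H); mnra.
Qed.

Lemma rd_add_high l k i T y : lg (l * k) -> i < k ->
  rd l (T + y * ex (l * k)) i = rd l T i.
Proof.
move=> H L; have [H1 H2] := lg_block H L; have Hl := lg_blockl H L.
rewrite [RHS]rdE //.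
have [E1 L1] := dv_md T (ex_neq0 H1); have [E2 L2] := dv_md (dv T (ex (l * i))) (ex_neq0 Hl).
apply: (rd_unique (hi := dv (dv T (ex (l * i))) (ex l) + y * ex (l * monus k (i + 1))) (lo := md
  T (ex (l * i)))) => //.
rewrite (ex_block H L).
move: (dv (dv _ _) _) (md (dv _ _) _) E2 => A B E2; rewrite {1}E1 E2; mlra.
Qed.

(** Course-of-values recursion: the iterated value is the whole table so far, so a step can consult
    every earlier entry. An entry is cut off at 2^l - 1 and stored as the new top block. *)
Lemma table (st : (nat -> M) -> M) : Df false st ->
  exists tab : M -> M -> M -> (nat -> M) -> M,
    Df false (fun r => tab (r 0%N) (r 1%N) (r 2%N) (shift (shift (shift r)))) /\
    forall z l r k, k <= ln M z -> l * k <= ln M z ->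
      tab z l k r < ex (l * k) /\
      forall i, i < k -> rd l (tab z l k r) i =
        mn (st (ocons i (ocons (tab z l i r) r))) (mask z l).
Proof.
move=> Dst.
have DG := Df_zr M false.
have DH : Df false (fun r : nat -> M => r 1%N +
   mn (st (ocons (r 0%N) (ocons (r 1%N) (shift (shift (shift (shift r))))))) (mask (r 2%N) (r 3%N))
     * bz (r 2%N) (r 3%N * r 0%N)).
  apply: Df_ad; first df. apply: Df_ml; last df. apply: Df_mn; last df.
  apply: (Df_under Dst); do 2 (apply: Dfs_cons; first df); by move=> i; apply: Df_var.
have DK : Df false (fun r : nat -> M => bz (r 1%N) (r 2%N * r 0%N)) by df.
have [I [DI HI]] := iterate DG DH DK.
exists (fun z l k r => I z k (ocons z (ocons l r))); split.
  apply: (Df_under DI (E := fun r =>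
    ocons (r 0%N) (ocons (r 2%N) (ocons (r 0%N) (ocons (r 1%N) (shift (shift (shift r)))))))).
  do 4 (apply: Dfs_cons; first df); by move=> i; apply: Df_var.
move=> z l r k Hk Hlk.
set R := ocons z (ocons l r); have [I0 IS] := HI z R.
pose V i := mn (st (ocons i (ocons (I z i R) r))) (mask z l).
have DIc : Df true (fun r0 : nat -> M => I z (r0 0%N) R).
  apply: (Df_under (b := true) DI (E := fun r0 => ocons z (ocons (r0 0%N) R))).
  do 2 (apply: Dfs_cons; first df); by move=> i; apply: Df_cst.
have Lk : lg k by exact: lg_le (ln_lg z) Hk.
have Llk : lg (l * k) by exact: lg_le (ln_lg z) Hlk.
have step i : i < k -> I z i R < ex (l * i) ->
    I z (i + 1) R = I z i R + V i * ex (l * i) /\ I z (i + 1) R < ex (l * (i + 1)).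
  move=> Li Lt; have [H1 H2] := lg_block Llk Li; have Hl := lg_blockl Llk Li.
  have B1 : l * i <= ln M z.
    by apply: (mle_trans (y := l * k)); split=> //; apply: ml_mono; mlra.
  have B2 : l * (i + 1) <= ln M z.
    by apply: (mle_trans (y := l * k)); split=> //; apply: ml_mono; mlra.
  have B3 : l <= ln M z.
    by apply: (mle_trans (y := l * (i + 1))); split=> //; have := mle0 (l * i); mlra.
  have [_ HV] := mn_le (st (ocons i (ocons (I z i R) r))) (mask z l).
  have Em := mask_ex1 B3.
  have Ex : ex (l * (i + 1)) = ex (l * i) * ex l.
    by rewrite -exD //; congr (ex _); mlra.
  have Lt2 : I z i R + V i * ex (l * i) < ex (l * (i + 1)).
    rewrite Ex; have : (V i + 1) * ex (l * i) <= ex l * ex (l * i).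
      by apply: ml_le2; [rewrite -Em /V; mlra|apply: mle_refl].
    by mlra.
  suff -> : I z (i + 1) R = I z i R + V i * ex (l * i) by [].
  have := IS i; rewrite /R /=; env; rewrite -/R => /(_ _)/ismin_le; rewrite !bzE //.
  by apply; [mlra|rewrite -/(V i); mlra].
have bnd : forall i, i <= k -> I z i R < ex (l * i).
  have D : Sg true (fun r0 : nat -> M => I z (r0 0%N) R < bz z (l * r0 0%N)).
    by apply: Sg_lt => //; df.
  move=> i Li; rewrite -(@bzE z); last first.
    by apply: (mle_trans (y := l * k)); split=> //; apply: ml_mono.
  apply: (LIND_le (P := fun i => I z i R < bz z (l * i)) D Lk) Li; first by rewrite ml0 bzE ?ex0;
    [have := ismin_leq I0|apply: mle0];
    rewrite (ismin_le I0 (mle0 _)); mlra.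
  move=> j Hj; rewrite !bzE; first by move=> Lt; case: (step j Hj Lt).
  - by apply: (mle_trans (y := l * k)); split=> //; apply: ml_mono; mlra.
  - by apply: (mle_trans (y := l * k)); split=> //; apply: ml_mono; mlra.
split; first by apply: bnd; apply: mle_refl.
move=> i Li; rewrite -/(V i).
have [H1 H2] := lg_block Llk Li; have Hl := lg_blockl Llk Li.
have [E1 _] := step i Li (bnd i ltac:(mlra)).
have LV : V i < ex l.
  have B3 : l <= ln M z.
    by apply: (mle_trans (y := l * k)); split=> //; rewrite -{1}(ml1 l); apply: ml_mono; mlra.
  have [_ HV] := mn_le (st (ocons i (ocons (I z i R) r))) (mask z l).
  by have := mask_ex1 B3; rewrite /V; mlra.
have main : forall j, j <= k -> (i < j -> rd l (I z j R) i = V i).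
  apply: LIND_le => //.
  - by apply: Sg_imp; [df|apply: Sg_eq; [apply: Df_rd; auto with pv|df]].
  - by move=> /mnot_le []; apply: mle0.
  - move=> j Lj IH Lij; have [Ej _] := step j Lj (bnd j ltac:(mlra)).
    rewrite Ej; case: (classic (i < j)) => [L|N].
      rewrite rd_add_high // ?IH //; exact: (proj1 (lg_block Llk Lj)).
    have Eij : j = i by mlra.
    rewrite Eij; apply: (rd_unique (hi := 0) (lo := I z i R)) => //; last by apply: bnd; mlra.
    by rewrite Eij in Lj *; mlra.
by apply: main => //; apply: mle_refl.
Qed.

(** ** The official sequences *)

Definition pow2 (n p : M) : Prop := exists y, ln M y = n /\ p = sm M 1 y.
Definition isseq a k : Prop :=
  exists l w, 1 <= l /\ a = pr l w /\ ln M w = su M (k * l).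
Definition entryM a i u : Prop :=
  exists l w hi lo p q, a = pr l w /\ pow2 l q /\ pow2 (i * l) p /\
    w = (hi * q + u) * p + lo /\ 1 <= hi /\ u < q /\ lo < p.

Definition ent a i : M := rd (p1 a) (p2 a) i.
Lemma Df_ent b F G : Df b F -> Df b G -> Df b (fun r : nat -> M => ent (F r) (G r)).
Proof. by rewrite /ent => *; df. Qed.
Hint Resolve Df_ent : pv.

Lemma pow2P n p : pow2 n p <-> lg n /\ p = ex n.
Proof.
split=> [[y [<- ->]]|[[z <-] ->]]; first by rewrite ex_ln; split=> //; apply: ln_lg.
by exists z; rewrite ex_ln.
Qed.

Lemma isseq_lg a k : isseq a k -> lg k.
Proof.
move=> [l [w [Hl [_ E]]]]; apply: (lg_le (ln_lg w)); rewrite E.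
have : k * 1 <= k * l by apply: ml_mono.
mlra.
Qed.

Lemma isseqP a k : isseq a k ->
  exists l w, [/\ 1 <= l, a = pr l w, lg (l * k) & ex (l * k) <= w /\ w < 2 * ex (l * k)].
Proof.
move=> S; have Hk := isseq_lg S; case: S => l [w [Hl [E L]]]; exists l, w.
have L' : ln M w = l * k + 1 by rewrite L; mlra.
have H1 : lg (l * k) by apply: (lg_le (ln_lg w)); rewrite L'; mlra.
split=> //; split.
- apply: NNPP => /mnot_le /(ln_ex _ H1); mlra.
- by rewrite -exS // -L'; apply: lt_exln.
Qed.

Lemma entryP a k i u : isseq a k -> (entryM a i u <-> i < k /\ u = ent a i).
Proof.
move=> S; have [l [w [Hl E Hlk [W1 W2]]]] := isseqP S; split.
- move=> [l' [w' [hi [lo [p [q [E' [/pow2P [Ll ->] [/pow2P [Lil ->] [Ew [Hhi [Hu Hlo]]]]]]]]]]]].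
  rewrite E in E'; case: (pr_inj E') => E1 E2; rewrite -E1 -E2 (ml_comm i) in Ew;
    rewrite -E1 in Ll Hu.
  rewrite -E1 (ml_comm i) in Hlo; rewrite -E1 (ml_comm i) in Lil.
  split; last by rewrite /ent E p1_pr p2_pr; symmetry; apply: rd_unique Ew Hu Hlo.
  (* The leading 1 of [w] is at position l k. An entry of index i >= k with hi >= 1 would force w >=
     2^(l i + l) >= 2^(l k + 1), which is too large. *)
  apply: NNPP => /nltE; rewrite -leE => L.
  have Lli : lg (l * i + l) by apply: lgD.
  have : ex (l * k + 1) <= ex (l * i + l).
    by apply: ex_mono => //; have := ml_mono l L; mlra.
  rewrite exS // exD //.
  have := ex_ge1 Ll; have := ex_ge1 Lil; move: (ex l) (ex (l * i)) Ew Hlo => q' p' Ew Hlo Hp Hq.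
  have : 1 * (q' * p') <= hi * (q' * p') by apply: ml_le2 => //; apply: mle_refl.
  by have := mle0 (u * p'); mlra.
- move=> [Hi ->]; rewrite /ent E p1_pr p2_pr.
  have [H1 H2] := lg_block Hlk Hi; have Ll := lg_blockl Hlk Hi.
  have [E1 L1] := dv_md w (ex_neq0 H1); have [E2 L2] := dv_md (dv w (ex (l * i))) (ex_neq0 Ll).
  exists l, w, (dv (dv w (ex (l * i))) (ex l)), (md w (ex (l * i))), (ex (l * i)), (ex l).
  rewrite rdE //; do !split=> //.
  + by apply/pow2P.
  + by apply/pow2P; rewrite ml_comm.
  + by rewrite {1}E1 {1}E2; mlra.
  (* If nothing stood above block i, then w < 2^(l (i + 1)) <= 2^(l k), against the leading 1. *)
  + case: (eq0_or (dv (dv w (ex (l * i))) (ex l))) => // Z; exfalso.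
    have : ex (l * (i + 1)) <= ex (l * k) by apply: ex_mono => //; apply: ml_mono; mlra.
    have -> : l * (i + 1) = l * i + l by mlra.
    rewrite exD //; rewrite Z in E2.
    have : ex (l * i) * (dv w (ex (l * i)) + 1) <= ex (l * i) * ex l by apply: ml_mono; mlra.
    by mlra.
Qed.

Lemma isseq_mk l k T : 1 <= l -> lg (l * k) -> T < ex (l * k) ->
  isseq (pr l (T + ex (l * k))) k /\
  forall i, i < k -> ent (pr l (T + ex (l * k))) i = rd l T i.
Proof.
move=> Hl H L; split.
- exists l, (T + ex (l * k)); do !split=> //.
  have H' : lg (l * k + 1) by apply: lgS.
  apply: mle_antisym; split.
    have : ln M (T + ex (l * k)) <= l * k + 1 by apply/(ln_ex _ H'); rewrite exS //; mlra.
    by mlra.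
  apply: NNPP => N.
  have : ln M (T + ex (l * k)) <= l * k by mlra.
  by move/(ln_ex _ H); mlra.
- move=> i Li; rewrite /ent p1_pr p2_pr -(rd_add_high T 1 H Li); congr (rd _ (_ + _) _).
  by rewrite (ml_comm 1) ml1.
Qed.

Definition mkseq z l k T : M := pr l (T + bz z (l * k)).
Lemma Df_mkseq b F G H K : Df b F -> Df b G -> Df b H -> Df b K ->
  Df b (fun r => mkseq (F r) (G r) (H r) (K r)).
Proof. by rewrite /mkseq /pr => *; df. Qed.

Lemma pr_mono x y z : y <= z -> pr x y <= pr x z.
Proof.
move=> H; have K : x + y <= x + z by mlra.
by have := ml_le2 K K; rewrite /pr; move: (_ * _) => ?; mlra.
Qed.

Lemma seq_of (v : (nat -> M) -> M) : Df false v ->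
  exists sq : M -> M -> M -> (nat -> M) -> M,
    Df false (fun r => sq (r 0%N) (r 1%N) (r 2%N) (shift (shift (shift r)))) /\
    forall z l k r, 1 <= l -> l * k <= ln M z ->
      (forall i, i < k -> v (ocons i r) < ex l) ->
      [/\ isseq (sq z l k r) k, forall i, i < k -> ent (sq z l k r) i = v (ocons i r)
        & sq z l k r <= pr l (2 * ex (l * k))].
Proof.
move=> Dv.
have D' : Df false (fun r => v (ocons (r 0%N) (shift (shift r)))).
  by apply: (Df_under Dv); apply: Dfs_cons; [df|move=> i; apply: Df_var].
have [tab [Dt Ht]] := table D'.
exists (fun z l k r => mkseq z l k (tab z l k r)); split.
  by apply: Df_mkseq => //; df.
move=> z l k r Hl Hz Hv.
have Hk : k <= ln M z.
  by apply: (mle_trans (y := l * k)); split=> //; rewrite ml_comm -{1}(ml1 k); apply: ml_mono.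
have [Lt Hrd] := Ht z l r k Hk Hz.
have Hlk : lg (l * k) by apply: lg_le (ln_lg z) Hz.
have [S1 S2] := isseq_mk Hl Hlk Lt.
rewrite /mkseq bzE //; split=> //; last by apply: pr_mono; mlra.
move=> i Hi; rewrite S2 // Hrd // mn_l //.
have Ll := lg_blockl Hlk Hi.
have B : l <= ln M z.
  by apply: (mle_trans (y := l * k)); split=> //; rewrite -{1}(ml1 l); apply: ml_mono; mlra.
by have := Hv i Hi; have := mask_ex1 B; env; mlra.
Qed.

End Tables.
#[export] Hint Resolve Df_bz Df_rd Df_ent Df_mkseq : pv.
#[global] Opaque md leb mn mx eqt bz rd ent ex p1 p2.

(** * The hitting set axioms in a model *)

Section Circuits.
Variable M : s12.
Local Open Scope M_scope.
Implicit Types x y z u v w c i j k l n o a t s q : M.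

Definition log_of n : Prop := exists y, n = ln M y.
Definition int_val z p n : Prop := (z = 2 * p /\ n = 0) \/ (z = su M (2 * n) /\ p = 0).
Definition int_add x y z : Prop := exists px nx py ny pz nz,
  int_val x px nx /\ int_val y py ny /\ int_val z pz nz /\ px + py + nz = nx + ny + pz.
Definition int_mul x y z : Prop := exists px nx py ny pz nz,
  int_val x px nx /\ int_val y py ny /\ int_val z pz nz /\
  px * py + nx * ny + nz = px * ny + nx * py + pz.
Definition int_nonzero z : Prop := exists p n, int_val z p n /\ ~ p = n.

Definition g_var j : M := pr 0 j.
Definition g_const z : M := pr 1 z.
Definition g_add u v : M := pr 2 (pr u v).
Definition g_mul u v : M := pr (su M 2) (pr u v).

Definition is_slp (C n o : M) : Prop :=
  isseq C (su M o) /\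
  forall i, i <= o -> exists g, entryM C i g /\
    ((exists j, j < n /\ g = g_var j) \/ (exists z, g = g_const z) \/
     (exists u v, u < i /\ v < i /\ (g = g_add u v \/ g = g_mul u v))).
Definition is_max x y m : Prop := (x <= y /\ m = y) \/ (y <= x /\ m = x).
Definition deg_trace (src : M -> M -> Prop) (C o D : M) : Prop :=
  isseq D (su M o) /\
  forall i, i <= o -> exists g e, entryM C i g /\ entryM D i e /\
    (((exists z, g = g_var z \/ g = g_const z) /\
        ((src i g /\ e = 1) \/ (~ src i g /\ e = 0))) \/
     (exists u v eu ev, entryM D u eu /\ entryM D v ev /\
        ((g = g_add u v /\ is_max eu ev e) \/ (g = g_mul u v /\ e = eu + ev)))).
Definition deg_le (src : M -> M -> Prop) (C o d : M) : Prop :=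
  exists D e, deg_trace src C o D /\ entryM D o e /\ e <= d.
Definition ckt (C n d s : M) : Prop :=
  ln M C <= s /\
  exists o, is_slp C n o /\
    (forall j, j < n -> deg_le (fun _ g => g = g_var j) C o d) /\
    (forall c, c <= o /\ (exists z, entryM C c (g_const z)) -> deg_le (fun i _ => i = c) C o d).
Definition eval_trace (C o a t : M) : Prop :=
  isseq t (su M o) /\
  forall i z, i <= o /\ entryM t i (su M z) -> exists g, entryM C i g /\
    ((exists j, g = g_var j /\ entryM a j z) \/ (g = g_const z) \/
     (exists u v x y, entryM t u (su M x) /\ entryM t v (su M y) /\
        ((g = g_add u v /\ int_add x y z) \/ (g = g_mul u v /\ int_mul x y z)))).
Definition eval_nonzero (C a : M) : Prop :=
  exists o t z, isseq C (su M o) /\ eval_trace C o a t /\ entryM t o (su M z) /\ int_nonzero z.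
Definition in_cube (h n q : M) : Prop :=
  isseq h n /\ forall j, j < n -> exists c, c < q /\ entryM h j (2 * c).

Definition ap5 (g : pv 5) (x1 x2 x3 x4 x5 : M) : M :=
  fint M g (Vector.cons M x1 4 (Vector.cons M x2 3 (Vector.cons M x3 2
    (Vector.cons M x4 1 (Vector.cons M x5 0 (Vector.nil M)))))).

Definition hitting (g : pv 5) : Prop :=
  forall e n d s q r m : M,
  log_of n /\ log_of d /\ log_of s /\ log_of q /\ log_of r /\ log_of m ->
  1 <= q /\ 2 * n * d <= q /\ m + n * ln M q < r ->
  exists H, (isseq H r /\ forall i, i < r -> exists h, entryM H i h /\ in_cube h n q) /\
    forall x, ln M x <= m -> forall C, ckt C n d s -> ap5 g e n d s x = C ->
      (exists a, isseq a n /\ eval_nonzero C a) ->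
      exists i h, i < r /\ entryM H i h /\ eval_nonzero C h.

Definition dual_php (f : pv 2) : Prop :=
  forall a b c : M, 2 * a <= b /\ 1 <= a ->
    exists y, (1 <= y /\ y <= b) /\ forall x, 1 <= x /\ x <= a -> ~ ap2 M f x c = y.

(** The predicates above copy the official formulas connective by connective, so satisfaction
    unfolds to them by conversion. *)
Lemma sat_HS g rho : sat M rho (HS g) <-> hitting g.
Proof. reflexivity. Qed.
Lemma sat_dWPHP f rho : sat M rho (dWPHP f) <-> dual_php f.
Proof. reflexivity. Qed.

Lemma log_ofE n : log_of n <-> lg n.
Proof. by split; case=> y E; exists y. Qed.

(** ** Sign-magnitude integers *)

Definition ipos z : M := cond (eqt z (2 * hf M z)) (hf M z) 0.
Definition ineg z : M := cond (eqt z (2 * hf M z)) 0 (hf M z).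
Lemma Df_ipos b F : Df b F -> Df b (fun r => ipos (F r)).
Proof. by rewrite /ipos => *; df. Qed.
Lemma Df_ineg b F : Df b F -> Df b (fun r => ineg (F r)).
Proof. by rewrite /ineg => *; df. Qed.
Hint Resolve Df_ipos Df_ineg : pv.

Lemma int_valP z p n : int_val z p n <-> p = ipos z /\ n = ineg z.
Proof.
rewrite /int_val /ipos /ineg; split.
- case=> -[-> ->].
    have -> : hf M (2 * p) = p by apply: hf_eq; mlra.
    by rewrite eqt1 !cond1.
  have E : hf M (su M (2 * n)) = n by apply: hf_eq; mlra.
  rewrite E eqt0 ?cond0 //; mlra.
- case: (hf_cases z) => E.
    by rewrite -E eqt1 !cond1 => -[-> ->]; left.
  have N : z <> 2 * hf M z by move: E; move: (hf M z) => h ->; mlra.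
  by rewrite eqt0 // !cond0 => -[-> ->]; right.
Qed.

Definition ival z : ZM M := (inj (ipos z) - inj (ineg z))%R.

Lemma int_addP x y z : int_add x y z <-> (ival x + ival y = ival z)%R.
Proof.
rewrite /ival; split.
- move=> [px [nx [py [ny [pz [nz [/int_valP[-> ->] [/int_valP[-> ->] [/int_valP[-> ->]]]]]]]]]].
  by move/eqE; rewrite !injD => E; lra.
- move=> E; exists (ipos x), (ineg x), (ipos y), (ineg y), (ipos z), (ineg z).
  by rewrite !int_valP; do !split=> //; apply/eqE; rewrite !injD; lra.
Qed.

Lemma int_mulP x y z : int_mul x y z <-> (ival x * ival y = ival z)%R.
Proof.
rewrite /ival; split.
- move=> [px [nx [py [ny [pz [nz [/int_valP[-> ->] [/int_valP[-> ->] [/int_valP[-> ->]]]]]]]]]].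
  by move/eqE; rewrite !(injD, injM) => E; nra.
- move=> E; exists (ipos x), (ineg x), (ipos y), (ineg y), (ipos z), (ineg z).
  by rewrite !int_valP; do !split=> //; apply/eqE; rewrite !(injD, injM); nra.
Qed.

Lemma int_nonzeroP z : int_nonzero z <-> (ival z <> 0)%R.
Proof.
rewrite /ival; split.
- move=> [p [n [/int_valP[-> ->] N]]] E; apply: N; apply/eqE; lra.
- move=> E; exists (ipos z), (ineg z); rewrite int_valP; split=> // E'; apply: E.
  by rewrite E'; lra.
Qed.

Definition icode p n : M := cond (leb n p) (2 * monus p n) (2 * monus n p + 1).
Definition iadd x y : M := icode (ipos x + ipos y) (ineg x + ineg y).
Definition imul x y : M :=
  icode (ipos x * ipos y + ineg x * ineg y) (ipos x * ineg y + ineg x * ipos y).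
Lemma Df_iadd b F G : Df b F -> Df b G -> Df b (fun r => iadd (F r) (G r)).
Proof. by rewrite /iadd /icode => *; df. Qed.
Lemma Df_imul b F G : Df b F -> Df b G -> Df b (fun r => imul (F r) (G r)).
Proof. by rewrite /imul /icode => *; df. Qed.

Lemma ival_pos c : ival (2 * c) = inj c.
Proof.
rewrite /ival; have /int_valP[<- <-] : int_val (2 * c) c 0 by left.
by rewrite inj0 subr0.
Qed.
Lemma ival_neg c : ival (2 * c + 1) = (- inj c)%R.
Proof.
rewrite /ival; have /int_valP[<- <-] : int_val (2 * c + 1) 0 c by right; rewrite (su_ad (2 * c)).
by rewrite inj0 sub0r.
Qed.
Lemma ival_code p n : ival (icode p n) = (inj p - inj n)%R.
Proof.
rewrite /icode; case: (classic (n <= p)) => L.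
- rewrite leb1 // cond1 ival_pos; have /eqE := monusK L; rewrite injD => E; lra.
- have L' : p < n by apply/mnot_le.
  rewrite leb0 // cond0 ival_neg; have /eqE := @monusK M n p ltac:(mlra); rewrite injD => E; lra.
Qed.
Lemma ival_add x y : ival (iadd x y) = (ival x + ival y)%R.
Proof. by rewrite ival_code /ival !injD; ring. Qed.
Lemma ival_mul x y : ival (imul x y) = (ival x * ival y)%R.
Proof. by rewrite ival_code /ival !(injD, injM); ring. Qed.
(** Both 2m and 2m + 1 have magnitude m; so [hf] serves as the absolute value in all size bounds. *)
Lemma ival_norm z : `|ival z|%R = inj (hf M z).
Proof.
case: (hf_cases z) => E; rewrite {1}E; last by rewrite su_ad ival_neg normrN ger0_norm // inj_ge0.
by rewrite ival_pos ger0_norm // inj_ge0.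
Qed.

Notation env1 x := (ocons x enil).
Notation env2 x y := (ocons x (env1 y)).
Notation env3 x y z := (ocons x (env2 y z)).

(** The entry of gate [i], computed from the table [f] of the previous entries; it is 0
    (not computed) when its length exceeds [l]. *)
Definition gate_raw (C t i : M) (f : M -> M) : M :=
  cond (eqt (p1 (ent C i)) 0) (ent t (p2 (ent C i)) + 1)
   (cond (eqt (p1 (ent C i)) 1) (p2 (ent C i) + 1)
     (cond (f (p1 (p2 (ent C i))) * f (p2 (p2 (ent C i))))
        (cond (eqt (p1 (ent C i)) 2)
          (iadd (monus (f (p1 (p2 (ent C i)))) 1) (monus (f (p2 (p2 (ent C i)))) 1) + 1)
          (imul (monus (f (p1 (p2 (ent C i)))) 1) (monus (f (p2 (p2 (ent C i)))) 1) + 1)) 0)).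
Definition gate (l C t i : M) (f : M -> M) : M :=
  cond (leb (ln M (gate_raw C t i f)) l) (gate_raw C t i f) 0.

(** [gate] already replaces an entry longer than l bits by 0, so the cutoff built into [table] never
    alters an entry. *)
Lemma ev_ex : exists T : M -> M -> M -> M -> M -> M,
  Df false (fun r => T (r 0%N) (r 1%N) (r 2%N) (r 3%N) (r 4%N)) /\
  forall z l k C t, k <= ln M z -> l * k <= ln M z ->
    T z l k C t < ex (l * k) /\
    forall i, i < k -> rd l (T z l k C t) i = gate l C t i (fun u => rd l (T z l i C t) u).
Proof.
have Dst : Df false (fun r : nat -> M => gate (r 2%N) (r 3%N) (r 4%N) (r 0%N)
    (fun u => rd (r 2%N) (r 1%N) u)).
  rewrite /gate /gate_raw; have := Df_iadd; have := Df_imul => H1 H2; df.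
have [tab [Dt Ht]] := table Dst.
exists (fun z l k C t => tab z l k (env3 l C t)); split.
  apply: (Df_under Dt (E := fun r => ocons (r 0%N) (ocons (r 1%N) (ocons (r 2%N)
    (ocons (r 1%N) (ocons (r 3%N) (ocons (r 4%N) enil))))))); df.
move=> z l k C t Hk Hlk.
have [H0 H] := Ht z l (env3 l C t) k Hk Hlk.
split=> // i Hi; rewrite H //; env; apply: mn_l.
have B : l <= ln M z.
  by apply: (mle_trans (y := l * k)); split=> //; rewrite -{1}(ml1 l); apply: ml_mono; mlra.
have Em := mask_ex1 B; have Ll : lg l by apply: lg_le (ln_lg z) B.
rewrite /gate; move: (gate_raw _ _ _ _) => v.
case: (classic (ln M v <= l)) => L.
  by rewrite leb1 // cond1; move/(ln_ex _ Ll): L; mlra.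
by rewrite leb0 ?cond0; [apply: mle0|apply/mnot_le].
Qed.

Definition EV : M -> M -> M -> M -> M -> M. pick ev_ex. Defined.
Lemma EV_spec z l k C t : k <= ln M z -> l * k <= ln M z ->
  EV z l k C t < ex (l * k) /\
  forall i, i < k -> rd l (EV z l k C t) i = gate l C t i (fun u => rd l (EV z l i C t) u).
Proof. exact: (proj2 (proj2_sig (constructive_indefinite_description _ ev_ex))). Qed.
Lemma Df_EV b F1 F2 F3 F4 F5 : Df b F1 -> Df b F2 -> Df b F3 -> Df b F4 -> Df b F5 ->
  Df b (fun r => EV (F1 r) (F2 r) (F3 r) (F4 r) (F5 r)).
Proof.
move=> *; apply: (@Df_under M (fun r => EV (r 0%N) (r 1%N) (r 2%N) (r 3%N) (r 4%N)) b
  (fun r => ocons (F1 r) (ocons (F2 r) (ocons (F3 r) (ocons (F4 r) (ocons (F5 r) enil)))))).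
  exact: (proj1 (proj2_sig (constructive_indefinite_description _ ev_ex))).
df.
Qed.

End Circuits.
#[global] Opaque EV icode iadd imul ipos ineg.

(** * Evaluation of circuits and its agreement with the official traces *)

Section Evaluation.
Variable M : s12.
Local Open Scope M_scope.
Implicit Types x y z u v w c i j k l n o a t s q C : M.
Hint Resolve Df_iadd Df_imul Df_EV Df_ipos Df_ineg : pv.

(** Induction on i for the statement that all u < i satisfy [P]. The additional bound u <= |z| makes
    this quantifier sharply bounded and keeps the statement Sigma^b_1. *)
Lemma LCI (P : M -> Prop) n : Sg true (fun r => P (r 0%N)) -> lg n ->
  (forall i, i < n -> (forall u, u < i -> P u) -> P i) -> forall i, i < n -> P i.
Proof.
move=> D [z Ez] H.
suff Q : forall i, i <= n -> forall u, u <= ln M z -> u < i -> P u.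
  by move=> i Hi; apply: (Q n (mle_refl _)) => //; rewrite Ez; mlra.
apply: LIND_le; last 2 first.
- by move=> u _ L; exfalso; have := mle0 u; mlra.
- move=> i Hi IH u Hu L; case: (classic (u < i)) => [|N]; first exact: IH.
  have -> : u = i by mlra.
  by apply: H => // v Hv; apply: IH => //; rewrite Ez; mlra.
- apply: (@Sg_sall M true (fun=> z) (fun u r => u < r 0%N -> P u)); first df.
  apply: Sg_imp; first df.
  by apply: (@Sg_comp M true (fun r => P (r 0%N)) (fun r => (ocons (r 0%N) enil))) => //; df.
- by exists z.
Qed.

Lemma slp_gate C n o i : is_slp C n o -> i <= o ->
  [\/ exists2 j, j < n & ent C i = g_var j, exists c, ent C i = g_const c
    | exists u v, [/\ u < i, v < i & ent C i = g_add u v \/ ent C i = g_mul u v]].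
Proof.
move=> [S H] /H [g [/(entryP _ _ S)[_ ->]]].
case=> [[j [Hj E]]|[[c E]|[u [v [Hu [Hv E]]]]]].
- by constructor 1; exists j.
- by constructor 2; exists c.
- by constructor 3; exists u, v.
Qed.

Lemma neq_12 : (1 : M) <> 0 /\ (2 : M) <> 0 /\ (2 : M) <> 1 /\ (su M 2 : M) <> 0 /\
  (su M 2 : M) <> 1 /\ (su M 2 : M) <> 2.
Proof. by do !split; mlra. Qed.

Lemma g_inj : [/\ forall j j', g_var j = g_var j' ->
  j = j', forall c c', g_const c = g_const c' -> c = c',
  forall u v u' v', g_add u v = g_add u' v' -> u = u' /\ v = v' &
  forall u v u' v', g_mul u v = g_mul u' v' -> u = u' /\ v = v'].
Proof.
split; [by move=> j j' /pr_inj[]|by move=> c c' /pr_inj[]| |];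
  by move=> u v u' v' /pr_inj[_ /pr_inj].
Qed.

Lemma g_neq : [/\ forall j c, g_var j <> g_const c, forall j u v,
  g_var j <> g_add u v /\ g_var j <> g_mul u v,
  forall c u v, g_const c <> g_add u v /\ g_const c <> g_mul u v &
  forall u v u' v', g_add u v <> g_mul u' v'].
Proof.
have [N1 [N2 [N3 [N4 [N5 N6]]]]] := neq_12.
split.
- by move=> j c /pr_inj[/esym].
- by move=> j u v; split=> /pr_inj[/esym].
- by move=> j u v; split=> /pr_inj[/esym].
- by move=> u v u' v' /pr_inj[/esym].
Qed.

Lemma monus_S x : monus (x + 1) 1 = x.
Proof. exact: monusE. Qed.

Lemma mul_neq0 x y : x * y <> 0 <-> x <> 0 /\ y <> 0.
Proof.
split=> [N|[Nx Ny] /ml_eq0[]//]; split=> E; apply: N; rewrite E ?ml0 //.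
by rewrite ml_comm ml0.
Qed.

Lemma monus1K x : x <> 0 -> su M (monus x 1) = x.
Proof. by move/neq0 => H; have := monusK H; mlra. Qed.

Section Table.
Variables (z l C n o t : M).
Hypotheses (slp : is_slp C n o) (Hz : l * su M o <= ln M z) (Hl : 1 <= l).

Lemma size_o : su M o <= ln M z.
Proof.
apply: (mle_trans (y := l * su M o)); split=> //.
by rewrite ml_comm -{1}(ml1 (su M o)); apply: ml_mono.
Qed.
Lemma lg_o : lg (su M o). Proof. exact: lg_le (ln_lg z) size_o. Qed.
Lemma lg_lo : lg (l * su M o). Proof. exact: lg_le (ln_lg z) Hz. Qed.
Lemma lg_l : lg l.
Proof. by apply: (lg_blockl (k := su M o) (i := 0)); [apply: lg_lo|have := mle0 o; mlra]. Qed.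

Definition ev i : M := rd l (EV z l (su M o) C t) i.
Definition cap v : M := cond (leb (ln M v) l) v 0.

(** In a course-of-values recursion the table for the first i gates is a prefix of the full one. *)
Lemma ev_step i u : i <= o -> u < i -> rd l (EV z l i C t) u = ev u.
Proof.
move=> Hi Hu; have Ho := size_o.
rewrite /ev (proj2 (EV_spec C t Ho Hz)); last by mlra.
apply: (proj2 (EV_spec C t _ _)) => //; first by mlra.
by apply: (mle_trans (y := l * su M o)); split=> //; apply: ml_mono; mlra.
Qed.

Lemma ev_gate i : i <= o ->
  exists2 f, ev i = gate l C t i f & forall u, u < i -> f u = ev u.
Proof.
move=> Hi; exists (fun u => rd l (EV z l i C t) u); last by move=> u; apply: ev_step.
by rewrite /ev (proj2 (EV_spec C t size_o Hz)) //; mlra.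
Qed.

Lemma ev_var i j : i <= o -> ent C i = g_var j -> ev i = cap (ent t j + 1).
Proof.
move=> /ev_gate[f -> _] E; rewrite /gate /gate_raw E /g_var p1_pr p2_pr.
by rewrite eqt1 !cond1.
Qed.
Lemma ev_const i c : i <= o -> ent C i = g_const c -> ev i = cap (c + 1).
Proof.
move=> /ev_gate[f -> _] E; rewrite /gate /gate_raw E /g_const p1_pr p2_pr.
have [H _] := neq_12.
by rewrite (eqt0 H) cond0 eqt1 !cond1.
Qed.
Lemma cap0 : cap 0 = 0.
Proof. by rewrite /cap ln0 leb1 ?cond1 //; apply: mle0. Qed.
Lemma ev_add i u v : i <= o -> u < i -> v < i -> ent C i = g_add u v ->
  ev i = cond (ev u * ev v) (cap (iadd (monus (ev u) 1) (monus (ev v) 1) + 1)) 0.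
Proof.
move=> /ev_gate[f -> Hf] Hu Hv E; rewrite /gate /gate_raw E /g_add !(p1_pr, p2_pr).
have [_ [H1 [H2 _]]] := neq_12.
rewrite (eqt0 H1) (eqt0 H2) !cond0 eqt1 !cond1 !Hf // -/(cap _).
case: (classic (ev u * ev v = 0)) => [->|N]; first by rewrite !cond0 cap0.
by rewrite !condN.
Qed.
Lemma ev_mul i u v : i <= o -> u < i -> v < i -> ent C i = g_mul u v ->
  ev i = cond (ev u * ev v) (cap (imul (monus (ev u) 1) (monus (ev v) 1) + 1)) 0.
Proof.
move=> /ev_gate[f -> Hf] Hu Hv E; rewrite /gate /gate_raw E /g_mul !(p1_pr, p2_pr).
have [_ [_ [_ [H1 [H2 H3]]]]] := neq_12.
rewrite (eqt0 H1) (eqt0 H2) (eqt0 H3) !cond0 !Hf // -/(cap _).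
case: (classic (ev u * ev v = 0)) => [->|N]; first by rewrite !cond0 cap0.
by rewrite !condN.
Qed.

Lemma cap_neq0 v : cap v <> 0 -> cap v = v.
Proof.
rewrite /cap; case: (classic (ln M v <= l)) => L; first by rewrite leb1 // cond1.
by rewrite leb0 ?cond0 //; apply/mnot_le.
Qed.
Lemma cap_small v : ln M v <= l -> cap v = v.
Proof. by move=> L; rewrite /cap leb1 // cond1. Qed.

Definition val i : ZM M := ival (monus (ev i) 1).

Lemma ev_cases i : i <= o -> ev i <> 0 ->
  [\/ exists2 j, j < n & ent C i = g_var j /\ ev i = ent t j + 1,
    exists2 c, ent C i = g_const c & ev i = c + 1
  | exists u v, [/\ u < i, v < i, ev u <> 0, ev v <> 0 &
     (ent C i = g_add u v /\ val i = (val u + val v)%R) \/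
     (ent C i = g_mul u v /\ val i = (val u * val v)%R)]].
Proof.
move=> Hi; case: (slp_gate slp Hi) => [[j Hj E]|[c E]|[u [v [Hu Hv E]]]].
- rewrite (ev_var Hi E) => N; constructor 1; exists j => //.
  by rewrite cap_neq0.
- rewrite (ev_const Hi E) => N; constructor 2; exists c => //.
  by rewrite cap_neq0.
- move=> N; constructor 3; exists u, v; case: E => E.
  + have En := ev_add Hi Hu Hv E.
    have /mul_neq0[Nu Nv] : ev u * ev v <> 0 by move=> Z; apply: N; rewrite En Z cond0.
    split=> //; left; split=> //; rewrite /val En condN; last by apply/mul_neq0.
    rewrite En condN in N; last by apply/mul_neq0.
    by rewrite cap_neq0 // monus_S ival_add.
  + have En := ev_mul Hi Hu Hv E.
    have /mul_neq0[Nu Nv] : ev u * ev v <> 0 by move=> Z; apply: N; rewrite En Z cond0.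
    split=> //; right; split=> //; rewrite /val En condN; last by apply/mul_neq0.
    rewrite En condN in N; last by apply/mul_neq0.
    by rewrite cap_neq0 // monus_S ival_mul.
Qed.

Definition ev_seq : M := pr l (EV z l (su M o) C t + ex (l * su M o)).
Lemma ev_seqP : isseq ev_seq (su M o) /\ forall i, i < su M o -> ent ev_seq i = ev i.
Proof.
apply: isseq_mk => //; first exact: lg_lo.
exact: (proj1 (EV_spec C t size_o Hz)).
Qed.

Hypothesis (St : isseq t n).

Lemma ev_trace : eval_trace C o t ev_seq.
Proof.
have [S1 S2] := ev_seqP; split=> // i x [Hi /(entryP _ _ S1)[Hi' Ei]].
rewrite S2 // in Ei; have N : ev i <> 0 by rewrite -Ei; apply: su_neq0.
have Ex : monus (ev i) 1 = x by rewrite -Ei su_ad monus_S.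
have SC := proj1 slp.
exists (ent C i); split; first by apply/(entryP _ _ SC).
case: (ev_cases Hi N) => [[j Hj [E E']]|[c E E']|[u [v [Hu Hv Nu Nv E]]]].
- left; exists j; split=> //; apply/(entryP _ _ St); split=> //.
  by rewrite -Ex E' monus_S.
- by right; left; rewrite E -Ex E' monus_S.
- right; right; exists u, v, (monus (ev u) 1), (monus (ev v) 1).
  rewrite !monus1K //; do !split.
  + by apply/(entryP _ _ S1); split; [mlra|rewrite S2 //; mlra].
  + by apply/(entryP _ _ S1); split; [mlra|rewrite S2 //; mlra].
  + case: E => -[E E']; [left|right]; split=> //.
    * by apply/int_addP; rewrite -Ex.
    * by apply/int_mulP; rewrite -Ex.
Qed.

Lemma ev_eval_nonzero : ev o <> 0 -> val o <> 0%R -> eval_nonzero C t.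
Proof.
move=> N Nv; have [S1 S2] := ev_seqP.
exists o, ev_seq, (monus (ev o) 1); do !split=> //.
- exact: (proj1 slp).
- exact: (proj2 ev_trace).
- by rewrite monus1K //; apply/(entryP _ _ S1); rewrite S2; mlra.
- exact/int_nonzeroP.
Qed.

Lemma ival_eqP x y : ival x = ival y <-> ipos x + ineg y = ipos y + ineg x.
Proof.
rewrite /ival; split=> [E|/eqE]; first by apply/eqE; rewrite !injD; lra.
by rewrite !injD => E; lra.
Qed.

Lemma Df_ev F : Df true F -> Df true (fun r => ev (F r)).
Proof. by rewrite /ev => H; df. Qed.
Hint Resolve Df_ev : pv.

Lemma slp_args i u v : i <= o -> ent C i = g_add u v \/ ent C i = g_mul u v -> u < i /\ v < i.
Proof.
have [N1 [N2 [N3 [N4 [N5 N6]]]]] := neq_12.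
move=> Hi E; case: (slp_gate slp Hi) => [[j _ E']|[c E']|[u' [v' [Hu' Hv' E']]]].
- by exfalso; rewrite E' in E; case: E => /pr_inj[E _]; [apply: N2|apply: N4].
- by exfalso; rewrite E' in E; case: E => /pr_inj[E _]; [apply: N3|apply: N5].
- suff [-> ->] : u = u' /\ v = v' by [].
  case: E' E => -> [] /pr_inj[E1 E2].
  + by have [-> ->] := pr_inj E2.
  + by case: N6.
  + by case: N6.
  + by have [-> ->] := pr_inj E2.
Qed.

Definition tval tr i : ZM M := ival (monus (ent tr i) 1).

Section Agreement.
Variable tr : M.
Hypothesis (Htr : eval_trace C o t tr).

Lemma trace_cases i : i <= o -> ent tr i <> 0 ->
  [\/ exists2 j, j < n & ent C i = g_var j /\ ent tr i = ent t j + 1,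
    exists2 c, ent C i = g_const c & ent tr i = c + 1
  | exists u v, [/\ u < i, v < i, ent tr u <> 0, ent tr v <> 0 &
     (ent C i = g_add u v /\ tval tr i = (tval tr u + tval tr v)%R) \/
     (ent C i = g_mul u v /\ tval tr i = (tval tr u * tval tr v)%R)]].
Proof.
move=> Hi N; case: Htr => S H.
have Ei := monus1K N.
have [|g [/(entryP _ _ (proj1 slp))[_ ->] K]] := H i (monus (ent tr i) 1).
  by split=> //; apply/(entryP _ _ S); split; [mlra|].
case: K => [[j [E /(entryP _ _ St)[Hj Ej]]]|[E|[u [v [x [y [/(entryP _ _ S)[Hu Eu] [/(entryP _ _
  S)[Hv Ev] E]]]]]]]].
- by constructor 1; exists j => //; split=> //; rewrite -Ej -su_ad.
- by constructor 2; exists (monus (ent tr i) 1) => //; rewrite -su_ad.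
- constructor 3; exists u, v.
  have [Lu Lv] : u < i /\ v < i by apply: slp_args => //; tauto.
  have Tu : tval tr u = ival x by rewrite /tval -Eu su_ad monus_S.
  have Tv : tval tr v = ival y by rewrite /tval -Ev su_ad monus_S.
  split=> //; try (by rewrite -?Eu -?Ev; apply: su_neq0).
  rewrite Tu Tv; case: E => -[E E']; [left|right]; split=> //; symmetry.
  + exact/int_addP.
  + exact/int_mulP.
Qed.

(** A trace determines integers and not their codes, zero having two of them, so the values are
    compared. Either side may leave a gate uncomputed; hence the claim is restricted to gates
    computed by both. *)
Lemma agree i : i <= o -> ent tr i <> 0 -> ev i <> 0 -> tval tr i = val i.
Proof.
move=> Hi.
apply: (LCI (P := fun i => ent tr i <> 0 -> ev i <> 0 ->
  ival (monus (ent tr i) 1) = ival (monus (ev i) 1))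
  (n := su M o)); last by mlra.
(* An equation between integers is not in the language of the model; the equation between positive
   and negative parts says the same and is. *)
- apply: (@Sg_ext M true (fun r => ent tr (r 0%N) <> 0 -> ev (r 0%N) <> 0 ->
    ipos (monus (ent tr (r 0%N)) 1) + ineg (monus (ev (r 0%N)) 1) =
    ipos (monus (ev (r 0%N)) 1) + ineg (monus (ent tr (r 0%N)) 1))).
    by move=> r; rewrite ival_eqP.
  df.
- exact: lg_o.
move=> {Hi} {}i Hi IH Nt Ne; have Hi' : i <= o by mlra.
have [I1 I2 I3 I4] := g_inj; have [N1 N2 N3 N4] := g_neq.
have [d1 d2] : (forall u v j, g_add u v <> g_var j /\ g_mul u v <> g_var j) /\
   (forall u v c, g_add u v <> g_const c /\ g_mul u v <> g_const c).
  by split=> u v w; split=> /esym; [apply: (proj1 (N2 _ _ _))|apply: (proj2 (N2 _ _ _))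
    |apply: (proj1 (N3 _ _ _))|apply: (proj2 (N3 _ _ _))].
case: (trace_cases Hi' Nt) => [[j Hj [E ->]]|[c E ->]|[u [v [Hu Hv Nu Nv E]]]];
case: (ev_cases Hi' Ne) => [[j' Hj' [E' ->]]|[c' E' ->]|[u' [v' [Hu' Hv' Nu' Nv' E']]]].
- by rewrite !monus_S; move: E'; rewrite E => /I1 ->.
- by case: (N1 j c'); rewrite -E -E'.
- by exfalso; case: E' => -[E' _]; [case: (N2 j u' v') => K _|case: (N2 j u' v') => _ K];
  apply: K; rewrite -E -E'.
- by case: (N1 j' c); rewrite -E -E'.
- by rewrite !monus_S; move: E'; rewrite E => /I2 ->.
- by exfalso; case: E' => -[E' _]; [case: (N3 c u' v') => K _|case: (N3 c u' v') => _ K];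
  apply: K; rewrite -E -E'.
- by exfalso; case: E => -[E _]; [case: (N2 j' u v) => K _|case: (N2 j' u v) => _ K]; apply: K;
  rewrite -E -E'.
- by exfalso; case: E => -[E _]; [case: (N3 c' u v) => K _|case: (N3 c' u v) => _ K]; apply: K;
  rewrite -E -E'.
- rewrite -/(tval tr i) -/(val i).
  have IHu := IH u Hu Nu; have IHv := IH v Hv Nv.
  case: E E' => -[E ->] [] [E' ->].
  + have [Eu Ev] : u' = u /\ v' = v by apply: I3; rewrite -E -E'.
    by rewrite Eu Ev in Nu' Nv' *; rewrite /tval /val IHu // IHv.
  + by case: (N4 u v u' v'); rewrite -E -E'.
  + by case: (N4 u' v' u v); rewrite -E -E'.
  + have [Eu Ev] : u' = u /\ v' = v by apply: I4; rewrite -E -E'.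
    by rewrite Eu Ev in Nu' Nv' *; rewrite /tval /val IHu // IHv.
Qed.

End Agreement.

Lemma eval_nonzeroP : ev o <> 0 -> (eval_nonzero C t <-> val o <> 0%R).
Proof.
move=> N; split; last exact: ev_eval_nonzero.
move=> [o' [tr [x [S [Htr [/(entryP _ _ (proj1 Htr))[_ Eo] /int_nonzeroP Nx]]]]]].
(* The code C fixes l and w, and |w| = (o + 1) l + 1 then fixes the output gate o. *)
have Eo' : o' = o.
  have [l1 [w1 [L1 [E1 K1]]]] := S; have [l2 [w2 [L2 [E2 K2]]]] := proj1 slp.
  move: E2; rewrite E1 => /pr_inj[El Ew]; rewrite -El -Ew K1 in K2.
  have K3 := su_inj K2; rewrite !(ml_comm _ l1) in K3.
  by apply: su_inj; apply: (ml_cancel (x := l1)) => //; apply/neq0.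
rewrite Eo' in Htr Eo.
rewrite -(agree Htr (mle_refl o)) //; first by rewrite /tval -Eo su_ad monus_S.
by rewrite -Eo; apply: su_neq0.
Qed.

End Table.
Lemma Df_evg b Fz Fl FC Fo Ft Fi : Df b Fz -> Df b Fl -> Df b FC -> Df b Fo -> Df b Ft -> Df b Fi ->
  Df b (fun r : nat -> M => ev (Fz r) (Fl r) (FC r) (Fo r) (Ft r) (Fi r)).
Proof. by rewrite /ev => *; df. Qed.

End Evaluation.
#[global] Opaque ev cap gate gate_raw.

Section Bounds.
Variable M : s12.
Local Open Scope M_scope.
Implicit Types x y z u v w c i j k l n o a t s q C : M.
Hint Resolve Df_iadd Df_imul Df_EV Df_ipos Df_ineg Df_evg Df_mx : pv.

(** ** Congruence of sign-magnitude codes *)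

Definition ceq (N a b : M) : Prop := md (ipos a + ineg b) N = md (ipos b + ineg a) N.

Lemma md_eqP N x y : N <> 0 -> (md x N = md y N <-> exists k : ZM M, (inj x - inj y = inj N * k)%R).
Proof.
move=> HN; have [Ex Lx] := dv_md x HN; have [Ey Ly] := dv_md y HN; split.
- move=> E; exists (inj (dv x N) - inj (dv y N))%R.
  rewrite E in Ex; move/eqE: Ex; move/eqE: Ey; rewrite !(injD, injM) => -> ->; ring.
- have half a b k' : (inj a - inj b = inj N * inj k')%R -> md a N = md b N.
    move=> E; have [Eb Lb] := dv_md b HN.
    apply: (proj2 (dv_unique (q := dv b N + k') _ Lb)).
    by apply/eqE; move/eqE: Eb; rewrite !(injD, injM) => Eb; lra.
  move=> [k]; have [/zge0P[k' ->]|K] := lerP 0%R k; first exact: half.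
  have [k' Ek] : exists k', (- k = inj k')%R by apply: zge0P; lra.
  by move=> E; symmetry; apply: (half _ _ k'); rewrite -Ek; lra.
Qed.

Lemma ceqP N a b : N <> 0 -> (ceq N a b <-> exists k : ZM M, (ival a - ival b = inj N * k)%R).
Proof.
move=> HN; rewrite /ceq md_eqP // /ival !injD.
by split=> -[k E]; exists k; rewrite -E; ring.
Qed.

(** * Congruence and size of the values of a circuit *)

Section Circuit.
Variables (z l C n o : M).
Hypotheses (slp : is_slp C n o) (Hz : l * su M o <= ln M z) (Hl : 1 <= l).
Local Notation ev := (ev z l C o).
Local Notation val := (val z l C o).

Lemma ev_ext t t' : (forall j, j < n -> ent t j = ent t' j) ->
  forall i, i < su M o -> ev t i = ev t' i.
Proof.
move=> E; apply: LCI; [df|exact: lg_o Hz Hl|].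
move=> i Hi IH; have Hi' : i <= o by mlra.
case: (slp_gate slp Hi') => [[j Hj G]|[c G]|[u [v [Hu Hv [G|G]]]]].
- by rewrite !(ev_var _ Hz Hl Hi' G) E.
- by rewrite !(ev_const _ Hz Hl Hi' G).
- by rewrite !(ev_add _ Hz Hl Hi' Hu Hv G) // !IH.
- by rewrite !(ev_mul _ Hz Hl Hi' Hu Hv G) // !IH.
Qed.

(** Sums and products preserve congruence. The induction is carried out for equality of remainders
    ([ceq]), an open formula, whereas the quotient k ranges over integers without a bound. *)
Lemma ev_congr N t t' : N <> 0 -> (forall j, j < n -> ceq N (ent t j) (ent t' j)) ->
  forall i, i < su M o -> ev t i <> 0 -> ev t' i <> 0 ->
  exists k : ZM M, (val t i - val t' i = inj N * k)%R.
Proof.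
move=> HN E i Hi; rewrite /val -ceqP //; move: i Hi.
apply: LCI; [rewrite /ceq; df|exact: lg_o Hz Hl|].
move=> i Hi IH; have Hi' : i <= o by mlra.
have {}IH u : u < i -> ev t u <> 0 -> ev t' u <> 0 ->
  exists k : ZM M, (val t u - val t' u = inj N * k)%R.
  by move=> Hu N1 N2; have := IH u Hu N1 N2; rewrite ceqP.
rewrite ceqP //.
have [I1 I2 I3 I4] := g_inj M; have [N1 N2 N3 N4] := g_neq M.
case: (slp_gate slp Hi') => [[j Hj G]|[c G]|[u [v [Hu Hv G]]]].
- rewrite !(ev_var _ Hz Hl Hi' G) // => K K'; rewrite (cap_neq0 K) (cap_neq0 K') !monus_S.
  by apply/(ceqP _ _ HN); apply: E.
- rewrite !(ev_const _ Hz Hl Hi' G) // => K K'; exists 0%R; ring.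
- move=> K K'; rewrite -!/(val _ _).
  case: (ev_cases slp Hz Hl Hi' K) => [[j _ [E1 _]]|[c E1 _]|[u1 [v1 [Hu1 Hv1 Nu1 Nv1 E1]]]].
  + by case: G => G; [case: (N2 j u v) => H _|case: (N2 j u v) => _ H]; case: H; rewrite -E1.
  + by case: G => G; [case: (N3 c u v) => H _|case: (N3 c u v) => _ H]; case: H; rewrite -E1.
  case: (ev_cases slp Hz Hl Hi' K') => [[j _ [E2 _]]|[c E2 _]|[u2 [v2 [Hu2 Hv2 Nu2 Nv2 E2]]]].
  + by case: G => G; [case: (N2 j u v) => H _|case: (N2 j u v) => _ H]; case: H; rewrite -E2.
  + by case: G => G; [case: (N3 c u v) => H _|case: (N3 c u v) => _ H]; case: H; rewrite -E2.
  case: E1 E2 => -[G1 ->] [] [G2 ->].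
  + have [Eu Ev] : u2 = u1 /\ v2 = v1 by apply: I3; rewrite -G1 -G2.
    rewrite Eu Ev in Nu2 Nv2 *.
    have [ku Eku] := IH _ Hu1 Nu1 Nu2; have [kv Ekv] := IH _ Hv1 Nv1 Nv2.
    by exists (ku + kv)%R; move: Eku Ekv => Eku Ekv; rewrite mulrDr -Eku -Ekv; ring.
  + by case: (N4 u1 v1 u2 v2); rewrite -G1 -G2.
  + by case: (N4 u2 v2 u1 v1); rewrite -G1 -G2.
  + have [Eu Ev] : u2 = u1 /\ v2 = v1 by apply: I4; rewrite -G1 -G2.
    rewrite Eu Ev in Nu2 Nv2 *.
    have [ku Eku] := IH _ Hu1 Nu1 Nu2; have [kv Ekv] := IH _ Hv1 Nv1 Nv2.
    exists (ku * val t v1 + val t' u1 * kv)%R.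
    have -> : (inj N * (ku * val t v1 + val t' u1 * kv) =
      (inj N * ku) * val t v1 + val t' u1 * (inj N * kv))%R by ring.
    by rewrite -Eku -Ekv; ring.
Qed.

(** [W] behaves like a degree along the gates. *)
Definition supra (W : M -> M) : Prop := forall i u v, i <= o ->
  (ent C i = g_add u v -> W u <= W i /\ W v <= W i) /\ (ent C i = g_mul u v -> W u + W v <= W i).

(** From hf c <= 2^X follows c + 1 <= 2^(X + 1) + 2 < 2^(X + 3): one bit for the sign, the rest for
    the successor that marks a computed entry. *)
Lemma cap_code X c : lg X -> X + su M 2 <= l -> hf M c <= ex X -> cap l (c + 1) = c + 1.
Proof.
move=> HX L Hc; apply: cap_small.
have H3 : lg (X + 1 + 1 + 1) by do 3 apply: lgS.
apply: (mle_trans (y := X + 1 + 1 + 1)); split; last by mlra.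
apply/(ln_ex _ H3); rewrite !exS //; try (by do ?apply: lgS).
by have [_ B] := hf_bounds c; have := ex_ge1 HX; mlra.
Qed.

(** The value of gate i is at most 2^(b e_i + W_i (A + i)), where [e] is the degree in the one
    variable that may be as large as 2^(b + A) and [W] a total degree; constants and the other
    variables are at most 2^A. In a product the exponents add up, as do [e] and [W]. A sum needs one
    further bit, which the increase of the index pays for. As [W] does not decrease along the gates,
    W_i <= w holds for every gate feeding an output of weight at most w. *)
Lemma value_size (W e : M -> M) b A w t :
  Df true (fun r => W (r 0%N)) -> Df true (fun r => e (r 0%N)) -> supra W -> supra e ->
  (forall i, i <= o -> 1 <= W i /\ e i <= W i) ->
  (forall i j, i <= o -> W i <= w -> j < n -> ent C i = g_var j ->
    hf M (ent t j) <= ex (b * e i + A)) ->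
  (forall i c, i <= o -> ent C i = g_const c -> hf M c <= ex A) ->
  b * w + w * (A + o) + su M 2 <= l ->
  forall i, i < su M o -> W i <= w ->
    ev t i <> 0 /\ hf M (monus (ev t i) 1) <= ex (b * e i + W i * (A + i)).
Proof.
move=> DW De SW Se HW Hvar Hconst HL.
have Dw F : Df true F -> Df true (fun r => W (F r)).
  by move=> H; apply: Df1_true.
have Dee F : Df true F -> Df true (fun r => e (F r)).
  by move=> H; apply: Df1_true.
have Ll : lg l by exact: (lg_l Hz Hl).
have lz : l <= ln M z.
  by apply: (mle_trans (y := l * su M o)); split=> //; rewrite -{1}(ml1 l); apply: ml_mono;
    have := mle0 o; mlra.
have expo i : i <= o -> W i <= w -> b * e i + W i * (A + i) + su M 2 <= l.
  move=> Hi HWi; have [_ He] := HW i Hi.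
  have H1 : b * e i <= b * w by apply: ml_mono; mlra.
  have H2 : W i * (A + i) <= w * (A + o) by apply: ml_le2 => //; mlra.
  by mlra.
have lgX i : i <= o -> W i <= w -> lg (b * e i + W i * (A + i)).
  by move=> Hi HWi; apply: (lg_le Ll); have := expo i Hi HWi; mlra.
(* For the induction the exponential is replaced by its computable form [bz z]; the exponents stay
   below l <= |z|, where the two agree. *)
suff K : forall i, i < su M o -> W i <= w ->
    ev t i <> 0 /\ hf M (monus (ev t i) 1) <= bz z (b * e i + W i * (A + i)).
  move=> i Hi HWi; have [K1 K2] := K i Hi HWi; split=> //.
  rewrite bzE in K2 => //; have := expo i ltac:(mlra) HWi; mlra.
apply: LCI; [df|exact: lg_o Hz Hl|].
move=> i Hi IH HWi; have Hi' : i <= o by mlra.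
have HX := lgX i Hi' HWi; have HE := expo i Hi' HWi.
have [W1 eW] := HW i Hi'.
rewrite bzE; last by mlra.
have {}IH u : u < i -> W u <= W i ->
  ev t u <> 0 /\ hf M (monus (ev t u) 1) <= ex (b * e u + W u * (A + u)).
  move=> Hu HWu; have [] := IH u Hu ltac:(mlra); split=> //.
  have Eu := expo u ltac:(clear -Hu Hi; mlra) ltac:(clear -HWu HWi; mlra).
  by rewrite bzE in b0 => //; clear -Eu lz; mlra.
have leaf c : hf M c <= ex (b * e i + A) -> cap l (c + 1) <> 0 /\
    hf M (monus (cap l (c + 1)) 1) <= ex (b * e i + W i * (A + i)).
  move=> Hc.
  have Hc' : hf M c <= ex (b * e i + W i * (A + i)).
    apply: (mle_trans (y := ex (b * e i + A))); split=> //; apply: ex_mono => //.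
    have : 1 * A <= W i * (A + i) by apply: ml_le2 => //; mlra.
    mlra.
  by rewrite (cap_code HX) // monus_S; split=> //; mlra.
(* Since u < i and W_i >= 1, the exponent grows by at least 1 from u to i, enough for the carry of
   an addition. *)
have key u : u < i -> W u <= W i -> e u <= e i ->
    b * e u + W u * (A + u) + 1 <= b * e i + W i * (A + i).
  move=> Hu HWu Heu.
  have H1 : b * e u <= b * e i by apply: ml_mono.
  have H2 : W u * (A + u) <= W i * (A + u) by apply: ml_le2 => //; apply: mle_refl.
  have H3 : W i * (A + u + 1) <= W i * (A + i) by apply: ml_mono; clear -Hu; mlra.
  by clear -H1 H2 H3 W1; mlra.
case: (slp_gate slp Hi') => [[j Hj G]|[c G]|[u [v [Hu Hv [G|G]]]]].
- by rewrite (ev_var _ Hz Hl Hi' G) //; apply: leaf; apply: (Hvar i j Hi' HWi Hj G).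
- rewrite (ev_const _ Hz Hl Hi' G) //; apply: leaf.
  have Hc := Hconst i c Hi' G; apply: (mle_trans (y := ex A)); split=> //.
  apply: ex_mono; last by have := mle0 (b * e i); mlra.
  apply: (lg_le HX); have := mle0 (b * e i);
    have : 1 * A <= W i * (A + i) by apply: ml_le2 => //; mlra.
  by mlra.
- have [W1u W1v] := proj1 (SW i u v Hi') G; have [e1u e1v] := proj1 (Se i u v Hi') G.
  have [Nu Bu] := IH u Hu W1u; have [Nv Bv] := IH v Hv W1v.
  have Ku := key u Hu W1u e1u; have Kv := key v Hv W1v e1v.
  have B : hf M (iadd (monus (ev t u) 1) (monus (ev t v) 1)) <= ex (b * e i + W i * (A + i)).
    apply/leE; rewrite -ival_norm ival_add.
    apply: (le_trans (ler_normD _ _)); rewrite !ival_norm -injD -leE.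
    have Lu := ex_mono HX Ku; have Lv := ex_mono HX Kv.
    have Iu : lg (b * e u + W u * (A + u)) by apply: (lg_le HX); clear -Ku; mlra.
    have Iv : lg (b * e v + W v * (A + v)) by apply: (lg_le HX); clear -Kv; mlra.
    rewrite exS // in Lu; rewrite exS // in Lv; clear -Lu Lv Bu Bv; mlra.
  rewrite (ev_add _ Hz Hl Hi' Hu Hv G) // condN; last by apply/mul_neq0.
  rewrite (cap_code HX) // monus_S.
  by split=> //; clra.
- have Wm := proj2 (SW i u v Hi') G; have em := proj2 (Se i u v Hi') G.
  have [wu wv] : W u <= W i /\ W v <= W i by clear -Wm; mlra.
  have [eu ev'] : e u <= e i /\ e v <= e i by clear -em; mlra.
  have [Nu Bu] := IH u Hu wu; have [Nv Bv] := IH v Hv wv.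
  have Ku := key u Hu wu eu; have Kv := key v Hv wv ev'.
  have B : hf M (imul (monus (ev t u) 1) (monus (ev t v) 1)) <= ex (b * e i + W i * (A + i)).
    apply/leE; rewrite -ival_norm ival_mul normrM !ival_norm -injM -leE.
    apply: (mle_trans (y := ex (b * e u + W u * (A + u) + (b * e v + W v * (A + v))))); split.
      by rewrite exD; [apply: ml_le2|apply: (lg_le HX); clear -Ku; mlra|apply: (lg_le HX);
        clear -Kv; mlra].
    apply: ex_mono => //.
    have H1 : W u * (A + u) <= W u * (A + i) by apply: ml_mono; clear -Hu; mlra.
    have H2 : W v * (A + v) <= W v * (A + i) by apply: ml_mono; clear -Hv; mlra.
    have H3 : b * (e u + e v) <= b * e i by apply: ml_mono.
    have H4 : (W u + W v) * (A + i) <= W i * (A + i) by apply: ml_le2 => //; apply: mle_refl.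
    by clear -H1 H2 H3 H4; mlra.
  rewrite (ev_mul _ Hz Hl Hi' Hu Hv G) // condN; last by apply/mul_neq0.
  rewrite (cap_code HX) // monus_S.
  by split=> //; clra.
Qed.

End Circuit.
End Bounds.

(** * Syntactic degrees and the total weight of a gate *)

Section Degrees.
Variable M : s12.
Local Open Scope M_scope.
Implicit Types x y z u v w c i j k l n o a t s q C d J D : M.
Hint Resolve Df_iadd Df_imul Df_EV Df_ipos Df_ineg Df_evg Df_mx : pv.

(** Degree with respect to the sources of key less than [J]; variable [j] has key [j] and
    the constant at gate [i] has key [n + i]. *)
Definition tdeg C n J i (f : M -> M) : M :=
  cond (eqt (p1 (ent C i)) 0) (leb (p2 (ent C i) + 1) J)
   (cond (eqt (p1 (ent C i)) 1) (leb (n + i + 1) J)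
     (cond (eqt (p1 (ent C i)) 2) (mx (f (p1 (p2 (ent C i)))) (f (p2 (p2 (ent C i)))))
        (f (p1 (p2 (ent C i))) + f (p2 (p2 (ent C i)))))).

Lemma td_ex : exists T : M -> M -> M -> M -> M -> M -> M,
  Df false (fun r => T (r 0%N) (r 1%N) (r 2%N) (r 3%N) (r 4%N) (r 5%N)) /\
  forall z l k C n J, k <= ln M z -> l * k <= ln M z ->
    forall i, i < k -> rd l (T z l k C n J) i =
      mn (tdeg C n J i (fun u => rd l (T z l i C n J) u)) (mask z l).
Proof.
have Dst : Df false (fun r : nat -> M => tdeg (r 3%N) (r 4%N) (r 5%N) (r 0%N)
    (fun u => rd (r 2%N) (r 1%N) u)) by rewrite /tdeg; df.
have [tab [Dt Ht]] := table Dst.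
exists (fun z l k C n J => tab z l k (ocons l (ocons C (ocons n (ocons J enil))))); split.
  apply: (Df_under Dt (E := fun r => ocons (r 0%N) (ocons (r 1%N) (ocons (r 2%N)
    (ocons (r 1%N) (ocons (r 3%N) (ocons (r 4%N) (ocons (r 5%N) enil)))))))); df.
move=> z l k C n J Hk Hlk i Hi.
have [_ H] := Ht z l (ocons l (ocons C (ocons n (ocons J enil)))) k Hk Hlk.
exact: H.
Qed.

Section Weights.
Variables (C n o : M).
Hypotheses (slp : is_slp C n o).

Lemma slp_lg : lg o.
Proof. by apply: (lg_le (isseq_lg (proj1 slp))); mlra. Qed.

Lemma tdeg_eqs J f :
  [/\ forall i j, ent C i = g_var j -> tdeg C n J i f = leb (j + 1) J,
      forall i c, ent C i = g_const c -> tdeg C n J i f = leb (n + i + 1) J,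
      forall i u v, ent C i = g_add u v -> tdeg C n J i f = mx (f u) (f v)
    & forall i u v, ent C i = g_mul u v -> tdeg C n J i f = f u + f v].
Proof.
have [N1 [N2 [N3 [N4 [N5 N6]]]]] := neq_12 M.
by split=> [i j|i c|i u v|i u v] E;
  rewrite /tdeg E /g_var /g_const /g_add /g_mul !(p1_pr, p2_pr) ?eqt1 ?(eqt0 N1) ?(eqt0 N2)
    ?(eqt0 N3) ?(eqt0 N4) ?(eqt0 N5) ?(eqt0 N6) ?cond0 ?cond1.
Qed.

Lemma leb_le1 x y : leb x y <= 1.
Proof.
case: (classic (x <= y)) => L; first by rewrite leb1 //; apply: mle_refl.
by rewrite leb0; [apply: mle0|apply/mnot_le].
Qed.

Lemma weights_ex : exists W : M -> M -> M,
  (forall F G, Df true F -> Df true G -> Df true (fun r => W (F r) (G r))) /\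
  forall J i, i <= o -> W J i = tdeg C n J i (W J).
Proof.
have [T [DT HT]] := td_ex.
have [z Ez] : lg ((o + 2) * su M o).
  by apply: lgM; [rewrite two -ad_assoc|rewrite su_ad]; repeat apply: lgS; exact: slp_lg.
(* The degree at gate i is at most 2^i, since a product at most doubles the largest earlier degree;
   blocks of o + 2 bits are never truncated. *)
pose l := o + 2.
have Hlo : l * su M o <= ln M z by rewrite Ez; apply: mle_refl.
have lz : l <= ln M z.
  by apply: (mle_trans (y := l * su M o)); split=> //; rewrite -{1}(ml1 l); apply: ml_mono;
    have := mle0 o; mlra.
have oz : su M o <= ln M z by apply: (mle_trans (y := l)); split=> //; rewrite /l; mlra.
have Ll : lg l by apply: (lg_le (ln_lg z)).
pose W J i := rd l (T z l (su M o) C n J) i.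
have DW F G : Df true F -> Df true G -> Df true (fun r => W (F r) (G r)).
  move=> HF HG; rewrite /W; apply: Df_rd => //; first df.
  apply: (@Df_under M (fun r => T (r 0%N) (r 1%N) (r 2%N) (r 3%N) (r 4%N) (r 5%N)) true
    (fun r => ocons z (ocons l (ocons (su M o) (ocons C (ocons n (ocons (F r) enil))))))) => //; df.
exists W; split=> // J.
have Wi i : i <= o -> W J i = mn (tdeg C n J i (W J)) (mask z l).
  move=> Hi; rewrite /W HT //; last by mlra.
  congr (mn _ _).
  have same u : u < i -> rd l (T z l i C n J) u = rd l (T z l (su M o) C n J) u.
    move=> Hu; rewrite !HT //; try mlra.
    by apply: (mle_trans (y := l * su M o)); split=> //; apply: ml_mono; mlra.
  have [E1 E2 E3 E4] := tdeg_eqs J (fun u => rd l (T z l i C n J) u).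
  have [F1 F2 F3 F4] := tdeg_eqs J (fun u => rd l (T z l (su M o) C n J) u).
  case: (slp_gate slp Hi) => [[j Hj G]|[c G]|[u [v [Hu Hv [G|G]]]]].
  - by rewrite (E1 _ _ G) (F1 _ _ G).
  - by rewrite (E2 _ _ G) (F2 _ _ G).
  - by rewrite (E3 _ _ _ G) (F3 _ _ _ G) !same.
  - by rewrite (E4 _ _ _ G) (F4 _ _ _ G) !same.
have lgi i : i <= o -> lg i by apply: lg_le slp_lg.
have bound i : i <= o -> (forall u, u < i -> W J u <= ex u) -> tdeg C n J i (W J) <= ex i.
  move=> Hi IH; have [E1 E2 E3 E4] := tdeg_eqs J (W J).
  have step u : u < i -> 2 * ex u <= ex i.
    by move=> Hu; rewrite -exS; [apply: ex_mono; [apply: lgi|]|apply: lgi]; mlra.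
  have e1 := ex_ge1 (lgi i Hi).
  case: (slp_gate slp Hi) => [[j Hj G]|[c G]|[u [v [Hu Hv [G|G]]]]].
  - by rewrite (E1 _ _ G); have := leb_le1 (j + 1) J; mlra.
  - by rewrite (E2 _ _ G); have := leb_le1 (n + i + 1) J; mlra.
  - rewrite (E3 _ _ _ G); have := IH u Hu; have := IH v Hv; have := step u Hu; have := step v Hv.
    by have := mle0 (ex u); have := mle0 (ex v); case: (mx_spec (W J u) (W J v)) => -[_ ->]; mlra.
  - by rewrite (E4 _ _ _ G); have := IH u Hu; have := IH v Hv; have := step u Hu;
    have := step v Hv; mlra.
have small i : i <= o -> (forall u, u < i -> W J u <= ex u) -> W J i = tdeg C n J i (W J).
  move=> Hi IH; rewrite Wi // mn_l //; apply: (mle_trans (y := ex i)); split; first exact: bound.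
  have : ex i < ex l by apply: ex_strict => //; rewrite /l; mlra.
  by have := mask_ex1 lz; mlra.
have all : forall i, i < su M o -> W J i <= bz z i.
  apply: LCI; [apply: Sg_le; [apply: DW; df|df]|rewrite su_ad; apply: lgS; exact: slp_lg|].
  move=> i Hi IH; rewrite bzE; last by mlra.
  have IH' u : u < i -> W J u <= ex u by move=> Hu; rewrite -(@bzE M z); [apply: IH|mlra].
  by rewrite small; [apply: bound; [mlra|]|mlra|].
move=> i Hi; apply: small => // u Hu; rewrite -(@bzE M z); [apply: all; mlra|mlra].
Qed.

(** The threshold J + 1 admits one source more than J. Its contribution is bounded by any [e] that
    grows like a degree along the gates and is at least 1 where this source occurs. *)
Lemma degree_step W : (forall F G, Df true F -> Df true G -> Df true (fun r => W (F r) (G r))) ->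
  (forall J i, i <= o -> W J i = tdeg C n J i (W J)) ->
  forall J (e : M -> M), Df true (fun r => e (r 0%N)) -> supra C o e ->
    (forall i, i <= o -> ent C i = g_var J -> 1 <= e i) ->
    (forall i c, i <= o -> ent C i = g_const c -> n + i = J -> 1 <= e i) ->
  forall i, i < su M o -> W (J + 1) i <= W J i + e i.
Proof.
move=> DW HW J e De Se Hv Hc.
have Dee F : Df true F -> Df true (fun r => e (F r)).
  by move=> H; apply: Df1_true.
apply: LCI; first by apply: Sg_le; [apply: DW; df|apply: Df_ad; [apply: DW; df|df]].
  by rewrite su_ad; apply: lgS; exact: slp_lg.
move=> i Hi IH; have Hi' : i <= o by mlra.
rewrite !HW //.
have [E1 E2 E3 E4] := tdeg_eqs (J + 1) (W (J + 1)); have [F1 F2 F3 F4] := tdeg_eqs J (W J).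
have leaf k : (k = J -> 1 <= e i) -> leb (k + 1) (J + 1) <= leb (k + 1) J + e i.
  move=> Hk; case: (classic (k = J)) => [E|N].
    by have := Hk E; have := leb_le1 (k + 1) (J + 1); have := mle0 (leb (k + 1) J); mlra.
  case: (classic (k + 1 <= J)) => L; first by rewrite !leb1 //; mlra.
  rewrite leb0; first exact: mle0.
  by case/neqE: N => N; move: N; rewrite -injS -leE; mlra.
case: (slp_gate slp Hi') => [[j Hj G]|[c G]|[u [v [Hu Hv' [G|G]]]]].
- by rewrite (E1 _ _ G) (F1 _ _ G); apply: leaf => E; apply: Hv => //; rewrite G E.
- by rewrite (E2 _ _ G) (F2 _ _ G); apply: leaf => E; apply: Hc G E.
- rewrite (E3 _ _ _ G) (F3 _ _ _ G); have [S1 S2] := proj1 (Se i u v Hi') G.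
  have := IH u Hu; have := IH v Hv'.
  by case: (mx_spec (W (J + 1) u) (W (J + 1) v)) => -[_ ->];
    case: (mx_spec (W J u) (W J v)) => -[L ->]; mlra.
- rewrite (E4 _ _ _ G) (F4 _ _ _ G); have := proj2 (Se i u v Hi') G.
  by have := IH u Hu; have := IH v Hv'; mlra.
Qed.

Lemma trace_degree src D : deg_trace src C o D ->
  [/\ supra C o (ent D),
   forall i, i <= o -> ((exists x, ent C i = g_var x) \/ (exists x, ent C i = g_const x)) ->
     (src i (ent C i) /\ ent D i = 1) \/ (~ src i (ent C i) /\ ent D i = 0) &
   forall i u v, i <= o -> (ent C i = g_add u v -> is_max (ent D u) (ent D v) (ent D i)) /\
      (ent C i = g_mul u v -> ent D i = ent D u + ent D v)].
Proof.
move=> [SD H].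
have [I1 I2 I3 I4] := g_inj M; have [N1 N2 N3 N4] := g_neq M.
have gates i u v : i <= o -> (ent C i = g_add u v -> is_max (ent D u) (ent D v) (ent D i)) /\
      (ent C i = g_mul u v -> ent D i = ent D u + ent D v).
  move=> Hi; have [g [e [/(entryP _ _ (proj1 slp))[_ ->] [/(entryP _ _ SD)[_ ->]]]]] := H i Hi.
  case=> [[[x [G|G]] _]|[u' [v' [eu [ev' [/(entryP _ _ SD)[_ ->] [/(entryP _ _ SD)[_ ->] E]]]]]]].
  - by rewrite G; split=> G'; [case: (N2 x u v) => K _|case: (N2 x u v) => _ K].
  - by rewrite G; split=> G'; [case: (N3 x u v) => K _|case: (N3 x u v) => _ K].
  - case: E => -[G E]; rewrite G; split=> G'.
    + by have [<- <-] := I3 _ _ _ _ G'.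
    + by case: (N4 _ _ _ _ G').
    + by case: (N4 _ _ _ _ (esym G')).
    + by have [<- <-] := I4 _ _ _ _ G'.
split=> //.
- move=> i u v Hi; have [K1 K2] := gates i u v Hi; split=> G.
    by case: (K1 G) => -[L ->]; split=> //; apply: mle_refl.
  by rewrite (K2 G); apply: mle_refl.
- move=> i Hi L; have [g [e [/(entryP _ _ (proj1 slp))[_ ->] [/(entryP _ _ SD)[_ ->]]]]] := H i Hi.
  case=> [[_]|[u' [v' [eu [ev' [_ [_ E]]]]]]] //.
  exfalso; case: L => -[x G]; rewrite G in E; case: E => -[E _].
  + by case: (N2 x u' v') => K _; apply: K.
  + by case: (N2 x u' v') => _ K; apply: K.
  + by case: (N3 x u' v') => K _; apply: K.
  + by case: (N3 x u' v') => _ K; apply: K.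
Qed.

(** The keys below n + o + 1 comprise all variables and all constants, so [W] at this threshold is
    at least 1 at each gate. Adding the sources one at a time, each of degree at most d at the
    output, gives the bound on W o. The functions [e] are the official degree traces of the single
    variables. *)
Theorem ckt_weights d : lg n ->
  (forall j, j < n -> deg_le (fun _ g => g = g_var j) C o d) ->
  (forall c, c <= o /\ (exists x, entryM C c (g_const x)) -> deg_le (fun i _ => i = c) C o d) ->
  exists W : M -> M, [/\ Df true (fun r => W (r 0%N)), supra C o W,
    forall i, i <= o -> 1 <= W i, W o <= (n + o + 1) * d &
    forall j, j < n -> exists e : M -> M, [/\ Df true (fun r => e (r 0%N)), supra C o e,
      forall i, i <= o -> e i <= W i, e o <= d &
      forall i, i <= o -> ent C i = g_var j -> 1 <= e i]].
Proof.
move=> Ln Hvar Hconst; have [W [DW HW]] := weights_ex.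
have [I1 I2 I3 I4] := g_inj M; have [N1 N2 N3 N4] := g_neq M.
have Lo : lg (su M o) by rewrite su_ad; apply: lgS; exact: slp_lg.
pose N := n + o + 1.
have LN : lg N by apply: lgS; apply: lgD => //; exact: slp_lg.
have W0 : forall i, i < su M o -> W 0 i <= 0.
  apply: LCI => //; first by apply: Sg_le; [apply: DW|]; df.
  move=> i Hi IH; rewrite HW; last by mlra.
  have [E1 E2 E3 E4] := tdeg_eqs 0 (W 0).
  have Hi' : i <= o by clear -Hi; mlra.
  case: (slp_gate slp Hi') => [[j Hj G]|[c G]|[u [v [Hu Hv [G|G]]]]].
  - by rewrite (E1 _ _ G) leb0; mlra.
  - by rewrite (E2 _ _ G) leb0; mlra.
  - by rewrite (E3 _ _ _ G); have := IH u Hu; have := IH v Hv;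
    case: (mx_spec (W 0 u) (W 0 v)) => -[_ ->].
  - by rewrite (E4 _ _ _ G); have := IH u Hu; have := IH v Hv; mlra.
have W1 : forall i, i < su M o -> 1 <= W N i.
  apply: LCI => //; first by apply: Sg_le; [|apply: DW]; df.
  move=> i Hi IH; rewrite HW; last by mlra.
  have [E1 E2 E3 E4] := tdeg_eqs N (W N).
  have Hi' : i <= o by clear -Hi; mlra.
  case: (slp_gate slp Hi') => [[j Hj G]|[c G]|[u [v [Hu Hv [G|G]]]]].
  - by rewrite (E1 _ _ G) leb1 /N; mlra.
  - by rewrite (E2 _ _ G) leb1 /N; mlra.
  - by rewrite (E3 _ _ _ G); have := IH u Hu; have := IH v Hv;
    case: (mx_spec (W N u) (W N v)) => -[_ ->].
  - by rewrite (E4 _ _ _ G); have := IH u Hu; have := IH v Hv; mlra.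
have SW : supra C o (W N).
  move=> i u v Hi; have [_ _ E3 E4] := tdeg_eqs N (W N); rewrite (HW N i Hi); split=> G.
    by rewrite (E3 _ _ _ G); case: (mx_spec (W N u) (W N v)) => -[L ->]; split=> //;
      apply: mle_refl.
  by rewrite (E4 _ _ _ G); apply: mle_refl.
have step := degree_step DW HW.
have sum : forall J, J <= N -> W J o <= J * d.
  apply: LIND_le => //; first by apply: Sg_le; [apply: DW|]; df.
    by have := W0 o ltac:(mlra); mlra.
  move=> J HJ IH.
  have fin (e : M -> M) : W (J + 1) o <= W J o + e o -> e o <= d ->
    W (J + 1) o <= (J + 1) * d by mlra.
  case: (classic (J < n)) => HJn.
    have [D [e [HD [/(entryP _ _ (proj1 HD))[_ ->] Hd]]]] := Hvar J HJn.
    have [S1 S2 S3] := trace_degree HD.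
    apply: (fin (ent D)) => //; apply: step => //; first df.
    - move=> i Hi G; case: (S2 i Hi ltac:(by left; exists J)) => -[K ->]; [exact: mle_refl|by []].
    - by move=> i c Hi G E; exfalso; move: HJn; rewrite -E; mlra.
    - mlra.
  (* A key J >= n stands for gate c = J - n, which is a source only if it is a constant. *)
  have Ec := @monusK M J n ltac:(mlra); set c := monus J n in Ec.
  case: (classic (c <= o /\ exists x, entryM C c (g_const x))) => [Hc|Nc].
    have [D [e [HD [/(entryP _ _ (proj1 HD))[_ ->] Hd]]]] := Hconst c Hc.
    have [S1 S2 S3] := trace_degree HD.
    apply: (fin (ent D)) => //; apply: step => //; first df.
    - move=> i Hi G; case: (slp_gate slp Hi) => [[j Hj G']|[c' G']|[u [v [_ _ [G'|G']]]]].
      + by move: G'; rewrite G => /I1 E; exfalso; move: Hj; rewrite -E.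
      + by case: (N1 J c'); rewrite -G.
      + by case: (N2 J u v) => K _; case: K; rewrite -G.
      + by case: (N2 J u v) => _ K; case: K; rewrite -G.
    - move=> i x Hi G E; case: (S2 i Hi ltac:(by right; exists x)) => -[K ->];
      first exact: mle_refl.
      by exfalso; apply: K; mlra.
    - mlra.
  (* Gate c is not a constant: no source has the key J, and the weight does not grow. *)
  apply: (fin (fun=> 0)); last exact: mle0.
  apply: step; [df| | | |mlra].
  - by move=> i u v Hi; split=> _; rewrite ?ad0; try split; apply: mle_refl.
  - move=> i Hi G; case: (slp_gate slp Hi) => [[j Hj G']|[c' G']|[u [v [_ _ [G'|G']]]]].
    + by move: G'; rewrite G => /I1 E; exfalso; move: Hj; rewrite -E.
    + by case: (N1 J c'); rewrite -G.
    + by case: (N2 J u v) => K _; case: K; rewrite -G.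
    + by case: (N2 J u v) => _ K; case: K; rewrite -G.
  - move=> i x Hi G E; exfalso; apply: Nc; have -> : c = i by mlra.
    by split=> //; exists x; apply/(entryP _ _ (proj1 slp)); split=> //; mlra.
exists (W N); split=> //.
- by apply: DW; df.
- by move=> i Hi; apply: W1; mlra.
- by apply: sum; apply: mle_refl.
move=> j Hj; have [D [e [HD [/(entryP _ _ (proj1 HD))[_ ->] Hd]]]] := Hvar j Hj.
have [S1 S2 S3] := trace_degree HD.
exists (ent D); split=> //.
- df.
- suff K : forall i, i < su M o -> ent D i <= W N i by move=> i Hi; apply: K; mlra.
  apply: LCI => //; first by apply: Sg_le; [|apply: DW]; df.
  move=> i Hi IH; have Hi' : i <= o by mlra.
  have leaf : (exists x, ent C i = g_var x) \/ (exists x, ent C i = g_const x) -> ent D i <= W N i.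
    move=> L; have := W1 i Hi; case: (S2 i Hi' L) => -[_ ->]; mlra.
  case: (slp_gate slp Hi') => [[j' _ G]|[c G]|[u [v [Hu Hv [G|G]]]]].
  - by apply: leaf; left; exists j'.
  - by apply: leaf; right; exists c.
  - have := IH u Hu; have := IH v Hv; have [L1 L2] := proj1 (SW i u v Hi') G.
    by case: (proj1 (S3 i u v Hi') G) => -[_ ->]; mlra.
  - have := IH u Hu; have := IH v Hv; have := proj2 (SW i u v Hi') G.
    by rewrite (proj2 (S3 i u v Hi') G); mlra.
- move=> i Hi G; case: (S2 i Hi ltac:(by left; exists j)) => -[K ->]; [exact: mle_refl|by []].
Qed.

End Weights.
End Degrees.

(** * A bound on the number of roots on a line *)

Section Roots.
Variable M : s12.
Local Open Scope M_scope.
Implicit Types x y z u v w c i j k l n o a t s q C d J D : M.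
Hint Resolve Df_iadd Df_imul Df_EV Df_ipos Df_ineg Df_evg Df_mx : pv.

Lemma md0P x N : N <> 0 -> (md x N = 0 <-> exists k, x = N * k).
Proof.
move=> HN; split=> [E|[k E]].
  by exists (dv x N); have [Ex _] := dv_md x HN; rewrite E ad0 in Ex.
by apply: (proj2 (dv_unique (q := k) (r := 0) _ _)); [rewrite ad0|move/neq0: HN => HN; clear -HN;
  mlra].
Qed.

(** F is built as q!, each factor being at most 2^|q|. In [root_bound] it absorbs the common
    divisors of B - x and B - h, which divide x - h. *)
Lemma common_multiple q : lg q -> exists F, [/\ 1 <= F, F <= ex (ln M q * q) &
  forall y, 1 <= y -> y <= q -> exists k, F = y * k].
Proof.
move=> Lq; have [z Ez] : lg (ln M q * q) by apply: lgM => //; apply: ln_lg.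
case: Lq => zq Ezq.
pose P k := exists F, F <= bz z (ln M q * k) /\ (1 <= F /\
  forall y, y <= ln M zq -> (1 <= y /\ y <= k -> md F y = 0)).
have EzL k : k <= q -> ln M q * k <= ln M z by move=> L; rewrite Ez; apply: ml_mono.
suff : P q.
  move=> [F [F1 [F2 F3]]]; exists F; split=> //.
    by rewrite bzE // in F1; rewrite Ez; apply: mle_refl.
  move=> y H1 H2; apply/md0P; first exact/neq0.
  by apply: F3; rewrite ?Ezq.
apply: (LIND (n := q)); [|by exists zq| |].
- apply: (@Sg_ex M (fun r => bz z (ln M q * r 0%N)) (fun F r => 1 <= F /\
    forall y, y <= ln M zq -> (1 <= y /\ y <= r 0%N -> md F y = 0))); first df.
  apply: Sg_and; first df.
  by apply: (@Sg_sall M true (fun=> zq) (fun y r => (1 <= y /\ y <= r 1%N -> md (r 0%N) y = 0)));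
    df.
- exists 1; split; first by rewrite ml0 bzE ?ex0; [apply: mle_refl|apply: mle0].
  by split=> [|y _ [H1 H2]]; [apply: mle_refl|exfalso; clear -H1 H2; mlra].
- move=> k Hk [F [F1 [F2 F3]]]; exists (F * (k + 1)).
  have Lk : k + 1 <= q by clear -Hk; mlra.
  have E1 := EzL _ Lk; have E0 := EzL k ltac:(clear -Hk; mlra).
  have L1 : lg (ln M q * (k + 1)) := lg_le (ln_lg z) E1.
  have L0 : lg (ln M q * k) := lg_le (ln_lg z) E0.
  rewrite bzE // in F1; rewrite bzE //; split.
    have -> : ln M q * (k + 1) = ln M q * k + ln M q by clra.
    rewrite exD //; last exact: ln_lg.
    by apply: ml_le2 => //; have := lt_exln q; clear -Lk; mlra.
  split; first by have := @ml_le2 M 1 F 1 (k + 1) F2 ltac:(clra); rewrite ml1.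
  move=> y Hy [H1 H2]; apply/md0P; first exact/neq0.
  case: (classic (y <= k)) => [L|N].
    have /md0P [|c Ec] := F3 y Hy (conj H1 L); first exact/neq0.
    by exists (c * (k + 1)); rewrite Ec ml_assoc.
  by exists F; have -> : y = k + 1 by [clear -N H2; mlra]; rewrite ml_comm.
Qed.

(** The exact value at [X = 2^b] is smaller than the [(d+1)]-st power of [2^b], yet divisible,
    up to small factors, by [2^b - x] for every root [x]; hence with more than [d] roots it
    vanishes, and so does the polynomial. *)
Lemma root_bound z l C n o j d q b A w (tup W e cnt : M -> M) (v : M) :
  is_slp C n o -> l * su M o <= ln M z -> 1 <= l -> j < n ->
  Df true (fun r => tup (r 0%N)) -> (forall c, isseq (tup c) n) ->
  (forall c, hf M c <= ex (b + A) -> ent (tup c) j = c) ->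
  (forall c c' u, u < n -> u <> j -> ent (tup c) u = ent (tup c') u) ->
  (forall c u, u < n -> u <> j -> hf M (ent (tup c) u) <= ex A) ->
  Df true (fun r => W (r 0%N)) -> supra C o W -> (forall i, i <= o -> 1 <= W i) -> W o <= w ->
  Df true (fun r => e (r 0%N)) -> supra C o e -> (forall i, i <= o -> e i <= W i) ->
  e o <= d -> (forall i, i <= o -> ent C i = g_var j -> 1 <= e i) ->
  (forall i c, i <= o -> ent C i = g_const c -> hf M c <= ex A) ->
  lg q -> 1 <= q -> q <= ex A -> d <= q ->
  w * (A + o) + (ln M q * q + 1) * q + A + su M 2 <= b ->
  b * w + w * (A + o) + su M 2 <= l ->
  let out c := ev z l C o (tup c) o in
  let root x := ipos (monus (out (2 * x)) 1) = ineg (monus (out (2 * x)) 1) in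
  Df true (fun r => cnt (r 0%N)) -> cnt 0 = 0 ->
  (forall x, x < q -> (root x -> cnt (x + 1) = cnt x + 1) /\ (~ root x -> cnt (x + 1) = cnt x)) ->
  hf M v <= ex A -> val z l C o (tup v) o <> 0%R -> cnt q <= d.
Proof.
move=> slp Hz Hl Hj Dtup Stup tup_j tup_u tup_A DW SW W1 Ww De Se eW ed ej Hconst Lq q1 qA dq Hb HL
  out root Dcnt cnt0 cntS Hv Nv.
set G := w * (A + o) in Hb HL.
have w1 : 1 <= w by have := W1 o (mle_refl o); clear -Ww; mlra.
have lgl : lg l := lg_l Hz Hl.
have lgG : lg G by apply: (lg_le lgl); have := mle0 (b * w); clear -HL; mlra.
have lgb : lg b.
  apply: (lg_le lgl); have : b * 1 <= b * w by apply: ml_mono.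
  by clear -HL; mlra.
have lgA : lg A.
  by apply: (lg_le lgb); have := mle0 ((ln M q * q + 1) * q); clear -Hb; mlra.
have lgw : lg w.
  apply: (lg_le lgl); have : 1 * w <= b * w; last by clear -HL; mlra.
  by apply: ml_le2; [have := mle0 ((ln M q * q + 1) * q); clear -Hb; mlra|apply: mle_refl].
have HW i : i <= o -> 1 <= W i /\ e i <= W i by move=> Hi; split; [apply: W1|apply: eW].
have leaf b' c i k : i <= o -> k < n -> ent C i = g_var k -> b' <= b ->
    hf M c <= ex (b' + A) -> lg (b' * e i + A) -> hf M (ent (tup c) k) <= ex (b' * e i + A).
  move=> Hi Hk G' Lb Hc Hlg; case: (classic (k = j)) => [E|N].
    rewrite E tup_j; last first.
      apply: (mle_trans (y := ex (b' + A))); split=> //; apply: ex_mono; first exact: lgD.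
      by clear -Lb; mlra.
    apply: (mle_trans (y := ex (b' + A))); split=> //; apply: ex_mono => //.
    have H1 : 1 <= e i by apply: ej => //; rewrite G' E.
    by have := ml_mono b' H1; rewrite ml1; clra.
  apply: (mle_trans (y := ex A)); split; first exact: tup_A.
  by apply: ex_mono => //; have := mle0 (b' * e i); clra.
have lgbe b' i : b' <= b -> i <= o -> W i <= w -> lg (b' * e i + A).
  move=> Lb Hi L; apply: lgD => //; apply: lgM; first exact: lg_le lgb Lb.
  by apply: (lg_le lgw); have := eW i Hi; clear -L; mlra.
(* Applied with b' = b to arguments of magnitude up to 2^(b + A), and with b' = 0 to the nonroot v,
   whose value is thereby at most 2^G. *)
have big b' c : b' <= b -> hf M c <= ex (b' + A) ->
    out c <> 0 /\ hf M (monus (out c) 1) <= ex (b' * d + G).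
  move=> Lb Hc.
  have Hvar i k : i <= o -> W i <= w -> k < n -> ent C i = g_var k ->
      hf M (ent (tup c) k) <= ex (b' * e i + A).
    by move=> Hi L Hk Gk; apply: leaf => //; apply: lgbe.
  have HL' : b' * w + w * (A + o) + su M 2 <= l.
    have : b' * w <= b * w by apply: ml_le2 => //; apply: mle_refl.
    by rewrite -/G; clear -HL; mlra.
  have oo : o < su M o by clra.
  have [N B] := value_size slp Hz Hl DW De SW Se HW Hvar Hconst HL' oo Ww.
  split=> //; apply: (mle_trans (y := ex (b' * e o + W o * (A + o)))); split=> //.
  apply: ex_mono; last first.
    have H1 := ml_mono b' ed; have H2 : W o * (A + o) <= G by apply: ml_le2 => //; apply: mle_refl.
    by clear -H1 H2; mlra.
  apply: lgD => //; apply: lgM; first exact: lg_le lgb Lb.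
  by apply: (lg_le Lq).
pose V c := val z l C o (tup c) o.
have congr c c' N : N <> 0 -> (exists k : ZM M, (ival c - ival c' = inj N * k)%R) ->
    hf M c <= ex (b + A) -> hf M c' <= ex (b + A) ->
    exists k : ZM M, (V c - V c' = inj N * k)%R.
  move=> HN Hcc Hc Hc'; have oo : o < su M o by clra.
  have [Nc _] := big b c (mle_refl b) Hc; have [Nc' _] := big b c' (mle_refl b) Hc'.
  apply: (ev_congr slp Hz Hl HN _ oo Nc Nc') => u Hu; apply/(ceqP _ _ HN).
  case: (classic (u = j)) => [->|Nu]; first by rewrite (tup_j c Hc) (tup_j c' Hc').
  by rewrite (tup_u c c' u Hu Nu); exists 0%R; ring.
have rootP x : root x <-> V (2 * x)%M = 0%R.
  rewrite /root /V /val /ival -/(out _); split=> [->|E]; first by rewrite subrr.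
  by apply/eqE; move: E => /eqP; rewrite subr_eq0 => /eqP.
pose B := ex b.
have H2 x : hf M (2 * x) = x by apply: hf_eq; clra.
have BA : B <= ex (b + A) by apply: ex_mono; [apply: lgD|clra].
have A1 := ex_ge1 lgA; have G1 := ex_ge1 lgG.
have Bbig : 2 * (2 * (ex G * ex A)) <= B.
  have lGA : lg (G + A) by apply: lgD.
  rewrite -exD // -!exS //; last exact: lgS.
  by apply: ex_mono => //; have := mle0 ((ln M q * q + 1) * q); clear -Hb; mlra.
have prod1 : ex A <= ex G * ex A by have := ml_le2 G1 (mle_refl (ex A)); rewrite ml_comm ml1.
have prod2 : ex G <= ex G * ex A by have := ml_le2 (mle_refl (ex G)) A1; rewrite ml1.
pose N0 := hf M (monus (out (2 * B)) 1).
have EN0 : inj N0 = `|V (2 * B)%M|%R by rewrite -ival_norm.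
have HB : hf M (2 * B) <= ex (b + A) by rewrite H2.
have [outB N0le] := big b (2 * B) (mle_refl b) HB; rewrite -/N0 in N0le.
have smallA x : x <= ex A -> x <= ex (b + A).
  move=> L; apply: (mle_trans (y := ex A)); split=> //.
  by apply: ex_mono; [apply: lgD|clra].
(* If the value at B were 0, then B - v would divide the nonzero value at v; but B - v exceeds 2^G,
   which bounds that value. *)
have N01 : 1 <= N0.
  apply: NNPP => N; have Z : N0 = 0 by clear -N; mlra.
  have PB : V (2 * B)%M = 0%R.
    by move: EN0; rewrite Z inj0 => /esym /eqP; rewrite normr_eq0 => /eqP.
  have vb : (`|ival v| <= inj (ex A))%R by rewrite ival_norm; apply/leE.
  have [Nn En] : exists Nn, (inj B - ival v = inj Nn)%R.
    apply: zge0P; move/leE: Bbig; move/leE: prod1; rewrite !injM !injS inj0.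
    have := ler_norm (ival v); have := inj_ge0 (ex A).
    by move: (inj (ex G) * inj (ex A))%R vb => X vb *; lra.
  have Nbig : (inj (ex G) + 1 <= inj Nn)%R.
    rewrite -En; move/leE: Bbig; move/leE: prod1; move/leE: prod2; rewrite !injM !injS inj0.
    move/leE: G1; rewrite injS inj0; have := ler_norm (ival v).
    by move: (inj (ex G) * inj (ex A))%R vb => X vb *; lra.
  have HNn : Nn <> 0 by move=> E; move: Nbig; rewrite E inj0; clear; have := inj_ge0 (ex G) => *;
    lra.
  have [k Ek] : exists k : ZM M, (V v - V (2 * B)%M = inj Nn * k)%R.
    apply: congr => //; last exact: smallA.
    by exists (-1)%R; rewrite ival_pos -En; ring.
  have [_ Pv] := big 0 v (mle0 b) ltac:(by rewrite ad_comm ad0).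
  have {}Pv : (`|V v| <= inj (ex G))%R.
    rewrite /V /val ival_norm -leE.
    by move: Pv; rewrite (ml_comm 0) ml0 ad_comm ad0.
  rewrite PB subr0 in Ek; have Nk : k != 0%R by apply/eqP => E; apply: Nv;
    rewrite -/(V v) Ek E mulr0.
  have k1 : (1 <= `|k|)%R.
    by have := @zdiscrete M 0%R `|k|%R ltac:(by rewrite normr_gt0); rewrite add0r.
  move: Pv; rewrite Ek normrM (ger0_norm (inj_ge0 Nn)) => Pv.
  have : (inj Nn * 1 <= inj Nn * `|k|)%R by apply: ler_wpM2l => //; apply: inj_ge0.
  by rewrite mulr1 => K; clear -K Pv Nbig; lra.
have xB x : x < q -> 2 * x <= B /\ x < B.
  move=> Hx; have : 2 * x + 1 + 1 <= 2 * (ex G * ex A) by clear -Hx qA prod1; mlra.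
  by clear -Bbig; mlra.
have dvd0 x : x < q -> root x -> exists k, N0 = monus B x * k.
  move=> Hx /rootP Rx; have [_ LxB] := xB x Hx; have Em := @monusK M B x ltac:(clear -LxB; mlra).
  have HN : monus B x <> 0 by move=> E; rewrite E in Em; clear -Em LxB; mlra.
  have [k Ek] : exists k : ZM M, (V (2 * B)%M - V (2 * x)%M = inj (monus B x) * k)%R.
    apply: congr => //; last by rewrite H2; apply: smallA; clear -Hx qA; mlra.
    by exists 1%R; rewrite !ival_pos mulr1; move/eqE: Em; rewrite injD => <-; ring.
  rewrite Rx subr0 in Ek.
  have [k' Ek'] := zge0P (normr_ge0 k); exists k'; apply/eqE.
  by rewrite EN0 Ek normrM injM -Ek' (ger0_norm (inj_ge0 _)).
have [F [F1 Fle Fdiv]] := common_multiple Lq.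
pose f := ln M q * q.
have lgf : lg f by apply: lgM => //; apply: ln_lg.
have lgf1 : lg (f + 1) by apply: lgS.
have F2 : 2 * F <= ex (f + 1) by rewrite exS // -/f; apply: ml_mono.
have cnt_le : forall x, x <= q -> cnt x <= x.
  have Dc F0 : Df true F0 -> Df true (fun r => cnt (F0 r)) by apply: Df1_true.
  apply: (LIND_le (P := fun x => cnt x <= x)) => //; [df|by rewrite cnt0; apply: mle_refl|].
  move=> x Hx IH; have [K1 K2] := cntS x Hx.
  by case: (classic (root x)) => R; [rewrite K1|rewrite K2] => //; clear -IH; mlra.
have [zz Ezz] : lg (b * q + (f + 1) * q + q) by do 2 apply: lgD => //; apply: lgM.
have expo1 x : x <= q -> b * cnt x <= ln M zz.
  move=> Hx; have := cnt_le x Hx => H; have : b * cnt x <= b * q by apply: ml_mono; clear -H Hx;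
    mlra.
  by rewrite Ezz; have := mle0 ((f + 1) * q); clra.
have expo2 x : x <= q -> (f + 1) * cnt x <= ln M zz.
  move=> Hx; have := cnt_le x Hx => H; have : (f + 1) * cnt x <= (f + 1) * q by apply: ml_mono;
    clear -H Hx; mlra.
  by rewrite Ezz; have := mle0 (b * q); clra.
have lgc1 x : x <= q -> lg (b * cnt x) by move=> Hx; apply: (lg_le (ln_lg zz)); apply: expo1.
have lgc2 x : x <= q -> lg ((f + 1) * cnt x) by move=> Hx; apply: (lg_le (ln_lg zz)); apply: expo2.
case: (Lq) => zq Ezq.
(* N is what is left of the value at B once the factors B - x of the roots x < h have been removed.
   Each removal divides it by 2^b, up to a factor 2^(f + 1), and B - x still divides F N for every
   root x >= h. *)
have [N [N1 [N2 _]]] : exists N, 1 <= N /\ (N * ex (b * cnt q) <= N0 * ex ((f + 1) * cnt q) /\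
    forall x, x <= ln M zq -> (q <= x /\ x < q /\ root x -> md (F * N) (monus B x) = 0)).
  pose Q h := exists N, N <= N0 /\ (1 <= N /\
    (N * bz zz (b * cnt h) <= N0 * bz zz ((f + 1) * cnt h) /\
    forall x, x <= ln M zq -> (h <= x /\ x < q /\ root x -> md (F * N) (monus B x) = 0))).
  suff : Q q.
    by move=> [N [_ H]]; exists N; move: H; rewrite !bzE //; [apply: expo2|apply: expo1];
      apply: mle_refl.
  have Dc F0 : Df true F0 -> Df true (fun r => cnt (F0 r)) by apply: Df1_true.
  have Dt F0 : Df true F0 -> Df true (fun r => tup (F0 r)) by apply: Df1_true.
  apply: (LIND (n := q)) => //.
  - apply: (@Sg_ex M (fun=> N0) (fun N r => 1 <= N /\
      (N * bz zz (b * cnt (r 0%N)) <= N0 * bz zz ((f + 1) * cnt (r 0%N)) /\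
       forall x, x <= ln M zq -> (r 0%N <= x /\ x < q /\ root x -> md (F * N) (monus B x) = 0)))).
      by df.
    apply: Sg_and; first df. apply: Sg_and; first df.
    apply: (@Sg_sall M true (fun=> zq) (fun x r => (r 1%N <= x /\ x < q /\ root x ->
      md (F * r 0%N) (monus B x) = 0))).
      by df.
    by rewrite /root /out; df.
  - exists N0; split; first exact: mle_refl.
    split=> //; split.
      by rewrite cnt0 !ml0 bzE ?ex0; [apply: mle_refl|apply: mle0].
    move=> x _ [_ [Hx Rx]]; have [k Ek] := dvd0 x Hx Rx; have [_ L] := xB x Hx.
    apply/md0P; first by move=> E; have := @monusK M B x ltac:(clear -L; mlra); rewrite E;
      clear -L; mlra.
    by exists (F * k); rewrite {1}Ek; clra.
  - move=> h Hh [N [N2 [N1 [N3 N4]]]]; have [c1 c2] := cntS h Hh.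
    have h0 : h <= q by clear -Hh; mlra.
    have h1 : h + 1 <= q by clear -Hh; mlra.
    case: (classic (root h)) => R; last first.
      exists N; rewrite (c2 R); split=> //; split=> //; split=> //.
      by move=> x Hx [L [L2 Rx]]; apply: N4 => //; split=> //; clear -L; mlra.
    have [B2 LB] := xB h Hh; have Em := @monusK M B h ltac:(clear -LB; mlra).
    set D := monus B h in Em.
    have HD : D <> 0 by move=> E; rewrite E in Em; clear -Em LB; mlra.
    have [N' EN'] : exists N', F * N = D * N'.
      by apply/md0P => //; apply: N4; [rewrite Ezq|split; [apply: mle_refl|]].
    have N'1 : 1 <= N'.
      apply/neq0 => E; rewrite E ml0 in EN'; case: (ml_eq0 EN') => E';
        [rewrite E' in F1|rewrite E' in N1].
        by clear -F1; mlra.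
      by clear -N1; mlra.
    (* From F N = (B - h) N' with B <= 2 (B - h) and 2 F <= 2^(f + 1). *)
    have half : B * N' <= ex (f + 1) * N.
      have L1 : B * N' <= 2 * D * N' by apply: ml_le2; [clear -Em B2; mlra|apply: mle_refl].
      have L2 : 2 * F * N <= ex (f + 1) * N by apply: ml_le2 => //; apply: mle_refl.
      by clear -L1 L2 EN'; mlra.
    have fB : ex (f + 1) <= B.
      apply: ex_mono => //; have : (f + 1) * 1 <= (f + 1) * q by apply: ml_mono.
      by have := mle0 G; rewrite -/f in Hb; clear -Hb; mlra.
    have N'N : N' <= N.
      have Hf := @ml_le2 M _ _ _ _ fB (mle_refl N).
      have H3 : B * N' <= B * N by clear -half Hf; mlra.
      by move: H3; rewrite ml_le //; have := ex_ge1 lgb.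
    exists N'; split; first by clear -N'N N2; mlra.
    split=> //; rewrite (c1 R); split.
      rewrite -(c1 R) !bzE; [|exact: expo2|exact: expo1]; rewrite (c1 R).
      rewrite !bzE in N3; [|exact: expo2|exact: expo1].
      have -> : b * (cnt h + 1) = b * cnt h + b by clra.
      have -> : (f + 1) * (cnt h + 1) = (f + 1) * cnt h + (f + 1) by clra.
      rewrite (exD (lgc1 h h0) lgb) (exD (lgc2 h h0) lgf1).
      have L1 := @ml_le2 M _ _ _ _ half (mle_refl (ex (b * cnt h))).
      have L2 := @ml_le2 M _ _ _ _ N3 (mle_refl (ex (f + 1))).
      by rewrite -/B; clear -L1 L2; mlra.
    move=> x Hx [L [L2 Rx]]; have [_ LxB] := xB x L2; have Ex := @monusK M B x ltac:(clear -LxB;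
      mlra).
    have Hd : monus B x <> 0 by move=> E; rewrite E in Ex; clear -Ex LxB; mlra.
    have /md0P [//|k Ek] := N4 x Hx ltac:(by split; [clear -L; mlra|split]).
    (* For a later root x put X = B - x and y = x - h, so that B - h = X + y. As X divides F N = (X
       + y) N', it divides y N', and since y divides F, it divides F N'. *)
    have Edel := @monusK M x h ltac:(clear -L; mlra).
    have [g Eg] := Fdiv (monus x h) ltac:(clear -Edel L; mlra) ltac:(clear -Edel L2; mlra).
    set X := monus B x in Ex Hd Ek *; set y := monus x h in Edel Eg.
    have EX : md 0 X = 0 by apply/md0P => //; exists 0; rewrite ml0.
    rewrite -EX; apply/(md_eqP (F * N') 0 Hd); exists (inj g * (inj k - inj N'))%R.
    rewrite inj0 subr0 Eg !injM.
    have : (inj X * inj k = (inj X + inj y) * inj N')%R.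
      rewrite -!injM -injD -injM; apply/eqE; rewrite -Ek EN'; congr (_ * _).
      by rewrite /D; clear -Em Ex Edel; mlra.
    by move=> E; have -> : (inj X * (inj g * (inj k - inj N')) =
      inj g * (inj X * inj k - inj X * inj N'))%R;
      [ring|rewrite E; ring].
apply: NNPP => Hc.
(* With N >= 1 the invariant yields b cnt q <= b d + G + (f + 1) cnt q. More than d roots contradict
   this, because b > G + (f + 1) q. *)
have {}Hc : d + 1 <= cnt q by clear -Hc; mlra.
have cq := cnt_le q (mle_refl q).
have lgd : lg d by apply: (lg_le Lq).
have lgbd : lg (b * d + G) by apply: lgD => //; apply: lgM.
have L1 : ex (b * cnt q) <= ex (b * d + G + (f + 1) * cnt q).
  rewrite (exD lgbd); last by apply: lgc2; apply: mle_refl.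
  have K1 := @ml_le2 M _ _ _ _ N1 (mle_refl (ex (b * cnt q))).
  have K2 := @ml_le2 M _ _ _ _ N0le (mle_refl (ex ((f + 1) * cnt q))).
  by clear -K1 K2 N2; mlra.
have L2 : b * d + G + (f + 1) * cnt q < b * cnt q.
  have K1 : b * (d + 1) <= b * cnt q by apply: ml_mono.
  have K2 : (f + 1) * cnt q <= (f + 1) * q by apply: ml_mono.
  by rewrite -/f in Hb; clear -K1 K2 Hb; mlra.
have L3 : ex (b * d + G + (f + 1) * cnt q) < ex (b * cnt q).
  by apply: ex_strict => //; apply: lgc1; apply: mle_refl.
by clear -L1 L3; mlra.
Qed.

End Roots.

(** * From parameter-free terms to function symbols *)

Section Symbols.
Variable M : s12.
Local Open Scope M_scope.

Lemma tfv_tsubst (K : nat) (s : nat -> tm) (t : tm) : (forall i, tfv K (s i)) -> tfv K (tsubst s t).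
Proof.
move=> H; elim/tm_nested_ind: t => [i|n' f ts IH]; first exact: H.
change (tfv K (fapp f (Vector.map (tsubst s) ts))); rewrite tfv_app.
by elim: IH => [|m t' ts' Ht _ IHts]; constructor.
Qed.

(** [F] reads two variables, but its defining term may mention others; these are replaced by 0 to
    obtain a term for a binary symbol. *)
Lemma symbol2 (F : M -> M -> M) : Df false (fun r => F (r 0%N) (r 1%N)) ->
  exists f : pv 2, forall x y, ap2 M f x y = F x y.
Proof.
move=> [t0 Ht]; pose s (i : nat) := match i with 0%N => var 0 | 1%N => var 1 | _ => zero end : tm.
have [|f Hf] := @symbol_of_term M 2 (tsubst s t0).
  by apply: tfv_tsubst => -[|[|i]]; cbn; lia.
exists f => x y; have := Hf (ocons x (ocons y enil)); rewrite /ap2 /= => ->.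
rewrite eval_tm_subst (Ht (ocons x (ocons y enil))); congr (eval _ _ _).
by apply: functional_extensionality => -[|[|i]].
Qed.

Lemma symbol5 (F : M -> M -> M -> M -> M -> M) :
  Df false (fun r => F (r 0%N) (r 1%N) (r 2%N) (r 3%N) (r 4%N)) ->
  exists f : pv 5, forall x1 x2 x3 x4 x5, ap5 f x1 x2 x3 x4 x5 = F x1 x2 x3 x4 x5.
Proof.
move=> [t0 Ht]; pose s (i : nat) := match i with 0%N => var 0 | 1%N => var 1 | 2%N => var 2
  | 3%N => var 3 | 4%N => var 4 | _ => zero end : tm.
have [|f Hf] := @symbol_of_term M 5 (tsubst s t0).
  by apply: tfv_tsubst => -[|[|[|[|[|i]]]]]; cbn; lia.
exists f => x1 x2 x3 x4 x5.
have := Hf (ocons x1 (ocons x2 (ocons x3 (ocons x4 (ocons x5 enil))))); rewrite /ap5 /= => ->.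
rewrite eval_tm_subst (Ht (ocons x1 (ocons x2 (ocons x3 (ocons x4 (ocons x5 enil)))))).
by congr (eval _ _ _); apply: functional_extensionality => -[|[|[|[|[|i]]]]].
Qed.

End Symbols.

(** * Decoding roots *)

Section Decoding.
Variable M : s12.
Local Open Scope M_scope.
Implicit Types x y z u v w c i j k l n o a t s q C d J D Y : M.
Hint Resolve Df_iadd Df_imul Df_EV Df_ipos Df_ineg Df_evg Df_mx Df_mkseq : pv.

Lemma Df_ap5 (g : pv 5) b (F1 F2 F3 F4 F5 : (nat -> M) -> M) : Df b F1 -> Df b F2 -> Df b F3 ->
  Df b F4 -> Df b F5 ->
  Df b (fun r => ap5 g (F1 r) (F2 r) (F3 r) (F4 r) (F5 r)).
Proof.
move=> *; apply: (@Df_under M (fun r => ap5 g (r 0%N) (r 1%N) (r 2%N) (r 3%N) (r 4%N)) b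
  (fun r => ocons (F1 r) (ocons (F2 r) (ocons (F3 r) (ocons (F4 r) (ocons (F5 r) enil)))))).
  by exists (fapp g (vtab 5 var)).
df.
Qed.

(** The cutoff 2^(|x| i) is never reached by x^i, as x < 2^|x|; [z] only has to be long enough for
    the exponent |x| i. *)
Lemma pow_ex : exists P : M -> M -> M -> M, Df false (fun r => P (r 0%N) (r 1%N) (r 2%N)) /\
  forall z x, P z x 0 = 1 /\ forall i, i < ln M z -> ln M x * (i + 1) <= ln M z ->
    P z x (i + 1) = P z x i * x.
Proof.
have [I [DI HI]] := @iterate M (fun=> 1) (fun r => r 1%N * r 3%N)
  (fun r => bz (r 1%N) (ln M (r 2%N) * r 0%N)) ltac:(df) ltac:(df) ltac:(df).
exists (fun z x i => I z i (ocons z (ocons x enil))); split.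
  apply: (Df_under DI (E := fun r =>
    ocons (r 0%N) (ocons (r 2%N) (ocons (r 0%N) (ocons (r 1%N) enil))))).
  df.
move=> z x; have [I0 IS] := HI z (ocons z (ocons x enil)).
have E0 : I z 0 (ocons z (ocons x enil)) = 1.
  by apply: (ismin_le I0); env; rewrite ml0 bzE ?ex0; [apply: mle_refl|apply: mle0].
split=> // i Hi Hx; have := IS i Hi; env => /ismin_le; apply.
rewrite bzE //.
have lgx : lg (ln M x * (i + 1)) := lg_le (ln_lg z) Hx.
have ei : ln M x * i <= ln M z by apply: (mle_trans (y := ln M x * (i + 1))); split=> //;
  apply: ml_mono; clra.
have -> : ln M x * (i + 1) = ln M x * i + ln M x by clra.
rewrite exD; [|exact: lg_le (ln_lg z) ei|exact: ln_lg].
apply: ml_le2; last by have := lt_exln x; clra.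
case: (eq0_or i) => [->|Hi0]; first by rewrite E0 ml0 ex0; apply: mle_refl.
have Ei := @monusK M i 1 Hi0; set i' := monus i 1 in Ei.
have := IS i' ltac:(clear -Ei Hi; mlra); env; rewrite Ei => /ismin_leq.
by rewrite bzE.
Qed.

Definition pow : M -> M -> M -> M. pick pow_ex. Defined.
Lemma pow_spec z x : pow z x 0 = 1 /\ forall i, i < ln M z -> ln M x * (i + 1) <= ln M z ->
    pow z x (i + 1) = pow z x i * x.
Proof. exact: (proj2 (proj2_sig (constructive_indefinite_description _ pow_ex))). Qed.
Lemma Df_pow b F G H : Df b F -> Df b G -> Df b H -> Df b (fun r => pow (F r) (G r) (H r)).
Proof. apply: Df3; exact: (proj1 (proj2_sig (constructive_indefinite_description _ pow_ex))). Qed.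
Hint Resolve Df_pow : pv.
Lemma pow0 z x : pow z x 0 = 1. Proof. exact: (proj1 (pow_spec z x)). Qed.

Section Powers.
Variables (z x n : M).
Hypotheses (x1 : 1 <= x) (Hn : ln M x * n <= ln M z).
Lemma lnx1 : 1 <= ln M x.
Proof. by rewrite -(ln1 M); apply: ln_mono. Qed.
Lemma pow_lgn : n <= ln M z.
Proof. by apply: (mle_trans (y := ln M x * n)); split=> //; have := ml_le2 lnx1 (mle_refl n);
  rewrite (ml_comm 1) ml1. Qed.
Lemma powS i : i < n -> pow z x (i + 1) = pow z x i * x.
Proof.
move=> Hi; apply: (proj2 (pow_spec z x)).
  by have := pow_lgn; move: Hi; clra.
by apply: (mle_trans (y := ln M x * n)); split=> //; apply: ml_mono; move: Hi; clra.
Qed.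
Lemma pow_bounds i : i <= n -> 1 <= pow z x i /\ pow z x i <= ex (ln M x * i).
Proof.
move=> Hi; have lgn : lg n by apply: (lg_le (ln_lg z)); apply: pow_lgn.
have Bz k : k <= n -> ln M x * k <= ln M z.
  by move=> Hk; apply: (mle_trans (y := ln M x * n)); split=> //; apply: ml_mono.
rewrite -(@bzE M z); last exact: Bz.
move: i Hi; apply: LIND_le => //; first df.
  by rewrite pow0 ml0 bzE ?ex0; [split; apply: mle_refl|apply: mle0].
move=> i Hi [H1 H2]; rewrite powS // bzE; last by apply: Bz; move: Hi; clra.
have Bi : ln M x * i <= ln M z by apply: Bz; move: Hi; clra.
rewrite bzE // in H2.
have -> : ln M x * (i + 1) = ln M x * i + ln M x by clra.
rewrite exD; [|exact: lg_le (ln_lg z) Bi|exact: ln_lg].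
split; first by have := ml_le2 H1 x1; rewrite ml1.
by apply: ml_le2 => //; have := lt_exln x; clra.
Qed.
Lemma powD i j : i + j <= n -> pow z x (i + j) = pow z x i * pow z x j.
Proof.
move=> Hij; have lgn : lg n by apply: (lg_le (ln_lg z)); apply: pow_lgn.
have lgj : lg j by apply: (lg_le lgn); move: Hij; clra.
apply: (LIND_le (P := fun j' => pow z x (i + j') =
  pow z x i * pow z x j') _ lgj _ _ (mle_refl j)); first df.
  by rewrite pow0 ml1 ad0.
move=> k Hk E; have -> : i + (k + 1) = i + k + 1 by clra.
rewrite powS; last by move: Hk Hij; clra.
by rewrite E powS; [clra|move: Hk Hij; clra].
Qed.
Lemma pow_neq0 i : i <= n -> pow z x i <> 0.
Proof. by move=> Hi; apply/neq0; case: (pow_bounds Hi). Qed.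
End Powers.

(** In the code ⟨l, w⟩ of a sequence of length k, |w| = k l + 1. *)
Definition seqlen a : M := dv (monus (ln M (p2 a)) 1) (p1 a).
Lemma Df_seqlen b F : Df b F -> Df b (fun r => seqlen (F r)).
Proof. by rewrite /seqlen => *; df. Qed.
Hint Resolve Df_seqlen : pv.
Lemma seqlenP a k : isseq a k -> seqlen a = k.
Proof.
move=> [l [w [Hl [-> E]]]]; rewrite /seqlen p1_pr p2_pr E su_ad monus_S.
by apply: (proj1 (dv_unique (r := 0) _ _)); [rewrite ad0 ml_comm|move: Hl; clra].
Qed.

(** Coordinates below [i] are the digits of [a] in blocks of |q| bits; the coordinate [i] has
    the code [c]; those above [i] are taken from the tuple [Y]. *)
Definition hyb z lt q a Y i c j : M :=
  cond (leb (j + 1) i) (2 * rd (ln M q) a j)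
    (cond (eqt j i) (mn c (mask z lt)) (ent Y j)).

Lemma htup_ex : exists T : M -> M -> M -> M -> M -> M -> M -> M -> M,
  Df false (fun r => T (r 0%N) (r 1%N) (r 2%N) (r 3%N) (r 4%N) (r 5%N) (r 6%N) (r 7%N)) /\
  forall z lt q n a Y i c, 1 <= lt -> lt * n <= ln M z ->
    (forall j, j < n -> hyb z lt q a Y i c j < ex lt) ->
    isseq (T z lt q n a Y i c) n /\ forall j, j < n ->
      ent (T z lt q n a Y i c) j = hyb z lt q a Y i c j.
Proof.
have D : Df false (fun r : nat ->
  M => hyb (r 1%N) (r 2%N) (r 3%N) (r 4%N) (r 5%N) (r 6%N) (r 7%N) (r 0%N)).
  by rewrite /hyb; df.
have [sq [Ds Hs]] := seq_of D.
exists (fun z lt q n a Y i c => sq z lt n (ocons z (ocons lt (ocons q (ocons a (ocons Y (ocons i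
  (ocons c enil)))))))).
split.
  apply: (Df_under Ds (E := fun r => ocons (r 0%N) (ocons (r 1%N) (ocons (r 3%N)
    (ocons (r 0%N) (ocons (r 1%N) (ocons (r 2%N) (ocons (r 4%N) (ocons (r 5%N) (ocons (r 6%N)
      (ocons (r 7%N) enil))))))))))).
  df.
by move=> z lt q n a Y i c H1 H2 H3;
  have [] := Hs z lt n (ocons z (ocons lt (ocons q (ocons a (ocons Y (ocons i (ocons c
    enil))))))) H1 H2 H3.
Qed.

Definition htup : M -> M -> M -> M -> M -> M -> M -> M -> M. pick htup_ex. Defined.
Lemma htup_spec z lt q n a Y i c : 1 <= lt -> lt * n <= ln M z ->
    (forall j, j < n -> hyb z lt q a Y i c j < ex lt) ->
    isseq (htup z lt q n a Y i c) n /\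
    forall j, j < n -> ent (htup z lt q n a Y i c) j = hyb z lt q a Y i c j.
Proof. exact: (proj2 (proj2_sig (constructive_indefinite_description _ htup_ex)) z lt q n a Y i
  c). Qed.
Lemma Df_htup b F1 F2 F3 F4 F5 F6 F7 F8 : Df b F1 -> Df b F2 -> Df b F3 -> Df b F4 ->
  Df b F5 -> Df b F6 -> Df b F7 -> Df b F8 ->
  Df b (fun r => htup (F1 r) (F2 r) (F3 r) (F4 r) (F5 r) (F6 r) (F7 r) (F8 r)).
Proof.
move=> *; apply: (@Df_under M (fun r =>
  htup (r 0%N) (r 1%N) (r 2%N) (r 3%N) (r 4%N) (r 5%N) (r 6%N) (r 7%N)) b
  (fun r => ocons (F1 r) (ocons (F2 r) (ocons (F3 r) (ocons (F4 r) (ocons (F5 r) (ocons (F6 r)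
    (ocons (F7 r) (ocons (F8 r) enil))))))))).
  exact: (proj1 (proj2_sig (constructive_indefinite_description _ htup_ex))).
df.
Qed.
Hint Resolve Df_htup : pv.

Lemma dseq_ex : exists T : M -> M -> M -> M -> M -> M,
  Df false (fun r => T (r 0%N) (r 1%N) (r 2%N) (r 3%N) (r 4%N)) /\
  forall z lt q n Y, 1 <= lt -> lt * n <= ln M z -> 1 <= q -> 2 * q <= ex lt ->
    [/\ isseq (T z lt q n Y) n,
        forall j, j < n -> ent (T z lt q n Y) j = 2 * md (dv Y (pow z q j)) q
      & T z lt q n Y <= pr lt (2 * ex (lt * n))].
Proof.
have D : Df false (fun r : nat ->
  M => 2 * md (dv (r 3%N) (pow (r 1%N) (r 2%N) (r 0%N))) (r 2%N)) by df.
have [sq [Ds Hs]] := seq_of D.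
exists (fun z lt q n Y => sq z lt n (ocons z (ocons q (ocons Y enil)))).
split.
  apply: (Df_under Ds (E := fun r => ocons (r 0%N) (ocons (r 1%N) (ocons (r 3%N)
    (ocons (r 0%N) (ocons (r 2%N) (ocons (r 4%N) enil))))))).
  df.
move=> z lt q n Y H1 H2 Hq H3; apply: Hs => // j Hj; env.
have := md_lt (dv Y (pow z q j)) (proj2 (neq0 q) Hq).
by move: H3; clra.
Qed.

Definition dseq : M -> M -> M -> M -> M -> M. pick dseq_ex. Defined.
Lemma dseq_spec z lt q n Y : 1 <= lt -> lt * n <= ln M z -> 1 <= q -> 2 * q <= ex lt ->
    [/\ isseq (dseq z lt q n Y) n,
        forall j, j < n -> ent (dseq z lt q n Y) j = 2 * md (dv Y (pow z q j)) q
      & dseq z lt q n Y <= pr lt (2 * ex (lt * n))].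
Proof. exact: (proj2 (proj2_sig (constructive_indefinite_description _ dseq_ex)) z lt q n Y). Qed.
Lemma Df_dseq b F1 F2 F3 F4 F5 : Df b F1 -> Df b F2 -> Df b F3 -> Df b F4 -> Df b F5 ->
  Df b (fun r => dseq (F1 r) (F2 r) (F3 r) (F4 r) (F5 r)).
Proof.
move=> *; apply: (@Df_under M (fun r => dseq (r 0%N) (r 1%N) (r 2%N) (r 3%N) (r 4%N)) b
  (fun r => ocons (F1 r) (ocons (F2 r) (ocons (F3 r) (ocons (F4 r) (ocons (F5 r) enil)))))).
  exact: (proj1 (proj2_sig (constructive_indefinite_description _ dseq_ex))).
df.
Qed.
Hint Resolve Df_dseq : pv.

Definition gout z l lt q n C a Y i c : M :=
  monus (ev z l C (monus (seqlen C) 1) (htup z lt q n a Y i c) (monus (seqlen C) 1)) 1.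
Definition zerot c : M := eqt (ipos c) (ineg c).
Lemma Df_gout b F1 F2 F3 F4 F5 F6 F7 F8 F9 F10 : Df b F1 -> Df b F2 -> Df b F3 -> Df b F4 ->
  Df b F5 -> Df b F6 -> Df b F7 -> Df b F8 -> Df b F9 -> Df b F10 ->
  Df b (fun r => gout (F1 r) (F2 r) (F3 r) (F4 r) (F5 r) (F6 r) (F7 r) (F8 r) (F9 r) (F10 r)).
Proof. by rewrite /gout => *; df. Qed.
Lemma Df_zerot b F : Df b F -> Df b (fun r => zerot (F r)).
Proof. by rewrite /zerot => *; df. Qed.
Hint Resolve Df_gout Df_zerot : pv.

(** ** Counting the roots on a line, and finding the one of a given rank *)

Lemma cnt_ex : exists K : M -> M -> M -> M -> M -> M -> M -> M -> M -> M -> M,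
  Df false (fun r => K (r 0%N) (r 1%N) (r 2%N) (r 3%N) (r 4%N) (r 5%N) (r 6%N) (r 7%N) (r 8%N) (r
    9%N)) /\
  forall z l lt q n C a Y i, K z l lt q n C a Y i 0 = 0 /\
    forall x, x < ln M z -> K z l lt q n C a Y i (x + 1) =
      K z l lt q n C a Y i x + zerot (gout z l lt q n C a Y i (2 * x)).
Proof.
have DH : Df false (fun r : nat -> M => r 1%N +
  zerot (gout (r 2%N) (r 3%N) (r 4%N) (r 5%N) (r 6%N) (r 7%N) (r 8%N) (r 9%N) (r 10%N) (2 * r
    0%N))) by df.
have [I [DI HI]] := @iterate M (fun=> 0) _ (fun r => r 0%N) ltac:(df) DH ltac:(df).
exists (fun z l lt q n C a Y i x => I z x (ocons z (ocons l (ocons lt (ocons q (ocons n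
  (ocons C (ocons a (ocons Y (ocons i enil)))))))))); split.
  apply: (Df_under DI (E := fun r => ocons (r 0%N) (ocons (r 9%N) (ocons (r 0%N) (ocons (r 1%N)
   (ocons (r 2%N) (ocons (r 3%N) (ocons (r 4%N) (ocons (r 5%N) (ocons (r 6%N) (ocons (r 7%N)
     (ocons (r 8%N) enil)))))))))))).
  df.
move=> z l lt q n C a Y i; set R := ocons z _; have [I0 IS] := HI z R.
have E0 : I z 0 R = 0 by apply: (ismin_le I0); apply: mle0.
split=> // x Hx; have := IS x Hx; rewrite {2 3}/R; env => /ismin_le; apply.
have B : I z x R <= x.
  case: (eq0_or x) => [->|Hx0]; first by rewrite E0; apply: mle_refl.
  have Ei := @monusK M x 1 Hx0; set x' := monus x 1 in Ei.
  have Hx' : x' < ln M z by move: Ei Hx; clra.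
  by have := IS x' Hx'; rewrite {2 3}/R; env; rewrite Ei => /ismin_leq.
have := leb_le1 (ipos (gout z l lt q n C a Y i (2 * x))) (ineg (gout z l lt q n C a Y i (2 * x))).
rewrite /zerot; case: (classic (ipos (gout z l lt q n C a Y i (2 * x)) =
  ineg (gout z l lt q n C a Y i (2 * x)))) => [->|N] _.
  by rewrite eqt1; clear -B; mlra.
by rewrite eqt0 //; clear -B; mlra.
Qed.

Definition cnt : M -> M -> M -> M -> M -> M -> M -> M -> M -> M -> M. pick cnt_ex. Defined.
Lemma cnt_spec z l lt q n C a Y i : cnt z l lt q n C a Y i 0 = 0 /\
    forall x, x < ln M z -> cnt z l lt q n C a Y i (x + 1) =
      cnt z l lt q n C a Y i x + zerot (gout z l lt q n C a Y i (2 * x)).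
Proof. exact: (proj2 (proj2_sig (constructive_indefinite_description _ cnt_ex))). Qed.
Lemma Df_cnt b F1 F2 F3 F4 F5 F6 F7 F8 F9 F10 : Df b F1 -> Df b F2 -> Df b F3 -> Df b F4 ->
  Df b F5 -> Df b F6 -> Df b F7 -> Df b F8 -> Df b F9 -> Df b F10 ->
  Df b (fun r => cnt (F1 r) (F2 r) (F3 r) (F4 r) (F5 r) (F6 r) (F7 r) (F8 r) (F9 r) (F10 r)).
Proof.
move=> *; apply: (@Df_under M (fun r =>
  cnt (r 0%N) (r 1%N) (r 2%N) (r 3%N) (r 4%N) (r 5%N) (r 6%N) (r 7%N) (r 8%N) (r 9%N)) b
  (fun r => ocons (F1 r) (ocons (F2 r) (ocons (F3 r) (ocons (F4 r) (ocons (F5 r) (ocons (F6 r)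
    (ocons (F7 r) (ocons (F8 r) (ocons (F9 r) (ocons (F10 r) enil))))))))))).
  exact: (proj1 (proj2_sig (constructive_indefinite_description _ cnt_ex))).
df.
Qed.
Hint Resolve Df_cnt : pv.

(** The root of rank k is where the counting function passes from k to k + 1. The guard
    [leb (r 3) x], that is q <= x, makes the test fail at the right end, so the search always stops
    inside S_q. *)
Lemma kroot_ex : exists K : M -> M -> M -> M -> M -> M -> M -> M -> M -> M -> M,
  Df false (fun r => K (r 0%N) (r 1%N) (r 2%N) (r 3%N) (r 4%N) (r 5%N) (r 6%N) (r 7%N) (r 8%N) (r
    9%N)) /\
  forall z l lt q n C a Y i k, 1 <= q -> let x := K z l lt q n C a Y i k in
    [/\ x < q, cnt z l lt q n C a Y i x <= k & x + 1 < q -> k < cnt z l lt q n C a Y i (x + 1)].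
Proof.
have [F [DF HF]] := @search M (fun x r => cond (leb (r 3%N) x) 0
   (leb (cnt (r 0%N) (r 1%N) (r 2%N) (r 3%N) (r 4%N) (r 5%N) (r 6%N) (r 7%N) (r 8%N) x) (r 9%N)))
  (fun r => r 3%N) ltac:(df) ltac:(df).
exists (fun z l lt q n C a Y i k => F (ocons z (ocons l (ocons lt (ocons q (ocons n
  (ocons C (ocons a (ocons Y (ocons i (ocons k enil))))))))))); split.
  by apply: (Df_under DF (E := fun r => ocons (r 0%N) (ocons (r 1%N) (ocons (r 2%N) (ocons (r 3%N)
   (ocons (r 4%N) (ocons (r 5%N) (ocons (r 6%N) (ocons (r 7%N) (ocons (r 8%N) (ocons (r 9%N)
     enil))))))))))); df.
move=> z l lt q n C a Y i k Hq; set R := ocons z _; rewrite /=; set x := F R.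
pose T y := cond (leb q y) 0 (leb (cnt z l lt q n C a Y i y) k).
have HH : T 0 <> 0 -> T (pw q) = 0 -> T x <> 0 /\ T (x + 1) = 0 := HF R.
have [||] := HH; rewrite {HH}/T.
- rewrite leb0 // cond0 (proj1 (cnt_spec z l lt q n C a Y i)); apply/lebP; exact: mle0.
- by rewrite leb1 ?cond1 //; have := lt_pw q; clra.
case: (classic (q <= x)) => L; first by rewrite (leb1 L) cond1 => /(_ erefl).
have L' : x < q by apply/mnot_le.
rewrite (leb0 L') cond0.
move=> /lebP H K; split=> //.
move=> L2; apply/mnot_le => N; move: K; rewrite (@leb0 M q); last by clear -L2; mlra.
by rewrite cond0 leb1 //; apply: neq10.
Qed.

Definition kroot : M -> M -> M -> M -> M -> M -> M -> M -> M -> M -> M. pick kroot_ex. Defined.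
Lemma kroot_spec z l lt q n C a Y i k : 1 <= q -> let x := kroot z l lt q n C a Y i k in
    [/\ x < q, cnt z l lt q n C a Y i x <= k & x + 1 < q -> k < cnt z l lt q n C a Y i (x + 1)].
Proof. exact: (proj2 (proj2_sig (constructive_indefinite_description _ kroot_ex)) z l lt q n C a
  Y i k). Qed.
Lemma Df_kroot b F1 F2 F3 F4 F5 F6 F7 F8 F9 F10 : Df b F1 -> Df b F2 -> Df b F3 -> Df b F4 ->
  Df b F5 -> Df b F6 -> Df b F7 -> Df b F8 -> Df b F9 -> Df b F10 ->
  Df b (fun r => kroot (F1 r) (F2 r) (F3 r) (F4 r) (F5 r) (F6 r) (F7 r) (F8 r) (F9 r) (F10 r)).
Proof.
move=> *; apply: (@Df_under M (fun r =>
  kroot (r 0%N) (r 1%N) (r 2%N) (r 3%N) (r 4%N) (r 5%N) (r 6%N) (r 7%N) (r 8%N) (r 9%N)) b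
  (fun r => ocons (F1 r) (ocons (F2 r) (ocons (F3 r) (ocons (F4 r) (ocons (F5 r) (ocons (F6 r)
    (ocons (F7 r) (ocons (F8 r) (ocons (F9 r) (ocons (F10 r) enil))))))))))).
  exact: (proj1 (proj2_sig (constructive_indefinite_description _ kroot_ex))).
df.
Qed.
Hint Resolve Df_kroot : pv.

(** The code of a root is [(lo + q^i hi) * (n d) + (i d + k)], where [k] is the rank of the
    [i]-th coordinate among the roots on its line. *)
Definition rootdec z l lt q n d C a v : M :=
  let i := dv (md v (n * d)) d in
  let k := md (md v (n * d)) d in
  let rest := dv v (n * d) in
  let lo := md rest (pow z q i) in
  let hi := dv rest (pow z q i) in
  lo + pow z q i * (kroot z l lt q n C a (dseq z lt q n (hi * pow z q (i + 1))) i k + q * hi).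
Lemma Df_rootdec b F1 F2 F3 F4 F5 F6 F7 F8 F9 : Df b F1 -> Df b F2 -> Df b F3 -> Df b F4 ->
  Df b F5 -> Df b F6 -> Df b F7 -> Df b F8 -> Df b F9 ->
  Df b (fun r => rootdec (F1 r) (F2 r) (F3 r) (F4 r) (F5 r) (F6 r) (F7 r) (F8 r) (F9 r)).
Proof. by rewrite /rootdec /= => *; df. Qed.
Hint Resolve Df_rootdec : pv.

Definition digit z R zeta t : M := md (dv zeta (pow z R t)) R.
Lemma Df_digit b F1 F2 F3 F4 : Df b F1 -> Df b F2 -> Df b F3 -> Df b F4 ->
  Df b (fun r => digit (F1 r) (F2 r) (F3 r) (F4 r)).
Proof. by rewrite /digit => *; df. Qed.
Hint Resolve Df_digit : pv.

(** [zeta] carries one root code for each point, as a digit in base n d q^(n - 1); the decoded roots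
    are put together as digits in base q^n. *)
Lemma prod_ex : exists K : M -> M -> M -> M -> M -> M -> M -> M -> M -> M -> M,
  Df false (fun r => K (r 0%N) (r 1%N) (r 2%N) (r 3%N) (r 4%N) (r 5%N) (r 6%N) (r 7%N) (r 8%N) (r
    9%N)) /\
  forall z l lt q n d C a zeta, K z l lt q n d C a zeta 0 = 0 /\
    forall t, t < ln M z ->
      let y := K z l lt q n d C a zeta t +
        rootdec z l lt q n d C a (digit z (n * d * pow z q (monus n 1)) zeta t) * pow z q (n * t) in
      y <= pow z q (n * (t + 1)) -> K z l lt q n d C a zeta (t + 1) = y.
Proof.
have DH : Df false (fun r : nat -> M => r 1%N +
  rootdec (r 2%N) (r 3%N) (r 4%N) (r 5%N) (r 6%N) (r 7%N) (r 8%N) (r 9%N)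
    (digit (r 2%N) (r 6%N * r 7%N * pow (r 2%N) (r 5%N) (monus (r 6%N) 1)) (r 10%N) (r 0%N))
   * pow (r 2%N) (r 5%N) (r 6%N * r 0%N)) by df.
have [I [DI HI]] := @iterate M (fun=> 0) _ (fun r =>
  pow (r 1%N) (r 4%N) (r 5%N * r 0%N)) ltac:(df) DH ltac:(df).
exists (fun z l lt q n d C a zeta x => I z x (ocons z (ocons l (ocons lt (ocons q (ocons n
  (ocons d (ocons C (ocons a (ocons zeta enil)))))))))); split.
  apply: (Df_under DI (E := fun r => ocons (r 0%N) (ocons (r 9%N) (ocons (r 0%N) (ocons (r 1%N)
   (ocons (r 2%N) (ocons (r 3%N) (ocons (r 4%N) (ocons (r 5%N) (ocons (r 6%N) (ocons (r 7%N)
     (ocons (r 8%N) enil)))))))))))).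
  df.
move=> z l lt q n d C a zeta; set R := ocons z _; have [I0 IS] := HI z R.
split; first by apply: (ismin_le I0); apply: mle0.
by move=> t Ht y Hy; have := IS t Ht; rewrite {2 3}/R; env => /ismin_le; apply.
Qed.

Definition prod : M -> M -> M -> M -> M -> M -> M -> M -> M -> M -> M. pick prod_ex. Defined.
Lemma prod_spec z l lt q n d C a zeta : prod z l lt q n d C a zeta 0 = 0 /\
    forall t, t < ln M z ->
      let y := prod z l lt q n d C a zeta t +
        rootdec z l lt q n d C a (digit z (n * d * pow z q (monus n 1)) zeta t) * pow z q (n * t) in
      y <= pow z q (n * (t + 1)) -> prod z l lt q n d C a zeta (t + 1) = y.
Proof. exact: (proj2 (proj2_sig (constructive_indefinite_description _ prod_ex))). Qed.
Lemma Df_prod b F1 F2 F3 F4 F5 F6 F7 F8 F9 F10 : Df b F1 -> Df b F2 -> Df b F3 -> Df b F4 ->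
  Df b F5 -> Df b F6 -> Df b F7 -> Df b F8 -> Df b F9 -> Df b F10 ->
  Df b (fun r => prod (F1 r) (F2 r) (F3 r) (F4 r) (F5 r) (F6 r) (F7 r) (F8 r) (F9 r) (F10 r)).
Proof.
move=> *; apply: (@Df_under M (fun r =>
  prod (r 0%N) (r 1%N) (r 2%N) (r 3%N) (r 4%N) (r 5%N) (r 6%N) (r 7%N) (r 8%N) (r 9%N)) b
  (fun r => ocons (F1 r) (ocons (F2 r) (ocons (F3 r) (ocons (F4 r) (ocons (F5 r) (ocons (F6 r)
    (ocons (F7 r) (ocons (F8 r) (ocons (F9 r) (ocons (F10 r) enil))))))))))).
  exact: (proj1 (proj2_sig (constructive_indefinite_description _ prod_ex))).
df.
Qed.

End Decoding.
#[global] Opaque pow htup dseq cnt kroot prod.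

(** ** Roots on a line *)

Section Tuples.
Variable M : s12.
Local Open Scope M_scope.
Implicit Types x y z u v w c i j k l n o a b s q C d J D Y B A : M.

Lemma mlt_trichotomy x y : [\/ x < y, x = y | y < x].
Proof.
case: (classic (x <= y)) => [H|/mnot_le]; last by constructor 3.
case: (classic (y <= x)) => [K|/mnot_le]; last by constructor 1.
by constructor 2; apply: mle_antisym.
Qed.

Lemma le_pr x y : x <= pr x y /\ y <= pr x y.
Proof.
rewrite /pr; split; first by have := mle0 ((x + y) * (x + y)); clra.
case: (eq0_or y) => [->|H]; first exact: mle0.
have H' : 1 <= x + y by move: H (mle0 x); clra.
have := ml_le2 H' (mle_refl (x + y)); rewrite (ml_comm 1) ml1.
by move: (mle0 x); clra.
Qed.

Lemma ent_le a k j : isseq a k -> j < k -> ent a j <= a.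
Proof.
move=> S Hj; have /(entryP _ _ S) := conj Hj (erefl (ent a j)); move: (ent a j) => u.
move=> [l [w [hi [lo [p [q [-> [/pow2P[Hl ->] [/pow2P[Hp ->] [Ew _]]]]]]]]]].
apply: (mle_trans (y := w)); split; last by case: (le_pr l w).
have := ml_le2 (ex_ge1 Hp) (mle_refl (hi * ex l + u)).
rewrite (ml_comm 1) ml1 Ew (ml_comm (ex (j * l))).
by move: (mle0 (hi * ex l)) (mle0 lo); clra.
Qed.

Lemma hf_le x : hf M x <= x.
Proof. by have := hf_bounds x; have := mle0 (hf M x); clear; move=> H [K _]; mlra. Qed.

Lemma le_exln x y : x <= y -> x <= ex (ln M y).
Proof. by have := lt_exln y; clra. Qed.

(** Codes of the same tuple may differ in their block length, so tuples are always compared entry by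
    entry. *)
Lemma eval_nonzero_ext C a a' n : isseq a n -> isseq a' n ->
  (forall j, j < n -> ent a j = ent a' j) -> eval_nonzero C a -> eval_nonzero C a'.
Proof.
move=> S S' E [o [t [z [So [[St Ht] [Et Nz]]]]]]; exists o, t, z; do 3!split=> //.
move=> i z' H; have [g [Eg K]] := Ht i z' H; exists g; split=> //.
case: K => [[j [Ej Hj]]|K]; [left; exists j; split=> //|by right].
by move: Hj; rewrite !(entryP _ _ S) !(entryP _ _ S') => -[Hj ->]; split=> //; apply: E.
Qed.

End Tuples.

Section Line.
Variable M : s12.
Local Open Scope M_scope.
Implicit Types x y u v c i j k a Y B z l lt q n d C o A b w : M.
Hint Resolve Df_iadd Df_imul Df_EV Df_ipos Df_ineg Df_evg Df_ev Df_mx Df_pow Df_seqlen Df_htup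
  Df_dseq
  Df_gout Df_zerot Df_cnt Df_kroot Df_rootdec Df_digit Df_prod Df_ap5 : pv.

(** The sizes needed to evaluate C along coordinate lines: 2^A bounds the constants and q and is the
    intended bound for coordinates, w bounds the total degree (o < A), 2^b is the large argument of
    [root_bound], l bits hold a value with its marker, lt bits hold a coordinate, and |z| has room
    for whole tables of either kind. *)
Record line z l lt q n d C o A b w : Prop := Line {
  line_slp : is_slp C n o;
  line_vars : forall j, j < n -> deg_le (fun _ g => g = g_var j) C o d;
  line_consts : forall c, c <= o /\ (exists x, entryM C c (g_const x)) ->
    deg_le (fun i _ => i = c) C o d;
  line_lgA : lg A; line_lgn : lg n; line_lgq : lg q;
  line_n1 : 1 <= n; line_q1 : 1 <= q; line_dq : d < q; line_qA : ln M q <= A; line_CA : ln M C <= A;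
  line_w : (n + A + 1) * d <= w;
  line_b : w * (A + A) + (ln M q * q + 1) * q + A + su M 2 <= b;
  line_l : b * w + w * (A + A) + su M 2 <= l;
  line_lt : b + A + su M 2 <= lt;
  line_z1 : l * (A + 1) <= ln M z;
  line_z2 : lt * n <= ln M z }.

Definition below q n A a Y i : Prop := i <= n /\ (forall j, j < i -> rd (ln M q) a j < q) /\
  forall j, j < n -> hf M (ent Y j) <= ex A.

Lemma line_lg z l lt q n d C o A b w : line z l lt q n d C o A b w ->
  [/\ lg l, lg lt, lg b & lg (b + A)].
Proof.
move=> LN; have [slp vd cd lgA lgn lgq n1 q1 dq qA CA wE bE lE ltE z1 z2] := LN.
have L1 : lg lt by apply: (lg_le (ln_lg z)); apply: (mle_trans (y := lt * n)); split=> //;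
  rewrite -{1}(ml1 lt); apply: ml_mono.
have L2 : lg (b + A) by apply: (lg_le L1); move: ltE; clra.
split=> //.
  apply: (lg_le (ln_lg z)); apply: (mle_trans (y := l * (A + 1))); split=> //.
  by rewrite -{1}(ml1 l); apply: ml_mono; move: (mle0 A); clra.
by apply: (lg_le L2); move: (mle0 A); clra.
Qed.
Lemma line_qex z l lt q n d C o A b w : line z l lt q n d C o A b w -> q < ex A.
Proof.
move=> LN; have [slp vd cd lgA lgn lgq n1 q1 dq qA CA wE bE lE ltE z1 z2] := LN.
exact/ln_ex. Qed.
Lemma line_l1 z l lt q n d C o A b w : line z l lt q n d C o A b w -> 1 <= l.
Proof.
move=> LN; have [slp vd cd lgA lgn lgq n1 q1 dq qA CA wE bE lE ltE z1 z2] := LN.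
by move: lE (mle0 (b * w)) (mle0 (w * (A + A))); clra. Qed.
(** C consists of o + 1 blocks of at least one bit, hence o < |C| <= A. *)
Lemma line_oA z l lt q n d C o A b w : line z l lt q n d C o A b w -> o < A.
Proof.
move=> LN; have [slp vd cd lgA lgn lgq n1 q1 dq qA CA wE bE lE ltE z1 z2] := LN.
have [[l' [c [Hl [E Ec]]]] _] := slp; apply/mnot_le => N.
have : ln M c <= ln M C by apply: ln_mono; rewrite E; case: (le_pr l' c).
have := ml_mono (su M o) Hl; rewrite ml1 Ec.
by move: CA N; clra.
Qed.
Lemma line_size z l lt q n d C o A b w : line z l lt q n d C o A b w -> l * su M o <= ln M z.
Proof.
move=> LN; have [slp vd cd lgA lgn lgq n1 q1 dq qA CA wE bE lE ltE z1 z2] := LN.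
apply: (mle_trans (y := l * (A + 1))); split=> //; apply: ml_mono.
by move: (line_oA LN); clra.
Qed.
Lemma line_exlt z l lt q n d C o A b w : line z l lt q n d C o A b w ->
  2 * ex (b + A) + 2 <= ex lt /\ ex A <= ex (b + A).
Proof.
move=> LN; have [slp vd cd lgA lgn lgq n1 q1 dq qA CA wE bE lE ltE z1 z2] := LN.
have [_ L1 _ L2] := (line_lg LN); split; last by apply: ex_mono => //; move: (mle0 b); clra.
apply: (mle_trans (y := ex (b + A + 1 + 1))); split; last first.
  by apply: ex_mono => //; move: ltE; clra.
rewrite !exS //; last exact: lgS.
by have := ex_ge1 L2; clra.
Qed.
Lemma line_const z l lt q n d C o A b w i c : line z l lt q n d C o A b w -> i <= o ->
  ent C i = g_const c -> hf M c <= ex A.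
Proof.
move=> LN; have [slp vd cd lgA lgn lgq n1 q1 dq qA CA wE bE lE ltE z1 z2] := LN.
move=> Hi E; apply: (mle_trans (y := c)); split; first exact: hf_le.
apply: (mle_trans (y := ex (ln M C))); split; last exact: ex_mono.
apply: le_exln; apply: (mle_trans (y := ent C i)); split.
  by rewrite E; case: (le_pr 1 c).
by apply: (ent_le (proj1 slp)); move: Hi; clra.
Qed.
(** The size bound with e = 0, no coordinate being singled out, shows that the output fits into its
    block and so is computed. *)
Lemma line_ev z l lt q n d C o A b w t : line z l lt q n d C o A b w -> (forall j, j < n ->
  hf M (ent t j) <= ex A) -> ev z l C o t o <> 0.
Proof.
move=> LN; have [slp vd cd lgA lgn lgq n1 q1 dq qA CA wE bE lE ltE z1 z2] := LN.
move=> Ht; have [W [DW SW W1 Ww _]] := ckt_weights slp lgn vd cd.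
have S0 : supra C o (fun=> 0) by move=> i u v _; rewrite ad0; split=> _; [split|]; apply: mle_refl.
have Wo : W o <= w.
  apply: (mle_trans (y := (n + o + 1) * d)); split=> //.
  apply: (mle_trans (y := (n + A + 1) * d)); split=> //; rewrite (ml_comm _ d) (ml_comm _ d).
  by apply: ml_mono; move: (line_oA LN); clra.
have Lw : b * w + w * (A + o) + su M 2 <= l.
  apply: (mle_trans (y := b * w + w * (A + A) + su M 2)); split=> //.
  have K : w * (A + o) <= w * (A + A) by apply: ml_mono; move: (line_oA LN); clra.
  by move: K; clra.
have := value_size slp (line_size LN) (line_l1 LN) (e := fun=> 0) (t := t) DW ltac:(df) SW S0
   (fun i Hi => conj (W1 i Hi) (mle0 (W i))) _ (fun i c =>
     line_const (i := i) (c := c) LN) Lw (i := o).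
case=> //.
- by move=> i j _ _ Hj _; rewrite ml0 ad_comm ad0; apply: Ht.
- by clra.
Qed.

Lemma hyb_bound z l lt q n d C o A b w a Y i c j : line z l lt q n d C o A b w ->
  below q n A a Y i -> j < n -> hyb z lt q a Y i c j < ex lt.
Proof.
move=> LN BL; have [slp vd cd lgA lgn lgq n1 q1 dq qA CA wE bE lE ltE z1 z2] := LN;
  have [iln [aq YA]] := BL.
move=> Hj; have [_ L1 _ L2] := (line_lg LN); rewrite /hyb.
have [E1 E2] := (line_exlt LN).
case: (classic (j + 1 <= i)) => [L|N].
  rewrite leb1 // cond1; have := aq j ltac:(move: L; clra).
  by move: (line_qex LN) E1 E2; clra.
rewrite leb0; last by apply/mnot_le.
rewrite cond0; case: (classic (j = i)) => [->|N2].
  rewrite eqt1 cond1; have [_ H] := mn_le c (mask z lt).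
  have ltz : lt <= ln M z by apply: (mle_trans (y := lt * n)); split=> //; rewrite -{1}(ml1 lt);
    apply: ml_mono.
  by have := mask_ex1 ltz; move: H; clra.
rewrite eqt0 // cond0; have := YA j Hj; have := hf_bounds (ent Y j).
by move: E1 E2; clear; move=> E1 E2 [_ H] K; mlra.
Qed.
Lemma htup_seq z l lt q n d C o A b w a Y i c : line z l lt q n d C o A b w ->
  below q n A a Y i -> isseq (htup z lt q n a Y i c) n.
Proof.
move=> LN BL; have [slp vd cd lgA lgn lgq n1 q1 dq qA CA wE bE lE ltE z1 z2] := LN;
  have [iln [aq YA]] := BL.
apply: (proj1 (htup_spec _ z2 _)); last by move=> j; apply: (hyb_bound c LN BL).
by move: ltE (mle0 (b + A)); clra.
Qed.
Lemma htup_ent z l lt q n d C o A b w a Y i c j : line z l lt q n d C o A b w ->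
  below q n A a Y i -> j < n -> ent (htup z lt q n a Y i c) j = hyb z lt q a Y i c j.
Proof.
move=> LN BL; have [slp vd cd lgA lgn lgq n1 q1 dq qA CA wE bE lE ltE z1 z2] := LN;
  have [iln [aq YA]] := BL.
apply: (proj2 (htup_spec _ z2 _)); last by move=> k; apply: (hyb_bound c LN BL).
by move: ltE (mle0 (b + A)); clra.
Qed.
Lemma htup_lo z l lt q n d C o A b w a Y i c j : line z l lt q n d C o A b w ->
  below q n A a Y i -> j < i -> ent (htup z lt q n a Y i c) j = 2 * rd (ln M q) a j.
Proof.
move=> LN BL; have [slp vd cd lgA lgn lgq n1 q1 dq qA CA wE bE lE ltE z1 z2] := LN;
  have [iln [aq YA]] := BL.
move=> Hj; rewrite (htup_ent c LN BL) /hyb ?leb1 ?cond1 //.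
- by move: Hj; clra.
- by move: Hj iln; clra.
Qed.
Lemma htup_hi z l lt q n d C o A b w a Y i c j : line z l lt q n d C o A b w ->
  below q n A a Y i -> i < j -> j < n -> ent (htup z lt q n a Y i c) j = ent Y j.
Proof.
move=> LN BL; have [slp vd cd lgA lgn lgq n1 q1 dq qA CA wE bE lE ltE z1 z2] := LN;
  have [iln [aq YA]] := BL.
move=> Hi Hj; rewrite (htup_ent c LN BL) // /hyb leb0 ?cond0; last by move: Hi; clra.
by rewrite eqt0 ?cond0 // => E; move: Hi; rewrite E; clra.
Qed.
Lemma htup_at z l lt q n d C o A b w a Y i c : line z l lt q n d C o A b w ->
  below q n A a Y i -> i < n -> hf M c <= ex (b + A) -> ent (htup z lt q n a Y i c) i = c.
Proof.
move=> LN BL; have [slp vd cd lgA lgn lgq n1 q1 dq qA CA wE bE lE ltE z1 z2] := LN;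
  have [iln [aq YA]] := BL.
move=> Hi Hc; rewrite (htup_ent c LN BL) // /hyb leb0 ?cond0; last by clra.
rewrite eqt1 cond1 mn_l //.
have ltz : lt <= ln M z by apply: (mle_trans (y := lt * n)); split=> //; rewrite -{1}(ml1 lt);
  apply: ml_mono.
have [H1 H2] := (line_exlt LN); have [_ K] := hf_bounds c.
by have := mask_ex1 ltz; move: Hc H1 K; clra.
Qed.

Lemma hyb_hf z l lt q n d C o A b w a Y i c : line z l lt q n d C o A b w -> below q n A a Y i ->
  (i < n -> hf M c <= ex A) -> forall j, j < n -> hf M (ent (htup z lt q n a Y i c) j) <= ex A.
Proof.
move=> LN BL Hc j Hj; have [iln [aq YA]] := BL.
case: (mlt_trichotomy j i) => [L|Eji|L].
- rewrite (htup_lo c LN BL L) (@hf_eq M _ (rd (ln M q) a j)).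
  + by have := aq j L; have := line_qex LN; clra.
  + exact: mle_refl.
  + by clra.
- rewrite Eji in Hj *; have Hc' := Hc Hj; rewrite (htup_at LN BL Hj) //.
  by apply: (mle_trans (y := ex A)); split=> //; case: (line_exlt LN).
- by rewrite (htup_hi c LN BL L Hj); apply: YA.
Qed.

Lemma goutE z l lt q n d C o A b w a Y i c : line z l lt q n d C o A b w ->
  gout z l lt q n C a Y i c = monus (ev z l C o (htup z lt q n a Y i c) o) 1.
Proof.
move=> LN; have [[S _] _ _ _ _ _ _ _ _ _ _ _ _ _ _ _ _] := LN.
by rewrite /gout (seqlenP S) su_ad monus_S.
Qed.

Lemma zerotP x : zerot x = 0 <-> ~ ipos x = ineg x.
Proof.
rewrite /zerot; split=> [E N|]; last exact: eqt0.
by move: E; rewrite N eqt1; apply: neq10.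
Qed.

Lemma ival_neq0 x : ival x <> 0%R <-> ~ ipos x = ineg x.
Proof.
rewrite /ival; split=> N E; apply: N; first by rewrite E subrr.
by apply/eqE; lra.
Qed.

Lemma hyb_nonzero z l lt q n d C o A b w a Y i c : line z l lt q n d C o A b w ->
  below q n A a Y i -> (i < n -> hf M c <= ex A) ->
  (eval_nonzero C (htup z lt q n a Y i c) <-> zerot (gout z l lt q n C a Y i c) = 0).
Proof.
move=> LN BL Hc.
rewrite (eval_nonzeroP (line_slp LN) (line_size LN) (line_l1 LN) (htup_seq c LN BL)
  (line_ev LN (hyb_hf LN BL Hc))).
by rewrite (goutE _ _ _ _ LN) zerotP /val ival_neq0.
Qed.

Lemma line_qz z l lt q n d C o A b w : line z l lt q n d C o A b w -> q <= ln M z.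
Proof.
move=> LN; have [slp vd cd lgA lgn lgq n1 q1 dq qA CA wE bE lE ltE z1 z2] := LN.
apply: (mle_trans (y := lt * n)); split=> //; apply: (mle_trans (y := lt)); split; last first.
  by rewrite -{1}(ml1 lt); apply: ml_mono.
by move: bE ltE (mle0 (w * (A + A))) (mle0 (ln M q * q * q)) (mle0 A); clra.
Qed.

Lemma cnt_step z l lt q n C a Y i x : x < ln M z ->
  let c := gout z l lt q n C a Y i (2 * x) in
  (ipos c = ineg c -> cnt z l lt q n C a Y i (x + 1) = cnt z l lt q n C a Y i x + 1) /\
  (~ ipos c = ineg c -> cnt z l lt q n C a Y i (x + 1) = cnt z l lt q n C a Y i x).
Proof.
move=> Hx c; have [_ /(_ x Hx) ->] := cnt_spec z l lt q n C a Y i; rewrite -/c /zerot.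
by split=> [->|N]; [rewrite eqt1|rewrite eqt0 // ad0].
Qed.

(** The tuples on the line differ in coordinate i only, in which C has degree at most d; the nonroot
    with coordinate v excludes the zero polynomial. *)
Lemma line_cnt z l lt q n d C o A b w a Y i v : line z l lt q n d C o A b w ->
  below q n A a Y i -> i < n -> hf M v <= ex A -> eval_nonzero C (htup z lt q n a Y i v) ->
  cnt z l lt q n C a Y i q <= d.
Proof.
move=> LN BL Hi Hv; have [slp vd cd lgA lgn lgq n1 q1 dq qA CA wE bE lE ltE z1 z2] := LN.
rewrite (eval_nonzeroP (line_slp LN) (line_size LN) (line_l1 LN) (htup_seq v LN BL)
  (line_ev LN (hyb_hf LN BL (fun=> Hv)))) => Nv.
have [W [DW SW W1 Ww He]] := ckt_weights slp lgn vd cd.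
have [e [De Se eW eo e1]] := He i Hi.
have Ao := line_oA LN.
have Wo : W o <= w.
  apply: (mle_trans (y := (n + o + 1) * d)); split=> //.
  apply: (mle_trans (y := (n + A + 1) * d)); split=> //; rewrite (ml_comm _ d) (ml_comm _ d).
  by apply: ml_mono; move: Ao; clra.
have wAo : w * (A + o) <= w * (A + A) by apply: ml_mono; move: Ao; clra.
have bE' : w * (A + o) + (ln M q * q + 1) * q + A + su M 2 <= b by move: wAo bE; clra.
have lE' : b * w + w * (A + o) + su M 2 <= l by move: wAo lE; clra.
have qex : q <= ex A by move: (line_qex LN); clra.
have dq' : d <= q by move: dq; clra.
apply: (root_bound (tup := htup z lt q n a Y i) (W := W) (e := e) (cnt := cnt z l lt q n C a Y i)
  slp (line_size LN) (line_l1 LN) Hi _ _ _ _ _ DW SW W1 Wo De Se eW eo e1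
  (fun i c => line_const (i := i) (c := c) LN) lgq q1 qex dq' bE' lE' _ _ _ Hv Nv).
- df.
- by move=> c; apply: (htup_seq c LN BL).
- by move=> c Hc; apply: (htup_at LN BL).
- by move=> c c' u Hu Nu; rewrite !(htup_ent _ LN BL Hu) /hyb (eqt0 Nu) !cond0.
- move=> c u Hu Nu; have -> : ent (htup z lt q n a Y i c) u = ent (htup z lt q n a Y i 0) u.
    by rewrite !(htup_ent _ LN BL Hu) /hyb (eqt0 Nu) !cond0.
  apply: (hyb_hf LN BL) => // _; apply: (mle_trans (y := 0)); split; [exact: hf_le|exact: mle0].
- df.
- exact: (proj1 (cnt_spec z l lt q n C a Y i)).
- move=> x Hx; have Hx' : x < ln M z by move: Hx (line_qz LN); clra.
  by have := cnt_step l lt q n C a Y i Hx'; rewrite (goutE _ _ _ _ LN).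
Qed.

(** If all points of S_q were roots, the root count up to q would be q > d. *)
Lemma line_nonroot z l lt q n d C o A b w a Y i v : line z l lt q n d C o A b w ->
  below q n A a Y i -> i < n -> hf M v <= ex A -> eval_nonzero C (htup z lt q n a Y i v) ->
  exists2 x, x < q & eval_nonzero C (htup z lt q n a Y i (2 * x)).
Proof.
move=> LN BL Hi Hv Nv; have Hd := line_cnt LN BL Hi Hv Nv; apply: NNPP => N.
have := line_dq LN; apply/mnot_le.
suff -> : q = cnt z l lt q n C a Y i q by [].
apply: (LIND (P := fun x => x = cnt z l lt q n C a Y i x) _ (line_lgq LN)); first by df.
  by rewrite (proj1 (cnt_spec z l lt q n C a Y i)).
move=> x Hx E; have Hx' : x < ln M z by move: Hx (line_qz LN); clra.
have [K _] := cnt_step l lt q n C a Y i Hx'; rewrite K -?E // => {K}.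
apply: NNPP => /zerotP; rewrite -(hyb_nonzero LN BL) => [K|_]; first by case: N; exists x.
rewrite (@hf_eq M _ x); [|exact: mle_refl|by clra].
by move: Hx (line_qex LN); clra.
Qed.

End Line.

(** ** Replacing a nonroot by one in the cube *)

Section Cube.
Variable M : s12.
Local Open Scope M_scope.
Implicit Types x y u v c i j k a t Y B z l lt q n d s C o A b w : M.
Hint Resolve Df_iadd Df_imul Df_EV Df_ipos Df_ineg Df_evg Df_ev Df_mx Df_pow Df_seqlen Df_htup
  Df_dseq
  Df_gout Df_zerot Df_cnt Df_kroot Df_rootdec Df_digit Df_prod Df_ap5 : pv.

(** These parameters meet the inequalities of [line] with as little slack as possible, each defined
    from the preceding ones. They depend on C only through A, hence one choice serves all circuits
    of bounded size. *)
Definition par_w n d A : M := (n + A + 1) * d.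
Definition par_b n d q A : M := par_w n d A * (A + A) + (ln M q * q + 1) * q + A + su M 2.
Definition par_l n d q A : M := par_b n d q A * par_w n d A + par_w n d A * (A + A) + su M 2.
Definition par_lt n d q A : M := par_b n d q A + A + su M 2.
Definition par_z n d q A : M := par_l n d q A * (A + 1) + par_lt n d q A * n.

Lemma par_z_lg n d q A : lg n -> lg d -> lg q -> lg A -> lg (par_z n d q A).
Proof.
move=> Hn Hd Hq HA; have H1 : lg (1 : M) by rewrite -(ln1 M); apply: ln_lg.
have H3 : lg (su M 2 : M) by have -> : su M 2 = 1 + 1 + 1 :> M; [clra|do 2!apply: lgS].
have Hw : lg (par_w n d A) by apply: lgM => //; apply: lgS; apply: lgD.
have Hb : lg (par_b n d q A).
  apply: lgD => //; apply: lgD => //; apply: lgD; first by apply: lgM => //; apply: lgD.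
  by apply: lgM => //; apply: lgS; apply: lgM => //; apply: ln_lg.
apply: lgD; apply: lgM => //.
- by apply: lgD => //; apply: lgD; apply: lgM => //; apply: lgD.
- exact: lgS.
- by apply: lgD => //; apply: lgD.
Qed.

Lemma line_par z q n d C o A : is_slp C n o ->
  (forall j, j < n -> deg_le (fun _ g => g = g_var j) C o d) ->
  (forall c, c <= o /\ (exists x, entryM C c (g_const x)) -> deg_le (fun i _ => i = c) C o d) ->
  lg A -> lg n -> lg q -> 1 <= n -> 1 <= q -> d < q -> ln M q <= A -> ln M C <= A ->
  par_z n d q A <= ln M z ->
  line z (par_l n d q A) (par_lt n d q A) q n d C o A (par_b n d q A) (par_w n d A).
Proof.
move=> H1 H2 H3 H4 H5 H6 H7 H8 H9 H10 H11 Hz; split=> //; try exact: mle_refl.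
- by apply: (mle_trans (y := par_z n d q A)); split=> //; rewrite /par_z;
  move: (mle0 (par_lt n d q A * n)); clra.
- by apply: (mle_trans (y := par_z n d q A)); split=> //; rewrite /par_z;
  move: (mle0 (par_l n d q A * (A + 1))); clra.
Qed.

Lemma line_qn z l lt q n d C o A b w : line z l lt q n d C o A b w -> ln M q * n <= ln M z.
Proof.
move=> LN; apply: (mle_trans (y := lt * n)); split; last exact: (line_z2 LN).
by apply: ml_le2; last exact: mle_refl; move: (line_lt LN) (line_qA LN) (mle0 b); clra.
Qed.

Lemma rd_low l a x i j : lg (l * (i + 1)) -> j < i -> rd l (a + x * ex (l * i)) j = rd l a j.
Proof.
move=> Hl Hj; apply: rd_add_high => //.
by apply: (lg_le Hl); apply: ml_mono; clra.
Qed.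

Lemma rd_top l a x i : lg l -> lg (l * i) -> a < ex (l * i) -> x < ex l ->
  rd l (a + x * ex (l * i)) i = x.
Proof.
move=> Hl Hi Ha Hx; apply: (rd_unique (hi := 0) (lo := a)) => //.
by clra.
Qed.

(** The induction statement of [cube_point]: [a'] supplies the coordinates below i and [a] the
    others. Nonvanishing is expressed by the computed output, since [eval_nonzero] quantifies over
    traces without a bound. *)
Definition partial z l lt q n C a i (a' : M) : Prop :=
  a' < bz z (ln M q * i) /\ (forall j, j <= ln M z -> j < i -> rd (ln M q) a' j < q) /\
  zerot (gout z l lt q n C a' a i (ent a i)) = 0.

Lemma cube_point C n o d q a : is_slp C n o ->
  (forall j, j < n -> deg_le (fun _ g => g = g_var j) C o d) ->
  (forall c, c <= o /\ (exists x, entryM C c (g_const x)) -> deg_le (fun i _ => i = c) C o d) ->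
  lg n -> lg q -> 1 <= n -> 1 <= q -> d < q -> isseq a n -> eval_nonzero C a ->
  exists a', [/\ a' < ex (ln M q * n), forall j, j < n -> rd (ln M q) a' j < q
    & forall t, isseq t n -> (forall j, j < n -> ent t j = 2 * rd (ln M q) a' j) ->
      eval_nonzero C t].
Proof.
move=> slp vd cd Hn Hq n1 q1 dq Sa Na.
(* The nonroot is arbitrary in Z^n, so its length has to enter A; its entries are at most its
   code. *)
pose A := ln M a + ln M C + ln M q.
have lgA : lg A by apply: lgD; [apply: lgD|]; apply: ln_lg.
have lgd : lg d by apply: (lg_le Hq); move: dq; clra.
have [z Ez] := par_z_lg Hn lgd Hq lgA.
have qA : ln M q <= A by rewrite /A; move: (mle0 (ln M a + ln M C)); clra.
have CA : ln M C <= A by rewrite /A; move: (mle0 (ln M a)) (mle0 (ln M q)); clra.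
have Hz : par_z n d q A <= ln M z by rewrite Ez; apply: mle_refl.
have LN := line_par slp vd cd lgA Hn Hq n1 q1 dq qA CA Hz.
move: (par_l _ _ _ _) (par_lt _ _ _ _) (par_b _ _ _ _) (par_w _ _ _) LN => l lt b w LN {Hz Ez}.
have aA j : j < n -> hf M (ent a j) <= ex A.
  move=> Hj; apply: (mle_trans (y := ent a j)); split; first exact: hf_le.
  apply: (mle_trans (y := a)); split; first exact: ent_le Sa Hj.
  apply: (mle_trans (y := ex (ln M a))); split; first exact/le_exln/mle_refl.
  by apply: ex_mono => //; rewrite /A; move: (mle0 (ln M C)) (mle0 (ln M q)); clra.
have qn := line_qn LN; have nz : n <= ln M z.
  apply: (mle_trans (y := ln M q * n)); split=> //.
  have := ml_le2 (y := ln M q) (x := 1) (z := n) (w := n); rewrite (ml_comm 1) ml1; apply;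
    last exact: mle_refl.
  by rewrite -(ln1 M); apply: ln_mono.
have bzq i : i <= n -> bz z (ln M q * i) = ex (ln M q * i).
  move=> Hi; apply: bzE; apply: (mle_trans (y := ln M q * n)); split=> //; exact: ml_mono.
have lgqn : lg (ln M q * n) := lg_le (ln_lg z) qn.
have BL i a' : i <= n -> partial z l lt q n C a i a' -> below q n A a' a i.
  move=> Hi [_ [H _]]; split=> //; split=> // j Hj; apply: H => //.
  by move: Hj Hi nz; clra.
have [a' [_ P]] : exists a', a' <= bz z (ln M q * n) /\ partial z l lt q n C a n a'.
  apply: (LIND (P := fun i => exists a',
    a' <= bz z (ln M q * i) /\ partial z l lt q n C a i a') _ Hn).
  - apply: (@Sg_ex M (fun r => bz z (ln M q * r 0%N)) (fun a' r =>
    partial z l lt q n C a (r 0%N) a')); first df.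
    rewrite /partial; env.
    apply: Sg_and; first df; apply: Sg_and; last by df.
    apply: (@Sg_sall M true (fun=> z) (fun j r => j < r 1%N -> rd (ln M q) (r 0%N) j < q)); df.
  - exists 0; split; first exact: mle0.
    have H0 : forall j, j < 0 -> rd (ln M q) 0 j < q by move=> j; clra.
    split; first by rewrite ml0 bzE ?ex0; [clra|exact: mle0].
    split; first by move=> j _; apply: H0.
    have B0 : below q n A 0 a 0 by split; [exact: mle0|split].
    apply/(hyb_nonzero LN B0); first exact: aA.
    apply: (eval_nonzero_ext Sa (htup_seq _ LN B0)) Na => j Hj.
    case: (eq0_or j) => [E0|j1]; first by rewrite E0 in Hj *; rewrite (htup_at LN B0 Hj) //;
      apply: (mle_trans (y := ex A)); split; [exact: aA|case: (line_exlt LN)].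
    by rewrite (htup_hi _ LN B0 _ Hj) //; move: j1; clra.
  - move=> i Hi [a' [_ P]]; have Hi' : i <= n by move: Hi; clra.
    have Hi1 : i + 1 <= n by move: Hi; clra.
    have B := BL i a' Hi' P; have [P1 [P2 P3]] := P.
    have N : eval_nonzero C (htup z lt q n a' a i (ent a i)).
      by apply/(hyb_nonzero LN B (fun _ => aA i Hi)).
    have [x Hx Nx] := line_nonroot LN B Hi (aA i Hi) N.
    have [lgi lgi1] := lg_block lgqn Hi.
    have xe : x < ex (ln M q) by have := lt_exln q; move: Hx; clra.
    rewrite (bzq i Hi') in P1.
    pose a2 := a' + x * ex (ln M q * i).
    have E2 : ex (ln M q * (i + 1)) = ex (ln M q * i) * ex (ln M q).
      rewrite -exD //; last exact: ln_lg.
      by congr ex; clra.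
    have L2 : a2 < ex (ln M q * (i + 1)).
      rewrite E2 /a2; have K : x + 1 <= ex (ln M q) by move: xe; clra.
      have := ml_mono (ex (ln M q * i)) K; move: P1; clra.
    have D2 j : j < i -> rd (ln M q) a2 j = rd (ln M q) a' j by apply: rd_low.
    have T2 : rd (ln M q) a2 i = x by apply: rd_top => //; apply: ln_lg.
    have B2 : below q n A a2 a (i + 1).
      split=> //; split=> // j Hj; case: (mlt_trichotomy j i) => [L|->|L].
      - by rewrite D2 //; case: B => [_ [H _]]; apply: H.
      - by rewrite T2.
      - by move: Hj L; clra.
    exists a2; rewrite /partial (bzq _ Hi1); split; first by move: L2; clra.
    split=> //; split; first by move=> j _; case: B2 => [_ [H _]]; apply: H.
    apply/(hyb_nonzero LN B2); first exact: aA.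
    apply: (eval_nonzero_ext (htup_seq _ LN B) (htup_seq _ LN B2)) Nx => j Hj.
    have x2 : hf M (2 * x) <= ex (b + A).
      rewrite (@hf_eq M _ x); [|exact: mle_refl|by clra].
      have [_ K] := line_exlt LN; have := line_qex LN; move: K Hx; clra.
    case: (mlt_trichotomy j i) => [L1|E|L3].
    - rewrite (htup_lo _ LN B L1) (htup_lo _ LN B2) ?D2 //.
      by move: L1; clra.
    - rewrite E (htup_at LN B Hi x2) (htup_lo _ LN B2) ?T2 //.
      by clra.
    rewrite (htup_hi _ LN B L3 Hj); case: (mlt_trichotomy j (i + 1)) => [L4|E|L4].
    - by move: L3 L4; clra.
    - rewrite E in Hj *; rewrite (htup_at LN B2 Hj) //.
      by apply: (mle_trans (y := ex A)); split; [exact: aA|case: (line_exlt LN)].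
    - by rewrite (htup_hi _ LN B2 L4 Hj).
have B := BL n a' (mle_refl n) P; have [P1 [_ P3]] := P.
exists a'; split; first by rewrite -bzq //; apply: mle_refl.
  by case: B => [_ [H _]].
move=> t St Et.
have nn : ~ n < n by clra.
have N : eval_nonzero C (htup z lt q n a' a n (ent a n)) by apply/(hyb_nonzero LN B (fun H =>
  False_ind _ (nn H))).
apply: (eval_nonzero_ext (htup_seq _ LN B) St) N => j Hj.
by rewrite Et // (htup_lo _ LN B Hj).
Qed.

End Cube.

(** ** Coding a root in the cube *)

Section RootCode.
Variable M : s12.
Local Open Scope M_scope.
Implicit Types x y u v c i j k a t Y B z l lt q n d s C o A b w : M.
Hint Resolve Df_iadd Df_imul Df_EV Df_ipos Df_ineg Df_evg Df_ev Df_mx Df_pow Df_seqlen Df_htup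
  Df_dseq
  Df_gout Df_zerot Df_cnt Df_kroot Df_rootdec Df_digit Df_prod Df_ap5 : pv.

Lemma dv_dv x y z : y <> 0 -> z <> 0 -> dv x (y * z) = dv (dv x y) z.
Proof.
move=> Hy Hz; have [E L] := dv_md x Hy; have [E' L'] := dv_md (dv x y) Hz.
apply: (proj1 (dv_unique (r := y * md (dv x y) z + md x y) _ _)).
  by rewrite {1}E {1}E'; clra.
have K : md (dv x y) z + 1 <= z by move: L'; clra.
by have := ml_mono y K; move: L; clra.
Qed.

Lemma cnt_mono z l lt q n C a Y i x y : x <= y -> y <= ln M z ->
  cnt z l lt q n C a Y i x <= cnt z l lt q n C a Y i y.
Proof.
move=> Hxy Hy; have Ey := monusK Hxy; rewrite -Ey; set e := monus y x in Ey *.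
have lge : lg e by apply: (lg_le (ln_lg z)); move: Ey Hy (mle0 x); clra.
apply: (LIND_le (P := fun e => cnt z l lt q n C a Y i x <= cnt z l lt q n C a Y i (e + x)) _ lge
  _ _ (mle_refl e)); first by df.
  by rewrite ad_comm ad0; apply: mle_refl.
move=> j Hj H; apply: (mle_trans (y := cnt z l lt q n C a Y i (j + x))); split=> //.
have Hz : j + x < ln M z by move: Hj Ey Hy; clra.
have -> : j + 1 + x = j + x + 1 by clra.
rewrite (proj2 (cnt_spec z l lt q n C a Y i) _ Hz).
by have := mle0 (zerot (gout z l lt q n C a Y i (2 * (j + x)))); clra.
Qed.

Lemma dseq_line z l lt q n d C o A b w Y : line z l lt q n d C o A b w ->
  [/\ isseq (dseq z lt q n Y) n,
      forall j, j < n -> ent (dseq z lt q n Y) j = 2 * md (dv Y (pow z q j)) q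
    & dseq z lt q n Y <= pr lt (2 * ex (lt * n))].
Proof.
move=> LN; apply: dseq_spec.
- by have := line_lt LN; move: (mle0 (b + A)); clra.
- exact: line_z2 LN.
- exact: line_q1 LN.
- by have [H1 H2] := line_exlt LN; move: H1 H2 (line_qex LN); clra.
Qed.

Lemma hf_dbl x : hf M (2 * x) = x.
Proof. by apply: hf_eq; [exact: mle_refl|clra]. Qed.

Lemma dseq_below z l lt q n d C o A b w a Y i : line z l lt q n d C o A b w ->
  i <= n -> (forall j, j < n -> rd (ln M q) a j < q) -> below q n A a (dseq z lt q n Y) i.
Proof.
move=> LN Hi aq; split=> //; split=> j Hj; first by apply: aq; move: Hj Hi; clra.
have [_ -> // _] := dseq_line Y LN; rewrite hf_dbl.
by have := md_lt (dv Y (pow z q j)) (proj2 (neq0 q) (line_q1 LN)); move: (line_qex LN); clra.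
Qed.

(** The line in direction i takes its coordinates below i from [a] and only those above i from [Y].
    This is why the decoder can recover it from partial knowledge of the root. *)
Lemma cnt_ext z l lt q n d C o A b w a Y Y' i : line z l lt q n d C o A b w ->
  below q n A a Y i -> below q n A a Y' i ->
  (forall j, i < j -> j < n -> ent Y j = ent Y' j) ->
  forall x, x <= q -> cnt z l lt q n C a Y i x = cnt z l lt q n C a Y' i x.
Proof.
move=> LN BL BL' E x; move: x; apply: LIND_le; [by df|exact: line_lgq LN| |].
  by rewrite !(proj1 (cnt_spec _ _ _ _ _ _ _ _ _)).
move=> x Hx Ex; have Hz : x < ln M z by move: Hx (line_qz LN); clra.
rewrite !(proj2 (cnt_spec _ _ _ _ _ _ _ _ _) _ Hz) Ex !(goutE _ _ _ _ LN).
congr (_ + zerot (monus _ 1)); apply: (ev_ext (line_slp LN) (line_size LN) (line_l1 LN));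
  last by clra.
move=> j Hj; rewrite !(htup_ent _ LN _ Hj) // /hyb.
case: (mlt_trichotomy j i) => [L|->|L].
- by rewrite leb1 ?cond1 //; move: L; clra.
- by rewrite eqt1 !cond1.
- by rewrite E.
Qed.

Lemma code_root z l lt q n d C o A b w a Y : line z l lt q n d C o A b w -> 
  (forall j, j < n -> rd (ln M q) a j < q) ->
  (forall t, isseq t n -> (forall j, j < n -> ent t j = 2 * rd (ln M q) a j) -> eval_nonzero C t) ->
  Y < pow z q n -> ~ eval_nonzero C (dseq z lt q n Y) ->
  exists v, v < n * d * pow z q (monus n 1) /\ rootdec z l lt q n d C a v = Y.
Proof.
move=> LN aq aN HY NY; set Yd := dseq z lt q n Y in NY *.
have [SY EY _] := dseq_line Y LN; rewrite -/Yd in SY EY.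
have BL i : i <= n -> below q n A a Yd i by move=> Hi; apply: dseq_below LN Hi aq.
have YA i : i < n -> hf M (ent Yd i) <= ex A by case: (BL 0 (mle0 n)) => [_ [_ H]]; apply: H.
have YA' i : i < n -> hf M (ent Yd i) <= ex (b + A).
  by move=> Hi; apply: (mle_trans (y := ex A)); split; [exact: YA|case: (line_exlt LN)].
(* At i = 0 the hybrid is the root Y, at i = n it is the nonroot a; so there is a step at which the
   value changes from zero to nonzero. *)
have [i [Hi [P1 P2]]] : exists i, i < n /\ ~ zerot (gout z l lt q n C a Yd i (ent Yd i)) = 0 /\
    ~ ~ zerot (gout z l lt q n C a Yd (i + 1) (ent Yd (i + 1))) = 0.
  apply: (LIND_flip (P := fun i => ~ zerot (gout z l lt q n C a Yd i (ent Yd i)) =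
    0) _ (line_lgn LN)).
  - by df.
  - have B := BL 0 (mle0 n); rewrite -(hyb_nonzero LN B) => [N|]; last exact: YA.
    apply: NY; apply: (eval_nonzero_ext (htup_seq _ LN B) SY) N => j Hj.
    case: (eq0_or j) => [E0|j1]; first by rewrite E0 in Hj *; rewrite (htup_at LN B Hj) //;
      apply: YA'.
    by rewrite (htup_hi _ LN B _ Hj) //; move: j1; clra.
  - have B := BL n (mle_refl n); apply; apply/(hyb_nonzero LN B); first exact: YA.
    by apply: aN (htup_seq _ LN B) _ => j Hj; rewrite (htup_lo _ LN B Hj).
have {P2} P2 := NNPP _ P2.
have Hi' : i <= n by move: Hi; clra.
have Hi1 : i + 1 <= n by move: Hi; clra.
have B := BL i Hi'; have B1 := BL _ Hi1.
have Hv : hf M (2 * rd (ln M q) a i) <= ex A.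
  by rewrite hf_dbl; move: (aq i Hi) (line_qex LN); clra.
(* The hybrid at i + 1 arises from the one at i by moving coordinate i to a_i, so the line in
   direction i contains a nonroot. *)
have Hd : cnt z l lt q n C a Yd i q <= d.
  apply: (line_cnt LN B Hi Hv); move: P2; rewrite -(hyb_nonzero LN B1) => [N|]; last exact: YA.
  apply: (eval_nonzero_ext (htup_seq _ LN B1) (htup_seq _ LN B)) N => j Hj.
  case: (mlt_trichotomy j i) => [L|E|L].
  - by rewrite (htup_lo _ LN B L) (htup_lo _ LN B1) //; move: L; clra.
  - rewrite E (htup_at LN B Hi) ?(htup_lo _ LN B1) //; first by clra.
    by apply: (mle_trans (y := ex A)); split=> //; case: (line_exlt LN).
  - rewrite (htup_hi _ LN B L Hj); case: (mlt_trichotomy j (i + 1)) => [L4|E|L4].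
    + by move: L L4; clra.
    + by rewrite E in Hj *; rewrite (htup_at LN B1 Hj) //; apply: YA'.
    + by rewrite (htup_hi _ LN B1 L4 Hj).
have q0 := proj2 (neq0 q) (line_q1 LN); have qn := line_qn LN.
pose p := pow z q i; pose u := dv Y p; pose yi := md u q; pose hi := dv u q; pose lo := md Y p.
have p0 : p <> 0 := pow_neq0 (line_q1 LN) qn Hi'.
have [EY1 Llo] := dv_md Y p0; have [Eu Lyi] := dv_md u q0.
rewrite -/u -/lo -/yi -/hi in EY1 Llo Eu Lyi.
have pS : pow z q (i + 1) = p * q := powS (line_q1 LN) qn Hi.
have yz : yi < ln M z by move: Lyi (line_qz LN); clra.
(* The rank of y_i, the number of roots before it on the line. It is less than d because y_i is a
   root itself. *)
pose k := cnt z l lt q n C a Yd i yi.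
have Ek : cnt z l lt q n C a Yd i (yi + 1) = k + 1.
  have [K _] := cnt_step l lt q n C a Yd i yz; apply: K; apply: NNPP => /zerotP;
    apply: contra_not _ P1 => <-.
  by rewrite EY.
have Lk : k < d.
  have : k + 1 <= cnt z l lt q n C a Yd i q; last by move: Hd; clra.
  by rewrite -Ek; apply: cnt_mono; [move: Lyi; clra|exact: line_qz LN].
(* The tuple that the decoder can form: the digits of Y above i, and 0 elsewhere. It defines the
   same line. *)
pose Y2 := dseq z lt q n (hi * pow z q (i + 1)).
have B2 : below q n A a Y2 i by apply: dseq_below LN Hi' aq.
have E2 j : i < j -> j < n -> ent Yd j = ent Y2 j.
  move=> L Hj; have [_ E3 _] := dseq_line (hi * pow z q (i + 1)) LN; rewrite EY // E3 //;
    congr (2 * md _ q).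
  have Li : i + 1 <= j by move: L; clra.
  have Ej := monusK Li; set e := monus j (i + 1) in Ej.
  have Lej : i + 1 + e <= n by move: Ej Hj; clra.
  have -> : j = i + 1 + e by move: Ej; clra.
  rewrite (powD (line_q1 LN) qn Lej).
  have pi0 : pow z q (i + 1) <> 0 := pow_neq0 (line_q1 LN) qn Hi1.
  have pe0 : pow z q e <> 0.
    by refine (pow_neq0 (line_q1 LN) qn _); move: Lej (mle0 i); clra.
  rewrite !dv_dv //; congr (dv _ _).
  rewrite pS dv_dv // -/u -/hi -pS.
  by apply: esym; apply: (proj1 (dv_unique (r := 0) _ _)); [clra|apply/neq0].
have kE : kroot z l lt q n C a Y2 i k = yi.
  have [] := @kroot_spec M z l lt q n C a Y2 i k (line_q1 LN); set x := kroot _ _ _ _ _ _ _ _ _ _.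
  move=> Lx; have Lx' : x <= q by move: Lx; clra.
  have qz := line_qz LN; have yz' : yi <= ln M z by move: yz; clra.
  rewrite -!(cnt_ext LN B B2 E2) //; last by move: Lx; clra.
  move=> H1 H2; case: (mlt_trichotomy x yi) => [L|//|L].
  - have Lq : x + 1 < q by move: L Lyi; clra.
    have Ly : x + 1 <= yi by move: L; clra.
    have := cnt_mono l lt q n C a Yd i Ly yz'.
    by move: (H2 Lq); rewrite -/k; clra.
  - have Ly : yi + 1 <= x by move: L; clra.
    have Lz : x <= ln M z by move: Lx qz; clra.
    by have := cnt_mono l lt q n C a Yd i Ly Lz; rewrite Ek; move: H1; clra.
have id : i * d + k < n * d.
  by have := ml_mono d Hi1; move: Lk; clra.
pose rest := lo + p * hi.
exists (rest * (n * d) + (i * d + k)); split.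
  have Li : i + 1 <= n := Hi1.
  have Ee := monusK Hi1; set e := monus n (i + 1) in Ee.
  have En : monus n 1 = i + e by apply: monusE; move: Ee; clra.
  have L1 : i + e <= n by move: Ee; clra.
  have L2 : i + 1 + e <= n by move: Ee; clra.
  have Pn : pow z q n = p * q * pow z q e.
    by rewrite -pS -(powD (line_q1 LN) qn L2); congr (pow z q _); move: Ee; clra.
  have Hhi : hi < pow z q e.
    apply/mnot_le => N; have := ml_mono (p * q) N; rewrite -Pn.
    move: HY Eu EY1; clear; move=> H Eu; rewrite Eu => EY1.
    by move: H; rewrite EY1; have := mle0 (p * yi + lo); mlra.
  (* [rest] is Y with digit i deleted, a number of n - 1 digits in base q. *)
  have Hr : rest + 1 <= pow z q (i + e).
    rewrite (powD (line_q1 LN) qn L1) -/p.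
    have K : hi + 1 <= pow z q e by move: Hhi; clra.
    by have := ml_mono p K; rewrite /rest; move: Llo; clra.
  by rewrite En; have := ml_mono (n * d) Hr; move: id; clra.
rewrite /rootdec.
have d0 : d <> 0 by move=> E0; move: Lk; rewrite E0; clra.
have [-> ->] : dv (rest * (n * d) + (i * d + k)) (n * d) = rest /\
    md (rest * (n * d) + (i * d + k)) (n * d) = i * d + k.
  by apply: dv_unique => //; clra.
have [-> ->] : dv (i * d + k) d = i /\ md (i * d + k) d = k.
  by apply: dv_unique => //; clra.
rewrite -/p; have [-> ->] : dv rest p = hi /\ md rest p = lo.
  by apply: dv_unique => //; rewrite /rest; clra.
by rewrite -/Y2 kE; move: EY1; rewrite Eu => ->; clra.
Qed.

End RootCode.

(** ** Hitting sets from the dual weak pigeonhole principle *)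

Section PigeonholeCoding.
Variable M : s12.
Local Open Scope M_scope.
Implicit Types x y u v c e i j k a t Y B z l lt q n d s r m C o A b w N R X zeta : M.
Hint Resolve Df_iadd Df_imul Df_EV Df_ipos Df_ineg Df_evg Df_ev Df_mx Df_pow Df_seqlen Df_htup
  Df_dseq
  Df_gout Df_zerot Df_cnt Df_kroot Df_rootdec Df_digit Df_prod Df_ap5 : pv.

(** The official principle concerns [1, a] and [1, b]; arguments and values are shifted by one to
    start at 0. *)
Lemma php_avoid (F : M -> M -> M) : (forall f : pv 2, dual_php M f) ->
  Df false (fun r : nat -> M => F (r 0%N) (r 1%N)) -> forall N B c, 2 * N <= B -> 1 <= N ->
  exists y, y < B /\ forall X, X < N -> F X c <> y.
Proof.
move=> php DF N B c HB HN.
have [|f Hf] := @symbol2 M (fun x c => F (monus x 1) c + 1).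
  apply: Df_ad; last by df.
  by apply: (Df_under DF (E := fun r : nat ->
    M => ocons (monus (r 0%N) 1) (ocons (r 1%N) enil))); df.
have [y [[y1 yB] Hy]] := php f N B c (conj HB HN).
have Ey := monusK y1; exists (monus y 1); split; first by move: Ey yB; clra.
move=> X HX E; apply: (Hy (X + 1)); first by split; move: HX (mle0 X); clra.
by rewrite Hf (monusE (z := X)) // E.
Qed.

Definition block z q n y i : M := md (dv y (pow z q (n * i))) (pow z q n).

Lemma cube_seq z lt q n y r : 1 <= lt -> lt * n <= ln M z -> 1 <= q -> 2 * q <= ex lt -> lg r ->
  exists H, isseq H r /\ forall i, i < r ->
    entryM H i (dseq z lt q n (block z q n y i)) /\ in_cube (dseq z lt q n (block z q n y i)) n q.
Proof.
move=> Hlt Hz Hq Hqt Hr.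
have D : Df false (fun r : nat -> M => dseq (r 1%N) (r 2%N) (r 3%N) (r 4%N)
    (block (r 1%N) (r 3%N) (r 4%N) (r 5%N) (r 0%N))) by rewrite /block; df.
have [sq [_ Hs]] := seq_of D.
pose lh := ln M (pr lt (2 * ex (lt * n))).
have [z' Ez'] : lg ((lh + 1) * r) by apply: lgM => //; apply: lgS; apply: ln_lg.
have [|||S E _] := Hs z' (lh + 1) r (ocons z (ocons lt (ocons q (ocons n (ocons y enil))))).
- by move: (mle0 lh); clra.
- by rewrite Ez'; apply: mle_refl.
- move=> i Hi; env; have [_ _ K] := dseq_spec (block z q n y i) Hlt Hz Hq Hqt.
  have := lt_exln (pr lt (2 * ex (lt * n))); rewrite -/lh => L.
  have : ex lh <= ex (lh + 1) by apply: ex_mono; [apply: lgS; apply: ln_lg|clra].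
  by move: K L; clra.
exists (sq z' (lh + 1) r (ocons z (ocons lt (ocons q (ocons n (ocons y enil)))))); split=> // i Hi.
have [Sd Ed _] := dseq_spec (block z q n y i) Hlt Hz Hq Hqt; split.
  by apply/(entryP _ _ S); split=> //; rewrite E.
split=> // j Hj; exists (md (dv (block z q n y i) (pow z q j)) q); split.
  by apply: md_lt; apply/neq0.
by apply/(entryP _ _ Sd); split=> //; rewrite Ed.
Qed.

(** X = x + E1 (a + E2 zeta) packs the argument x < E1 of g, a nonroot a < E2 given by its digits,
    and the codes zeta of the r roots. *)
Definition F_of (g : pv 5) e n d s q r z l lt E1 E2 X : M :=
  prod z l lt q n d (ap5 g e n d s (md X E1)) (md (dv X E1) E2) (dv (dv X E1) E2) r.
(** The pigeonhole principle allows one parameter, so all eleven are packed into it by iterated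
    pairing. *)
Definition F_par (g : pv 5) X c : M :=
  let c1 := p2 c in let c2 := p2 c1 in let c3 := p2 c2 in let c4 := p2 c3 in let c5 := p2 c4 in
  let c6 := p2 c5 in let c7 := p2 c6 in let c8 := p2 c7 in let c9 := p2 c8 in
  F_of g (p1 c) (p1 c1) (p1 c2) (p1 c3) (p1 c4) (p1 c5) (p1 c6) (p1 c7) (p1 c8) (p1 c9) (p2 c9) X.
Lemma Df_F_par g : Df false (fun r : nat -> M => F_par g (r 0%N) (r 1%N)).
Proof. by rewrite /F_par /F_of; cbv zeta; apply: Df_prod; df. Qed.
Lemma F_parE g e n d s q r z l lt E1 E2 X :
  F_par g X (pr e (pr n (pr d (pr s (pr q (pr r (pr z (pr l (pr lt (pr E1 E2)))))))))) =
  F_of g e n d s q r z l lt E1 E2 X.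
Proof. by rewrite /F_par /= !(p1_pr, p2_pr). Qed.

Lemma digit_low z R n zeta v t j : 1 <= R -> ln M R * n <= ln M z -> t <= n -> j < t ->
  digit z R (zeta + v * pow z R t) j = digit z R zeta j.
Proof.
move=> R1 Rn Ht Hj; have Hj1 : j + 1 <= t by move: Hj; clra.
have Ee := monusK Hj1; set e := monus t (j + 1) in Ee.
have Et : t = j + 1 + e by move: Ee; clra.
have j0 : j < n by move: Hj Ht; clra.
have Hn : j + 1 + e <= n by rewrite -Et.
rewrite /digit Et (powD R1 Rn Hn) (powS R1 Rn j0); set p := pow z R j; set pe := pow z R e.
have p0 : p <> 0 by refine (pow_neq0 R1 Rn _); move: j0; clra.
have [E L] := dv_md zeta p0.
have [-> _] : dv (zeta + v * (p * R * pe)) p = dv zeta p + R * (v * pe) /\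
    md (zeta + v * (p * R * pe)) p = md zeta p.
  by apply: dv_unique => //; rewrite {1}E; clra.
have [E' L'] := dv_md (dv zeta p) (proj2 (neq0 R) R1).
apply: (proj2 (dv_unique (q := dv (dv zeta p) R + v * pe) _ L')).
by rewrite {1}E'; clra.
Qed.

Lemma digit_top z R n zeta v t : 1 <= R -> ln M R * n <= ln M z -> t <= n ->
  zeta < pow z R t -> v < R -> digit z R (zeta + v * pow z R t) t = v.
Proof.
move=> R1 Rn Ht Hz Hv; rewrite /digit.
have [-> _] : dv (zeta + v * pow z R t) (pow z R t) =
  v /\ md (zeta + v * pow z R t) (pow z R t) = zeta.
  by apply: dv_unique => //; clra.
by case: (dv_small Hv).
Qed.

Lemma block_acc z q n r y t : 1 <= q -> ln M q * (n * r) <= ln M z -> t < r ->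
  md y (pow z q (n * t)) + block z q n y t * pow z q (n * t) = md y (pow z q (n * (t + 1))) /\
  pow z q (n * (t + 1)) = pow z q (n * t) * pow z q n.
Proof.
move=> q1 Hz Ht; have L : n * t + n <= n * r.
  have K : t + 1 <= r by move: Ht; clra.
  by have := ml_mono n K; clra.
have Ep : pow z q (n * (t + 1)) = pow z q (n * t) * pow z q n.
  by rewrite -(powD q1 Hz L); congr (pow z q _); clra.
have a0 : pow z q (n * t) <> 0 by refine (pow_neq0 q1 Hz _); move: L (mle0 n); clra.
have b0 : pow z q n <> 0 by refine (pow_neq0 q1 Hz _); move: L (mle0 (n * t)); clra.
split=> //; rewrite /block Ep.
move: a0 b0; generalize (pow z q (n * t)) (pow z q n) => p p' a0 b0.
have [E1 L1] := dv_md y a0; have [E2 L2] := dv_md (dv y p) b0.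
apply: esym; apply: (proj2 (dv_unique (q := dv (dv y p) p') _ _)).
  by rewrite {1}E1 {1}E2; clra.
have K : md (dv y p) p' + 1 <= p' by move: L2; clra.
by have := ml_mono p K; move: L1; clra.
Qed.

Lemma prod_blocks z l lt q n d C a zeta r y : 1 <= q -> ln M q * (n * r) <= ln M z -> r <= ln M z ->
  (forall j, j < r -> rootdec z l lt q n d C a (digit z (n * d * pow z q (monus n 1)) zeta j) =
     block z q n y j) ->
  y < pow z q (n * r) -> prod z l lt q n d C a zeta r = y.
Proof.
move=> q1 Hz rz Hd Hy.
suff -> : prod z l lt q n d C a zeta r = md y (pow z q (n * r)) by case: (dv_small Hy).
have [P0 PS] := prod_spec z l lt q n d C a zeta.
apply: (LIND (P := fun t => prod z l lt q n d C a zeta t =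
  md y (pow z q (n * t))) _ (lg_le (ln_lg z) rz)).
- by df.
- rewrite P0 ml0 pow0; apply: esym; apply: (proj2 (dv_unique (q := y) _ _)); clra.
- move=> t Ht E; have Htz : t < ln M z by move: Ht rz; clra.
  have [B1 B2] := block_acc y q1 Hz Ht.
  have := PS t Htz; rewrite /= E Hd // B1; apply.
  have [L|//] : md y (pow z q (n * (t + 1))) < pow z q (n * (t + 1)) \/ False.
    left; apply: md_lt; refine (pow_neq0 q1 Hz _); apply: ml_mono; move: Ht; clra.
  by move: L; clra.
Qed.

End PigeonholeCoding.

Section HittingSets.
Variable M : s12.
Local Open Scope M_scope.
Implicit Types x y u v c e i j k a t Y B z l lt q n d s r m C o A b w N R X zeta : M.
Hint Resolve Df_iadd Df_imul Df_EV Df_ipos Df_ineg Df_evg Df_ev Df_mx Df_pow Df_seqlen Df_htup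
  Df_dseq
  Df_gout Df_zerot Df_cnt Df_kroot Df_rootdec Df_digit Df_prod Df_ap5 : pv.

Lemma pow_doubling z q R n r : 1 <= R -> 1 <= q -> ln M R * r <= ln M z ->
  ln M q * (n * r) <= ln M z ->
  r <= ln M z -> n <= n * r -> 2 * R <= pow z q n -> pow z R r * ex r <= pow z q (n * r).
Proof.
move=> R1 q1 HR Hq Hr Hn H2; rewrite -(bzE Hr).
apply: (LIND_le (P := fun t => pow z R t * bz z t <= pow z q (n * t)) _ (lg_le (ln_lg z) Hr) _ _
  (mle_refl r)).
- by apply: Sg_le; df.
- by rewrite !pow0 ml0 pow0 bzE ?ex0 ?ml1; [apply: mle_refl|apply: mle0].
move=> t Ht H; have Htz : t + 1 <= ln M z by move: Ht Hr; clra.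
have Htz' : t <= ln M z by move: Htz; clra.
rewrite (bzE Htz) (exS (lg_le (ln_lg z) Htz')) (powS R1 HR Ht).
rewrite (bzE Htz') in H.
have L : n * t + n <= n * r.
  have K : t + 1 <= r by move: Ht; clra.
  by have := ml_mono n K; clra.
have -> : n * (t + 1) = n * t + n by clra.
rewrite (powD q1 Hq L); have := ml_le2 H H2.
by clra.
Qed.

Lemma seq_nonzero_nil C a h : isseq a 0 -> isseq h 0 -> eval_nonzero C a -> eval_nonzero C h.
Proof. by move=> Sa Sh; apply: (eval_nonzero_ext Sa Sh) => j; clra. Qed.

(** Each gate has weight at least 1, while the output has weight at most (n + o + 1) d. *)
Lemma ckt_degree C n d s : lg n -> ckt C n d s -> 1 <= d.
Proof.
move=> Hn [_ [o [slp [vd cd]]]]; have [W [_ _ W1 Wo _]] := ckt_weights slp Hn vd cd.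
case: (eq0_or d) => // d0; rewrite d0 ml0 in Wo.
by have := W1 o (mle_refl o); move: Wo; clra.
Qed.

Lemma dual_php_hitting (g : pv 5) : (forall f : pv 2, dual_php M f) -> hitting M g.
Proof.
move=> php e n d s q r m [/log_ofE Hn [/log_ofE Hd [/log_ofE Hs [/log_ofE Hq [/log_ofE Hr
  /log_ofE Hm]]]]] [q1 [ndq mr]].
have r1 : 1 <= r by move: mr (mle0 (m + n * ln M q)); clra.
(* For d = 0 there are no circuits, and for n = 0 the empty tuple is the only point. Any r points
   form a hitting set then, and r >= 1 ensures that there is one. *)
case: (classic (n = 0 \/ d = 0)) => [deg|ndeg].
  pose lt := ln M q + 1; have lglt : lg lt by apply: lgS; apply: ln_lg.
  have [z Ez] := lgM lglt Hn; have Hz : lt * n <= ln M z by rewrite Ez; apply: mle_refl.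
  have Hlt : 1 <= lt by rewrite /lt; move: (mle0 (ln M q)); clra.
  have Hqt : 2 * q <= ex lt by rewrite /lt exS; [have := lt_exln q; clra|apply: ln_lg].
  have [H [SH HH]] := cube_seq 0 Hlt Hz q1 Hqt Hr; exists H; split.
    by split=> // i Hi; have [H1 H2] := HH i Hi; eexists; split; [exact: H1|].
  move=> x Hx C HC _ [a [Sa Na]].
  have d1 := ckt_degree Hn HC; case: deg => E; last by move: d1; rewrite E; clra.
  have r0 : 0 < r by move: r1; clra.
  have [H1 [H2 _]] := HH 0 r0; exists 0; eexists; split=> //; split; first exact: H1.
  by rewrite E in Sa H2 *; apply: seq_nonzero_nil Sa H2 Na.
have n1 : 1 <= n by apply/neq0 => E; apply: ndeg; left.
have d1 : 1 <= d by apply/neq0 => E; apply: ndeg; right.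
have dq : d < q.
  by have := ml_le2 n1 (mle_refl d); move: ndq d1; rewrite (ml_comm 1) ml1; clra.
pose A := s + ln M q; have lgA : lg A by apply: lgD => //; apply: ln_lg.
have lgqn : lg (ln M q * n) by apply: lgM => //; apply: ln_lg.
have lq1 : 1 <= ln M q by rewrite -(ln1 M); apply: ln_mono.
have lgz0 := par_z_lg Hn Hd Hq lgA.
have [z Ez] := lgD lgz0 (lgM lgqn Hr).
have Hz : par_z n d q A <= ln M z by rewrite Ez; move: (mle0 (ln M q * n * r)); clra.
have qnrz : ln M q * (n * r) <= ln M z by rewrite Ez; move: (mle0 (par_z n d q A)); clra.
have nnr : n <= n * r by have := ml_mono n r1; rewrite ml1.
have qnz : ln M q * n <= ln M z.
  by apply: (mle_trans (y := ln M q * (n * r))); split=> //; apply: ml_mono.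
have rz : r <= ln M z.
  apply: (mle_trans (y := ln M q * (n * r))); split=> //.
  by have := ml_le2 lq1 (ml_le2 n1 (mle_refl r)); rewrite !(ml_comm 1) !ml1.
pose n' := monus n 1; have En : n' + 1 = n := monusK n1.
pose R := n * d * pow z q n'.
have qS : pow z q n = pow z q n' * q.
  by rewrite -{1}En; refine (powS q1 qnz _); move: En; clra.
have p1 : 1 <= pow z q n'.
  by refine (proj1 (pow_bounds q1 qnz _)); move: En; clra.
have R1 : 1 <= R.
  have := ml_le2 (ml_le2 n1 d1) p1; rewrite !ml1; exact.
have R2 : 2 * R <= pow z q n.
  by rewrite qS /R; have := ml_mono (pow z q n') ndq; clra.
have Rz : ln M R * r <= ln M z.
  apply: (mle_trans (y := ln M q * n * r)); split; last by rewrite Ez;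
    move: (mle0 (par_z n d q A)); clra.
  apply: ml_le2; last exact: mle_refl.
  apply/(ln_ex R lgqn); have [_ K] := pow_bounds q1 qnz (mle_refl n).
  by move: R1 R2 K; clra.
pose l := par_l n d q A; pose lt := par_lt n d q A.
pose E1 := ex m; pose E2 := ex (ln M q * n).
have e1 : 1 <= E1 by apply: ex_ge1.
have e2 : 1 <= E2 by apply: ex_ge1.
have Rr1 : 1 <= pow z R r := proj1 (pow_bounds R1 Rz (mle_refl r)).
(* Since 2 R <= q^n, each of the r points saves one bit. As r > m + n|q|, these bits pay for E1 =
   2^m and E2 = 2^(n|q|), with one left over for the factor 2. *)
have NB : 2 * (E1 * E2 * pow z R r) <= pow z q (n * r).
  apply: (mle_trans (y := pow z R r * ex r)); split; last exact: pow_doubling.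
  have K : 2 * (E1 * E2) <= ex r.
    rewrite -exD // -exS; last exact: lgD.
    by apply: ex_mono => //; move: mr; clra.
  by have := ml_mono (pow z R r) K; clra.
have N1 : 1 <= E1 * E2 * pow z R r.
  by have := ml_le2 (ml_le2 e1 e2) Rr1; rewrite !ml1.
(* The r digits of the omitted value y in base q^n are the points of the hitting set. *)
have [y [yB Hy]] := php_avoid php (Df_F_par M g)
  (pr e (pr n (pr d (pr s (pr q (pr r (pr z (pr l (pr lt (pr E1 E2)))))))))) NB N1.
have Hlt : 1 <= lt by rewrite /lt /par_lt; move: (mle0 (par_b n d q A)) (mle0 A); clra.
have Hltz : lt * n <= ln M z.
  apply: (mle_trans (y := par_z n d q A)); split=> //; rewrite /par_z -/lt.
  by move: (mle0 (par_l n d q A * (A + 1))); clra.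
have Hqt : 2 * q <= ex lt.
  have lglt : lg lt by apply: (lg_le (ln_lg z)); apply: (mle_trans (y := lt * n)); split=> //;
    rewrite -{1}(ml1 lt); apply: ml_mono.
  apply: (mle_trans (y := ex (ln M q + 1))); split; last first.
    by apply: ex_mono => //; rewrite /lt /par_lt /A;
      move: (mle0 (par_b n d q (s + ln M q))) (mle0 s); clra.
  by rewrite exS; [have := lt_exln q; clra|apply: ln_lg].
have [H [SH HH]] := cube_seq y Hlt Hltz q1 Hqt Hr; exists H; split.
  by split=> // i Hi; have [H1 H2] := HH i Hi; eexists; split; [exact: H1|].
move=> x Hx C HC EC [a [Sa Na]]; apply: NNPP => Nroot.
have roots t : t < r -> ~ eval_nonzero C (dseq z lt q n (block z q n y t)).
  move=> Ht Nt; apply: Nroot; exists t; eexists; split=> //; split; last exact: Nt.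
  by case: (HH t Ht).
have [sC [o [slp [vd cd]]]] := HC.
have qA : ln M q <= A by rewrite /A; move: (mle0 s); clra.
have CA : ln M C <= A by rewrite /A; move: sC (mle0 (ln M q)); clra.
have LN := line_par slp vd cd lgA Hn Hq n1 q1 dq qA CA Hz.
have [a' [La' aq aN]] := cube_point slp vd cd Hn Hq n1 q1 dq Sa Na.
have code t : t < r -> exists v, v < R /\ rootdec z l lt q n d C a' v = block z q n y t.
  move=> Ht; apply: (code_root LN aq aN); last exact: roots.
  by apply: md_lt; apply/neq0; rewrite qS; have := ml_le2 p1 q1; rewrite ml1.
(* A code exists for each t < r separately. Length induction appends them one by one as digits in
   base R; the bound R^t keeps the statement Sigma^b_1. *)
have [zeta [_ [Lz Dz]]] : exists zeta, zeta <= pow z R r /\ (zeta < pow z R r /\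
    forall j, j <= ln M z -> j < r ->
      rootdec z l lt q n d C a' (digit z R zeta j) = block z q n y j).
  apply: (LIND (P := fun t => exists zeta, zeta <= pow z R t /\ (zeta < pow z R t /\
    forall j, j <= ln M z -> j < t ->
      rootdec z l lt q n d C a' (digit z R zeta j) = block z q n y j)) _ Hr).
  - apply: (@Sg_ex M (fun rho => pow z R (rho 0%N)) (fun zeta rho => zeta < pow z R (rho 0%N) /\
      forall j, j <= ln M z -> j < rho 0%N ->
        rootdec z l lt q n d C a' (digit z R zeta j) = block z q n y j)); first df.
    apply: Sg_and; first df.
    apply: (@Sg_sall M true (fun=> z) (fun j rho => j < rho 1%N ->
      rootdec z l lt q n d C a' (digit z R (rho 0%N) j) = block z q n y j)); first df.
    by rewrite /block; df.
  - exists 0; rewrite pow0; split; first exact: mle0; split; first by clra.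
    by move=> j _; clra.
  move=> t Ht [zeta [_ [Lz Dz]]]; have [v [Lv Ev]] := code t Ht.
  have Ht' : t <= r by move: Ht; clra.
  exists (zeta + v * pow z R t).
  have L : zeta + v * pow z R t < pow z R (t + 1).
    rewrite (powS R1 Rz Ht); have K : v + 1 <= R by move: Lv; clra.
    by have := ml_mono (pow z R t) K; move: Lz; clra.
  split; first by move: L; clra.
  split=> // j jz Hj; case: (mlt_trichotomy j t) => [Lj|->|Lj].
  - by rewrite (digit_low _ _ R1 Rz Ht' Lj); apply: Dz.
  - by rewrite (digit_top R1 Rz Ht' Lz Lv).
  - by move: Hj Lj; clra.
have xE : x < E1 by apply/(ln_ex x Hm).
have e10 := proj2 (neq0 E1) e1; have e20 := proj2 (neq0 E2) e2.
apply: (Hy (x + E1 * (a' + E2 * zeta))).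
  have K1 : zeta + 1 <= pow z R r by move: Lz; clra.
  have K2 : a' + 1 <= E2 by move: La'; rewrite -/E2; clra.
  have K3 := ml_mono E2 K1.
  have K4 : a' + E2 * zeta + 1 <= E2 * pow z R r by move: K3 K2; clra.
  by have := ml_mono E1 K4; move: xE; clra.
rewrite F_parE /F_of.
have [-> ->] : dv (x + E1 * (a' + E2 * zeta)) E1 =
  a' + E2 * zeta /\ md (x + E1 * (a' + E2 * zeta)) E1 = x.
  by apply: dv_unique => //; clra.
have [-> ->] : dv (a' + E2 * zeta) E2 = zeta /\ md (a' + E2 * zeta) E2 = a'.
  by apply: dv_unique => //; clra.
rewrite EC; apply: prod_blocks => // j Hj.
by rewrite -/n' -/R Dz //; move: Hj rz; clra.
Qed.

End HittingSets.

(** * The dual weak pigeonhole principle from hitting sets *)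

Section Amplification.
Variable M : s12.
Local Open Scope M_scope.
Implicit Types x y u v c e i j k a t Y B z l q n d s r m C o A w N R X T : M.

Hint Resolve Df_ap2 : pv.

(** Maps [0, a 2^k) onto [0, a 2^(k+1)) when [f] maps [1, a] onto a superset of [1, 2a]. *)
Definition stretch (f : pv 2) a c B z : M :=
  mn (dv z a * (2 * a) + md (monus (ap2 M f (md z a + 1) c) 1) (2 * a)) B.

Lemma stretches_ex (f : pv 2) : exists I : M -> M -> M -> M -> M -> M -> M,
  Df false (fun rho => I (rho 0%N) (rho 1%N) (rho 2%N) (rho 3%N) (rho 4%N) (rho 5%N)) /\
  forall z a c B x, x <= B -> I z a c B x 0 = x /\
    forall k, k < ln M z -> I z a c B x (k + 1) = stretch f a c B (I z a c B x k).
Proof.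
have [I [DI HI]] := @iterate M (fun rho => rho 3%N)
  (fun rho => stretch f (rho 2%N) (rho 3%N) (rho 4%N) (rho 1%N)) (fun rho => rho 3%N)
  ltac:(df) ltac:(rewrite /stretch; df) ltac:(df).
exists (fun z a c B x k => I z k (ocons a (ocons c (ocons B (ocons x enil))))); split.
  apply: (Df_under DI (E := fun rho : nat -> M => ocons (rho 0%N) (ocons (rho 5%N) (ocons (rho 1%N)
    (ocons (rho 2%N) (ocons (rho 3%N) (ocons (rho 4%N) enil))))))); df.
move=> z a c B x Hx; have [I0 IS] := HI z (ocons a (ocons c (ocons B (ocons x enil)))).
split; first exact: (ismin_le I0).
move=> k Hk; apply: (ismin_le (IS k Hk)); rewrite /stretch; env.
by case: (mn_le (dv (I z k (ocons a (ocons c (ocons B (ocons x enil))))) a * (2 * a) +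
  md (monus (ap2 M f (md (I z k (ocons a (ocons c (ocons B (ocons x enil))))) a + 1) c) 1) (2 *
    a)) B).
Qed.

Definition stretches (f : pv 2) : M -> M -> M -> M -> M -> M -> M. pick (stretches_ex f). Defined.
Lemma stretches_spec f z a c B x : x <= B -> stretches f z a c B x 0 = x /\
    forall k, k < ln M z -> stretches f z a c B x (k + 1) =
      stretch f a c B (stretches f z a c B x k).
Proof. exact: (proj2 (proj2_sig (constructive_indefinite_description _ (stretches_ex f))) z a c B
  x). Qed.
Lemma Df_stretches f b F1 F2 F3 F4 F5 F6 : Df b F1 -> Df b F2 -> Df b F3 -> Df b F4 -> Df b F5 ->
  Df b F6 ->
  Df b (fun rho => stretches f (F1 rho) (F2 rho) (F3 rho) (F4 rho) (F5 rho) (F6 rho)).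
Proof.
move=> *; apply: (@Df_under M (fun rho =>
  stretches f (rho 0%N) (rho 1%N) (rho 2%N) (rho 3%N) (rho 4%N) (rho 5%N)) b
  (fun rho => ocons (F1 rho) (ocons (F2 rho) (ocons (F3 rho) (ocons (F4 rho) (ocons (F5 rho)
    (ocons (F6 rho) enil))))))).
  exact: (proj1 (proj2_sig (constructive_indefinite_description _ (stretches_ex f)))).
df.
Qed.
Hint Resolve Df_stretches : pv.

(** The iteration adds its steps at the end, whereas a preimage is sought from the end backwards and
    so adds them at the beginning. *)
Lemma stretches_comm f z a c B x k : x <= B -> k < ln M z ->
  stretches f z a c B x (k + 1) = stretches f z a c B (stretch f a c B x) k.
Proof.
move=> Hx Hk; have Hs : stretch f a c B x <= B by case: (mn_le (dv x a * (2 * a) + md (monus (ap2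
  M f (md x a + 1) c) 1) (2 * a)) B).
have Hkz : k <= ln M z by move: Hk; clra.
have [I0 IS] := stretches_spec f z a c Hx; have [J0 JS] := stretches_spec f z a c Hs.
have E : k < ln M z -> stretches f z a c B x (k + 1) = stretches f z a c B (stretch f a c B x) k.
  apply: (LIND (P := fun k => k < ln M z ->
    stretches f z a c B x (k + 1) = stretches f z a c B (stretch f a c B x) k) _ (lg_le (ln_lg z)
      Hkz)).
  - by rewrite /stretch; df.
  - by move=> z0; rewrite IS // I0 J0.
  move=> i Hi E Hiz; have Hi' : i < ln M z by move: Hiz; clra.
  by rewrite IS // E // JS.
exact: E.
Qed.

Lemma stretches_onto (f : pv 2) z a c T w : 1 <= a -> T <= ln M z ->
  (forall v, v < 2 * a -> exists2 x, x < a & ap2 M f (x + 1) c = v + 1) -> w < a * ex T ->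
  exists2 x, x < a & stretches f z a c (a * ex T) x T = w.
Proof.
move=> a1 Tz onto Hw; have lgT : lg T := lg_le (ln_lg z) Tz; set B := a * ex T.
have bzT k : bz z (monus T k) = ex (monus T k).
  apply: bzE; apply: (mle_trans (y := T)); split=> //.
  case: (mle_total T k) => L; first by have := monusK L; move: (mle0 k); clra.
  by rewrite monus0 //; apply: mle0.
have exT k : k <= T -> ex (monus T k) <= ex T.
  by move=> L; apply: ex_mono => //; have := monusK L; move: (mle0 k); clra.
(* After k backward steps there is a preimage of w below a 2^(T - k). This bound makes the induction
   on k a Sigma^b_1 one. *)
have [x [_ [Lx Ex]]] : exists x, x <= a * bz z (monus T T) /\
    (x < a * bz z (monus T T) /\ stretches f z a c B x T = w).
  apply: (LIND (P := fun k => exists x, x <= a * bz z (monus T k) /\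
    (x < a * bz z (monus T k) /\ stretches f z a c B x k = w)) _ lgT).
  - apply: (@Sg_ex M (fun rho => a * bz z (monus T (rho 0%N))) (fun x rho =>
    x < a * bz z (monus T (rho 0%N)) /\
      stretches f z a c B x (rho 0%N) = w)); df.
  - have w1 : w <= B by rewrite /B; move: Hw; clra.
    exists w; rewrite bzT (monusE (z := T)) ?ad0 //; do !split=> //.
    by case: (stretches_spec f z a c w1).
  move=> k Hk [y [_ [Ly Ey]]].
  have Hk1 : k + 1 <= T by move: Hk; clra.
  have Hk' : k <= T by move: Hk; clra.
  have Ee := monusK Hk1; set e := monus T (k + 1) in Ee *.
  have Ek : monus T k = e + 1 by apply: monusE; move: Ee; clra.
  have lge : lg e by apply: (lg_le lgT); move: Ee (mle0 k); clra.
  rewrite bzT Ek exS // in Ly; rewrite /e bzT -/e.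
  have a0 : 2 * a <> 0 by apply/neq0; move: a1; clra.
  have [Ey1 Lv] := dv_md y a0; set u := dv y (2 * a) in Ey1; set v := md y (2 * a) in Ey1 Lv.
  have [x Lx Ex] := onto v Lv.
  have Lu : u + 1 <= ex e.
    have : u < ex e; last by clra.
    apply/mnot_le => N; have := ml_mono (2 * a) N.
    by move: Ly; rewrite Ey1; clra.
  (* As y = 2 a u + v and f maps x + 1 to v + 1, one stretch takes a u + x to y. *)
  exists (a * u + x); have L : a * u + x < a * ex e.
    by have := ml_mono a Lu; move: Lx; clra.
  have LB : a * u + x <= B.
    have := ml_mono a (exT _ Hk1); rewrite -/e /B; move: L; clra.
  split; first by move: L; clra.
  split=> //; rewrite stretches_comm //; last by move: Hk Tz; clra.
  rewrite /stretch; have [-> ->] : dv (a * u + x) a = u /\ md (a * u + x) a = x by apply: dv_unique.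
  rewrite Ex (monusE (z := v)) // (proj2 (dv_small Lv)).
  have -> : u * (2 * a) + v = y by rewrite Ey1; clra.
  rewrite mn_l //; have := ml_mono a (exT _ Hk'); rewrite Ek exS // -/B.
  by move: Ly; clra.
exists x => //; move: Lx; rewrite bzT (monusE (z := 0)) ?ex0 ?ml1 //.
by clra.
Qed.

End Amplification.
#[global] Opaque stretches.

(** ** Products of linear factors *)

Section Products.
Variable M : s12.
Local Open Scope M_scope.
Notation three := (su M 2 : M).
Implicit Types x y u v c i j k t z l q r C o h w : M.
Hint Resolve Df_ev Df_ipos Df_ineg : pv.

(** A circuit for the product of the [X - cf k] with [k < r]: the gate 0 is the variable, the
    gate [3 k + 1] computes the product of the first [k] factors. *)
Record product (C r : M) (cf : M -> M) : Prop := Product {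
  product_seq : isseq C (three * r + 2);
  product0 : ent C 0 = g_var 0;
  product1 : ent C 1 = g_const 2;
  product2 : forall k, k < r -> ent C (three * k + 2) = g_const (2 * cf k + 1);
  product3 : forall k, k < r -> ent C (three * k + three) = g_add 0 (three * k + 2);
  product4 : forall k, k < r -> ent C (three * k + three + 1) =
    g_mul (three * k + 1) (three * k + three) }.

Lemma lt3_cases x : x < three -> [\/ x = 0, x = 1 | x = 2].
Proof.
move=> H; case: (mlt_trichotomy x 1) => [L|->|L].
- by constructor 1; case: (eq0_or x) => // K; move: L K; clra.
- by constructor 2.
- by constructor 3; move: H L; clra.
Qed.

Lemma dv3 k x : x < three -> dv (three * k + x) three = k /\ md (three * k + x) three = x.
Proof. by move=> H; apply: dv_unique. Qed.

Lemma gate_cases r i : i <= three * r + 1 ->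
  [\/ i = 0, i = 1 | exists2 k, k < r &
    [\/ i = three * k + 2, i = three * k + three | i = three * k + three + 1]].
Proof.
move=> Hi; case: (eq0_or i) => [|i1]; first by constructor 1.
have N3 : three <> 0 by case: (neq_12 M) => _ [_ [_ []]].
case: (mlt_trichotomy i 1) => [L|->|L]; [by move: L i1; clra|by constructor 2|constructor 3].
have L2 : 2 <= i by move: L; clra.
have Ei := monusK L2; have [Ed Ld] := dv_md (monus i 2) N3.
move: Ed Ld Ei; move: (monus i 2) => i'; move: (dv i' _) (md i' _) => k x Ed Lx Ei.
have Hk : k < r.
  apply/mnot_le => N; have := ml_mono three N; move: Hi Ei Ed (mle0 x).
  by clra.
exists k => //; rewrite -Ei Ed; case: (lt3_cases Lx) => ->.
- by constructor 1; rewrite ad0.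
- by constructor 2; clra.
- by constructor 3; clra.
Qed.

Lemma product_slp C r cf : product C r cf -> is_slp C 1 (three * r + 1).
Proof.
move=> P; have S := product_seq P; have So : three * r + 2 = su M (three * r + 1) by clra.
split; first by rewrite -So.
move=> i Hi; exists (ent C i); split.
  by apply/(entryP _ _ S); split=> //; move: Hi; clra.
case: (gate_cases Hi) => [->|->|[k Hk [->|->|->]]].
- by left; exists 0; rewrite (product0 P); split=> //; clra.
- by right; left; exists 2; rewrite (product1 P).
- by right; left; exists (2 * cf k + 1); rewrite (product2 P).
- right; right; exists 0, (three * k + 2); rewrite (product3 P) //.
  by do !split; [move: (mle0 k); clra|clra|left].
- right; right; exists (three * k + 1), (three * k + three); rewrite (product4 P) //.
  by do !split; [clra|clra|right].
Qed.

(** Reduces a degree bound to a closed form [D] for the degrees of the gates, with parameters [rho];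
    [seq_of] then lists them as an official trace. *)
Lemma product_deg C r cf (src : M -> M -> Prop) (D : (nat -> M) -> M) rho d (lD : M) :
  product C r cf -> Df false D -> lg lD -> 1 <= lD ->
  (forall i, i <= three * r + 1 -> D (ocons i rho) < ex lD) ->
  (forall i, i = 0 \/ i = 1 \/ (exists2 k, k < r & i = three * k + 2) ->
    (src i (ent C i) /\ D (ocons i rho) = 1) \/ (~ src i (ent C i) /\ D (ocons i rho) = 0)) ->
  (forall k, k < r -> is_max (D (ocons 0 rho)) (D (ocons (three * k + 2) rho)) (D (ocons (three *
    k + three) rho))) ->
  (forall k, k < r -> D (ocons (three * k + three + 1) rho) =
    D (ocons (three * k + 1) rho) + D (ocons (three * k + three) rho)) ->
  D (ocons (three * r + 1) rho) <= d -> deg_le src C (three * r + 1) d.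
Proof.
move=> P DD lgD lD1 HD H0 H3 H4 Hd; have SC := product_seq P.
have So : three * r + 2 = su M (three * r + 1) by clra.
have [sq [_ Hs]] := seq_of DD.
have [z Ez] := lgM lgD (isseq_lg SC).
have [||S E _] := Hs z lD (three * r + 2) rho lD1.
- by rewrite Ez; apply: mle_refl.
- by move=> i Hi; apply: HD; move: Hi; clra.
set t := sq _ _ _ _ in S E.
have lt_o i : i <= three * r + 1 -> i < three * r + 2 by clra.
have En i : i <= three * r + 1 -> entryM t i (D (ocons i rho)).
  by move=> Hi; apply/(entryP _ _ S); split; [apply: lt_o|rewrite E //; apply: lt_o].
exists t, (D (ocons (three * r + 1) rho)); split; last by split=> //; apply: En; apply: mle_refl.
split; first by rewrite -So.
move=> i Hi; exists (ent C i), (D (ocons i rho)); split; first by apply/(entryP _ _ SC);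
  split=> //; apply: lt_o.
split; first exact: En.
case: (gate_cases Hi) => [Ei|Ei|[k Hk [Ei|Ei|Ei]]].
- left; split; last by apply: H0; left.
  by exists 0; left; rewrite Ei (product0 P).
- left; split; last by apply: H0; right; left.
  by exists 2; right; rewrite Ei (product1 P).
- left; split; last by apply: H0; right; right; exists k.
  by exists (2 * cf k + 1); right; rewrite Ei (product2 P).
- right; exists 0, (three * k + 2), (D (ocons 0 rho)), (D (ocons (three * k + 2) rho)).
  have L1 : 0 <= three * r + 1 := mle0 _.
  have L2 : three * k + 2 <= three * r + 1 by move: Hi; rewrite Ei; clra.
  split; first exact: En; split; first exact: En.
  by left; rewrite Ei (product3 P) //; split=> //; apply: H3.
- right; exists (three * k + 1), (three * k + three), (D (ocons (three * k + 1) rho)),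
  (D (ocons (three * k + three) rho)).
  have L1 : three * k + 1 <= three * r + 1 by move: Hi; rewrite Ei; clra.
  have L2 : three * k + three <= three * r + 1 by move: Hi; rewrite Ei; clra.
  split; first exact: En; split; first exact: En.
  by right; rewrite Ei (product4 P) //; split=> //; apply: H4.
Qed.

(** The residue of i + 1 modulo 3 tells the kind of a gate: 0 for the constant of a factor, 1 for a
    linear factor (or the variable at gate 0), 2 for the product of the first (i + 1)/3 factors. *)
Definition var_degree i : M :=
  cond (eqt (md (i + 1) three) 0) 0 (cond (eqt (md (i + 1) three) 1) 1 (dv (i + 1) three)).
(** Each constant enters the chain of products once: its degree is 1 in its own factor and in all
    products after it, and 0 elsewhere. The initial constant 1 is itself the empty product at gate
    1. *)
Definition const_degree c i : M :=
  cond (eqt (md (i + 1) three) 0) (eqt i c) (cond (eqt (md (i + 1) three) 1) (eqt i (c + 1)) (leb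
    c i)).

Lemma neq3 : [/\ (1 : M) <> 0, (2 : M) <> 0, (2 : M) <> 1 & (three : M) <> 0].
Proof. by case: (neq_12 M) => ? [? [? [? _]]]; split. Qed.
Lemma lt3 : [/\ 0 < three, 1 < three & (2 : M) < three].
Proof. by split; clra. Qed.
Lemma next2 k : dv (three * k + 2 + 1) three = k + 1 /\ md (three * k + 2 + 1) three = 0.
Proof.
have -> : three * k + 2 + 1 = three * (k + 1) + 0 by clra.
by apply: dv3; case: lt3.
Qed.
Lemma next3 k : dv (three * k + three + 1) three = k + 1 /\ md (three * k + three + 1) three = 1.
Proof.
have -> : three * k + three + 1 = three * (k + 1) + 1 by clra.
by apply: dv3; case: lt3.
Qed.
Lemma next1 k : dv (three * k + 1 + 1) three = k /\ md (three * k + 1 + 1) three = 2.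
Proof.
have -> : three * k + 1 + 1 = three * k + 2 by clra.
by apply: dv3; case: lt3.
Qed.
Lemma var_degreeE k : [/\ var_degree 0 = 1, var_degree (three * k + 1) = k,
  var_degree (three * k + 2) = 0 & var_degree (three * k + three) = 1].
Proof.
have [N1 N2 N3 N4] := neq3; have [L0 L1 L2] := lt3; rewrite /var_degree.
have [-> ->] := next1 k; have [_ ->] := next2 k; have [_ ->] := next3 k.
have -> : 0 + 1 = three * 0 + 1 :> M by clra.
have [_ ->] := dv3 0 L1.
by rewrite !(eqt0 N1) !(eqt0 N2) !(eqt0 N3) !eqt1 !cond0 !cond1.
Qed.
Lemma const_degreeE c k : [/\ const_degree c 0 = eqt 0 (c + 1),
  const_degree c (three * k + 1) = leb c (three * k + 1),
  const_degree c (three * k + 2) = eqt (three * k + 2) c &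
  const_degree c (three * k + three) = eqt (three * k + three) (c + 1)].
Proof.
have [N1 N2 N3 N4] := neq3; have [L0 L1 L2] := lt3; rewrite /const_degree.
have [_ ->] := next1 k; have [_ ->] := next2 k; have [_ ->] := next3 k.
have E0 : 0 + 1 = three * 0 + 1 :> M by clra.
have -> : md (0 + 1) three = 1 by rewrite E0; case: (dv3 0 L1).
by rewrite !(eqt0 N1) !(eqt0 N2) !(eqt0 N3) !eqt1 !cond0 !cond1.
Qed.

Lemma var_degree1 : var_degree (1 : M) = 0.
Proof.
have E : 1 = three * 0 + 1 :> M by clra.
by rewrite {1}E; have [_ -> _ _] := var_degreeE 0.
Qed.
Lemma const_degree1 c : const_degree c 1 = leb c 1.
Proof.
have E : 1 = three * 0 + 1 :> M by clra.
by rewrite {1}E; have [_ -> _ _] := const_degreeE c 0; rewrite -E.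
Qed.

End Products.

(** * Degrees and values of the product circuit *)

Section ProductValues.
Variable M : s12.
Local Open Scope M_scope.
Notation three := (su M 2 : M).
Implicit Types x y u v c i j k t z l lt q r n d A b w C o h : M.
Hint Resolve Df_ev Df_ipos Df_ineg : pv.

Lemma product_var_deg C r cf : product C r cf -> lg r ->
  forall j, j < 1 -> deg_le (fun _ g => g = g_var j) C (three * r + 1) r.
Proof.
move=> P Hr j Hj; have -> : j = 0 by case: (eq0_or j) => // j1; move: Hj j1; clra.
have lg2 : lg (three * r + 2) := isseq_lg (product_seq P).
have [G1 G2 G3 G4] := g_neq M.
refine (@product_deg M C r cf (fun _ g => g =
  g_var 0) (fun rho => var_degree (rho 0%N)) enil r (three * r + 2) P _ lg2 _ _ _ _ _ _); env.
- by rewrite /var_degree; df.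
- by move: (mle0 r); clra.
- move=> i Hi; apply: (mle_trans (y := three * r + 2 + 1)); split; last first.
    by have := ex_gt lg2; clra.
  have : var_degree i <= three * r + 2; last by clra.
  case: (gate_cases Hi) => [->|->|[k Hk [->|->|->]]].
  + by have [-> _ _ _] := var_degreeE (0 : M); move: (mle0 r); clra.
  + by rewrite var_degree1; apply: mle0.
  + by have [_ _ -> _] := var_degreeE k; apply: mle0.
  + by have [_ _ _ ->] := var_degreeE k; move: (mle0 r); clra.
  + have -> : three * k + three + 1 = three * (k + 1) + 1 by clra.
    by have [_ -> _ _] := var_degreeE (k + 1); move: Hk (mle0 r); clra.
- move=> i [->|[->|[k Hk ->]]].
  + by left; rewrite (product0 P); have [-> _ _ _] := var_degreeE (0 : M).
  + right; rewrite (product1 P); split; first by move/esym; apply: G1.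
    exact: var_degree1.
  + right; rewrite (product2 P) //; split; first by move/esym; apply: G1.
    by have [_ _ -> _] := var_degreeE k.
- move=> k Hk; have [E0 _ E2 E3] := var_degreeE k; rewrite E0 E2 E3; right; split=> //; exact: mle0.
- move=> k Hk; have [_ E1 _ E3] := var_degreeE k; rewrite E1 E3.
  have -> : three * k + three + 1 = three * (k + 1) + 1 by clra.
  by have [_ -> _ _] := var_degreeE (k + 1).
- by have [_ -> _ _] := var_degreeE r; apply: mle_refl.
Qed.

Lemma eqt_le1 x y : eqt x y <= 1.
Proof.
case: (classic (x = y)) => [->|N]; first by rewrite eqt1; apply: mle_refl.
by rewrite eqt0 //; apply: mle0.
Qed.

Lemma product_const_deg C r cf : product C r cf -> lg r -> 1 <= r ->
  forall c, c <= three * r + 1 /\ (exists x, entryM C c (g_const x)) ->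
  deg_le (fun i _ => i = c) C (three * r + 1) r.
Proof.
move=> P Hr r1 c [Hc [x /(entryP _ _ (product_seq P))[_ Ex]]].
have lg2 : lg (three * r + 2) := isseq_lg (product_seq P).
have [G1 G2 G3 G4] := g_neq M.
have Ec : c = 1 \/ exists2 t, t < r & c = three * t + 2.
  case: (gate_cases Hc) => [E|E|[k Hk [E|E|E]]]; [| by left | by right; exists k | |]; exfalso;
    move: Ex; rewrite E.
  - by rewrite (product0 P) => /esym; apply: G1.
  - by rewrite (product3 P) //; case: (G3 x 0 (three * k + 2)).
  - by rewrite (product4 P) //; case: (G3 x (three * k + 1) (three * k + three)).
have c1 : 1 <= c by case: Ec => [->|[t _ ->]]; [apply: mle_refl|move: (mle0 t); clra].
have N0 : (0 : M) <> c + 1 by move: c1; clra.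
refine (@product_deg M C r cf (fun i _ => i = c) (fun rho => const_degree (rho 1%N) (rho 0%N))
  (ocons c enil) r (three * r + 2) P _ lg2 _ _ _ _ _ _); env.
- by rewrite /const_degree; df.
- by move: (mle0 r); clra.
- move=> i Hi; have : const_degree c i <= 1.
    rewrite /const_degree; case: (classic (md (i + 1) three = 0)) => [->|N].
      by rewrite eqt1 cond1; apply: eqt_le1.
    rewrite (eqt0 N) cond0; case: (classic (md (i + 1) three = 1)) => [->|N'].
      by rewrite eqt1 cond1; apply: eqt_le1.
    by rewrite (eqt0 N') cond0; apply: leb_le1.
  by have := ex_gt lg2; move: (mle0 r); clra.
- move=> i [->|[->|[k Hk ->]]].
  + right; split; first by move=> E; move: c1; rewrite -E; clra.
    by have [-> _ _ _] := const_degreeE c 0; apply: eqt0.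
  + rewrite const_degree1; case: (classic (1 = c)) => [<-|N]; first by left; split=> //;
    apply: leb1; apply: mle_refl.
    by right; split=> //; apply: leb0; apply/mnot_le => L; apply: N; apply: mle_antisym.
  + have [_ _ -> _] := const_degreeE c k.
    by case: (classic (three * k + 2 = c)) => [<-|N]; [left; rewrite eqt1|right; rewrite eqt0].
- move=> k Hk; have [-> _ -> ->] := const_degreeE c k; rewrite (eqt0 N0); left; split;
  first exact: mle0.
  case: (classic (three * k + 2 = c)) => [<-|N].
    have -> : three * k + three = three * k + 2 + 1 by clra.
    by rewrite !eqt1.
  by rewrite !eqt0 // => E; apply: N; move: E; clra.
- move=> k Hk; have -> : three * k + three + 1 = three * (k + 1) + 1 by clra.
  have [_ -> _ _] := const_degreeE c (k + 1); have [_ -> _ ->] := const_degreeE c k.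
  case: Ec => [->|[t Ht ->]].
    rewrite !leb1 ?eqt0 ?ad0 //.
    * by move: (mle0 k); clra.
    * by move: (mle0 k); clra.
    * by move: (mle0 k); clra.
  case: (mlt_trichotomy t k) => [L|->|L].
  + rewrite !leb1 ?eqt0 ?ad0 //.
    * by move: L; clra.
    * by move: L; clra.
    * by move: L; clra.
  + rewrite leb1; last by clra.
    rewrite leb0; last by clra.
    have -> : three * k + three = three * k + 2 + 1 by clra.
    by rewrite eqt1; clra.
  + rewrite !leb0 ?eqt0 ?ad0 //.
    * by move: L; clra.
    * by move: L; clra.
    * by move: L; clra.
- have [_ -> _ _] := const_degreeE c r.
  by have := leb_le1 c (three * r + 1); move: r1; clra.
Qed.

(** Stated from the later gate back to the earlier one, because a computed gate has computed
    arguments and the size bound guarantees this only for the output. *)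
Lemma product_step C r cf z l t h : product C r cf -> l * su M (three * r + 1) <= ln M z ->
  1 <= l ->
  ent t 0 = 2 * h -> forall k, k < r -> ev z l C (three * r + 1) t (three * k + three + 1) <> 0 ->
  ev z l C (three * r + 1) t (three * k + 1) <> 0 /\
  val z l C (three * r + 1) t (three * k + three + 1) =
    (val z l C (three * r + 1)%M t (three * k + 1)%M * (inj h - inj (cf k)))%R.
Proof.
move=> P Hz Hl Et k Hk; have slp := product_slp P.
have [I1 I2 I3 I4] := g_inj M; have [G1 G2 G3 G4] := g_neq M.
have K : k + 1 <= r by move: Hk; clra.
have L4 : three * k + three + 1 <= three * r + 1 by have := ml_mono three K; clra.
have L3 : three * k + three <= three * r + 1 by move: L4; clra.
have L2 : three * k + 2 <= three * r + 1 by move: L3; clra.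
move=> N4; have := ev_cases slp Hz Hl L4 N4; rewrite (product4 P Hk).
case=> [[j _ [/esym E _]]|[c /esym E _]|[u [v [_ _ Nu Nv [[/esym E _]|[E V4]]]]]].
- by case: (G2 j (three * k + 1) (three * k + three)).
- by case: (G3 c (three * k + 1) (three * k + three)).
- by case: (G4 _ _ _ _ E).
have [Eu Ev] := I4 _ _ _ _ E; subst u v; clear E.
split=> //; rewrite V4; congr (_ * _)%R.
have := ev_cases slp Hz Hl L3 Nv; rewrite (product3 P Hk).
case=> [[j _ [/esym E _]]|[c /esym E _]|[u [v [_ _ N0 N2 [[E V3]|[E _]]]]]].
- by case: (G2 j 0 (three * k + 2)).
- by case: (G3 c 0 (three * k + 2)).
- have [Eu Ev] := I3 _ _ _ _ E; subst u v; clear E.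
  rewrite V3; congr (_ + _)%R.
    have := ev_cases slp Hz Hl (mle0 _) N0; rewrite (product0 P).
    case=> [[j _ [/I1 <- E]]|[c E _]|[u [v [_ _ _ _ [[E _]|[E _]]]]]].
    + by rewrite /val E (monusE (z := ent t 0)) // Et ival_pos.
    + by case: (G1 _ _ E).
    + by case: (G2 0 u v).
    + by case: (G2 0 u v).
  have := ev_cases slp Hz Hl L2 N2; rewrite (product2 P Hk).
  case=> [[j _ [/esym E _]]|[c /I2 <- E]|[u [v [_ _ _ _ [[E _]|[E _]]]]]].
  + by case: (G1 _ _ E).
  + by rewrite /val E (monusE (z := 2 * cf k + 1)) // ival_neg.
  + by case: (G3 (2 * cf k + 1) u v).
  + by case: (G3 (2 * cf k + 1) u v).
- by case: (G4 _ _ _ _ E).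
Qed.

Lemma product_nonzero C r cf z l lt q A b w t h : product C r cf ->
  line z l lt q 1 r C (three * r + 1) A b w -> isseq t 1 -> ent t 0 = 2 * h -> h <= ex A ->
  (eval_nonzero C t <-> forall k, k < r -> cf k <> h).
Proof.
move=> P LN St Et Hh; have slp := product_slp P.
have Hz := line_size LN; have Hl := line_l1 LN.
have ev0 : ev z l C (three * r + 1) t (three * r + 1) <> 0.
  apply: (line_ev LN) => j Hj; have -> : j = 0 by case: (eq0_or j) => // j1; move: Hj j1; clra.
  by rewrite Et hf_dbl.
have lgr : lg r by apply: (lg_le (isseq_lg (product_seq P))); move: (mle0 r); clra.
rewrite (eval_nonzeroP slp Hz Hl St ev0).
have step := product_step P Hz Hl Et.
(* The inductions descend from the output, where the value is known to be computed, along the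
   partial products. *)
pose ix k : M := three * monus r k + 1.
have ix0 : ix 0 = three * r + 1 by rewrite /ix (monusE (z := r)) // ad0.
have ixS k : k < r -> exists2 k',
  k' + (k + 1) = r & ix k = three * k' + three + 1 /\ ix (k + 1) = three * k' + 1.
  move=> Hk; have Hk1 : k + 1 <= r by move: Hk; clra.
  have E := monusK Hk1; exists (monus r (k + 1)) => //; split=> //.
  by rewrite /ix (monusE (x := r) (y := k) (z := monus r (k + 1) + 1)); [clra|move: E; clra].
split=> [N k Hk Eh|N Z].
  have Hk1 : k + 1 <= r by move: Hk; clra.
  (* [e] steps below the output is gate 3k + 4, the first product to contain factor k. A nonzero
     output would make it nonzero as well, although that factor vanishes. *)
  have Ee := monusK Hk1; set e := monus r (k + 1) in Ee.
  have lge : lg e by apply: (lg_le lgr); move: Ee (mle0 k); clra.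
  have [Ne Ve] : ev z l C (three * r + 1) t (ix e) <> 0 /\
      ~ ipos (monus (ev z l C (three * r + 1) t (ix e)) 1) =
        ineg (monus (ev z l C (three * r + 1) t (ix e)) 1).
    apply: (LIND (P := fun e => ev z l C (three * r + 1) t (ix e) <> 0 /\
      ~ ipos (monus (ev z l C (three * r + 1) t (ix e)) 1) =
        ineg (monus (ev z l C (three * r + 1) t (ix e)) 1)) _ lge).
    - by rewrite /ix; df.
    - by rewrite ix0; split=> //; apply/ival_neq0.
    move=> i Hi [Ni Vi]; have Hir : i < r by move: Hi Ee (mle0 k); clra.
    have [k' Ek' [E1 E2]] := ixS i Hir; rewrite E1 in Ni Vi; rewrite E2.
    have Hk' : k' < r by move: Ek' (mle0 i); clra.
    have [N1 V1] := step k' Hk' Ni; split=> //.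
    by apply/ival_neq0 => Z; move: Vi => /ival_neq0; apply; move: V1; rewrite /val Z mul0r.
  have Ei : ix e = three * k + three + 1.
    by rewrite /ix (monusE (z := k + 1)); [clra|move: Ee; clra].
  rewrite Ei in Ne Ve; have [_ V1] := step k Hk Ne.
  by move: Ve => /ival_neq0; apply; move: V1; rewrite /val Eh subrr mulr0.
(* If the output is zero and no factor is, the zero descends to gate 1, which is the constant 1. *)
have [Ne Ve] : ev z l C (three * r + 1) t (ix r) <> 0 /\
    ipos (monus (ev z l C (three * r + 1) t (ix r)) 1) =
      ineg (monus (ev z l C (three * r + 1) t (ix r)) 1).
  apply: (LIND (P := fun e => ev z l C (three * r + 1) t (ix e) <> 0 /\
    ipos (monus (ev z l C (three * r + 1) t (ix e)) 1) =
      ineg (monus (ev z l C (three * r + 1) t (ix e)) 1)) _ lgr).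
  - by rewrite /ix; df.
  - by rewrite ix0; split=> //; apply: NNPP => /ival_neq0.
  move=> i Hi [Ni Vi]; have [k' Ek' [E1 E2]] := ixS i Hi; rewrite E1 in Ni Vi; rewrite E2.
  have Hk' : k' < r by move: Ek' (mle0 i); clra.
  have [N1 V1] := step k' Hk' Ni; split=> //; apply: NNPP => /ival_neq0 Nz.
  move: Vi; apply/ival_neq0; move: V1; rewrite /val => -> /eqP.
  rewrite mulf_eq0 => /orP[/eqP //|/eqP E]; apply: (N k' Hk'); apply/eqE.
  by move: E; clear; lra.
have E1 : ix r = 1 by rewrite /ix (monusE (z := 0)); clra.
have L1 : 1 <= three * r + 1 by move: (mle0 r); clra.
rewrite E1 in Ne Ve; have [I1 I2 I3 I4] := g_inj M; have [G1 G2 G3 G4] := g_neq M.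
have := ev_cases slp Hz Hl L1 Ne; rewrite (product1 P).
case=> [[j _ [/esym E _]]|[c /I2 <- E]|[u [v [_ _ _ _ [[E _]|[E _]]]]]].
- by case: (G1 _ _ E).
- move: Ve; rewrite E (monusE (z := 2)) //; apply/ival_neq0.
  have -> : (2 : M) = 2 * 1 by clra.
  by rewrite ival_pos inj1 => /eqP; rewrite oner_eq0.
- by case: (G3 2 u v).
- by case: (G3 2 u v).
Qed.

End ProductValues.

(** * The circuit as a computed code, and the derivation of the pigeonhole principle *)

Section DualPigeonhole.
Variable M : s12.
Local Open Scope M_scope.
Notation three := (su M 2 : M).
Implicit Types x y u v c e i j k a t Y B z l q n d s r m C o A w N R X T h H G : M.
Hint Resolve Df_ev Df_ipos Df_ineg Df_ap2 Df_stretches : pv.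

(** Gate i in closed form, its kind read off from i + 1 modulo 3 as in [var_degree], so that
    [seq_of] computes the whole circuit from the number w of its roots' digits. *)
Definition product_gate j w i : M :=
  cond (eqt (md (i + 1) three) 0) (g_const (2 * rd j w (monus (dv (i + 1) three) 1) + 1))
    (cond (eqt (md (i + 1) three) 1)
      (cond (eqt i 0) (g_var 0) (g_add 0 (monus i 1)))
      (cond (eqt i 1) (g_const 2) (g_mul (monus i three) (monus i 1)))).

Lemma pr_mono2 x y u v : x <= u -> y <= v -> pr x y <= pr u v.
Proof.
move=> H K; apply: (mle_trans (y := pr x v)); split; first exact: pr_mono.
have L : x + v <= u + v by move: H; clra.
by have := ml_le2 L L; rewrite /pr; move: H; generalize ((x + v) * (x + v)) ((u + v) * (u + v));
  clear=> p p'; mlra.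
Qed.

Lemma product_gateE j w : [/\ product_gate j w 0 = g_var 0, product_gate j w 1 = g_const 2 &
  forall k, [/\ product_gate j w (three * k + 2) = g_const (2 * rd j w k + 1),
    product_gate j w (three * k + three) = g_add 0 (three * k + 2) &
    product_gate j w (three * k + three + 1) = g_mul (three * k + 1) (three * k + three)]].
Proof.
have [N1 N2 N3 N4] := neq3 M; have [L0 L1 L2] := lt3 M; rewrite /product_gate; split.
- have -> : md (0 + 1) three = 1.
    have -> : 0 + 1 = three * 0 + 1 :> M by clra.
    by case: (dv3 0 L1).
  by rewrite (eqt0 N1) !eqt1 cond0 !cond1.
- have -> : md (1 + 1) three = 2.
    have -> : 1 + 1 = three * 0 + 2 :> M by clra.
    by case: (dv3 0 L2).
  by rewrite (eqt0 N2) (eqt0 N3) !eqt1 !cond0 !cond1.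
move=> k; have [-> ->] := next2 k; have [_ ->] := next3 k.
have E4 : three * k + three + 1 = three * (k + 1) + 1 :> M by clra.
have -> : md (three * k + three + 1 + 1) three = 2 by rewrite E4; case: (next1 (k + 1)).
have K0 := mle0 k.
split.
- by rewrite eqt1 cond1 (monusE (z := k)).
- rewrite (eqt0 N1) eqt1 cond0 cond1 eqt0 ?cond0; last by move: K0; clra.
  by rewrite (monusE (z := three * k + 2)) //; clra.
- rewrite (eqt0 N2) (eqt0 N3) !cond0 eqt0 ?cond0; last by move: K0; clra.
  rewrite (monusE (z := three * k + 1)); last by clra.
  by rewrite (monusE (z := three * k + three)).
Qed.

Definition gate_bound j r : M := pr three (pr (three * r + 2 + 2 * ex j) (three * r + 2 + 2 * ex
  j)).

Lemma product_gate_bound j w r i : lg (j * r) -> 1 <= r -> lg j -> i < three * r + 2 ->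
  product_gate j w i <= gate_bound j r.
Proof.
move=> Hjr r1 Hj Hi; rewrite /gate_bound; set B := three * r + 2 + 2 * ex j.
have [E0 E1 E] := product_gateE j w; have ej := ex_ge1 Hj.
have [B0 B1] := le_pr B B; have K1 : 1 <= three by clra.
have K2 : 2 <= three by clra.
have Hi' : i <= three * r + 1 by move: Hi; clra.
have iB : three * r + 2 <= B by rewrite /B; move: ej; clra.
case: (gate_cases Hi') => [->|->|[k Hk K]].
- by rewrite E0; apply: pr_mono2; apply: mle0.
- rewrite E1; apply: pr_mono2 => //; apply: (mle_trans (y := B)); split=> //.
  by rewrite /B; move: (mle0 r) (mle0 (ex j)); clra.
have [E2 E3 E4] := E k; have Hk1 : k + 1 <= r by move: Hk; clra.
have Kr := ml_mono three Hk1; case: K => ->.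
- rewrite E2; apply: pr_mono2 => //; apply: (mle_trans (y := B)); split=> //.
  have [lgk _] := lg_block Hjr Hk.
  by have := rd_lt w lgk Hj; rewrite /B; move: (mle0 r); clra.
- rewrite E3; apply: pr_mono2 => //; apply: pr_mono2; first exact: mle0.
  by move: iB Kr; clra.
- by rewrite E4; apply: pr_mono2; [apply: mle_refl|apply: pr_mono2; move: iB Kr; clra].
Qed.

Lemma product_circuit_ex : exists mk : M -> M -> M -> M -> M -> M,
  Df false (fun rho => mk (rho 0%N) (rho 1%N) (rho 2%N) (rho 3%N) (rho 4%N)) /\
  forall z l r j w, ln M (gate_bound j r) <= l -> 1 <= l -> lg (j * r) -> lg j -> 1 <= r ->
    l * (three * r + 2) <= ln M z ->
    product (mk z l r j w) r (rd j w) /\ mk z l r j w <= pr l (2 * ex (l * (three * r + 2))).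
Proof.
have D : Df false (fun rho : nat -> M => product_gate (rho 1%N) (rho 2%N) (rho 0%N)).
  by rewrite /product_gate /g_const /g_var /g_add /g_mul; df.
have [sq [Ds Hs]] := seq_of D.
exists (fun z l r j w => sq z l (three * r + 2) (ocons j (ocons w enil))); split.
  apply: (Df_under Ds (E := fun rho : nat ->
    M => ocons (rho 0%N) (ocons (rho 1%N) (ocons (three * rho 2%N + 2)
    (ocons (rho 3%N) (ocons (rho 4%N) enil)))))); df.
move=> z l r j w Hl l1 Hjr Hj r1 Hz;
  have [//|//||S E L] := Hs z l (three * r + 2) (ocons j (ocons w enil)).
  move=> i Hi; env; have Hb := product_gate_bound w Hjr r1 Hj Hi.
  have Hl' : gate_bound j r < ex l.
    have lgl : lg l by apply: (lg_le (ln_lg z)); apply: (mle_trans (y := l * (three * r + 2)));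
      split=> //; rewrite -{1}(ml1 l); apply: ml_mono; move: (mle0 r); clra.
    exact/(ln_ex _ lgl).
  by move: Hb Hl'; clra.
split=> //; have [E0 E1 E2] := product_gateE j w.
have r0 := mle0 r; split=> //.
- by rewrite E //; move: r0; clra.
- by rewrite E //; move: r0; clra.
- move=> k Hk; have Hk1 : k + 1 <= r by move: Hk; clra.
  have [F2 _ _] := E2 k; rewrite E //; have := ml_mono three Hk1; clra.
- move=> k Hk; have Hk1 : k + 1 <= r by move: Hk; clra.
  have [_ F3 _] := E2 k; rewrite E //; have := ml_mono three Hk1; clra.
- move=> k Hk; have Hk1 : k + 1 <= r by move: Hk; clra.
  have [_ _ F4] := E2 k; rewrite E //; have := ml_mono three Hk1; clra.
Qed.

Lemma digits_ex (c : M -> M) j r : Df true (fun rho => c (rho 0%N)) -> lg j -> lg r ->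
  (forall i, i < r -> c i < ex j) ->
  exists w, w < ex (j * r) /\ forall i, i < r -> rd j w i = c i.
Proof.
move=> Dc Hj Hr Hc; have lgT := lgM Hj Hr; have [z Ez] := lgD lgT Hr.
have jz : j * r <= ln M z by rewrite Ez; move: (mle0 r); clra.
have rz : r <= ln M z by rewrite Ez; move: (mle0 (j * r)); clra.
have bzj i : i <= r -> bz z (j * i) = ex (j * i).
  by move=> Hi; apply: bzE; apply: (mle_trans (y := j * r)); split=> //; apply: ml_mono.
have [w [_ [Lw Ew]]] : exists w, w <= bz z (j * r) /\ (w < bz z (j * r) /\
    forall i, i <= ln M z -> i < r -> rd j w i = c i).
  apply: (LIND (P := fun t => exists w, w <= bz z (j * t) /\ (w < bz z (j * t) /\
    forall i, i <= ln M z -> i < t -> rd j w i = c i)) _ Hr).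
  - apply: (@Sg_ex M (fun rho => bz z (j * rho 0%N)) (fun w rho => w < bz z (j * rho 0%N) /\
      forall i, i <= ln M z -> i < rho 0%N -> rd j w i = c i)); first df.
    apply: Sg_and; first df.
    apply: (@Sg_sall M true (fun=> z) (fun i rho => i < rho 1%N -> rd j (rho 0%N) i = c i));
      first df.
    apply: Sg_imp; first df.
    by apply: Sg_eq; [df|exact: Dc].
  - exists 0; rewrite bzj ?ml0 ?ex0; last exact: mle0.
    by split; [exact: mle0|split; [|move=> i _]]; clra.
  move=> t Ht [w [_ [Lw Ew]]]; have Ht' : t <= r by move: Ht; clra.
  have Ht1 : t + 1 <= r by move: Ht; clra.
  have [lgt lgt1] := lg_block lgT Ht; rewrite (bzj _ Ht') in Lw; rewrite (bzj _ Ht1).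
  have L : w + c t * ex (j * t) < ex (j * (t + 1)).
    have -> : j * (t + 1) = j * t + j by clra.
    rewrite exD //; have K : c t + 1 <= ex j by have := Hc t Ht; clra.
    by have := ml_mono (ex (j * t)) K; move: Lw; clra.
  exists (w + c t * ex (j * t)); split; first by move: L; clra.
  split=> // i iz Hi; case: (mlt_trichotomy i t) => [Li|->|Li].
  - by rewrite rd_low //; apply: Ew.
  - by apply: rd_top => //; apply: Hc.
  - by move: Hi Li; clra.
exists w; split; first by rewrite -bzj //; apply: mle_refl.
by move=> i Hi; apply: Ew => //; move: Hi rz; clra.
Qed.

Lemma singleton_ex x : exists2 t, isseq t 1 & ent t 0 = x.
Proof.
pose l := ln M x + 1; have lgl : lg l by apply: lgS; apply: ln_lg.
have l1 : 1 <= l by rewrite /l; move: (mle0 (ln M x)); clra.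
have xl : x < ex l by apply/(ln_ex _ lgl); rewrite /l; clra.
have [||S E] := @isseq_mk M l 1 x l1; rewrite ?ml1 //.
rewrite ml1 in S E; exists (pr l (x + ex l)) => //; rewrite E; last by clra.
have E0 : x = 0 + x * ex (l * 0) by rewrite ml0 ex0; clra.
rewrite {1}E0; apply: rd_top => //; rewrite ml0 ?ex0; [exact: lg0|clra].
Qed.

Lemma ex_ln_le x : 1 <= x -> ex (ln M x) <= 2 * x.
Proof.
move=> x1; have l1 : 1 <= ln M x by rewrite -(ln1 M); apply: ln_mono.
have E := monusK l1; move: E; move: (monus _ 1) => i E.
have lgi : lg i by apply: (lg_le (ln_lg x)); rewrite -E; clra.
rewrite -E exS //; apply: ml_mono; apply: NNPP => /mnot_le /(ln_ex x lgi).
by rewrite -E; clra.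
Qed.

Lemma hitting_dual_php (f : pv 2) : (forall g : pv 5, hitting M g) -> dual_php M f.
Proof.
move=> hs a b c [ab a1]; apply: NNPP => N.
have onto v : v < 2 * a -> exists2 x, x < a & ap2 M f (x + 1) c = v + 1.
  move=> Hv; apply: NNPP => N'; apply: N; exists (v + 1); split.
    by split; move: Hv ab (mle0 v); clra.
  move=> x [x1 xa] E; apply: N'; have Ex := monusK x1.
  by exists (monus x 1); [move: xa Ex; clra|rewrite Ex].
have [mk [Dmk Hmk]] := product_circuit_ex.
have Dmk' b0 F1 F2 F3 F4 F5 : Df b0 F1 -> Df b0 F2 -> Df b0 F3 -> Df b0 F4 -> Df b0 F5 ->
    Df b0 (fun rho => mk (F1 rho) (F2 rho) (F3 rho) (F4 rho) (F5 rho)).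
  move=> *; apply: (@Df_under M (fun rho => mk (rho 0%N) (rho 1%N) (rho 2%N) (rho 3%N) (rho 4%N)) b0
    (fun rho => ocons (F1 rho) (ocons (F2 rho) (ocons (F3 rho) (ocons (F4 rho) (ocons (F5 rho)
      enil)))))) => //; df.
(* The parameter e of g packs z, l, r, j, a, c, the cutoff a 2^T and T; thus F is given by a
   parameter-free term. *)
pose F e (n d s x : M) := mk (p1 e) (p1 (p2 e)) (p1 (p2 (p2 e))) (p1 (p2 (p2 (p2 e))))
  (stretches f (p1 e) (p1 (p2 (p2 (p2 (p2 e))))) (p1 (p2 (p2 (p2 (p2 (p2 e))))))
    (p1 (p2 (p2 (p2 (p2 (p2 (p2 e))))))) x (p2 (p2 (p2 (p2 (p2 (p2 (p2 e)))))))).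
have [|g Hg] := @symbol5 M F; first (rewrite /F; apply: Dmk'; df).
(* The axiom is applied with n = 1 and d = r, so it demands q >= 2r and r > m + |q|. Here r = 2m + 8
   and 2r < q = 2^j <= 4r, whence |q| = j + 1 <= m + 7. *)
pose m := ln M a; pose r := 2 * (m + 2 * 2); pose j := ln M (2 * r); pose q := ex j.
have lgm : lg m := ln_lg a.
have lgc (k : M) : lg k -> lg (2 * k) by move=> H; have -> : 2 * k = k + k by [clra]; apply: lgD.
have lg1 : lg (1 : M) by rewrite -(ln1 M); apply: ln_lg.
have lg2 : lg (2 : M) by have := lgc _ lg1; rewrite ml1.
have lg4 : lg (2 * 2 : M) := lgc _ lg2.
have lgr : lg r by apply: lgc; apply: lgD.
have r1 : 1 <= r by rewrite /r; move: (mle0 m); clra.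
have lgj : lg j := ln_lg _.
have qr : q <= 2 * (2 * r) by apply: ex_ln_le; move: r1; clra.
have lgq : lg q := lg_le (lgc _ (lgc _ lgr)) qr.
have rq : 2 * r < q := lt_exln _.
have dq : r < q by move: rq; clra.
have q1 : 1 <= q by apply: ex_ge1.
have lnq : ln M q = j + 1.
  apply: mle_antisym; split.
    by apply/(ln_ex _ (lgS lgj)); rewrite exS // -/q; move: q1; clra.
  have : ~ ln M q <= j by move/(ln_ex _ lgj); rewrite -/q; clra.
  by move/mnot_le; clra.
have jm : j <= m + 2 * 2 + 2.
  have N0 : m + 2 * 2 <> 0 by apply/neq0; move: (mle0 m); clra.
  have N1 : r <> 0 by apply/neq0.
  have [E1 _] := ln_dbl N1; have [E2 _] := ln_dbl N0.
  by rewrite /j E1 /r E2; have := ln_le (m + 2 * 2); clra.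
have mr : m + 1 * ln M q < r by rewrite (ml_comm 1) ml1 lnq /r; move: jm; clra.
pose T := j * r; have lgT : lg T := lgM lgj lgr.
pose l := ln M (gate_bound j r) + 1; have lgl : lg l by apply: lgS; apply: ln_lg.
have lg3 : lg (three * r + 2).
  have -> : three * r + 2 = 2 * r + r + 2 * 1 by clra.
  by apply: lgD; [apply: lgD => //; apply: lgc|apply: lgc].
have lgl3 := lgM lgl lg3.
have [z Ez] := lgD lgl3 lgT.
have Tz : T <= ln M z by rewrite Ez; move: (mle0 (l * (three * r + 2))); clra.
have lz : l * (three * r + 2) <= ln M z by rewrite Ez; move: (mle0 T); clra.
have Gl : ln M (gate_bound j r) <= l by rewrite /l; clra.
have l1 : 1 <= l by rewrite /l; move: (mle0 (ln M (gate_bound j r))); clra.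
pose s := ln M (pr l (2 * ex (l * (three * r + 2)))).
pose e := pr z (pr l (pr r (pr j (pr a (pr c (pr (a * ex T) T)))))).
have ndq : 2 * 1 * r <= q by move: rq; clra.
have logs : log_of (1 : M) /\ log_of r /\ log_of s /\ log_of q /\ log_of r /\ log_of m.
  by rewrite !log_ofE; do !split=> //; apply: ln_lg.
have [H [[SH HH] hit]] := hs g e 1 r s q r m logs (conj q1 (conj ndq mr)).
pose ch i := hf M (ent (ent H i) 0).
have one0 : (0 : M) < 1 by clra.
have cH i : i < r -> [/\ isseq (ent H i) 1, ent (ent H i) 0 = 2 * ch i & ch i < q].
  move=> Hi; have [h [/(entryP _ _ SH)[_ ->] [Sh Ch]]] := HH i Hi.
  have [x [Hx /(entryP _ _ Sh)[_ Ex]]] := Ch 0 one0.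
  by rewrite /ch -Ex hf_dbl.
have Dch : Df true (fun rho : nat -> M => ch (rho 0%N)) by rewrite /ch; df.
have [|w [Lw Ew]] := digits_ex Dch lgj lgr; first by move=> i Hi; case: (cH i Hi).
have Lw' : w < a * ex T.
  have := ml_le2 a1 (mle_refl (ex T)); rewrite (ml_comm 1) ml1.
  by move: Lw; rewrite -/T; clra.
(* w codes all r points of H, and still it has a preimage x < a, with |x| <= m: a short string names
   the circuit whose roots are exactly these points. *)
have [x Lx Ex] := stretches_onto a1 Tz onto Lw'.
have xm : ln M x <= m by apply: ln_mono; move: Lx; clra.
have [P LC] := Hmk z l r j w Gl l1 lgT lgj r1 lz.
have EC : ap5 g e 1 r s x = mk z l r j w.
  by rewrite Hg /F /e !(p1_pr, p2_pr) Ex.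
set C := mk z l r j w in P LC EC.
have sC : ln M C <= s := ln_mono LC.
have slp := product_slp P.
have vd := product_var_deg P lgr; have cd := product_const_deg P lgr r1.
have ck : ckt C 1 r s by split=> //; exists (three * r + 1).
pose A := s + ln M q; have lgA : lg A by apply: lgD; apply: ln_lg.
have [z' Ez'] := par_z_lg lg1 lgr lgq lgA.
have qA : ln M q <= A by rewrite /A; move: (mle0 s); clra.
have CA : ln M C <= A by rewrite /A; move: sC (mle0 (ln M q)); clra.
have Hz' : par_z 1 r q A <= ln M z' by rewrite Ez'; apply: mle_refl.
have LN := line_par slp vd cd lgA lg1 lgq (mle_refl 1) q1 dq qA CA Hz'.
have qex := line_qex LN.
(* The roots c_i are less than q, so the circuit does not vanish at q, whose sign-magnitude code is
   2q. *)
have [t St Et] := singleton_ex (2 * q).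
have rdq k : k < r -> rd j w k < q by move=> Hk; rewrite Ew //; case: (cH k Hk).
have Nt : eval_nonzero C t.
  apply/(product_nonzero P LN St Et); first by move: qex; clra.
  by move=> k Hk E; have := rdq k Hk; rewrite E; clra.
have [i [h [Hi [/(entryP _ _ SH)[_ ->] Nh]]]] := hit x xm C ck EC (ex_intro _ t (conj St Nt)).
have [Sh Eh Lh] := cH i Hi.
have hA : ch i <= ex A by move: Lh qex; clra.
by have := proj1 (product_nonzero P LN Sh Eh hA) Nh i Hi; apply; apply: Ew.
Qed.

End DualPigeonhole.

Theorem theorem5p2 : provably_equivalent S12 dWPHP_PV HS_PV.
Proof.
split=> A.
- case=> g; apply: completeness; first exact: S12_dWPHP_subst.
  move=> N HN rho; have HS : models N S12 by move=> B sigma HB; apply: HN; left.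
  apply/(@sat_HS (S12Model HS)); apply: dual_php_hitting => f.
  exact: (HN _ rho (or_intror (dWPHP_PV_ax f))).
- case=> f; apply: completeness; first exact: S12_HS_subst.
  move=> N HN rho; have HS : models N S12 by move=> B sigma HB; apply: HN; left.
  apply/(@sat_dWPHP (S12Model HS)); apply: hitting_dual_php => g.
  exact: (HN _ rho (or_intror (HS_PV_ax g))).
Qed.
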